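(* Let $(X,B)$ be a globally $F$-split projective surface pair over a perfect field of positive characteristic. Then $$H^0(X, \Omega_X^{[i]}(\log \lfloor B\rfloor)(-D))=0$$ for every $i\ge 0$ and every $\mathbb{Z}$-divisor $D$ on $X$ satisfying $\kappa(X, D)>i$.
   Context: A pair $(X,B)$ consists of a normal variety $X$ and an effective $\mathbb{Q}$-divisor $B$; here $\dim X=2$ and $X$ is projective. $(X,B)$ is globally $F$-split if $\mathcal{O}_X\to F^e_*\mathcal{O}_X(\lfloor(p^e-1)B\rfloor)$ splits as an $\mathcal{O}_X$-module homomorphism for some $e>0$, where $F$ is the absolute Frobenius and $p$ the characteristic. For a normal variety $X$, a reduced divisor $B'$, a $\mathbb{Q}$-divisor $D$ and $i\ge 0$, $\Omega_X^{[i]}(\log B')(D):=j_*(\Omega_U^i(\log B')\otimes\mathcal{O}_U(\lfloor D\rfloor))$, where $j\colon U\hookrightarrow X$ is the inclusion of the log smooth locus of $(X,B')$ (the largest open subset where $X$ is smooth and $B'$ has simple normal crossing support). $\kappa(X,D)$ is the Iitaka dimension of the Weil divisor $D$: it is $-\infty$ if $H^0(X,\mathcal{O}_X(mD))=0$ for all $m>0$, and otherwise the maximum, over $m>0$ with $H^0(X,\mathcal{O}_X(mD))\ne0$, of the dimension of the closure of the image of the rational map defined by $H^0(X,\mathcal{O}_X(mD))$. *)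

(* Defs.v *)
(* Projective varieties are described inside their function field K / k: an
   integral closed subscheme X of P^n_k is determined by the homogeneous
   coordinates (s_0 : ... : s_n) in K of its generic point.  Its i-th standard
   chart is Spec k[s_0/s_i, ..., s_n/s_i], and since X is separated a point x is
   determined by the subring O_{X,x} of K.  Points are therefore encoded as
   subsets of K (their local rings); x is a specialisation of y if and only if
   O_x is contained in O_y.  Quasi-coherent torsion-free sheaves are subsheaves
   of constant sheaves, so that restriction maps are inclusions. *)
From HB Require Import structures.
From mathcomp Require Import all_boot all_order all_algebra.
From mathcomp Require Import boolp classical_sets cardinality.
From mathcomp Require Import freeg.
From mathcomp Require mpoly.

Set Implicit Arguments.
Unset Strict Implicit.
Unset Printing Implicit Defensive.

Import Order.TTheory GRing.Theory Num.Theory.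
Local Open Scope classical_set_scope.
Local Open Scope ring_scope.

Section KahlerForms.
Variables (k K : fieldType) (iota : {rmorphism k -> K}) (i : nat).

(* The free K-module on the symbols da_1 ^ ... ^ da_i. *)
Local Notation symbols := {freeg {ffun 'I_i -> K} / K}.

Definition symb (a : 'I_i -> K) : symbols := << finfun a >>.

Definition subst (a : 'I_i -> K) (j : 'I_i) (x : K) : 'I_i -> K :=
  fun l => if l == j then x else a l.

Inductive kahler_relator : symbols -> Prop :=
| relD a j x y : kahler_relator
    (symb (subst a j (x + y)) - symb (subst a j x) - symb (subst a j y))
| relM a j x y : kahler_relator
    (symb (subst a j (x * y))
       - x *: symb (subst a j y) - y *: symb (subst a j x))
| relC a j (c : k) : kahler_relator (symb (subst a j (iota c)))
| relA (a : 'I_i -> K) j l : j != l -> a j = a l -> kahler_relator (symb a).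

Inductive kahler_relation : symbols -> Prop :=
| kahler_relation0 : kahler_relation 0
| kahler_relation_lin c r w :
    kahler_relator r -> kahler_relation w -> kahler_relation (c *: r + w).

Definition kahler_rel (w : symbols) : bool := `[< kahler_relation w >].

Lemma kahler_relationD u v :
  kahler_relation u -> kahler_relation v -> kahler_relation (u + v).
Proof.
move=> hu hv; elim: hu => [|c r w hr _ IH]; first by rewrite add0r.
by rewrite -addrA; exact: kahler_relation_lin.
Qed.

Lemma kahler_relationZ c u : kahler_relation u -> kahler_relation (c *: u).
Proof.
elim=> [|d r w hr _ IH]; first by rewrite scaler0; exact: kahler_relation0.
by rewrite scalerDr scalerA; exact: kahler_relation_lin.
Qed.

Fact kahler_rel_zmod_closed : zmod_closed kahler_rel.
Proof.
split=> [|u v]; rewrite !unfold_in; first exact/asboolP/kahler_relation0.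
move=> /asboolP hu /asboolP hv; apply/asboolP.
by rewrite -scaleN1r; apply: kahler_relationD => //; exact: kahler_relationZ.
Qed.

HB.instance Definition _ :=
  GRing.isZmodClosed.Build _ kahler_rel kahler_rel_zmod_closed.

(* The K-module Omega^i_{K/k}, i-th exterior power of Omega^1_{K/k}. *)
Definition kahler_forms :=
  Quotient.quot (GRing.ZmodClosed.clone _ kahler_rel _).

HB.instance Definition _ := GRing.Zmodule.on kahler_forms.

Definition kform (w : symbols) : kahler_forms := (\pi w)%qT.
Definition kscale (c : K) (w : kahler_forms) : kahler_forms :=
  kform (c *: repr w).

Lemma kform_eq u v : kform u = kform v <-> kahler_relation (u - v).
Proof.
rewrite /kform; split=> [/eqP|h]; last first.
  by apply/eqP; rewrite -Quotient.idealrBE; apply/asboolP.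
by rewrite -Quotient.idealrBE => /asboolP.
Qed.

Lemma kformK w : kform (repr w) = w.
Proof. exact: reprK. Qed.

Lemma kformD u v : kform (u + v) = kform u + kform v.
Proof. exact: Quotient.pi_add. Qed.

Lemma kformZ c w : kscale c (kform w) = kform (c *: w).
Proof.
by apply/kform_eq; rewrite -scalerBr; apply/kahler_relationZ/kform_eq/kformK.
Qed.

Fact kscaleA a b v : kscale a (kscale b v) = kscale (a * b) v.
Proof. by rewrite -[v]kformK !kformZ scalerA. Qed.
Fact kscale1 : left_id 1 kscale.
Proof. by move=> v; rewrite -[v]kformK kformZ scale1r. Qed.
Fact kscaleDr : right_distributive kscale +%R.
Proof.
by move=> a u v; rewrite -[u]kformK -[v]kformK -kformD !kformZ scalerDr kformD.
Qed.
Fact kscaleDl v : {morph kscale^~ v : a b / a + b}.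
Proof. by move=> a b; rewrite -[v]kformK !kformZ scalerDl kformD. Qed.

HB.instance Definition _ := GRing.Zmodule_isLmodule.Build K kahler_forms
  kscaleA kscale1 kscaleDr kscaleDl.

(* da_1 ^ ... ^ da_i *)
Definition wedge_d (a : 'I_i -> K) : kahler_forms := kform (symb a).

End KahlerForms.

Section Points.
Variables (k K : fieldType) (iota : {rmorphism k -> K}).
Variables (n : nat) (s : 'I_n.+1 -> K).

Definition affine_coord (i j : 'I_n.+1) : K := s j / s i.

Definition chart (i : 'I_n.+1) : set K :=
  [set f | exists g : mpoly.mpoly n.+1 k,
     f = mpoly.mmap iota (affine_coord i) g].

Definition prime_ideal (A q : set K) : Prop :=
  [/\ q `<=` A, q 0 /\ ~ q 1, forall a b, q a -> q b -> q (a + b),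
      forall a b, A a -> q b -> q (a * b)
    & forall a b, A a -> A b -> q (a * b) -> q a \/ q b].

Definition localization (A q : set K) : set K :=
  [set f | exists a b, [/\ A a, A b, ~ q b & f = a / b]].

Definition chart_point (i : 'I_n.+1) (x : set K) : Prop :=
  exists q, prime_ideal (chart i) q /\ x = localization (chart i) q.

Definition points : set (set K) :=
  [set x | exists i, s i != 0 /\ chart_point i x].

Definition zariski_open (V : set (set K)) : Prop :=
  V `<=` points /\
  forall i, s i != 0 -> exists2 I : set K, I `<=` chart i &
    forall q, prime_ideal (chart i) q ->
      (V (localization (chart i) q) <-> ~ I `<=` q).

End Points.

(* Krull dimension of a family of points, via chains of specialisations. *)
Definition has_chain (K : Type) (C : set (set K)) (d : nat) : Prop :=
  exists c : 'I_d.+1 -> set K,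
    (forall j, C (c j)) /\ (forall j l : 'I_d.+1, (j < l)%N -> c j `<` c l).

Definition dim_is (K : Type) (C : set (set K)) (d : nat) : Prop :=
  has_chain C d /\ ~ has_chain C d.+1.

Record proj_variety (k : fieldType) := ProjVariety {
  fun_field :> fieldType;
  constants : {rmorphism k -> fun_field};
  ambient_dim : nat;
  coord : 'I_ambient_dim.+1 -> fun_field;
  coord_neq0 : exists i, coord i != 0;
  coord_gen : forall i, coord i != 0 -> forall f : fun_field,
    exists a b, [/\ chart constants coord i a, chart constants coord i b,
                    b != 0 & f = a / b] }.

Definition perfect_field (p : nat) (k : fieldType) : Prop :=
  p \in [pchar k] /\ forall a : k, exists b : k, b ^+ p = a.

Section Variety.
Variables (k : fieldType) (X : proj_variety k).

Definition pt : set (set X) := points (constants X) (@coord _ X).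
Definition opn (V : set (set X)) : Prop :=
  zariski_open (constants X) (@coord _ X) V.

(* dim O_{X,x} *)
Definition codim_is (x : set X) (d : nat) : Prop :=
  dim_is [set y | pt y /\ x `<=` y] d.

Definition normal_variety : Prop :=
  forall x, pt x -> forall (f : X) (g : {poly X}),
    g \is monic -> (forall l, x g`_l) -> root g f -> x f.

Definition max_ideal (x : set X) : set X :=
  [set f | x f /\ (f = 0 \/ ~ x f^-1)].

(* A prime divisor is identified with its generic point. *)
Definition prime_divisor (P : set X) : Prop := pt P /\ codim_is P 1.

Definition is_divisor (V : zmodType) (D : set X -> V) : Prop :=
  (forall P, D P != 0 -> prime_divisor P) /\ finite_set [set P | D P != 0].

(* ord_P f = m, for P with local ring a discrete valuation ring and f <> 0 *)
Definition ord_is (P : set X) (f : X) (m : int) : Prop :=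
  exists t u, [/\ max_ideal P = [set t * a | a in P], P u, P u^-1, u != 0
                & f = u * t ^ m].

(* Gamma(V, O_X) *)
Definition regular_functions (V : set (set X)) : set X :=
  [set f | forall x, V x -> x f].

(* Gamma(V, O_X(E)) *)
Definition divisorial_sections (V : set (set X)) (E : set X -> int) : set X :=
  [set f | f = 0 \/ forall P, V P -> prime_divisor P ->
     exists m, ord_is P f m /\ 0 <= m + E P].

Definition divisorial_stalk (x : set X) (E : set X -> int) : set X :=
  [set f | exists V, [/\ opn V, V x & divisorial_sections V E f]].

Definition floor_div (D : set X -> rat) : set X -> int :=
  fun P => Num.floor (D P).

(* The maps phi V are the components of the splitting, as a morphism of sheaves;
   O_X acts on F^e_* through p^e-th powers. *)
Definition globally_F_split (p : nat) (B : set X -> rat) : Prop :=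
  exists e : nat, (0 < e)%N /\
  exists phi : set (set X) -> X -> X,
  let E := floor_div (fun P => ((p ^ e)%N%:R - 1) * B P) in
  forall V, opn V -> V !=set0 ->
  [/\ forall f, divisorial_sections V E f -> regular_functions V (phi V f),
      forall f g, divisorial_sections V E f -> divisorial_sections V E g ->
        phi V (f + g) = phi V f + phi V g,
      forall a f, regular_functions V a -> divisorial_sections V E f ->
        phi V (a ^+ (p ^ e) * f) = a * phi V f,
      forall W f, opn W -> W !=set0 -> W `<=` V ->
        divisorial_sections V E f -> phi W f = phi V f
    & forall a, regular_functions V a -> phi V (a ^+ (p ^ e)) = a].

(* Jacobian criterion: X has codimension n + 1 - d in the affine space with
   coordinates s_0/s_i, ..., s_n/s_i (the equation s_i/s_i = 1 included). *)
Definition smooth_at (x : set X) : Prop :=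
  exists d, dim_is pt d /\
  exists i, coord i != 0 /\ chart_point (constants X) (@coord _ X) i x /\
  let c := ((@ambient_dim _ X).+1 - d)%N in
  let ev := mpoly.mmap (constants X) (affine_coord (@coord _ X) i) in
  exists (g : 'I_c -> mpoly.mpoly (@ambient_dim _ X).+1 k)
         (h : 'I_c -> 'I_(@ambient_dim _ X).+1),
    (forall a, ev (g a) = 0) /\
    let J := \det (\matrix_(a, b) ev (mpoly.mderiv (h b) (g a))) in
    J != 0 /\ x J^-1.

(* t generates the ideal of the prime divisor P in the local ring O_x *)
Definition local_equation (x P : set X) (t : X) : Prop :=
  x `&` max_ideal P = [set t * a | a in x].

Definition snc_at (B' : set X -> int) (x : set X) : Prop :=
  exists d (t : 'I_d -> X),
  [/\ codim_is x d,
      max_ideal x = [set f | exists a : 'I_d -> X,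
                       (forall j, x (a j)) /\ f = \sum_j a j * t j]
    & forall P, B' P != 0 -> x `<=` P -> exists j, local_equation x P (t j)].

Definition log_smooth_locus (B' : set X -> int) : set (set X) :=
  [set x | exists V, [/\ opn V, V x
                       & forall y, V y -> smooth_at y /\ snc_at B' y]].

Section LogForms.
Variables (i : nat) (B' : set X -> int).

Local Notation Omega := (kahler_forms (constants X) i).

(* Generators w_1 ^ ... ^ w_i of Omega^i(log B') at x, where w_j = da_j with a_j
   regular at x for j outside J, and w_j = da_j/a_j with a_j a local equation at
   x of a component of B' for j in J. *)
Definition log_generator (x : set X) (w : Omega) : Prop :=
  exists (J : {set 'I_i}) (a : 'I_i -> X),
  [/\ forall j, j \notin J -> x (a j),
      forall j, j \in J ->
        exists P, [/\ B' P != 0, x `<=` P & local_equation x P (a j)]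
    & w = (\prod_(j in J) (a j)^-1) *: wedge_d (constants X) a].

(* The stalk of Omega^i(log B') (x) O(E) at x, for x in the log smooth locus *)
Definition log_forms_stalk (E : set X -> int) (x : set X) (w : Omega) : Prop :=
  exists m (c : 'I_m -> X) (g : 'I_m -> Omega),
  [/\ forall l, divisorial_stalk x E (c l), forall l, log_generator x (g l)
    & w = \sum_l c l *: g l].

(* Gamma(V, Omega_X^{[i]}(log B')(D)) *)
Definition reflexive_log_forms (D : set X -> rat) (V : set (set X)) :
    set Omega :=
  [set w | forall x, (V `&` log_smooth_locus B') x ->
     log_forms_stalk (floor_div D) x w].

End LogForms.

Definition global_sections (E : set X -> int) : set X :=
  divisorial_sections pt E.

(* f_0, ..., f_N is a k-basis of H^0(X, O_X(E)) *)
Definition is_basis_H0 (E : set X -> int) (N : nat) (f : 'I_N.+1 -> X) : Prop :=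
  (forall g, global_sections E g <->
     exists c : 'I_N.+1 -> k, g = \sum_j constants X (c j) * f j) /\
  (forall c : 'I_N.+1 -> k, \sum_j constants X (c j) * f j = 0 ->
     forall j, c j = 0).

(* H^0(X, O_X(E)) is nonzero, and the closure of the image of the rational map
   it defines, whose generic point is (f_0 : ... : f_N), has dimension d. *)
Definition map_image_dim (E : set X -> int) (d : nat) : Prop :=
  exists N (f : 'I_N.+1 -> X),
    is_basis_H0 E f /\ dim_is (points (constants X) f) d.

(* kappa(X, D) = kappa, with None standing for -oo *)
Definition iitaka_dim_is (D : set X -> int) (kappa : option nat) : Prop :=
  let mult m := (fun P => D P *+ m) : set X -> int in
  match kappa with
  | None => forall m, (0 < m)%N -> global_sections (mult m) = [set 0]
  | Some d =>
      (exists m, (0 < m)%N /\ map_image_dim (mult m) d) /\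
      (forall m d', (0 < m)%N -> map_image_dim (mult m) d' -> (d' <= d)%N)
  end.

End Variety.

(* Main.v *)
(* Idea.  The splitting induces an additive map [phi] of the function field [K]
   with [phi (a ^+ p * f) = a * phi f] and [phi 1 = 1] which, at a prime divisor
   [P] with uniformizer [t], maps [t^(1-p) O_P] into [O_P] if [P] is a component
   of [floor B], and [O_P] into [O_P] otherwise.  For a p-basis [z, x] of [K] put
     theta z x = \sum_(l, j < p) phi (z^l x^j)^p z^(p-1-l) x^(p-1-j).
   It is nonzero and is multiplied by the (p-1)-st power of the Jacobian under a
   change of p-basis, so that it represents a section of (1-p)(K_X + floor B).
   - If [c dz /\ dx] is a logarithmic 2-form with values in [-D], then
     [c^(p-1) theta z x] is a section of [-(p-1) D].
   - A logarithmic 1-form [w] with values in [-D] is annihilated by a derivation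
     [del].  The p-curvature of [del], multiplied by powers of [theta] and of [w],
     is a section of a negative multiple of [D]; it must vanish, so that
     [del^p = 0] after normalization.  Then [w = gamma dy] with [y] in the kernel
     of [del], and [gamma^(p-1)] times the one-variable analogue of [theta] at [y]
     is a section of [-(p-1) D].
   A nonzero section [psi] of [-m D] is impossible as soon as [kappa(D) >= 1]: if
   [f, g] are sections of [n D] with [g / f] transcendental over [k], then
   [psi^n f^m] and [psi^n g^m] are regular everywhere, hence algebraic over [k].
   Sections are only tested at prime divisors, by pairing forms with derivations
   that preserve [O_P] and, along the boundary, its maximal ideal; local p-bases
   exist because [K : K^p] = p^2 on a surface over a perfect field. *)
Require Import Defs.
From HB Require Import structures.
From mathcomp Require Import all_boot all_order all_algebra.
From mathcomp Require Import boolp classical_sets cardinality.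
From mathcomp Require Import mpoly ring.

Set Implicit Arguments.
Unset Strict Implicit.
Unset Printing Implicit Defensive.

Import Order.TTheory GRing.Theory Num.Theory.
Local Open Scope classical_set_scope.
Local Open Scope ring_scope.

(** * Derivations and p-bases *)

(** [theta] only sees (p-1)-st powers of Jacobians; hence the exponents p-1 everywhere. For a form w
    = g (dx - c dz) put [del] = d/dz + c d/dx. Along a prime divisor where D has coefficient d, with
    logarithmic frame D1, D2, the field w(D2) D1 - w(D1) D2 divided by t^d preserves the local ring
    and the boundary, and so does its p-th iterate. It is killed by w, hence equals h [del], where h
    = t^(-d) g J and J is the logarithmic Jacobian of (z, x). By Hochschild's formula w takes the
    value h^p g A on the iterate, with A = [del]^p x. So (g J)^p g A has order at least (p+1) d: p
    times d from the normalization of the field, once more from the last evaluation. Its (p-1)-st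
    power trades J^(p(p-1)) for [theta]^p, whence the exponent (p+1)(p-1). Once w = gamma dy, the
    obstacle is that dy may vanish along a divisor. There y is replaced by a polynomial in y with
    p-th power coefficients whose differential does not vanish; the one-variable trace changes by
    the (p-1)-st power of the derivative, which matches gamma^(p-1). *)

Record subring (K : fieldType) (A : set K) : Prop := Subring {
  subring1 : A 1;
  subringB : forall a b, A a -> A b -> A (a - b);
  subringM : forall a b, A a -> A b -> A (a * b) }.

Section Subring.
Variables (K : fieldType) (A : set K).
Hypothesis sA : subring A.

Lemma subring0 : A 0.
Proof. by rewrite -(subrr (1 : K)); apply: subringB => //; exact: subring1. Qed.
Lemma subringN a : A a -> A (- a).
Proof. by move=> Aa; rewrite -sub0r; apply: subringB => //; exact: subring0. Qed.
Lemma subringD a b : A a -> A b -> A (a + b).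
Proof. by move=> Aa Ab; rewrite -[b]opprK; apply: subringB => //; exact: subringN. Qed.
Lemma subringX a n : A a -> A (a ^+ n).
Proof.
move=> Aa; elim: n => [|n IH]; first by rewrite expr0; exact: subring1.
by rewrite exprS; exact: subringM.
Qed.
Lemma subring_sum I (r : seq I) (P : pred I) F :
  (forall i, P i -> A (F i)) -> A (\sum_(i <- r | P i) F i).
Proof. by move=> h; apply: big_ind => //; [exact: subring0 | exact: subringD]. Qed.
Lemma subring_prod I (r : seq I) (P : pred I) F :
  (forall i, P i -> A (F i)) -> A (\prod_(i <- r | P i) F i).
Proof. by move=> h; apply: big_ind => //; [exact: subring1 | exact: subringM]. Qed.
Lemma subring_nat n : A n%:R.
Proof. by elim: n => [|n IH]; [exact: subring0 | rewrite -natr1; apply: subringD => //; exact: subring1]. Qed.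
End Subring.

Lemma subringT (K : fieldType) : subring [set: K].
Proof. by []. Qed.

Record derivation (K : fieldType) (D : K -> K) : Prop := Derivation {
  derD : forall x y, D (x + y) = D x + D y;
  derM : forall x y, D (x * y) = x * D y + y * D x }.

Section Derivations.
Variable K : fieldType.
Implicit Types D E : K -> K.

Lemma der0 D : derivation D -> D 0 = 0.
Proof. by move=> dD; apply: (@addIr _ (D 0)); rewrite -(derD dD) !add0r. Qed.
Lemma der1 D : derivation D -> D 1 = 0.
Proof.
by move=> dD; apply: (@addIr _ (D 1)); rewrite add0r -{3}[1]mulr1 (derM dD) !mul1r.
Qed.
Lemma derN D x : derivation D -> D (- x) = - D x.
Proof. by move=> dD; apply: (@addIr _ (D x)); rewrite -(derD dD) !addNr (der0 dD). Qed.
Lemma derB D x y : derivation D -> D (x - y) = D x - D y.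
Proof. by move=> dD; rewrite (derD dD) (derN _ dD). Qed.
Lemma der_sum D I (r : seq I) (P : pred I) (F : I -> K) : derivation D ->
  D (\sum_(i <- r | P i) F i) = \sum_(i <- r | P i) D (F i).
Proof. by move=> dD; apply: big_morph => [x y|]; [exact: derD | exact: der0]. Qed.
Lemma derX D x n : derivation D -> D (x ^+ n) = x ^+ n.-1 * D x *+ n.
Proof.
move=> dD; elim: n => [|n IH]; first by rewrite expr0 (der1 dD).
rewrite exprS (derM dD) IH /=; case: n {IH} => [|n] /=.
  by rewrite mulr0n mulr0 add0r.
by rewrite mulrnAr mulrA -exprS -mulrSr.
Qed.
Lemma derV D x : derivation D -> D x^-1 = - (D x / x ^+ 2).
Proof.
move=> dD; have [->|x0] := eqVneq x 0; first by rewrite invr0 (der0 dD) mul0r oppr0.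
have := der1 dD; rewrite -(mulfV x0) (derM dD) => /eqP; rewrite addrC addr_eq0 => /eqP h.
by apply: (mulfI x0); rewrite mulrN -[LHS]opprK -h; congr (- _); field.
Qed.
Lemma der_lin D E a b : derivation D -> derivation E ->
  derivation (fun f => a * D f + b * E f).
Proof.
move=> dD dE; split=> x y; first by rewrite (derD dD) (derD dE); ring.
by rewrite (derM dD) (derM dE); ring.
Qed.
Lemma der_scale D a : derivation D -> derivation (fun f => a * D f).
Proof.
move=> dD; split=> x y; first by rewrite (derD dD); ring.
by rewrite (derM dD); ring.
Qed.
Lemma iter_derD D n x y : derivation D ->
  iter n D (x + y) = iter n D x + iter n D y.
Proof. by move=> dD; elim: n => //= n ->; rewrite (derD dD). Qed.
Lemma derMn D x n : derivation D -> D (x *+ n) = D x *+ n.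
Proof. by move=> dD; elim: n => [|n IH]; rewrite ?mulr0n ?(der0 dD) // !mulrS (derD dD) IH. Qed.
Lemma iter_derM D n x y : derivation D ->
  iter n D (x * y) = \sum_(i < n.+1) (iter (n - i) D x * iter i D y) *+ 'C(n, i).
Proof.
move=> dD; elim: n => [|n IH]; first by rewrite big_ord1 bin0 mulr1n.
rewrite iterS IH (der_sum _ _ _ dD).
have h (i : 'I_n.+1) : D ((iter (n - i) D x * iter i D y) *+ 'C(n, i)) =
   (iter (n - i) D x * iter i.+1 D y) *+ 'C(n, i) +
   (iter (n.+1 - i) D x * iter i D y) *+ 'C(n, i).
  rewrite (derMn _ _ dD) (derM dD) mulrnDl subSn; last by rewrite -ltnS.
  by rewrite !iterS [iter i D y * _]mulrC.
rewrite (eq_bigr _ (fun i _ => h i)) big_split /=.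
rewrite [RHS]big_ord_recl [X in _ + X = _]big_ord_recl.
rewrite addrCA; congr (_ + _); first by rewrite !bin0.
have -> : \sum_(i < n.+1) iter (n.+1 - lift ord0 i) D x * iter (lift ord0 i) D y *+ 'C(n.+1, lift ord0 i)
  = \sum_(i < n.+1) (iter (n - i) D x * iter i.+1 D y *+ 'C(n, i)
      + iter (n - i) D x * iter i.+1 D y *+ 'C(n, i.+1)).
  apply: eq_bigr => i _; rewrite /= /bump leq0n add1n subSS binS mulrnDr addrC; reflexivity.
rewrite big_split /=; congr (_ + _).
rewrite [RHS]big_ord_recr /= bin_small // mulr0n addr0.
apply: eq_bigr => i _; rewrite /= /bump leq0n add1n subSS; reflexivity.
Qed.

End Derivations.

Section CharP.
Variables (K : fieldType) (p : nat).
Hypothesis charK : p \in [pchar K].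
Implicit Types (D E : K -> K) (O I : set K).

Let p_pr : prime p. Proof. exact: pcharf_prime charK. Qed.
Let p_gt0 : (0 < p)%N. Proof. exact: prime_gt0. Qed.
Let p_gt1 : (1 < p)%N. Proof. exact: prime_gt1. Qed.

Lemma frobD (x y : K) : (x + y) ^+ p = x ^+ p + y ^+ p.
Proof. exact: (rmorphD (pFrobenius_aut charK)). Qed.
Lemma frobB (x y : K) : (x - y) ^+ p = x ^+ p - y ^+ p.
Proof. exact: (rmorphB (pFrobenius_aut charK)). Qed.
Lemma frobN (x : K) : (- x) ^+ p = - x ^+ p.
Proof. exact: (rmorphN (pFrobenius_aut charK)). Qed.
Lemma frob_sum (I : Type) (r : seq I) (P : pred I) (F : I -> K) :
  (\sum_(i <- r | P i) F i) ^+ p = \sum_(i <- r | P i) F i ^+ p.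
Proof. exact: (rmorph_sum (pFrobenius_aut charK)). Qed.

Lemma natp_unit n : (0 < n < p)%N -> n%:R != 0 :> K.
Proof.
move=> /andP[n0 np]; rewrite -(dvdn_pcharf charK); apply: contraL np => /dvdn_leq.
by rewrite -leqNgt => -> //.
Qed.

(** Bezout's identity provides the inverse of [n] as a natural number, so that one can divide by [n]
    inside any additive subgroup of [K]. *)
Lemma natp_inv n : (0 < n < p)%N -> exists m : nat, n%:R * m%:R = 1 :> K.
Proof.
move=> /andP[n0 np].
have cop : coprime n p.
  by rewrite coprime_sym prime_coprime //; apply/negP => /(dvdn_leq n0); rewrite leqNgt np.
have [a b ab _] := egcdnP p n0; exists a.
rewrite -natrM mulnC ab (eqP cop) natrD natrM (pcharf0 charK) mulr0 add0r; reflexivity.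
Qed.

Lemma der_frob D x : derivation D -> D (x ^+ p) = 0.
Proof. by move=> dD; rewrite (derX _ _ dD) -mulr_natr (pcharf0 charK) mulr0. Qed.

Lemma der_frobM D x y : derivation D -> D (x ^+ p * y) = x ^+ p * D y.
Proof. by move=> dD; rewrite (derM dD) (der_frob _ dD) mulr0 addr0. Qed.

(** In Leibniz's rule for the [p]-th iterate the inner binomial coefficients vanish modulo [p]. *)
Lemma iter_der_p D : derivation D -> derivation (iter p D).
Proof.
move=> dD; split=> x y; first exact: iter_derD.
rewrite (iter_derM _ _ _ dD) big_ord_recr /= (bigD1 (Ordinal p_gt0)) //=.
rewrite subn0 bin0 subnn binn !mulr1n big1 ?addr0 => [|i i0]; last first.
  rewrite -mulr_natr; have -> : ('C(p, i))%:R = 0 :> K; last by rewrite mulr0.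
  apply/eqP; rewrite -(dvdn_pcharf charK); apply: prime_dvd_bin => //.
  by rewrite ltn_ord andbT lt0n; apply: contraNneq i0 => i0; apply/eqP/val_inj.
by rewrite addrC [iter p D x * y]mulrC.
Qed.

(* The [D]-stable additive subgroups closed under multiplication by [x]; both
   [0] and the ideals of [D]-stable rings containing [x] qualify. *)
Record der_stable D x (I : set K) : Prop := DerStable {
  ds0 : I 0;
  dsB : forall a b, I a -> I b -> I (a - b);
  dsM : forall a, I a -> I (x * a);
  dsD : forall a, I a -> I (D a) }.

(** Induction on the degree: [D] sends the sum to the polynomial with coefficients [c l.+1 *+ l.+1],
    of smaller degree, and [l.+1 < p] is invertible. Subtracting the higher terms leaves [c 0]. *)
Lemma der_coefs D x I (c : nat -> K) n : derivation D -> D x = 1 ->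
    der_stable D x I -> (n <= p)%N -> (forall l, (l < n)%N -> D (c l) = 0) ->
    I (\sum_(l < n) c l * x ^+ l) ->
  forall l, (l < n)%N -> I (c l).
Proof.
move=> dD Dx [I0 IB IM ID]; elim: n c => // n IH c np c0 h.
have IN a : I a -> I (- a) by move=> Ia; rewrite -sub0r; exact: IB.
have IA a b : I a -> I b -> I (a + b) by move=> ? ?; rewrite -[b]opprK; exact/IB/IN.
have Imul a m : I a -> I (a *+ m).
  by move=> Ia; elim: m => [|m Im]; rewrite ?mulr0n // mulrS; exact: IA.
have Ic l : (l < n)%N -> I (c l.+1).
  move=> ln; have [m hm] : exists m : nat, l.+1%:R * m%:R = 1 :> K.
    by apply: natp_inv => /=; exact: leq_trans np.
  suff : I (c l.+1 *+ l.+1) by move=> /(Imul _ m); rewrite -mulrnA -mulr_natr natrM hm mulr1.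
  move: l ln {m hm}; apply: (IH (fun l => c l.+1 *+ l.+1)).
  - exact: ltnW.
  - by move=> l ln; rewrite (derMn _ _ dD) c0 ?mul0rn.
  move: (ID _ h); rewrite (der_sum _ _ _ dD) big_ord_recl.
  rewrite (derM dD) expr0 (der1 dD) c0 // !mulr0 !add0r.
  congr I; apply: eq_bigr => i _; rewrite (derM dD) (derX _ _ dD) Dx c0 ?ltn_ord //.
  by rewrite mulr0 addr0 /= mulr1 mulrnAr mulrnAl.
case=> [_|l]; last by rewrite ltnS; exact: Ic.
suff : I (x * \sum_(l < n) c l.+1 * x ^+ l).
  move=> h'; have := IB _ _ h h'; congr I.
  rewrite big_ord_recl expr0 mulr1 mulr_sumr -addrA -sumrB big1 ?addr0 // => i _.
  by rewrite /= /bump leq0n add1n exprS; ring.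
apply: (IM); apply: (big_ind I) => // i _; rewrite mulrC.
have := Ic _ (ltn_ord i); move: (c _) => a Ia.
by elim: (nat_of_ord i) => [|j IHj]; rewrite ?expr0 ?mul1r // exprS -mulrA; exact: (IM).
Qed.

(** The dual derivations d/dx and d/dw are part of the data: they force the monomials of degrees
    below [p] in [x] and [w] to be independent over p-th powers and, by preserving [O], bound the
    coefficients in expansions of elements of [O]. *)
Record pbasis (O : set K) (x w : K) D E : Prop := Pbasis {
  pb_x : O x; pb_w : O w;
  pb_D : derivation D; pb_E : derivation E;
  pb_DO : forall f, O f -> O (D f); pb_EO : forall f, O f -> O (E f);
  pb_Dx : D x = 1; pb_Dw : D w = 0; pb_Ex : E x = 0; pb_Ew : E w = 1 }.

Lemma pbasis_swap O x w D E : pbasis O x w D E -> pbasis O w x E D.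
Proof. by case. Qed.

Lemma pbasisT O x w D E : pbasis O x w D E -> pbasis setT x w D E.
Proof. by case=> *; split. Qed.

Lemma pbasis_exchange O x w D E eta : subring O -> pbasis O x w D E ->
    O eta -> E eta != 0 -> O (E eta)^-1 ->
  pbasis O x eta (fun f => D f - D eta / E eta * E f) (fun f => (E eta)^-1 * E f).
Proof.
move=> sO [Ox Ow dD dE DO EO Dx Dw Ex Ew] Oeta nz Oinv.
have h f : D f - D eta / E eta * E f = 1 * D f + (- (D eta / E eta)) * E f.
  by rewrite mul1r mulNr.
split=> //.
- by rewrite (funext h); exact: der_lin.
- exact: der_scale.
- move=> f Of; apply: subringB => //; first exact: DO.
  by apply: subringM => //; [apply: subringM => //; exact: DO | exact: EO].
- by move=> f Of; apply: subringM => //; exact: EO.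
- by rewrite Dx Ex mulr0 subr0.
- by rewrite divfK // subrr.
- by rewrite Ex mulr0.
- by rewrite mulVf.
Qed.

Definition pexp (x w : K) (e : nat -> nat -> K) : K :=
  \sum_(l < p) \sum_(m < p) e l m ^+ p * x ^+ l * w ^+ m.

(** [der_coefs] is applied in powers of [w] with [E], then in powers of [x] with [D]. With [I] = 0
    this is the independence of the monomials; with [I] = [O] or its maximal ideal it controls the
    coefficients. *)
Lemma pexp_coefs O x w D E I (e : nat -> nat -> K) : pbasis O x w D E ->
    der_stable D x I -> der_stable E w I -> I (pexp x w e) ->
  forall l m, (l < p)%N -> (m < p)%N -> I (e l m ^+ p).
Proof.
move=> [Ox Ow dD dE DO EO Dx Dw Ex Ew] sD sE.
have -> : pexp x w e = \sum_(m < p) (\sum_(l < p) e l m ^+ p * x ^+ l) * w ^+ m.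
  by rewrite /pexp exchange_big; apply: eq_bigr => m _; rewrite mulr_suml.
move=> h l m lp mp.
have /(_ m mp) : forall m, (m < p)%N -> I (\sum_(l < p) e l m ^+ p * x ^+ l).
  apply: (der_coefs (D := E) (x := w)) h => // m' _.
  rewrite (der_sum _ _ _ dE) big1 // => i _.
  by rewrite (der_frobM _ _ dE) (derX _ _ dE) Ex mulr0 mul0rn mulr0.
move/(der_coefs (c := fun l => e l m ^+ p) dD Dx sD (leqnn p)); apply=> // l' _.
exact: der_frob.
Qed.

(** The bound [K : K^p] <= p^2, phrased by linear relations with p-th power coefficients to avoid
    the subfield K^p. *)
Definition pdeg_le2 : Prop := forall (T : finType) (z : T -> K), (p * p < #|T|)%N ->
  exists c : T -> K, (exists i, c i != 0) /\ \sum_i c i ^+ p * z i = 0.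

Lemma pexp_span_indep x w f : pdeg_le2 ->
    (forall e, pexp x w e = 0 -> forall l m, (l < p)%N -> (m < p)%N -> e l m = 0) ->
  exists e, f = pexp x w e.
Proof.
move=> deg indep.
(* The p^2 monomials together with [f] are dependent. A relation in which the coefficient of [f]
   vanishes would contradict [indep]. *)
pose z (i : option ('I_p * 'I_p)) := if i is Some (l, m) then x ^+ l * w ^+ m else f.
have [|c [[i ci] hc]] := deg _ z.
  by rewrite card_option card_prod card_ord.
pose e (a : K) l m : K := if insub l is Some l' then if insub m is Some m' then
   c (Some (l', m')) / a else 0 else 0.
have eE a (l m : 'I_p) : e a l m = c (Some (l, m)) / a.
  by rewrite /e !valK.
have zE : \sum_(j : 'I_p * 'I_p) c (Some j) ^+ p * z (Some j) = pexp x w (e 1).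
  rewrite /pexp pair_bigA; apply: eq_bigr => -[l m] _ /=.
  by rewrite eE divr1 mulrA.
have hc' : c None ^+ p * f + pexp x w (e 1) = 0.
  rewrite -zE; apply: etrans hc; rewrite (bigD1 None) //=; congr (_ + _).
  rewrite [RHS](reindex_omap Some id) /=; last by case.
  by apply: eq_bigl => j; rewrite eqxx.
have [c0|c0] := eqVneq (c None) 0; last first.
  exists (e (- c None)); apply: (mulfI (expf_neq0 p c0)).
  move/eqP: hc'; rewrite addr_eq0 => /eqP ->; rewrite /pexp -sumrN mulr_sumr.
  apply: eq_bigr => l _; rewrite -sumrN mulr_sumr; apply: eq_bigr => m _.
  rewrite !eE divr1 invrN mulrN frobN exprMn exprVn !mulrA mulrN.
  by rewrite mulrCA mulfV ?mulr1 ?mulNr // expf_neq0.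
exfalso; move: hc'; rewrite c0 expr0n gtn_eqF // mul0r add0r => h.
have := indep _ h; case: i ci => [[l m]|]; last by rewrite c0 eqxx.
move=> nz /(_ l m (ltn_ord l) (ltn_ord m)) /eqP.
by rewrite eE divr1 (negbTE nz).
Qed.

Lemma pexp_indep x w D E : pbasis setT x w D E ->
  forall e, pexp x w e = 0 -> forall l m, (l < p)%N -> (m < p)%N -> e l m = 0.
Proof.
move=> pb e h l m lp mp.
have s0 D' x' : derivation D' -> der_stable D' x' [set (0 : K)].
  by move=> dD'; split=> //= [a b -> ->|a ->|a ->]; rewrite ?subrr ?mulr0 //; exact: der0.
have := pexp_coefs pb (s0 _ _ (pb_D pb)) (s0 _ _ (pb_E pb)) h lp mp.
by move=> /= /eqP; rewrite expf_eq0 p_gt0 /= => /eqP.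
Qed.

Lemma pexp_span x w D E f : pdeg_le2 -> pbasis setT x w D E ->
  exists e, f = pexp x w e.
Proof. by move=> deg /pexp_indep; exact: pexp_span_indep. Qed.

Lemma pexp_neq0 x w D E e l m : pbasis setT x w D E -> (l < p)%N -> (m < p)%N ->
  e l m != 0 -> pexp x w e != 0.
Proof.
move=> pb lp mp; apply: contraNN => /eqP h; apply/eqP.
exact: pexp_indep pb _ h _ _ lp mp.
Qed.

Lemma der_stable_ring O D x : subring O -> O x -> (forall f, O f -> O (D f)) ->
  der_stable D x O.
Proof.
move=> sO Ox DO; split=> //; first exact: subring0.
- by move=> a b; exact: subringB.
- by move=> a; exact: subringM.
Qed.

Lemma pexp_expand O x w D E f : pdeg_le2 -> subring O ->
    (forall a, O (a ^+ p) -> O a) -> pbasis O x w D E -> O f ->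
  exists e, (forall l m, O (e l m)) /\ f = pexp x w e.
Proof.
move=> deg sO root pb Of; have [e fE] := pexp_span f deg (pbasisT pb).
have h : forall l m, (l < p)%N -> (m < p)%N -> O (e l m).
  move=> l m lp mp; apply: root; move: l m lp mp.
  apply: (pexp_coefs pb); last by rewrite -fE.
    by apply: der_stable_ring => //; [exact: pb_x pb | exact: pb_DO pb].
  by apply: der_stable_ring => //; [exact: pb_w pb | exact: pb_EO pb].
(* Coefficients out of range do not enter [pexp]; they are set to 0 so that all of them lie in
   [O]. *)
exists (fun l m => if (l < p)%N && (m < p)%N then e l m else 0); split.
  by move=> l m; case: ifP => [/andP[] |_]; [exact: h | exact: subring0].
by rewrite fE; apply: eq_bigr => l _; apply: eq_bigr => m _; rewrite !ltn_ord.
Qed.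

(** A derivation with values in a module is linear over p-th powers, hence determined by its values
    on monomials in [x] and [w]. The module is [K] itself in [pbasis_der] and the space of forms in
    [wedge_chain]. *)
Lemma pbasis_chain (M : lmodType K) (delta : K -> M) x w D E f : pdeg_le2 ->
    pbasis setT x w D E ->
    (forall a b, delta (a + b) = delta a + delta b) ->
    (forall a b, delta (a * b) = a *: delta b + b *: delta a) ->
  delta f = D f *: delta x + E f *: delta w.
Proof.
move=> deg pb dA dM.
have [_ _ dD dE _ _ Dx Dw Ex Ew] := pb.
have d0 : delta 0 = 0 by apply: (@addIr _ (delta 0)); rewrite -dA !add0r.
have dX a n : delta (a ^+ n) = (a ^+ n.-1 *+ n) *: delta a.
  elim: n => [|n IH].
    rewrite expr0 mulr0n scale0r; apply: (@addIr _ (delta 1)).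
    by rewrite add0r -[RHS](congr1 delta (mulr1 1)) dM !scale1r.
  rewrite exprS dM IH scalerA -scalerDl; case: n {IH} => [|n] /=.
    by rewrite mulr0n mulr0 add0r.
  by rewrite mulrnAr -exprS -mulrSr.
have dp a b : delta (a ^+ p * b) = a ^+ p *: delta b.
  by rewrite dM dX -mulr_natr (pcharf0 charK) mulr0 scale0r scaler0 addr0.
have dsum (I : finType) (F : I -> K) : delta (\sum_i F i) = \sum_i delta (F i).
  exact: (big_morph delta dA d0).
have [e ->] := pexp_span f deg pb; rewrite /pexp.
rewrite (der_sum _ _ _ dD) (der_sum _ _ _ dE) dsum !scaler_suml -big_split.
apply: eq_bigr => l _ /=.
rewrite (der_sum _ _ _ dD) (der_sum _ _ _ dE) dsum !scaler_suml -big_split.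
apply: eq_bigr => m _ /=; rewrite -!mulrA dp (der_frobM _ _ dD) (der_frobM _ _ dE).
rewrite dM (derM dD) (derM dE) !dX !(derX _ _ dD) !(derX _ _ dE) Dx Dw Ex Ew.
rewrite !mulr0 !mulr1 !mul0rn !mulr0 addr0 add0r -!scalerA -scalerDr.
by rewrite !scalerA addrC.
Qed.

Lemma pbasis_der x w D E F f : pdeg_le2 -> pbasis setT x w D E -> derivation F ->
  F f = D f * F x + E f * F w.
Proof.
move=> deg pb dF.
exact: (pbasis_chain (M := K^o) (delta := F) f deg pb (derD dF) (derM dF)).
Qed.

End CharP.

(** * Frobenius-inverse-linear maps *)

Section Trace.
Variables (K : fieldType) (p : nat).
Hypothesis charK : p \in [pchar K].
Implicit Types (Psi : K -> K) (x y z w f : K).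

Let p_pr : prime p. Proof. exact: pcharf_prime charK. Qed.
Let p_gt0 : (0 < p)%N. Proof. exact: prime_gt0. Qed.

Definition additive_fun Psi := forall x y, Psi (x + y) = Psi x + Psi y.
Definition linear_consts Psi : set K := [set c | forall f, Psi (c * f) = c * Psi f].

(* If [Psi] is linear over a subfield L containing [z ^+ p], then [Psi] composed
   with multiplications by powers of [z] is assembled into a map that is linear
   over L(z): the analogue of a relative trace for L(z) / L. *)
Definition rel_trace z Psi f : K :=
  \sum_(j < p) z ^+ (p.-1 - j) * Psi (z ^+ j * f).

Lemma additive_fun0 Psi : additive_fun Psi -> Psi 0 = 0.
Proof. by move=> aP; apply: (@addIr _ (Psi 0)); rewrite -aP !add0r. Qed.

Lemma linear_consts_ring Psi : additive_fun Psi -> subring (linear_consts Psi).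
Proof.
move=> aP; split=> [f|a b ha hb f|a b ha hb f]; first by rewrite !mul1r.
  rewrite [RHS]mulrBl -ha -hb; apply: (@addIr _ (Psi (b * f))); rewrite -aP.
  by rewrite mulrBl !subrK.
by rewrite -mulrA ha hb mulrA.
Qed.

Lemma rel_trace_additive z Psi : additive_fun Psi -> additive_fun (rel_trace z Psi).
Proof.
move=> aP x y; rewrite /rel_trace -big_split; apply: eq_bigr => i _ /=.
by rewrite mulrDr aP mulrDr.
Qed.

Lemma rel_trace_const z Psi c : linear_consts Psi c -> linear_consts (rel_trace z Psi) c.
Proof.
move=> hc f; rewrite /rel_trace mulr_sumr; apply: eq_bigr => i _.
by rewrite mulrCA hc mulrCA.
Qed.

(** Multiplying [f] by [z] shifts the sum by one step; the factor [z ^+ p] of the term that wraps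
    around passes through [Psi] by linearity. *)
Lemma rel_trace_self z Psi : additive_fun Psi -> linear_consts Psi (z ^+ p) ->
  linear_consts (rel_trace z Psi) z.
Proof.
move=> aP hz f; rewrite /rel_trace mulr_sumr.
have h n (F : nat -> K) : (0 < n)%N ->
  \sum_(j < n) F j = F 0%N + \sum_(j < n.-1) F j.+1.
  by case: n => // n _; rewrite big_ord_recl.
have h' n (F : nat -> K) : (0 < n)%N ->
  \sum_(j < n) F j = F n.-1 + \sum_(j < n.-1) F j.
  by case: n => // n _; rewrite big_ord_recr addrC.
rewrite (h' _ (fun j => z ^+ (p.-1 - j) * Psi (z ^+ j * (z * f)))) //.
rewrite (h _ (fun j => z * (z ^+ (p.-1 - j) * Psi (z ^+ j * f)))) //.
congr (_ + _).
  by rewrite subnn subn0 expr0 !mul1r mulrA -exprSr mulrA -exprS prednK // hz.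
apply: eq_bigr => j _; rewrite mulrA -exprSr [RHS]mulrA -exprS.
by have := ltn_ord j; rewrite -subn_gt0 subnS => /prednK ->.
Qed.

Lemma rel_traceC x y Psi f : additive_fun Psi ->
    linear_consts Psi (x ^+ p) -> linear_consts Psi (y ^+ p) ->
  rel_trace x (rel_trace y Psi) f = rel_trace y (rel_trace x Psi) f.
Proof.
move=> _ _ _; rewrite /rel_trace.
under eq_bigr do rewrite mulr_sumr.
under [RHS]eq_bigr do rewrite mulr_sumr.
rewrite exchange_big; apply: eq_bigr => i _; apply: eq_bigr => j _.
by rewrite mulrCA [y ^+ i * (_ * f)]mulrCA.
Qed.

(** Times b - a the sum is b^p - a^p = (b - a)^p. For a = b it is p a^(p-1) = 0. *)
Lemma sum_expr_subr (R : idomainType) (a b : R) : p \in [pchar R] ->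
  \sum_(i < p) b ^+ (p.-1 - i) * a ^+ i = (b - a) ^+ p.-1.
Proof.
move=> charR; have [->|ab] := eqVneq b a.
  have p1 : (p.-1 == 0)%N = false by rewrite -subn1 subn_eq0 leqNgt prime_gt1.
  rewrite subrr expr0n p1 mulr0n.
  rewrite (eq_bigr (fun=> a ^+ p.-1)) => [|i _].
    by rewrite sumr_const card_ord -mulr_natr (pcharf0 charR) mulr0.
  have ip : (i <= p.-1)%N by rewrite -ltnS prednK // ltn_ord.
  by rewrite -exprD subnK.
have ba : b - a != 0 by rewrite subr_eq0.
apply: (mulfI ba); rewrite -exprS prednK //.
rewrite -subrXX; exact/esym/(rmorphB (pFrobenius_aut charR)).
Qed.

Section Change.
Variables (Psi : K -> K) (z f : K).
Hypothesis aP : additive_fun Psi.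
Hypothesis zP : linear_consts Psi (z ^+ p).

(** The linear functional X^j |-> Psi(z^j f) on K[X]. By [sum_expr_subr] the relative trace of Q(z)
    is its value at (Q(z) - Q)^(p-1), when Q has constant coefficients for [Psi]; and it kills the
    multiples of (z - X)^p = z^p - X^p. *)
Let L (h : {poly K}) : K := \sum_(j < size h) h`_j * Psi (z ^+ j * f).

Let Lw n (h : {poly K}) : (size h <= n)%N ->
  L h = \sum_(j < n) h`_j * Psi (z ^+ j * f).
Proof.
move=> hn; rewrite /L (big_ord_widen n (fun j => h`_j * Psi (z ^+ j * f))) //.
rewrite [RHS](bigID (fun j : 'I_n => (j < size h)%N)) /= [X in _ = _ + X]big1 ?addr0 //.
by move=> j; rewrite -leqNgt => /(nth_default 0) ->; rewrite mul0r.
Qed.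

Let LD h g : L (h + g) = L h + L g.
Proof.
have sD := size_polyD h g.
rewrite (Lw sD) (Lw (leq_maxl (size h) (size g))) (Lw (leq_maxr (size h) (size g))).
by rewrite -big_split; apply: eq_bigr => i _; rewrite coefD mulrDl.
Qed.

Let LZ c h : L (c *: h) = c * L h.
Proof.
rewrite (Lw (size_scale_leq c h)) /L mulr_sumr.
by apply: eq_bigr => i _; rewrite coefZ mulrA.
Qed.

Let L0 : L 0 = 0.
Proof. by rewrite /L size_poly0 big_ord0. Qed.

Let L_Xp h : L ('X^p * h) = z ^+ p * L h.
Proof.
have s : (size ('X^p * h)%R <= p + size h)%N.
  by apply: (leq_trans (size_polyMleq _ _)); rewrite size_polyXn.
rewrite (Lw s) big_split_ord /= big1 ?add0r => [|i _]; last first.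
  by rewrite coefXnM ltn_ord mul0r.
rewrite /L mulr_sumr; apply: eq_bigr => i _.
by rewrite coefXnM ltnNge leq_addr /= addKn exprD -mulrA zP mulrCA.
Qed.

Let charKX : p \in [pchar {poly K}].
Proof. by rewrite pchar_poly. Qed.

Let L_kill h : L ((z%:P - 'X) ^+ p * h) = 0.
Proof.
have -> : (z%:P - 'X) ^+ p = (z ^+ p)%:P - 'X^p :> {poly K}.
  by rewrite polyC_exp; exact: (rmorphB (pFrobenius_aut charKX)).
rewrite mulrBl -scaleN1r -[_%:P * h]/(_ * _) mul_polyC LD !LZ L_Xp mulN1r.
exact: subrr.
Qed.

Let L_eval (Q : {poly K}) : (forall j, linear_consts Psi Q`_j) -> L Q = Psi (Q.[z] * f).
Proof.
move=> hQ; rewrite horner_coef mulr_suml.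
rewrite (big_morph Psi aP (additive_fun0 aP)) /L; apply: eq_bigr => i _.
by rewrite -mulrA hQ.
Qed.

Let coefs_M (P Q : {poly K}) : (forall j, linear_consts Psi P`_j) ->
  (forall j, linear_consts Psi Q`_j) -> forall j, linear_consts Psi (P * Q)`_j.
Proof.
move=> hP hQ j; rewrite coefM; apply: (subring_sum (linear_consts_ring aP)) => i _.
exact: (subringM (linear_consts_ring aP)).
Qed.

Let coefs_X (P : {poly K}) n : (forall j, linear_consts Psi P`_j) ->
  forall j, linear_consts Psi (P ^+ n)`_j.
Proof.
move=> hP; elim: n => [|n IH]; last by rewrite exprS; exact: coefs_M.
by move=> j; rewrite expr0 coef1; exact: (subring_nat (linear_consts_ring aP)).
Qed.

(** Write P(z) - P = (z - X) Q, so that Q(z) = P'(z). Modulo X - z the polynomial Q^(p-1) is the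
    constant P'(z)^(p-1); hence (P(z) - P)^(p-1) and P'(z)^(p-1) (z - X)^(p-1) differ by a multiple
    of (z - X)^p, on which [L] vanishes. *)
Lemma rel_trace_change (P : {poly K}) : (forall j, linear_consts Psi P`_j) ->
  rel_trace P.[z] Psi f = P^`().[z] ^+ p.-1 * rel_trace z Psi f.
Proof.
move=> hP.
have LE (Q : {poly K}) : (forall j, linear_consts Psi Q`_j) ->
    rel_trace Q.[z] Psi f = L ((Q.[z]%:P - Q) ^+ p.-1).
  move=> hQ; rewrite -(sum_expr_subr _ _ charKX) (big_morph L LD L0).
  apply: eq_bigr => i _; rewrite -polyC_exp mul_polyC LZ L_eval; last exact: coefs_X.
  by rewrite horner_exp.
have hX j : linear_consts Psi ('X : {poly K})`_j.
  by rewrite coefX; exact: (subring_nat (linear_consts_ring aP)).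
have -> : rel_trace z Psi f = L ((z%:P - 'X) ^+ p.-1).
  by rewrite -[X in rel_trace X](hornerX z) LE // hornerX.
rewrite LE //.
have /factor_theorem [Q hQ] : root (P - P.[z]%:P) z.
  by rewrite /root !hornerE subrr.
have Qz : Q.[z] = P^`().[z].
  have dP : P^`() = (Q * ('X - z%:P) + P.[z]%:P)^`() by rewrite -hQ subrK.
  by rewrite dP derivD derivM derivXsubC derivC !hornerE subrr mulr0 add0r.
have /factor_theorem [h hh] : root (Q ^+ p.-1 - (Q.[z] ^+ p.-1)%:P) z.
  by rewrite /root !hornerE subrr.
have -> : P.[z]%:P - P = (z%:P - 'X) * Q.
  by rewrite -opprB hQ -mulrN opprB mulrC.
rewrite exprMn -[Q ^+ _](subrK (Q.[z] ^+ p.-1)%:P) hh mulrDr LD.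
have -> : (z%:P - 'X) ^+ p.-1 * (h * ('X - z%:P)) = (z%:P - 'X) ^+ p * (- h).
  by rewrite -[X in (_ - _) ^+ X * - _](prednK p_gt0) exprS; ring.
by rewrite L_kill add0r mulrC mul_polyC LZ Qz.
Qed.

End Change.

Lemma der_horner (D : K -> K) (P : {poly K}) w : derivation D ->
  (forall j, D P`_j = 0) -> D P.[w] = P^`().[w] * D w.
Proof.
move=> dD; elim/poly_ind: P => [|P c IH] hP.
  by rewrite deriv0 !horner0 (der0 dD) mul0r.
have hP' j : D P`_j = 0.
  by have := hP j.+1; rewrite coefD coefMX coefC addr0.
have hc : D c = 0 by have := hP 0%N; rewrite coefD coefMX coefC add0r.
rewrite derivD derivM derivX derivC !hornerE (derD dD) (derM dD) IH // hc.
ring.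
Qed.

Section Theta.
Variable phi : K -> K.
Hypothesis phiD : forall x y, phi (x + y) = phi x + phi y.
Hypothesis phiM : forall a f, phi (a ^+ p * f) = a * phi f.
Hypothesis phi1 : phi 1 = 1.
Hypothesis deg : pdeg_le2 K p.

(** The p-th power turns the p^(-1)-linear [phi] into a K^p-linear map, to which relative traces
    apply. *)
Definition psi0 f : K := phi f ^+ p.

Lemma psi0_additive : additive_fun psi0.
Proof. by move=> x y; rewrite /psi0 phiD (frobD charK). Qed.
Lemma psi0_const a : linear_consts psi0 (a ^+ p).
Proof. by move=> f; rewrite /psi0 phiM exprMn. Qed.

Definition sigma y : K := rel_trace y psi0 1.
Definition theta x w : K := rel_trace w (rel_trace x psi0) 1.

Lemma thetaC x w : theta x w = theta w x.
Proof. apply: rel_traceC; [exact: psi0_additive | exact: psi0_const ..]. Qed.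

Lemma sigma_change (P : {poly K}) y : (forall j, exists a, P`_j = a ^+ p) ->
  sigma P.[y] = P^`().[y] ^+ p.-1 * sigma y.
Proof.
move=> hP; apply: rel_trace_change; [exact: psi0_additive | exact: psi0_const |].
by move=> j; have [a ->] := hP j; exact: psi0_const.
Qed.

(** As a polynomial in [w], [eta] has coefficients in K^p[x], which are constants of the inner trace
    in [x]; so [rel_trace_change] applies, and the derivative is [E eta]. *)
Lemma theta_step x w D E eta : pbasis setT x w D E ->
  theta x eta = E eta ^+ p.-1 * theta x w.
Proof.
move=> pb; have [_ _ dD dE _ _ Dx Dw Ex Ew] := pb.
have [e etaE] := pexp_span charK eta deg pb.
pose P := \poly_(m < p) (\sum_(l < p) e l m ^+ p * x ^+ l).
have Pw : P.[w] = eta.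
  rewrite horner_poly etaE /pexp exchange_big; apply: eq_bigr => m _.
  by rewrite mulr_suml.
have DP j : E P`_j = 0.
  rewrite coef_poly; case: ifP => _; last exact: der0.
  rewrite (der_sum _ _ _ dE) big1 // => i _.
  by rewrite (der_frobM charK _ _ dE) (derX _ _ dE) Ex mulr0 mul0rn mulr0.
have -> : E eta = P^`().[w] by rewrite -Pw (der_horner _ dE DP) Ew mulr1.
have aP := rel_trace_additive x psi0_additive.
have cP a : linear_consts (rel_trace x psi0) (a ^+ p).
  exact/rel_trace_const/psi0_const.
rewrite -Pw; apply: rel_trace_change => // j.
have sC := linear_consts_ring aP.
rewrite coef_poly; case: ifP => _; last exact: (subring0 sC).
apply: (subring_sum sC) => i _; apply: (subringM sC) => //; apply: (@subringX _ _ sC).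
exact/rel_trace_self/psi0_const/psi0_additive.
Qed.

Lemma theta_change t u D E z x : pbasis setT t u D E -> (D z != 0) || (E z != 0) ->
  theta z x = (D z * E x - E z * D x) ^+ p.-1 * theta t u.
Proof.
(* Two applications of [theta_step], replacing u' by [z] and then t' by [x], each contribute one
   factor of the Jacobian; the first replacement requires [E' z] to be nonzero. *)
have key t' u' D' E' : pbasis setT t' u' D' E' -> E' z != 0 ->
    theta z x = (D' x * E' z - E' x * D' z) ^+ p.-1 * theta t' u'.
  move=> pb Ez.
  have pb' := pbasis_exchange (@subringT K) pb I Ez I.
  have -> : D' x * E' z - E' x * D' z = (D' x - D' z / E' z * E' x) * E' z.
    by field.
  rewrite exprMn -[RHS]mulrA -(theta_step z pb) [theta t' z]thetaC.
  exact: theta_step (pbasis_swap pb').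
move=> pb /orP[h|h].
  by rewrite (key _ _ _ _ (pbasis_swap pb) h) [theta u t]thetaC; congr (_ ^+ _ * _); ring.
rewrite (key _ _ _ _ pb h).
have -> : D z * E x - E z * D x = - (D x * E z - E x * D z) by ring.
(* Since (-1)^p = -1 in characteristic p, also for p = 2, the sign disappears. *)
rewrite exprNn; have -> : (-1) ^+ p.-1 = 1 :> K; last by rewrite mul1r.
have n1 : (-1 : K) != 0 by rewrite oppr_eq0 oner_neq0.
by apply: (mulIf n1); rewrite -exprSr prednK // (frobN charK) expr1n mul1r.
Qed.

End Theta.
End Trace.

(** * Discrete valuation rings *)

Record dvr (K : fieldType) (O : set K) (t : K) : Prop := Dvr {
  dvr_ring : subring O;
  dvr_t : O t;
  dvr_tV : ~ O t^-1;
  dvr_val : forall f, f != 0 -> exists u (m : int), [/\ O u, O u^-1, u != 0 & f = u * t ^ m] }.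

(** Order at least [m], phrased by membership in [O] so that 0 satisfies it for every [m]. *)
Definition val_ge (K : fieldType) (O : set K) (t : K) (m : int) : set K :=
  [set f | O (f * t ^ (- m))].

Section ValGe.
Variables (K : fieldType) (O : set K) (t : K).
Hypothesis dO : dvr O t.
Let sO := dvr_ring dO.

Lemma dvr_t0 : t != 0.
Proof.
by apply/eqP => t0; case: dO => _ _ + _; rewrite t0 invr0; apply; exact: subring0.
Qed.

Lemma val_geM m n f g : val_ge O t m f -> val_ge O t n g -> val_ge O t (m + n) (f * g).
Proof.
move=> hf hg; rewrite /val_ge /= opprD expfzDr ?dvr_t0 // mulrACA; exact: subringM.
Qed.

Lemma val_ge0 f : val_ge O t 0 f <-> O f.
Proof. by rewrite /val_ge /= oppr0 expr0z mulr1. Qed.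

Lemma val_geX m n f : val_ge O t m f -> val_ge O t (m *+ n) (f ^+ n).
Proof.
move=> hf; elim: n => [|n IH]; last by rewrite exprS mulrS; exact: val_geM.
by rewrite mulr0n expr0; apply/val_ge0; exact: (subring1 sO).
Qed.

Lemma val_geMl m f g : O f -> val_ge O t m g -> val_ge O t m (f * g).
Proof. by move=> Of hg; rewrite -[m]add0r; apply: val_geM => //; apply/val_ge0. Qed.

Lemma val_geMr m f g : val_ge O t m f -> O g -> val_ge O t m (f * g).
Proof. by move=> hf Og; rewrite mulrC; exact: val_geMl. Qed.

Lemma dvr_root p a : (0 < p)%N -> O (a ^+ p) -> O a.
Proof.
move=> p0 ha; have [->|a0] := eqVneq a 0; first exact: subring0.
have [u [[m|m] [Ou Ou' u0 aE]]] := dvr_val dO a0.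
  by rewrite aE; apply: subringM => //; exact: (@subringX _ _ sO _ m (dvr_t dO)).
exfalso; apply: (dvr_tV dO); move: ha; rewrite aE exprMn NegzE.
move=> /(subringM sO (@subringX _ _ sO _ p Ou')).
rewrite mulrA -exprMn mulVf // expr1n mul1r -exprnN exprVn.
rewrite -exprM => h.
have e : (m.+1 * p = (m.+1 * p).-1.+1)%N by rewrite prednK // muln_gt0.
move: h; rewrite e exprS invfM => /(subringM sO (@subringX _ _ sO _ (m.+1 * p).-1 (dvr_t dO))).
by rewrite mulrCA mulfV ?mulr1 // expf_neq0 // dvr_t0.
Qed.

Lemma dvr_unit f : O f -> (exists2 a, O a & f = t * a) \/ (f != 0 /\ O f^-1).
Proof.
move=> Of; have [->|f0] := eqVneq f 0.
  by left; exists 0; rewrite ?mulr0 //; exact: subring0.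
have [u [[[|m]|m] [Ou Ou' u0 fE]]] := dvr_val dO f0.
- by right; rewrite fE expr0z mulr1.
- left; exists (u * t ^+ m); last by rewrite fE -exprnP exprS mulrCA.
  by apply: subringM => //; exact: (@subringX _ _ sO _ m (dvr_t dO)).
- exfalso; apply: (dvr_tV dO).
  have -> : t^-1 = u^-1 * f * t ^+ m.
    rewrite fE NegzE mulrA mulVf // mul1r -exprnN exprS invfM -mulrA mulVf ?mulr1 //.
    by rewrite expf_neq0 // dvr_t0.
  by do 2?apply: (subringM sO) => //; exact: (@subringX _ _ sO _ m (dvr_t dO)).
Qed.

Lemma dvr_nonunit a : O a -> t * a != 0 -> ~ O (t * a)^-1.
Proof.
move=> Oa ta0 h; apply: (dvr_tV dO).
have a0 : a != 0 by apply: contraNneq ta0 => ->; rewrite mulr0.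
have -> : t^-1 = (t * a)^-1 * a by rewrite invfM -mulrA mulVf ?mulr1.
exact: subringM.
Qed.

(** Bounds the divisibility by powers of [t]: this starts the descent of [good_param_int] and gives
    the independence in [frame_indep]. *)
Lemma dvr_pow_ndvd f : f != 0 -> exists n, ~ exists2 a, O a & f = t ^+ n * a.
Proof.
move=> f0; have [u [m [Ou Ou' u0 fE]]] := dvr_val dO f0.
exists `|m|.+1 => -[a Oa fa]; apply: (dvr_tV dO).
have t0 := dvr_t0.
have -> : t^-1 = a * u^-1 * t ^ (`|m|%:Z - m).
  apply: (mulfI (expf_neq0 `|m|.+1 t0)); rewrite !mulrA -fa fE.
  rewrite exprS mulrAC mulfV // mul1r [u * _ * _]mulrAC mulfV // mul1r.
  by rewrite -expfzDr // addrCA subrr addr0.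
apply: (subringM sO); first exact: subringM.
have : 0 <= `|m|%:Z - m by rewrite subr_ge0 abszE ler_norm.
by case: (_ - m) => // k _; exact: (@subringX _ _ sO _ k (dvr_t dO)).
Qed.

End ValGe.

Lemma sum_ord_recl (V : nmodType) n (F : nat -> V) : (0 < n)%N ->
  \sum_(j < n) F j = F 0%N + \sum_(j < n.-1) F j.+1.
Proof. by case: n => // n _; rewrite big_ord_recl. Qed.

Section Local.
Variables (K : fieldType) (p : nat).
Hypothesis charK : p \in [pchar K].
Hypothesis deg : pdeg_le2 K p.
Variable phi : K -> K.
Hypothesis phiD : forall x y, phi (x + y) = phi x + phi y.
Hypothesis phiM : forall a f, phi (a ^+ p * f) = a * phi f.
Hypothesis phi1 : phi 1 = 1.

Let p_pr : prime p. Proof. exact: pcharf_prime charK. Qed.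
Let p_gt0 : (0 < p)%N. Proof. exact: prime_gt0. Qed.
Let p_gt1 : (1 < p)%N. Proof. exact: prime_gt1. Qed.

Lemma iter_der_in (O : set K) D n f : (forall g, O g -> O (D g)) -> O f -> O (iter n D f).
Proof. by move=> h Of; elim: n => //= n; exact: h. Qed.

Local Notation sigma := (sigma p phi).
Local Notation theta := (theta p phi).

(** After reversal of both indices [theta] becomes a p-basis expansion, whose coefficient at z^(p-1)
    x^(p-1) is the p-th power of [phi 1] = 1. *)
Lemma theta_neq0 z x D E : pbasis setT z x D E -> theta z x != 0.
Proof.
move=> pb.
pose e l m := phi (z ^+ (p.-1 - l) * (x ^+ (p.-1 - m) * 1)).
have -> : theta z x = pexp p z x e.
  rewrite /theta /rel_trace /pexp exchange_big.
  rewrite (reindex_inj rev_ord_inj); apply: eq_bigr => m _; rewrite mulr_sumr.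
  rewrite (reindex_inj rev_ord_inj); apply: eq_bigr => l _ /=.
  have sub (i : 'I_p) : (p - i.+1 = p.-1 - i)%N by rewrite subnS -subn1 -subnDA addnC subnDA subn1.
  have sub' (i : 'I_p) : (p.-1 - (p.-1 - i) = i)%N.
    by rewrite subKn // -ltnS prednK.
  by rewrite !sub !sub' /e /psi0; ring.
apply: (pexp_neq0 charK (l := p.-1) (m := p.-1) pb); rewrite ?ltn_predL //.
by rewrite /e subnn !expr0 !mul1r phi1 oner_neq0.
Qed.

Lemma sigma_neq0 z y D E : pbasis setT z y D E -> sigma y != 0.
Proof.
move=> pb.
pose e l m := if l == 0%N then phi (y ^+ (p.-1 - m) * 1) else 0.
have -> : sigma y = pexp p z y e.
  rewrite /sigma /rel_trace /pexp exchange_big.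
  rewrite (reindex_inj rev_ord_inj); apply: eq_bigr => m _.
  rewrite (bigD1 (Ordinal p_gt0)) //= big1 ?addr0 => [|l l0]; last first.
    have -> : e l m = 0 by rewrite /e ifN //; apply: contra l0 => /eqP h; apply/eqP/val_inj.
    by rewrite expr0n gtn_eqF // !mul0r.
  rewrite /e /= /psi0 expr0 !mulr1.
  have -> : (p - m.+1 = p.-1 - m)%N by rewrite subnS -subn1 -subnDA addnC subnDA subn1.
  have -> : (p.-1 - (p.-1 - m) = m)%N by rewrite subKn // -ltnS prednK.
  by rewrite mulrC.
apply: (pexp_neq0 charK (l := 0) (m := p.-1) pb); rewrite ?ltn_predL //.
by rewrite /e /= subnn expr0 mul1r phi1 oner_neq0.
Qed.

(** [lam] is a local equation of the boundary: [t] along its components, 1 elsewhere. [lf_phi] says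
    that [phi] maps lam^(1-p) O into O. *)
Record local_frame (O : set K) (t u : K) (Dt Du : K -> K) (lam : K) : Prop := LocalFrame {
  lf_dvr : dvr O t;
  lf_pb : pbasis O t u Dt Du;
  lf_lam : lam = 1 \/ lam = t;
  lf_phi : forall f, O f -> O (phi (f / lam ^+ p.-1)) }.

(** The stalk of the logarithmic vector fields: derivations preserving [O] and the ideal of the
    boundary. Forms are tested by their values on these. *)
Record test_der (O : set K) (lam : K) (F : K -> K) : Prop := TestDer {
  td_der : derivation F;
  td_O : forall f, O f -> O (F f);
  td_lam : O (F lam / lam) }.

Section Frame.
Variables (O : set K) (t u : K) (Dt Du : K -> K) (lam : K).
Hypothesis lf : local_frame O t u Dt Du lam.
Let dO := lf_dvr lf.
Let sO := dvr_ring dO.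
Let pb := lf_pb lf.
Let t0 := dvr_t0 dO.

Lemma lf_lam0 : lam != 0.
Proof. by case: (lf_lam lf) => ->; rewrite ?oner_neq0. Qed.
Let lam0 := lf_lam0.

Lemma lf_Olam : O lam.
Proof. by case: (lf_lam lf) => ->; [exact: subring1 | exact: dvr_t]. Qed.

Lemma lf_phiO f : O f -> O (phi f).
Proof.
move=> Of; have -> : f = (lam ^+ p.-1 * f) / lam ^+ p.-1.
  by rewrite mulrAC mulfV ?mul1r // expf_neq0.
by apply: (lf_phi lf); apply: subringM => //; exact: (@subringX _ _ sO _ _ lf_Olam).
Qed.

Lemma test_Dt a : O a -> test_der O lam (fun f => a * lam * Dt f).
Proof.
have [Ot Ou dD dE DO EO Dx Dw Ex Ew] := pb.
move=> Oa; split; first exact: der_scale.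
  by move=> f Of; apply: subringM => //; [apply: subringM => //; exact: lf_Olam | exact: DO].
rewrite mulrAC mulfK //.
by case: (lf_lam lf) => ->; apply: subringM => //; rewrite ?(der1 dD) ?Dx; [exact: subring0 | exact: subring1].
Qed.

Lemma test_Du a : O a -> test_der O lam (fun f => a * Du f).
Proof.
have [Ot Ou dD dE DO EO Dx Dw Ex Ew] := pb.
move=> Oa; split; first exact: der_scale.
  by move=> f Of; apply: subringM => //; exact: EO.
by case: (lf_lam lf) => ->; rewrite ?(der1 dE) ?Ex ?mulr0 mul0r; exact: subring0.
Qed.

Lemma test_add F G : test_der O lam F -> test_der O lam G ->
  test_der O lam (fun f => F f + G f).
Proof.
move=> [dF FO Fl] [dG GO Gl]; split.
- have -> : (fun f => F f + G f) = (fun f => 1 * F f + 1 * G f).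
    by apply: funext => f; rewrite !mul1r.
  exact: der_lin.
- by move=> f Of; apply: subringD => //; [exact: FO | exact: GO].
- by rewrite mulrDl; exact: subringD.
Qed.

(** If an iterate sends [lam] to lam b, one more application of [F] gives lam F b + b F lam, again
    in the ideal of [lam]. The p-curvature uses n = p. *)
Lemma test_iter F n : derivation (iter n F) -> test_der O lam F -> test_der O lam (iter n F).
Proof.
move=> dn [dF FO Fl]; split => //; first by move=> f; exact: iter_der_in.
elim: n {dn} => [|n IH] /=; first by rewrite mulfV //; exact: subring1.
have -> : iter n F lam = lam * (iter n F lam / lam) by rewrite mulrC divfK.
rewrite (derM dF) mulrDl; apply: subringD => //.
  by rewrite mulrAC mulfV // mul1r; exact: FO.
by rewrite -mulrA; exact: subringM.
Qed.

(** For lam = t, a factor t^(p-1) splits off every summand. For j = 0 it comes from (t eps)^(p-1).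
    For j > 0 the argument of [phi] is t^p times an element of t^(1-p) O, so its image lies in t O
    and the p-th power of that in t^p O. *)
Lemma rel_trace_local eps f : O eps -> O f ->
  O (rel_trace p (t * eps) (psi0 p phi) f / lam ^+ p.-1).
Proof.
move=> Oe Of; rewrite /rel_trace mulr_suml; apply: (subring_sum sO) => j _.
have jp := ltn_ord j.
have Oz : O (t * eps) by apply: subringM => //; exact: dvr_t dO.
rewrite /psi0; case: (lf_lam lf) => lamE.
  rewrite lamE expr1n divr1; apply: (subringM sO); first exact: (@subringX _ _ sO).
  apply: (@subringX _ _ sO); apply: lf_phiO; apply: (subringM sO) => //.
  exact: (@subringX _ _ sO).
case: j jp => -[|j] /= _ jp.
  rewrite expr0 mul1r subn0 exprMn mulrAC -lamE [lam ^+ _ * _ / _]mulrAC mulfV ?mul1r ?expf_neq0 //.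
  by apply: (subringM sO); apply: (@subringX _ _ sO) => //; exact: lf_phiO.
have tp : t ^+ p = t * t ^+ p.-1 by rewrite -exprS prednK.
have T0 : t ^+ p.-1 != 0 by rewrite expf_neq0.
have -> : phi ((t * eps) ^+ j.+1 * f) =
    t * phi ((t ^+ j * eps ^+ j.+1 * f) / lam ^+ p.-1).
  rewrite -phiM lamE tp exprMn [t ^+ j.+1]exprS; congr phi.
  by move: (t ^+ p.-1) T0 => T T0; field.
set a := phi _; have Oa : O a.
  apply: (lf_phi lf); apply: (subringM sO) => //.
  by apply: (subringM sO); apply: (@subringX _ _ sO) => //; exact: dvr_t dO.
rewrite [(t * a) ^+ p]exprMn tp lamE.
have -> : (t * eps) ^+ (p.-1 - j.+1) * (t * t ^+ p.-1 * a ^+ p) / t ^+ p.-1 =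
  (t * eps) ^+ (p.-1 - j.+1) * (t * a ^+ p).
  by move: (t ^+ p.-1) T0 => T T0; field.
apply: (subringM sO); first exact: (@subringX _ _ sO).
apply: (subringM sO); [exact: dvr_t dO | exact: (@subringX _ _ sO)].
Qed.

Lemma theta_local : O (theta t u / lam ^+ p.-1).
Proof.
have Ou := pb_w pb; have Ot := pb_x pb.
rewrite /theta {1}/rel_trace mulr_suml; apply: (subring_sum sO) => j _.
rewrite -mulrA; apply: (subringM sO); first exact: (@subringX _ _ sO).
rewrite mulr1 -[t]mulr1; apply: rel_trace_local; first exact: subring1.
exact: (@subringX _ _ sO).
Qed.

Lemma sigma_local y : O y -> O (sigma y).
Proof.
move=> Oy; apply: (subring_sum sO) => j _; apply: (subringM sO); first exact: (@subringX _ _ sO).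
apply: (@subringX _ _ sO); apply: lf_phiO; rewrite mulr1; exact: (@subringX _ _ sO).
Qed.

Lemma max_stable D x : derivation D -> O x -> (forall f, O f -> O (D f)) ->
  D t = 0 -> der_stable D x [set f | exists2 a, O a & f = t * a].
Proof.
move=> dD Ox DO Dt0; split=> /=.
- by exists 0; rewrite ?mulr0 //; exact: subring0.
- by move=> _ _ [a Oa ->] [b Ob ->]; exists (a - b); rewrite ?mulrBr //; exact: subringB.
- by move=> _ [a Oa ->]; exists (x * a); [exact: subringM | rewrite mulrCA].
- by move=> _ [a Oa ->]; exists (D a); [exact: DO | rewrite (derM dD) Dt0 mulr0 addr0].
Qed.

(** Modulo [t] the p-basis expansion of [f] is a polynomial in [u] with p-th power coefficients. Its
    u-derivative vanishes modulo [t], so by [der_coefs] for the ideal of [t] only the constant term,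
    a p-th power, survives. *)
Lemma residue_pth_power f : O f -> (exists2 a, O a & Du f = t * a) ->
  exists c a, [/\ O c, O a & f - c ^+ p = t * a].
Proof.
have [Ot Ou dD dE DO EO Dx Dw Ex Ew] := pb.
move=> Of [b Ob Duf].
have [e [Oe fE]] := pexp_expand charK deg sO (fun a => dvr_root dO p_gt0) pb Of.
pose m := [set f : K | exists2 a, O a & f = t * a].
have [m0 mB mM _] := max_stable dE Ou EO Ex.
have mO a g : O a -> m g -> m (a * g).
  by move=> Oa [c Oc ->]; exists (a * c); [exact: subringM | rewrite mulrCA].
have mD a c : m a -> m c -> m (a + c).
  by move=> ma mc; rewrite -[c]opprK; apply: (mB) => //; rewrite -sub0r; exact: mB.
have msum n (F : 'I_n -> K) : (forall i, m (F i)) -> m (\sum_i F i).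
  by move=> h; apply: (big_ind m).
pose c j := e 0%N j ^+ p; pose g := \sum_(j < p) c j * u ^+ j.
have OX := @subringX _ _ sO.
have fg : m (f - g).
  rewrite fE /pexp exchange_big -sumrB; apply: (msum) => j.
  rewrite -mulr_suml -mulrBl mulrC; apply: (mO); first exact: OX.
  rewrite (sum_ord_recl (fun l => e l j ^+ p * t ^+ l)) // expr0 mulr1 addrAC subrr add0r.
  apply: (msum) => l; rewrite exprS mulrCA; exists (e l.+1 j ^+ p * t ^+ l) => //.
  by apply: (subringM sO); apply: (OX).
have Eg : m (\sum_(j < p.-1) (c j.+1 *+ j.+1) * u ^+ j).
  have -> : \sum_(j < p.-1) (c j.+1 *+ j.+1) * u ^+ j = Du g.
    rewrite (der_sum _ _ _ dE) (sum_ord_recl (fun j => Du (c j * u ^+ j))) //.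
    rewrite expr0 mulr1 (der_frob charK _ dE) add0r; apply: eq_bigr => j _.
    by rewrite (der_frobM charK _ _ dE) (derX _ _ dE) Ew mulr1 /= mulrnAr mulrnAl.
  have -> : Du g = Du f - Du (f - g) by rewrite (derB _ _ dE) subKr.
  apply: (mB); first by exists b.
  by case: (max_stable dE Ou EO Ex) => _ _ _; apply.
have mc j : (j < p.-1)%N -> m (c j.+1).
  move=> jp; have [n hn] : exists n : nat, j.+1%:R * n%:R = 1 :> K.
    by apply: (natp_inv charK); rewrite /= -ltn_predRL.
  suff /(mO n%:R) : m (c j.+1 *+ j.+1).
    by rewrite -[c j.+1 *+ _]mulr_natr mulrCA [n%:R * _]mulrC hn mulr1; apply; exact: subring_nat.
  have st := max_stable dE Ou EO Ex.
  apply: (der_coefs charK (c := fun j => c j.+1 *+ j.+1) dE Ew st (leq_pred p) _ Eg jp) => l _.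
  by rewrite (derMn _ _ dE) (der_frob charK _ dE) mul0rn.
have [h Oh hE] : m (f - c 0%N).
  have -> : f - c 0%N = (f - g) + (g - c 0%N) by rewrite addrA subrK.
  apply: (mD) => //; rewrite /g (sum_ord_recl (fun j => c j * u ^+ j)) // expr0 mulr1 addrAC subrr add0r.
  by apply: (msum) => j; rewrite mulrC; apply: (mO); [exact: OX | exact: mc].
by exists (e 0%N 0%N), h.
Qed.

End Frame.
End Local.

(** * Changing the parameter along a divisor *)

Section Reparam.
Variables (K : fieldType) (p : nat).
Hypothesis charK : p \in [pchar K].
Hypothesis deg : pdeg_le2 K p.
Variable phi : K -> K.
Hypothesis phiD : forall x y, phi (x + y) = phi x + phi y.
Hypothesis phiM : forall a f, phi (a ^+ p * f) = a * phi f.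

Let p_pr : prime p. Proof. exact: pcharf_prime charK. Qed.
Let p_gt0 : (0 < p)%N. Proof. exact: prime_gt0. Qed.
Let p_gt1 : (1 < p)%N. Proof. exact: prime_gt1. Qed.

Local Notation sigma := (sigma p phi).

(* The relation between [y] and a polynomial [y'] in [y] with p-th power
   coefficients, [r] being the value of its derivative at [y] *)
Record reparam (y y' r : K) : Prop := Reparam {
  rp_neq0 : r != 0;
  rp_der : forall F, derivation F -> F y' = r * F y;
  rp_sigma : sigma y' = r ^+ p.-1 * sigma y }.

Lemma reparam_refl y : reparam y y 1.
Proof. by split=> [|F dF|]; rewrite ?oner_neq0 ?expr1n ?mul1r. Qed.

Lemma reparam_trans y y' y'' r r' :
  reparam y y' r -> reparam y' y'' r' -> reparam y y'' (r' * r).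
Proof.
move=> [r0 rD rS] [r0' rD' rS']; split; first by rewrite mulf_neq0.
  by move=> F dF; rewrite rD' // rD // mulrA.
by rewrite rS' rS exprMn mulrA.
Qed.

(** The new parameter is P(y) for the Frobenius twist P of s (X - c)^a, so its coefficients are p-th
    powers. The derivative is nonzero because [p] does not divide [a]; for a = 1 it is the constant
    s^p, which also covers y = c^p. *)
Lemma reparam_step y s c a : s != 0 -> ~~ (p %| a)%N -> (a == 1%N) || (y - c ^+ p != 0) ->
  reparam y (s ^+ p * (y - c ^+ p) ^+ a) (s ^+ p * ((y - c ^+ p) ^+ a.-1 *+ a)).
Proof.
move=> s0 pa ya.
pose P := map_poly (pFrobenius_aut charK) (s%:P * ('X - c%:P) ^+ a).
have PE : P = (s ^+ p)%:P * ('X - (c ^+ p)%:P) ^+ a.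
  by rewrite /P rmorphM rmorphXn rmorphB /= map_polyX !map_polyC.
have Pc j : exists b, P`_j = b ^+ p by rewrite /P coef_map; eexists.
have <- : P.[y] = s ^+ p * (y - c ^+ p) ^+ a by rewrite PE !hornerE.
have <- : P^`().[y] = s ^+ p * ((y - c ^+ p) ^+ a.-1 *+ a).
  rewrite PE derivM derivC mul0r add0r deriv_exp derivXsubC mul1r.
  by rewrite hornerM hornerC hornerMn !hornerE.
split.
- rewrite PE derivM derivC mul0r add0r deriv_exp derivXsubC mul1r.
  rewrite hornerM hornerC hornerMn !hornerE mulf_neq0 ?expf_neq0 //.
  rewrite -mulr_natr mulf_neq0 //; last by rewrite -(dvdn_pcharf charK).
  by case/orP: ya => [/eqP->|h]; rewrite ?expr0 ?oner_neq0 // expf_neq0.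
- by move=> F dF; apply: der_horner => // j; have [b ->] := Pc j; exact: der_frob.
- exact: sigma_change.
Qed.

Section Frame.
Variables (O : set K) (t u : K) (Dt Du : K -> K) (lam : K).
Hypothesis lf : local_frame p phi O t u Dt Du lam.
Let dO := lf_dvr lf.
Let sO := dvr_ring dO.
Let pb := lf_pb lf.
Let t0 := dvr_t0 dO.

(** The two ways for dy' not to vanish along the divisor: y' varies along it, or y' is a
    uniformizer. *)
Definition good_param y' :=
  [/\ O y', Du y' != 0 & O (Du y')^-1] \/
  (exists eps, [/\ O eps, O eps^-1, eps != 0 & y' = t * eps]).

(** Induction on [n], which bounds the vanishing of dy. If [Du y] is not a unit, then y = c^p + v
    t^m with [v] a unit and m > 0. When [p] does not divide [m], a power of y - c^p times a p-th
    power is a uniformizer. When m = kp, replacing [y] by [v] lowers the vanishing of the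
    differential by kp. *)
Lemma good_param_int n y : O y ->
    ~ ((exists2 a, O a & Dt y = t ^+ n * a) /\ (exists2 a, O a & Du y = t ^+ n * a)) ->
  exists y' r, reparam y y' r /\ good_param y'.
Proof.
have [Ot Ou dD dE DO EO Dx Dw Ex Ew] := pb.
elim: n y => [|n IH] y Oy hy.
  exfalso; apply: hy; split; [exists (Dt y) | exists (Du y)]; rewrite ?expr0 ?mul1r //.
    exact: DO.
  exact: EO.
have [hDu|[u0 ui]] := dvr_unit dO (EO _ Oy); last first.
  by exists y, 1; split; [exact: reparam_refl | left].
have [c [a [Oc Oa ya]]] := residue_pth_power charK deg lf Oy hDu.
(* If y = c^p, then dy = 0 is divisible by every power of [t], contrary to [hy]. *)
have yc0 : y - c ^+ p != 0.
  apply/eqP => yc; apply: hy.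
  have -> : y = c ^+ p * 1 by rewrite mulr1; apply/eqP; rewrite -subr_eq0; apply/eqP.
  rewrite (der_frobM charK _ _ dD) (der_frobM charK _ _ dE) (der1 dD) (der1 dE) mulr0.
  by split; exists 0; rewrite ?mulr0 //; exact: subring0.
have [v [m [Ov Ov' v0 vE]]] := dvr_val dO yc0.
have [e eE] : exists e : nat, m = e.+1%:Z.
  case: m vE => [[|e]|e] vE; [exfalso|by exists e|exfalso].
    apply: (dvr_nonunit dO Oa); first by rewrite -ya.
    by rewrite -ya vE expr0z mulr1.
  apply: (dvr_nonunit dO Oa); first by rewrite -ya.
  rewrite -ya vE NegzE -exprnN invfM invrK; apply: (subringM sO) => //.
  exact: (@subringX _ _ sO).
rewrite {m}eE -exprnP in vE.
have [/dvdnP[k kE]|pe] := boolP (p %| e.+1)%N; last first.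
  (* Bezout: a' (e+1) = b' p + 1, so (y - c^p)^a' divided by t^(b' p) is v^a' t. The same relation
     shows that [p] does not divide a'. *)
  have cop : coprime e.+1 p by rewrite coprime_sym prime_coprime.
  have [a' b' ab _] := egcdnP p (ltn0Sn e); rewrite (eqP cop) in ab.
  have pa' : ~~ (p %| a')%N.
    apply/negP => pa'; have : (p %| 1)%N.
      by rewrite -(dvdn_addr _ (dvdn_mull b' (dvdnn p))) -ab dvdn_mulr.
    by rewrite dvdn1; case: (p) p_gt1 => [|[]].
  have tb : t ^- b' != 0 by rewrite invr_neq0 // expf_neq0.
  have rp := @reparam_step y (t ^- b') c a' tb pa' (introT orP (or_intror yc0)).
  exists ((t ^- b') ^+ p * (y - c ^+ p) ^+ a'); eexists; split; first exact: rp.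
  right; exists (v ^+ a'); split; last 2 first.
  - by rewrite expf_neq0.
  - rewrite vE exprMn -exprM [(e.+1 * _)%N]mulnC ab exprD expr1 exprVn -exprM.
    have : t ^+ (b' * p) != 0 by rewrite expf_neq0.
    by move: (t ^+ (b' * p)) => T T0; field.
  - exact: (@subringX _ _ sO).
  - by rewrite -exprVn; exact: (@subringX _ _ sO).
have p1 : ~~ (p %| 1)%N by rewrite dvdn1; case: (p) p_gt1 => [|[]].
have tk : t ^- k != 0 by rewrite invr_neq0 // expf_neq0.
have rp := @reparam_step y (t ^- k) c 1 tk p1 isT.
have k0 : (0 < k)%N by case: (k) kE.
have T0 : t ^+ (k * p) != 0 by rewrite expf_neq0.
have y'E : (t ^- k) ^+ p * (y - c ^+ p) ^+ 1 = v.
  by rewrite expr1 vE kE exprVn -exprM mulrCA mulVf ?mulr1.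
move: rp; rewrite y'E /= expr0 mulr1n mulr1 => rp.
(* Here dy = t^(kp) dv with kp > 0, so divisibility of dv by t^n yields divisibility of dy by
   t^(n+1). *)
have back F : derivation F -> (exists2 b, O b & F v = t ^+ n * b) ->
    exists2 b, O b & F y = t ^+ n.+1 * b.
  move=> dF [b Ob]; rewrite (rp_der rp dF) exprVn -exprM => h.
  exists (t ^+ (k * p).-1 * b); first by apply: (subringM sO) => //; exact: (@subringX _ _ sO).
  rewrite -[F y](mulKf (invr_neq0 T0)) h invrK -{1}(@prednK (k * p)) ?muln_gt0 ?k0 //.
  by rewrite !exprS; ring.
have [|y'' [r [rp' gp]]] := IH v Ov.
  by move=> [h1 h2]; apply: hy; split; exact: back.
by exists y''; eexists; split; [exact: reparam_trans rp rp' | exact: gp].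
Qed.

Lemma good_param_exists y : (Dt y != 0) || (Du y != 0) ->
  exists y' r, reparam y y' r /\ good_param y'.
Proof.
have [Ot Ou dD dE DO EO Dx Dw Ex Ew] := pb.
move=> Dy.
have y0 : y != 0 by apply: contraTneq Dy => ->; rewrite (der0 dD) (der0 dE) eqxx.
have [v [m [Ov Ov' v0 vE]]] := dvr_val dO y0.
(* Multiplication by the p-th power s^p makes [y] integral, since |m| p + m is nonnegative. *)
pose s := t ^+ `|m|%N.
have s0 : s != 0 by rewrite expf_neq0.
have p1 : ~~ (p %| 1)%N by rewrite dvdn1; case: (p) p_gt1 => [|[]].
have rp := @reparam_step y s 0 1 s0 p1 isT.
have y'E : s ^+ p * (y - 0 ^+ p) ^+ 1 = s ^+ p * y by rewrite expr0n gtn_eqF // subr0 expr1.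
move: rp; rewrite y'E /= expr0 mulr1n mulr1 => rp.
have Oy' : O (s ^+ p * y).
  rewrite vE mulrCA; apply: (subringM sO) => //; rewrite /s -exprM exprnP -expfzDr //.
  have : 0 <= (`|m| * p)%N%:Z + m.
    rewrite PoszM addrC -[m in m + _]opprK addrC subr_ge0.
    apply: (@le_trans _ _ `|m|%N%:Z); first by rewrite abszE -normrN ler_norm.
    by rewrite -PoszM lez_nat leq_pmulr.
  by case: (_ + m) => // j _; exact: (@subringX _ _ sO).
have [n hn] : exists n, ~ ((exists2 a, O a & Dt (s ^+ p * y) = t ^+ n * a) /\
    (exists2 a, O a & Du (s ^+ p * y) = t ^+ n * a)).
  have sp : s ^+ p != 0 by rewrite expf_neq0.
  case/orP: Dy => h.
    have [n hn] : exists n, ~ exists2 a, O a & Dt (s ^+ p * y) = t ^+ n * a.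
      by apply: (dvr_pow_ndvd dO); rewrite (rp_der rp dD) mulf_neq0.
    by exists n; case.
  have [n hn] : exists n, ~ exists2 a, O a & Du (s ^+ p * y) = t ^+ n * a.
    by apply: (dvr_pow_ndvd dO); rewrite (rp_der rp dE) mulf_neq0.
  by exists n; case.
have [y'' [r [rp' gp]]] := good_param_int Oy' hn.
by exists y''; eexists; split; [exact: reparam_trans rp rp' | exact: gp].
Qed.

(** Let y' be a good parameter, dy' = r dy. If [Du y'] is a unit, the test derivation with value 1
    at y' bounds gam / r, and [sigma y'] is integral. If y' is a uniformizer, the one with value
    [lam] only bounds gam lam / r, but [rel_trace_local] makes [sigma y'] divisible by lam^(p-1). *)
Lemma sigma_val y gam (d : int) : (Dt y != 0) || (Du y != 0) ->
    (forall F, test_der O lam F -> val_ge O t d (gam * F y)) ->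
  val_ge O t (d *+ p.-1) (gam ^+ p.-1 * sigma y).
Proof.
have [Ot Ou dD dE DO EO Dx Dw Ex Ew] := pb.
move=> Dy hF; have [y' [r [[r0 rD rS] gp]]] := good_param_exists Dy.
have lam0 := lf_lam0 lf.
have sE : sigma y = r ^- p.-1 * sigma y' by rewrite rS mulKf // expf_neq0.
case: gp => [[Oy' Du0 Dui]|[eps [Oe Oe' e0 y'E]]].
  have := hF _ (test_Du lf Dui); rewrite -[Du y](mulKf r0) -(rD _ dE) => h.
  have {}h : val_ge O t d (gam / r).
    by have := h; congr val_ge; field; rewrite r0.
  rewrite sE mulrA -expr_div_n; apply: (val_geMr dO).
    exact: (val_geX dO).
  exact: (sigma_local lf).
have DtE : Dt y' = eps + t * Dt eps by rewrite y'E (derM dD) Dx mulr1 addrC.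
have Oy' : O y' by rewrite y'E; exact: (subringM sO).
have [[a Oa Da]|[D0 Di]] := dvr_unit dO (DO _ Oy').
- exfalso; apply: (dvr_nonunit dO (a := a - Dt eps)).
  + by apply: (subringB sO) => //; exact: DO.
  + by rewrite mulrBr -Da DtE addrK.
  + by rewrite mulrBr -Da DtE addrK.
have := hF _ (test_Dt lf Di); rewrite -[Dt y](mulKf r0) -(rD _ dD) => h.
have {}h : val_ge O t d (gam * lam / r).
  by have := h; congr val_ge; field; rewrite r0.
have -> : gam ^+ p.-1 * sigma y = (gam * lam / r) ^+ p.-1 * (sigma y' / lam ^+ p.-1).
  rewrite sE expr_div_n exprMn.
  have : lam ^+ p.-1 != 0 by rewrite expf_neq0.
  have : r ^+ p.-1 != 0 by rewrite expf_neq0.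
  by move: (lam ^+ _) (r ^+ _) => A B B0 A0; field; rewrite B0 A0.
apply: (val_geMr dO); first exact: (val_geX dO).
by rewrite y'E; apply: (rel_trace_local charK phiM lf) => //; exact: (subring1 sO).
Qed.

End Frame.
End Reparam.

(** * Vanishing of forms on the function field *)

Section Hochschild.
Variables (K : fieldType) (p : nat).
Hypothesis charK : p \in [pchar K].
Variables (del : K -> K) (z : K).
Hypothesis ddel : derivation del.
Hypothesis del_z : del z = 1.

Let p_pr : prime p. Proof. exact: pcharf_prime charK. Qed.
Let p_gt0 : (0 < p)%N. Proof. exact: prime_gt0. Qed.
Let p_gt1 : (1 < p)%N. Proof. exact: prime_gt1. Qed.

Lemma natp_fact_neq0 m : (m < p)%N -> (m`!)%:R != 0 :> K.
Proof.
elim: m => [|m IH] mp; first by rewrite oner_neq0.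
by rewrite factS natrM mulf_neq0 //; [exact: (natp_unit charK) | exact/IH/ltnW].
Qed.

Lemma iter_der_base : iter p del z = 0.
Proof.
case: (p) p_gt1 => [|[|n]] // _; rewrite !iterSr del_z (der1 ddel).
by elim: n => //= n ->; rewrite (der0 ddel).
Qed.

Lemma iter_der_pow j m : iter j del (z ^+ m) = z ^+ (m - j) *+ m ^_ j.
Proof.
elim: j => [|j IH]; first by rewrite subn0 ffactn0.
rewrite iterS IH (derMn _ _ ddel) (derX _ _ ddel) del_z mulr1 -mulrnA ffactnSr mulnC.
by rewrite subnS.
Qed.

Lemma iter_scaled_der h n : exists c : nat -> K, [/\ c n = h ^+ n, (0 < n)%N -> c 0%N = 0
  & forall f, iter n (fun g => h * del g) f = \sum_(j < n.+1) c j * iter j del f].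
Proof.
elim: n => [|n [c [cn c0 cE]]].
  by exists (fun=> 1); split=> // f; rewrite big_ord1 mul1r.
exists (fun j => h * ((if j is j'.+1 then c j' else 0) + (if j == n.+1 then 0 else del (c j)))).
split=> [|_|f]; first by rewrite eqxx addr0 cn exprS.
  case: n c0 cn {cE} => [|n] c0 cn /=; last by rewrite c0 // (der0 ddel) addr0 mulr0.
  by rewrite cn expr0 (der1 ddel) addr0 mulr0.
rewrite iterS cE (der_sum _ _ _ ddel) mulr_sumr.
under [RHS]eq_bigr => j _ do rewrite -mulrA mulrDl mulrDr.
rewrite [RHS]big_split /= [X in _ = X + _]big_ord_recl mul0r mulr0 add0r.
rewrite [X in _ = _ + X]big_ord_recr /= eqxx mul0r mulr0 addr0 -big_split.
apply: eq_bigr => j _ /=; rewrite (derM ddel) mulrDr; congr (_ + _).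
by rewrite ltn_eqF // mulrC [_ * del _]mulrC mulrC.
Qed.

(** The difference of (h del)^p and h^p del^p is a derivation, and also an operator of order below p
    in [del] without constant term. Comparing its value at z^m with m z^(m-1) times its value at [z]
    kills the coefficient of del^m for 1 < m < p, because m! is invertible. *)
Lemma hochschild h : exists c1, forall f,
  iter p (fun g => h * del g) f = h ^+ p * iter p del f + c1 * del f.
Proof.
have [c [cp c0 cE]] := iter_scaled_der h p; exists (c 1%N) => f.
pose E f := iter p (fun g => h * del g) f - h ^+ p * iter p del f.
have dhdel : derivation (fun g => h * del g) by exact: der_scale.
have EE g : E g = \sum_(j < p) c j * iter j del g.
  by rewrite /E cE big_ord_recr /= cp addrK.
have dE : derivation E.
  have -> : E = fun g => 1 * iter p (fun g => h * del g) g + (- h ^+ p) * iter p del g.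
    by apply: funext => g; rewrite mul1r mulNr.
  by apply: der_lin; apply: iter_der_p.
have Ez : E z = c 1%N.
  rewrite EE (bigD1 (Ordinal p_gt1)) //= del_z mulr1 big1 ?addr0 // => j j1.
  case: j j1 => -[|[|j]] jp //= _; first by rewrite c0 // mul0r.
  have -> : del (del (iter j del z)) = 0; last by rewrite mulr0.
  by rewrite -!iterS -[z]expr1 iter_der_pow ffact_small.
have cj m : (1 < m < p)%N -> c m = 0.
  elim/ltn_ind: m => m IH /andP[m1 mp].
  have := derX z m dE; rewrite Ez EE (bigD1 (Ordinal p_gt1)) //=.
  rewrite (derX _ _ ddel) del_z mulr1 mulrnAr [z ^+ _ * c _]mulrC -[RHS]addr0 => /addrI.
  have m1' : Ordinal mp != Ordinal p_gt1.
    by apply/eqP => /(congr1 val) /= e1; rewrite e1 in m1.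
  rewrite (bigD1 (Ordinal mp)) //= big1 => [|j /andP[j1 jm]].
    rewrite iter_der_pow subnn expr0 ffactnn !addr0 => /eqP.
    rewrite mulf_eq0 => /orP[/eqP //|].
    by rewrite (negbTE (natp_fact_neq0 mp)).
  have [jltm|mj|jm'] := ltngtP j m; last by case/eqP: jm; exact: val_inj.
    case: j j1 jm jltm => -[|[|j]] jp //= _ _ jltm; first by rewrite c0 // mul0r.
    by rewrite IH ?mul0r.
  by rewrite iter_der_pow ffact_small // mulr0n mulr0.
rewrite -[LHS](subrK (h ^+ p * iter p del f)) -/(E f) EE addrC; congr (_ + _).
rewrite (bigD1 (Ordinal p_gt1)) //= big1 ?addr0 // => j j1.
case: j j1 => -[|[|j]] jp //= _; first by rewrite c0 // mul0r.
by rewrite cj ?mul0r.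
Qed.

(** The constant term of the Taylor expansion of [f] in powers of [z], truncated below order p. *)
Definition taylor0 f : K := \sum_(j < p) (- z) ^+ j / j`!%:R * iter j del f.

(** The derivative telescopes to its last term, a multiple of del^p f. *)
Lemma taylor0_ker f : (forall g, iter p del g = 0) -> del (taylor0 f) = 0.
Proof.
move=> nil; rewrite /taylor0 (der_sum _ _ _ ddel).
have dnat n : del n%:R = 0 by rewrite (derMn _ _ ddel) (der1 ddel) mul0rn.
have dinv n : del (n%:R^-1) = 0 by rewrite (derV _ ddel) dnat mul0r oppr0.
have dzn j : del ((- z) ^+ j) = - ((- z) ^+ j.-1 *+ j).
  by rewrite (derX _ _ ddel) (derN _ ddel) del_z mulrN1 mulNrn.
pose T j := (- z) ^+ j / j`!%:R * iter j.+1 del f.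
have TE j : (j < p)%N -> del ((- z) ^+ j / j`!%:R * iter j del f) =
    T j - (if j is j'.+1 then T j' else 0).
  case: j => [|j] jp.
    by rewrite subr0 (derM ddel) (derM ddel) dinv dzn mulr0n oppr0 !mulr0 !addr0 mulr0 addr0.
  rewrite (derM ddel) (derM ddel) dinv dzn mulr0 add0r /T factS natrM /= -[(- z) ^+ j *+ _]mulr_natr.
  congr (_ + _); have := natp_fact_neq0 (ltnW jp); move: (j`!%:R) => F F0.
  have : j.+1%:R != 0 :> K by rewrite (natp_unit charK).
  move: (j.+1%:R) => N N0; move: ((- z) ^+ j) (del (iter j del f)) => Z G.
  by field; rewrite F0.
rewrite (eq_bigr (fun j : 'I_p => T j - (if val j is j'.+1 then T j' else 0))); last first.
  by move=> j _; exact: TE.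
rewrite sumrB; have -> : \sum_(i < p) T i = \sum_(i < p.-1) T i.
  rewrite -[in LHS](prednK p_gt0) big_ord_recr /= {2}/T prednK // nil mulr0 addr0.
  by [].
by rewrite (sum_ord_recl (fun j => if j is j'.+1 then T j' else 0)) // add0r subrr.
Qed.

End Hochschild.

Section Core.
Variables (K : fieldType) (p : nat).
Hypothesis charK : p \in [pchar K].
Hypothesis deg : pdeg_le2 K p.
Variable phi : K -> K.
Hypothesis phiD : forall x y, phi (x + y) = phi x + phi y.
Hypothesis phiM : forall a f, phi (a ^+ p * f) = a * phi f.
Hypothesis phi1 : phi 1 = 1.
(** [J] stands for the set of prime divisors, with local rings [O], uniformizers [t], boundary
    equations [lam] and coefficients [d] of the divisor D; [no_sections] says that -m D has no
    nonzero section. *)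
Variables (J : Type) (O : J -> set K) (t lam : J -> K) (d : J -> int).
Hypothesis frames : forall j, exists u Dt Du, local_frame p phi (O j) (t j) u Dt Du (lam j).
Hypothesis no_sections : forall psi m, (0 < m)%N ->
  (forall j, val_ge (O j) (t j) (d j *+ m) psi) -> psi = 0.

Let p_pr : prime p. Proof. exact: pcharf_prime charK. Qed.
Let p_gt0 : (0 < p)%N. Proof. exact: prime_gt0. Qed.
Let p_gt1 : (1 < p)%N. Proof. exact: prime_gt1. Qed.
Let p1_gt0 : (0 < p.-1)%N. Proof. by rewrite -subn1 subn_gt0. Qed.

Local Notation sigma := (sigma p phi).
Local Notation theta := (theta p phi).

Section Jacobian.
Variables (z x : K) (Dz Dx : K -> K) (j : J) (u : K) (Dt Du : K -> K).
Hypothesis pbz : pbasis setT z x Dz Dx.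
Hypothesis lf : local_frame p phi (O j) (t j) u Dt Du (lam j).

Lemma frame_nonconst (y : K) D E v : pbasis setT y v D E -> (Dt y != 0) || (Du y != 0).
Proof.
move=> pb; have := pb_Dx pb.
rewrite (pbasis_der charK y deg (pbasisT (lf_pb lf)) (pb_D pb)).
have [->|//] := eqVneq (Dt y) 0; have [->|//] := eqVneq (Du y) 0.
by rewrite !mul0r addr0 => /esym/eqP; rewrite oner_eq0.
Qed.

(** By [theta_change] from the frame to (z, x). The factor lam^(p-1) absorbed in the logarithmic
    Jacobian is available since [theta_local] divides [theta] of the frame by it. *)
Lemma theta_jacobian : exists2 o, O j o &
  theta z x = (lam j * (Dt z * Du x - Du z * Dt x)) ^+ p.-1 * o.
Proof.
exists (theta (t j) u / lam j ^+ p.-1); first exact: (theta_local charK phiM lf).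
rewrite (theta_change charK phiD phiM deg x (pbasisT (lf_pb lf)) (frame_nonconst pbz)).
have : lam j ^+ p.-1 != 0 by rewrite expf_neq0 // (lf_lam0 lf).
rewrite exprMn; move: (lam j ^+ _) ((_ - _) ^+ _) (theta _ _) => L A B L0.
by field.
Qed.

End Jacobian.

Lemma no_twoform (z x : K) Dz Dx c : pbasis setT z x Dz Dx ->
    (forall j F G, test_der (O j) (lam j) F -> test_der (O j) (lam j) G ->
      val_ge (O j) (t j) (d j) (c * (F z * G x - G z * F x))) ->
  c = 0.
Proof.
move=> pb hc; apply/eqP; apply: contraT => c0.
have := theta_neq0 charK phi1 pb; have := expf_neq0 p.-1 c0 => c1 th0.
have := mulf_neq0 c1 th0; rewrite (_ : c ^+ p.-1 * theta z x = 0) ?eqxx //.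
apply: (no_sections p1_gt0) => j; have [u [Dt [Du lf]]] := frames j.
have [o Oo ->] := theta_jacobian pb lf; rewrite mulrA -exprMn.
have dO := lf_dvr lf; apply: (val_geMr dO) => //; apply: (val_geX dO).
(* On the logarithmic frame lam d/dt, d/du the form takes the value c times the Jacobian of
   [theta_jacobian]. *)
have := hc j _ _ (test_Dt lf (subring1 (dvr_ring dO))) (test_Du lf (subring1 (dvr_ring dO))).
by congr val_ge; ring.
Qed.

Section OneForm.
Variables (z x : K) (Dz Dx : K -> K) (g c : K).
Hypothesis pbz : pbasis setT z x Dz Dx.
(** The value at [F] of the form g (dx - c dz); it vanishes at [del]. *)
Let W F : K := g * (F x - c * F z).
Hypothesis hW : forall j F, test_der (O j) (lam j) F -> val_ge (O j) (t j) (d j) (W F).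

Let del f := Dz f + c * Dx f.

Let ddel : derivation del.
Proof.
have [_ _ dD dE _ _ _ _ _ _] := pbz.
have -> : del = fun f => 1 * Dz f + c * Dx f by apply: funext => f; rewrite mul1r.
exact: der_lin.
Qed.

Let del_z : del z = 1.
Proof. by rewrite /del (pb_Dx pbz) (pb_Ex pbz) mulr0 addr0. Qed.
Let del_x : del x = c.
Proof. by rewrite /del (pb_Dw pbz) (pb_Ew pbz) mulr1 add0r. Qed.

(** As del^p z = 0, the p-curvature is seen by the form through [iter p del x] alone. *)
Let p_curvature_val j :
  val_ge (O j) (t j) (d j *+ (p.+1 * p.-1))
    (iter p del x ^+ p.-1 * g ^+ (p.+1 * p.-1) * theta z x ^+ p).
Proof.
have [u [Dt [Du lf]]] := frames j; have dO := lf_dvr lf; have sO := dvr_ring dO.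
have [o Oo ->] := theta_jacobian pbz lf.
set J' := lam j * (_ - _).
have [_ _ dDt dDu _ _ _ _ _ _] := lf_pb lf.
pose D1 f := 1 * lam j * Dt f; pose D2 f := 1 * Du f.
have T1 : test_der (O j) (lam j) D1 by exact: (test_Dt lf (subring1 sO)).
have T2 : test_der (O j) (lam j) D2 by exact: (test_Du lf (subring1 sO)).
pose td := t j ^ (- d j).
pose a1 := W D1 * td; pose a2 := W D2 * td.
have Oa1 : O j a1 by exact: hW T1.
have Oa2 : O j a2 by exact: hW T2.
(* The contraction of the form with the logarithmic bivector, normalized by t^(-d) to have
   coefficients in [O]. The form vanishes on it, so it is a multiple of [del]. *)
pose delP f := a2 * lam j * Dt f + (- a1) * Du f.
have TP : test_der (O j) (lam j) delP.
  by apply: (test_add lf (test_Dt lf Oa2)); apply: (test_Du lf); exact: subringN.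
have WP : delP x = c * delP z.
  by rewrite /delP /a1 /a2 /W /D1 /D2; ring.
pose h := delP z.
have delPE : delP = fun f => h * del f.
  apply: funext => f; rewrite (pbasis_der charK f deg pbz (td_der TP)) WP /del /h; ring.
have [c1 hoch] := hochschild charK ddel del_z h.
have := hW (test_iter lf (iter_der_p charK (td_der TP)) TP).
rewrite /W delPE !hoch (iter_der_base charK ddel del_z) del_z del_x.
set A := iter p del x.
have hE : h = td * (g * J') by rewrite /h /delP /a1 /a2 /W /D1 /D2 /J'; ring.
(* The term in [c1] cancels because the form vanishes on [del]. *)
have -> : g * (h ^+ p * A + c1 * c - c * (h ^+ p * 0 + c1 * 1)) = h ^+ p * (g * A) by ring.
rewrite hE exprMn -mulrA => hv.
(* Each of the p factors [h] contains t^(-d), and the bound [hv] accounts for one more [d]. *)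
have {}hv : val_ge (O j) (t j) (d j *+ p.+1) ((g * J') ^+ p * (g * A)).
  rewrite /val_ge /= in hv *; have := hv; congr (O j _).
  have -> : t j ^ (- (d j *+ p.+1)) = td ^+ p.+1.
    by rewrite /td -mulNrn -mulr_natr natz -exprz_exp.
  by rewrite -/td exprS; ring.
(* The p-th power of J'^(p-1), contributed by [theta], is the (p-1)-st power of J'^p. *)
have -> : A ^+ p.-1 * (g ^+ (p.+1 * p.-1) * (J' ^+ p.-1 * o) ^+ p) =
  ((g * J') ^+ p * (g * A)) ^+ p.-1 * o ^+ p.
  rewrite !exprMn -!exprM mulSn exprD [(p * p.-1)%N]mulnC; ring.
rewrite mulrnA; apply: (val_geMr dO); last exact: (@subringX _ _ sO).
exact: (val_geX dO).
Qed.

Lemma no_oneform : g = 0.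
Proof.
apply/eqP; apply: contraT => g0.
have [_ _ dDz dDx _ _ _ _ _ _] := pbz.
have A0 : iter p del x = 0.
  have n0 : (0 < p.+1 * p.-1)%N by rewrite muln_gt0.
  have := no_sections n0 p_curvature_val => /eqP.
  rewrite !mulf_eq0 !expf_eq0 (negbTE g0) (negbTE (theta_neq0 charK phi1 pbz)) !andbF !orbF.
  by case/andP => _ /eqP.
have nil f : iter p del f = 0.
  rewrite (pbasis_der charK f deg pbz (iter_der_p charK ddel)) A0.
  by rewrite (iter_der_base charK ddel del_z) !mulr0 addr0.
(* Otherwise [Dx] kills every f with del^n f = 0, by induction on n: all terms of [taylor0] but the
   first involve iterates of [del], which are killed by lower powers of [del]. For f = x and n = p
   this contradicts Dx x = 1. *)
have [f yf] : exists f, Dx (taylor0 p del z f) != 0.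
  apply: contrapT => no.
  have no' f : Dx (taylor0 p del z f) = 0.
    by apply/eqP; apply/negPn/negP => nz; apply: no; exists f.
  have : forall n f, iter n del f = 0 -> Dx f = 0.
    elim/ltn_ind => n IH f nf.
    case: n IH nf => [|n] IH nf; first by rewrite -[f]/(iter 0 del f) nf (der0 dDx).
    have := no' f; rewrite /taylor0 (sum_ord_recl (fun i => (- z) ^+ i / i`!%:R * iter i del f)) //.
    rewrite (derD dDx) /= expr0 fact0 divr1 mul1r (der_sum _ _ _ dDx) big1 ?addr0 // => i _.
    have dz0 m : Dx ((- z) ^+ m / m`!%:R) = 0.
      rewrite (derM dDx) (derX _ _ dDx) (derN _ dDx) (pb_Ex pbz) oppr0 mulr0 mul0rn mulr0 addr0.
      rewrite (derV _ dDx) (derMn _ _ dDx) (der1 dDx) mul0rn mul0r oppr0 mulr0.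
      by [].
    rewrite (derM dDx) dz0 mulr0 addr0 (IH (n - i)%N) ?mulr0 //.
      by rewrite ltnS leq_subr.
    have [ni|ni] := leqP i n.
      by rewrite -[del _]/(iter i.+1 del f) -iterD addnS subnK.
    have it0 m : iter m del 0 = 0 by elim: m => //= m ->; exact: der0.
    have ni' : (n.+1 <= i.+1)%N by rewrite ltnS ltnW.
    by rewrite -[del _]/(iter i.+1 del f) -(subnK ni') [iter (_ + n.+1) _ _]iterD nf !it0.
  move/(_ p x (nil x)); rewrite (pb_Ew pbz) => /eqP; by rewrite oner_eq0.
set y := taylor0 p del z f in yf.
have dely : del y = 0 by exact: (taylor0_ker charK ddel del_z).
have Dzy : Dz y = - (c * Dx y) by apply/eqP; rewrite -addr_eq0; exact/eqP.
(* Since del y = 0, dy = Dx y (dx - c dz), so the form equals gam dy. *)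
pose gam := g / Dx y.
have Wg F : derivation F -> W F = gam * F y.
  move=> dF; rewrite /W (pbasis_der charK y deg pbz dF) Dzy /gam.
  by field.
have pby := pbasis_exchange (@subringT K) pbz I yf I.
have s0 := sigma_neq0 charK phi1 pby.
have gam0 : gam != 0 by rewrite mulf_neq0 ?invr_neq0.
have := mulf_neq0 (expf_neq0 p.-1 gam0) s0.
rewrite (_ : gam ^+ p.-1 * sigma y = 0) ?eqxx //.
apply: (no_sections p1_gt0) => j; have [u [Dt [Du lf]]] := frames j.
apply: (sigma_val charK deg phiD phiM lf).
  exact: (frame_nonconst lf (pbasis_swap pby)).
by move=> F tF; rewrite -(Wg _ (td_der tF)); exact: hW.
Qed.

End OneForm.

Lemma no_oneform2 (z x : K) Dz Dx w1 w2 : pbasis setT z x Dz Dx ->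
    (forall j F, test_der (O j) (lam j) F ->
       val_ge (O j) (t j) (d j) (w1 * F z + w2 * F x)) ->
  w1 = 0 /\ w2 = 0.
Proof.
move=> pb h.
have key z' x' D E a b : pbasis setT z' x' D E ->
   (forall j F, test_der (O j) (lam j) F ->
       val_ge (O j) (t j) (d j) (a * F z' + b * F x')) -> b = 0.
  move=> pb' h'; apply/eqP; apply: contraT => b0.
  have hb j F : test_der (O j) (lam j) F ->
      val_ge (O j) (t j) (d j) (b * (F x' - (- (a / b)) * F z')).
    by move=> tF; have := h' j F tF; congr val_ge; field.
  have e0 : b = 0 := no_oneform pb' hb.
  by rewrite e0 eqxx in b0.
split; last exact: key pb h.
by apply: key (pbasis_swap pb) _ => j F tF; rewrite addrC; exact: h.
Qed.

End Core.

(** * Residue fields and p-bases of discrete valuation rings *)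

Section ResidueField.
Variables (K : fieldType) (O m : set K).

Record local_pair : Prop := LocalPair {
  lp_ring : subring O;
  lp_sub : m `<=` O;
  lp0 : m 0;
  lpB : forall a b, m a -> m b -> m (a - b);
  lpM : forall a b, O a -> m b -> m (a * b);
  lp1 : ~ m 1;
  lp_unit : forall a, O a -> ~ m a -> O a^-1 }.

Hypothesis lp : local_pair.
Let sO := lp_ring lp.

(** The set of candidates depends only on the class of [a] modulo [m], hence so does the choice; the
    residue field is the subtype of [K] formed by these representatives. *)
Definition residue_rep (a : K) : K := xget 0 [set b | O b /\ m (a - b)].

Lemma residue_repP a : O a -> O (residue_rep a) /\ m (a - residue_rep a).
Proof.
move=> Oa; rewrite /residue_rep; case: xgetP => [b _ //|/(_ a)].
by case; split=> //; rewrite subrr; exact: lp0 lp.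
Qed.

Let mN a : m a -> m (- a).
Proof. by rewrite -sub0r => ma; apply: (lpB lp) => //; exact: lp0 lp. Qed.
Let mD a b : m a -> m b -> m (a + b).
Proof. by move=> ma mb; rewrite -[b]opprK; apply: (lpB lp) => //; exact: mN. Qed.

Lemma residue_rep_eq a b : m (a - b) -> residue_rep a = residue_rep b.
Proof.
move=> ab; rewrite /residue_rep; congr (xget 0 _); apply/seteqP; split=> c /= [Oc h]; split => //.
  have -> : b - c = (a - c) - (a - b) by ring.
  exact: (lpB lp).
have -> : a - c = (a - b) + (b - c) by ring.
exact: mD.
Qed.

Definition residue_pred : pred K := fun a => `[< O a /\ residue_rep a = a >].

Definition residue_field : Type := {a : K | residue_pred a}.
HB.instance Definition _ := SubChoice.copy residue_field {a : K | residue_pred a}.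

Lemma residue_predP a : O a -> residue_pred (residue_rep a).
Proof.
move=> Oa; have [Or ma] := residue_repP Oa; apply/asboolP; split => //.
by apply: residue_rep_eq; rewrite -opprB; exact: mN.
Qed.

(* [residue] is only meaningful on [O]. *)
Definition residue (a : K) : residue_field :=
  if pselect (O a) is left Oa then exist (fun a => residue_pred a) _ (residue_predP Oa)
  else exist (fun a => residue_pred a) _ (residue_predP (subring0 sO)).

Lemma residue_valK (x : residue_field) : O (val x) /\ residue (val x) = x.
Proof.
case: x => a ha /=; have /asboolP[Oa ra] := ha; split=> //.
by rewrite /residue; case: pselect => // Oa'; apply: val_inj.
Qed.

Lemma residue_eq a b : O a -> O b -> residue a = residue b <-> m (a - b).
Proof.
move=> Oa Ob; split=> [|ab]; rewrite /residue; case: pselect => // Oa'; case: pselect => // Ob'.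
  move=> /(congr1 val) /= h.
  have -> : a - b = (a - residue_rep a) - (b - residue_rep b) by rewrite h; ring.
  by apply: (lpB lp); [case: (residue_repP Oa) | case: (residue_repP Ob)].
by apply: val_inj; exact: residue_rep_eq.
Qed.

Let add (x y : residue_field) := residue (val x + val y).
Let opp (x : residue_field) := residue (- val x).
Let mul (x y : residue_field) := residue (val x * val y).
Let inv (x : residue_field) := if x == residue 0 then x else residue (val x)^-1.

Let valO (x : residue_field) : O (val x). Proof. by case: (residue_valK x). Qed.
Let mval a : O a -> m (a - val (residue a)).
Proof. by move=> Oa; apply/residue_eq => //; case: (residue_valK (residue a)). Qed.

Lemma residue_addE a b : O a -> O b -> add (residue a) (residue b) = residue (a + b).
Proof.
move=> Oa Ob; apply/residue_eq; try exact: subringD.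
have -> : val (residue a) + val (residue b) - (a + b) =
  - ((a - val (residue a)) + (b - val (residue b))) by ring.
by apply: mN; apply: mD; exact: mval.
Qed.
Let oppE a : O a -> opp (residue a) = residue (- a).
Proof.
move=> Oa; apply/residue_eq; try exact: subringN.
by rewrite opprK addrC; exact: mval.
Qed.
Lemma residue_mulE a b : O a -> O b -> mul (residue a) (residue b) = residue (a * b).
Proof.
move=> Oa Ob; apply/residue_eq; try exact: subringM.
have -> : val (residue a) * val (residue b) - a * b =
  - (a * (b - val (residue b)) + val (residue b) * (a - val (residue a))) by ring.
by apply: mN; apply: mD; apply: (lpM lp) => //; exact: mval.
Qed.

Let addA : associative add.
Proof.
move=> x y z; have [Ox <-] := residue_valK x; have [Oy <-] := residue_valK y.
have [Oz <-] := residue_valK z.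
by rewrite !residue_addE ?addrA //; exact: subringD.
Qed.
Let addC : commutative add.
Proof. by move=> x y; rewrite /add addrC. Qed.
Let add0 : left_id (residue 0) add.
Proof.
move=> x; have [Ox <-] := residue_valK x.
by rewrite residue_addE ?add0r //; exact: subring0.
Qed.
Let addN : left_inverse (residue 0) opp add.
Proof.
move=> x; have [Ox <-] := residue_valK x.
by rewrite oppE // residue_addE ?addNr //; exact: subringN.
Qed.
HB.instance Definition _ := GRing.isZmodule.Build residue_field addA addC add0 addN.

Let mulA : associative mul.
Proof.
move=> x y z; have [Ox <-] := residue_valK x; have [Oy <-] := residue_valK y.
have [Oz <-] := residue_valK z.
by rewrite !residue_mulE ?mulrA //; exact: subringM.
Qed.
Let mulC : commutative mul.
Proof. by move=> x y; rewrite /mul mulrC. Qed.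
Let mul1 : left_id (residue 1) mul.
Proof.
move=> x; have [Ox <-] := residue_valK x.
by rewrite residue_mulE ?mul1r //; exact: subring1.
Qed.
Let mulDl : left_distributive mul add.
Proof.
move=> x y z; have [Ox <-] := residue_valK x; have [Oy <-] := residue_valK y.
have [Oz <-] := residue_valK z.
by rewrite residue_addE ?residue_mulE ?residue_addE ?mulrDl //; try exact: subringM; exact: subringD.
Qed.
Let one_neq0 : residue 1 != residue 0.
Proof.
apply/eqP => /residue_eq h; apply: (lp1 lp); rewrite -[1]subr0; apply: h.
  exact: subring1.
exact: subring0.
Qed.
HB.instance Definition _ := GRing.Zmodule_isComNzRing.Build residue_field
  mulA mulC mul1 mulDl one_neq0.

Let mulV (x : residue_field) : x != 0 -> inv x * x = 1.
Proof.
rewrite -[0]/(residue 0) -[1]/(residue 1) /inv => x0; rewrite (negbTE x0).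
have [Ox xE] := residue_valK x.
have nm : ~ m (val x).
  move=> mx; case/eqP: x0; rewrite -xE; apply/residue_eq => //; first exact: subring0.
  by rewrite subr0.
have v0 : val x != 0 by apply/eqP => v0; apply: nm; rewrite v0; exact: lp0 lp.
rewrite -[X in _ * X]xE -[_ * _]/(mul _ _) residue_mulE ?mulVf //.
exact: (lp_unit lp).
Qed.
Let inv0 : inv 0 = 0.
Proof. by rewrite /inv -[0]/(residue 0) eqxx. Qed.
HB.instance Definition _ := GRing.ComNzRing_isField.Build residue_field mulV inv0.

Lemma residue_field_exists : exists (F : fieldType) (pi : K -> F), [/\ pi 1 = 1,
    forall a b, O a -> O b -> pi (a + b) = pi a + pi b,
    forall a b, O a -> O b -> pi (a * b) = pi a * pi b,
    forall a, O a -> (pi a = 0 <-> m a) & forall x, exists2 a, O a & pi a = x].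
Proof.
exists (residue_field : fieldType), residue; split=> //.
- by move=> a b Oa Ob; rewrite -residue_addE.
- by move=> a b Oa Ob; rewrite -residue_mulE.
- by move=> a Oa; rewrite -[a in m a]subr0; apply: residue_eq => //; exact: subring0.
- by move=> x; have [Ox xE] := residue_valK x; exists (val x).
Qed.

End ResidueField.

Section PthIndependence.
Variables (F : fieldType) (p : nat).
Hypothesis charF : p \in [pchar F].
Let p_pr : prime p. Proof. exact: pcharf_prime charF. Qed.
Let p_gt0 : (0 < p)%N. Proof. exact: prime_gt0. Qed.

Lemma natr_pth n : (n%:R : F) ^+ p = n%:R.
Proof. exact: (rmorph_nat (pFrobenius_aut charF)). Qed.

Lemma coef_XsubC_expS (u : F) s : (('X - u%:P) ^+ s.+1)`_s = - u *+ s.+1.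
Proof.
have top n : (('X - u%:P) ^+ n)`_n = 1.
  have := lead_coef_exp ('X - u%:P) n.
  by rewrite lead_coefXsubC expr1n /lead_coef size_exp_XsubC.
elim: s => [|s IH]; first by rewrite expr1 coefB coefX coefC sub0r.
rewrite exprS mulrBl coefB coefXM coefCM IH top mulr1 /=.
by rewrite [RHS]mulrSr.
Qed.

(** A relation of least degree over F^p divides X^p - u^p = (X - u)^p, so up to a constant it is
    some (X - u)^n with 0 < n < p. As [n] is invertible, its two leading coefficients exhibit [u] as
    a p-th power. *)
Lemma pth_independence (u : F) (P : {poly F}) : (forall c, u != c ^+ p) ->
  (size P <= p)%N -> (map_poly (pFrobenius_aut charF) P).[u] = 0 -> P = 0.
Proof.
pose Fr := pFrobenius_aut charF.
move=> hu sP Pu; apply/eqP; apply: contraT => P0.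
pose good n := `[< exists Q : {poly F}, [/\ Q != 0, size Q = n & (map_poly Fr Q).[u] = 0] >].
have ex : exists n, good n by exists (size P); apply/asboolP; exists P.
have [n /asboolP[Q [Q0 sQ Qu]] nmin] := ex_minnP ex.
have np : (n <= p)%N by apply: leq_trans sP; apply: nmin; apply/asboolP; exists P.
have charX : p \in [pchar {poly F}] by rewrite pchar_poly.
have XuE : map_poly Fr ('X^p - u%:P) = ('X - u%:P) ^+ p.
  rewrite rmorphB /= map_polyXn map_polyC /=.
  rewrite -[LHS]/('X^p - (u ^+ p)%:P) polyC_exp.
  exact/esym/(rmorphB (pFrobenius_aut charX)).
have dvd : map_poly Fr Q %| ('X - u%:P) ^+ p.
  rewrite -XuE dvdp_map /dvdp.
  apply/eqP; set R := _ %% Q; apply/eqP; apply: contraT => R0.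
  have sR : (size R < n)%N by rewrite -sQ ltn_modp.
  have : good (size R).
    apply/asboolP; exists R; split => //.
    have : map_poly Fr ('X^p - u%:P) = map_poly Fr (('X^p - u%:P) %/ Q * Q + R) by rewrite -divp_eq.
    rewrite XuE => /(congr1 (fun f : {poly F} => f.[u])).
    rewrite rmorphD rmorphM /= !hornerE Qu mulr0 add0r subrr expr0n gtn_eqF //.
  by move/nmin; rewrite leqNgt sR.
have [s _ /eqpP[[a b] /= /andP[a0 b0] ab]] := dvdp_exp_XsubCP dvd.
have sz : n = s.+1.
  have := congr1 (fun f : {poly F} => size f) ab.
  by rewrite !size_scale // size_map_poly sQ size_exp_XsubC.
case: s => [|s] in ab sz *.
  have := congr1 (fun f : {poly F} => f.[u]) ab.
  rewrite expr0 !hornerZ Qu mulr0 hornerC mulr1 => /esym/eqP.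
  by rewrite (negbTE b0).
have c1 : a * Q`_s.+1 ^+ p = b.
  have := congr1 (fun f : {poly F} => f`_s.+1) ab; rewrite !coefZ coef_map /= => ->.
  have := lead_coef_exp ('X - u%:P) s.+1.
  by rewrite lead_coefXsubC expr1n /lead_coef size_exp_XsubC => ->; rewrite mulr1.
have c2 : a * Q`_s ^+ p = b * (- u *+ s.+1).
  by have := congr1 (fun f : {poly F} => f`_s) ab; rewrite !coefZ coef_map coef_XsubC_expS.
have s1 : s.+1%:R != 0 :> F by apply: (natp_unit charF); rewrite /= -ltnS -sz ltnS.
have Q1 : Q`_s.+1 != 0.
  by apply: contraNneq b0 => h; rewrite -c1 h expr0n gtn_eqF // mulr0.
(* The next coefficient divided by the leading one is -(s+1) u, and s+1 is its own p-th power. *)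
have /negP[] := hu (- Q`_s / Q`_s.+1 / s.+1%:R); apply/eqP.
rewrite !exprMn !exprVn natr_pth (frobN charF).
have Q1p : Q`_s.+1 ^+ p != 0 by rewrite expf_neq0.
apply: (mulfI a0); rewrite -!mulrA mulNr mulrN mulrA c2 -c1.
rewrite -[- u *+ _]mulr_natr; move: (_ ^+ p) Q1p (s.+1%:R) s1 => q q0 m m0.
by field; rewrite m0.
Qed.
End PthIndependence.

Section Frames.
Variables (K : fieldType) (p : nat).
Hypothesis charK : p \in [pchar K].
Let p_pr : prime p. Proof. exact: pcharf_prime charK. Qed.
Let p_gt0 : (0 < p)%N. Proof. exact: prime_gt0. Qed.
Let p_gt1 : (1 < p)%N. Proof. exact: prime_gt1. Qed.

Lemma residue_independence (O m : set K) u (c : nat -> K) : local_pair O m ->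
    O u -> (forall a, O a -> ~ m (u - a ^+ p)) -> (forall j, O (c j)) ->
    m (\sum_(j < p) c j ^+ p * u ^+ j) ->
  forall j, (j < p)%N -> m (c j).
Proof.
move=> lp Ou hu Oc hm; have sO := lp_ring lp; have OX := @subringX _ _ sO.
have [F [pi [pi1 piD piM pi0 pis]]] := residue_field_exists lp.
have piX a n : O a -> pi (a ^+ n) = pi a ^+ n.
  by move=> Oa; elim: n => [|n IH]; rewrite ?expr0 // !exprS piM ?IH //; exact: OX.
have p0 : pi 0 = 0 by apply/pi0; [exact: subring0 | exact: lp0 lp].
have piN n : pi n%:R = n%:R.
  elim: n => [|n IH] //; rewrite -!natr1 piD ?pi1 ?IH //.
    exact: subring_nat.
  exact: subring1.
have charF : p \in [pchar F].
  by rewrite inE p_pr /= -piN (pcharf0 charK) p0 eqxx.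
have piS n (f : nat -> K) : (forall j, O (f j)) ->
    pi (\sum_(j < n) f j) = \sum_(j < n) pi (f j).
  move=> Of; elim: n => [|n IH]; first by rewrite !big_ord0.
  by rewrite !big_ord_recr /= piD ?IH //; apply: (subring_sum sO).
pose P := \poly_(j < p) pi (c j).
have hu' b : pi u != b ^+ p.
  have [a Oa <-] := pis b; rewrite -piX //; apply/eqP => e.
  have Oap : O (- a ^+ p) by apply: (subringN sO); exact: OX.
  apply: (hu a Oa); apply/pi0; first exact: subringD.
  have := piD _ _ (OX a p Oa) Oap; rewrite subrr p0 => e2.
  by rewrite piD // e -e2.
have : P = 0.
  have := @pth_independence F p charF (pi u) P hu' (size_poly _ _); apply.
  rewrite (@horner_coef_wide _ p); last by rewrite size_map_poly size_poly.
  rewrite -[RHS](proj2 (pi0 _ (lp_sub lp hm)) hm).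
  have Oj j : O (c j ^+ p * u ^+ j) by apply: (subringM sO); exact: OX.
  rewrite (piS _ (fun j => c j ^+ p * u ^+ j)) //; apply: eq_bigr => j _.
  by rewrite coef_map coef_poly ltn_ord /= piM ?piX //; exact: OX.
move=> P0 j jp; apply/pi0 => //.
by have := congr1 (fun f : {poly F} => f`_j) P0; rewrite coef_poly jp coef0.
Qed.

Lemma dvr_local_pair (O : set K) t : dvr O t ->
  local_pair O [set f | exists2 a, O a & f = t * a].
Proof.
move=> dO; have sO := dvr_ring dO; have Ot := dvr_t dO; split=> //=.
- by move=> _ [a Oa ->]; exact: subringM.
- by exists 0; rewrite ?mulr0 //; exact: subring0.
- by move=> _ _ [a Oa ->] [b Ob ->]; exists (a - b); rewrite ?mulrBr //; exact: subringB.
- by move=> a _ Oa [b Ob ->]; exists (a * b); [exact: subringM | rewrite mulrCA].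
- move=> [a Oa a1]; apply: (dvr_tV dO); suff -> : t^-1 = a by [].
  by apply: (mulfI (dvr_t0 dO)); rewrite mulfV ?(dvr_t0 dO).
- by move=> a Oa na; have [//|[]] := dvr_unit dO Oa.
Qed.

(** [D] is the formal d/dv, well defined by uniqueness of coefficients and linear over [M].
    Leibniz's rule is checked for multiplication by [v], then by its powers, and extended by
    linearity. *)
Lemma basis_derivation (M : set K) v : subring M -> M (v ^+ p) ->
    (forall f, exists c : nat -> K, (forall j, M (c j)) /\ f = \sum_(j < p) c j * v ^+ j) ->
    (forall c : nat -> K, (forall j, M (c j)) -> \sum_(j < p) c j * v ^+ j = 0 ->
       forall j, (j < p)%N -> c j = 0) ->
  exists D, derivation D /\ (forall c : nat -> K, (forall j, M (c j)) ->
    D (\sum_(j < p) c j * v ^+ j) = \sum_(j < p) c j * (v ^+ j.-1 *+ j)).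
Proof.
move=> sM Mv span indep.
have [cf cfP] := choice span.
pose D f := \sum_(j < p) cf f j * (v ^+ j.-1 *+ j).
have DE (c : nat -> K) : (forall j, M (c j)) ->
    D (\sum_(j < p) c j * v ^+ j) = \sum_(j < p) c j * (v ^+ j.-1 *+ j).
  move=> Mc; apply: eq_bigr => j _; congr (_ * _).
  set f := \sum_(i < p) _; have [Mf fE] := cfP f.
  apply/eqP; rewrite -subr_eq0; apply/eqP.
  apply: (indep (fun j => cf f j - c j)) (ltn_ord j) => [i|]; first exact: subringB.
  by under eq_bigr do rewrite mulrBl; rewrite sumrB -fE subrr.
have DD f g : D (f + g) = D f + D g.
  have [Mf fE] := cfP f; have [Mg gE] := cfP g.
  rewrite {1}fE {1}gE -big_split /=.
  under eq_bigr do rewrite -mulrDl.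
  rewrite (DE (fun j => cf f j + cf g j)); last by move=> j; exact: subringD.
  by rewrite -big_split; apply: eq_bigr => j _; rewrite mulrDl.
have DM c f : M c -> D (c * f) = c * D f.
  move=> Mc; have [Mf fE] := cfP f; rewrite {1}fE mulr_sumr.
  under eq_bigr do rewrite mulrA.
  rewrite (DE (fun j => c * cf f j)); last by move=> j; exact: subringM.
  by rewrite mulr_sumr; apply: eq_bigr => j _; rewrite mulrA.
have Dv f : D (v * f) = f + v * D f.
  have [Mf fE] := cfP f.
  (* Multiplication by [v] shifts the coefficients; the top one wraps around to degree 0 with the
     factor v^p of [M], in accordance with d(v^p)/dv = 0. *)
  pose c j := if j is j'.+1 then cf f j' else cf f p.-1 * v ^+ p.
  have split n (F : nat -> K) : (0 < n)%N -> \sum_(j < n) F j = F n.-1 + \sum_(j < n.-1) F j.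
    by case: n => // n _; rewrite big_ord_recr addrC.
  have -> : v * f = \sum_(j < p) c j * v ^+ j.
    rewrite (sum_ord_recl (fun j => c j * v ^+ j)) // expr0 mulr1 fE mulr_sumr.
    rewrite (split _ (fun j => v * (cf f j * v ^+ j))) //; congr (_ + _).
      by rewrite mulrCA -exprS prednK.
    by apply: eq_bigr => j _; rewrite mulrCA -exprS.
  rewrite DE; last by case=> [|j] //=; apply: subringM.
  rewrite [X in _ = X + _]fE /D mulr_sumr -big_split (split _ (fun j => cf f j * v ^+ j + v * (cf f j * (v ^+ j.-1 *+ j)))) //=.
  rewrite (sum_ord_recl (fun j => c j * (v ^+ j.-1 *+ j))) // mulr0n mulr0 add0r.
  have vj j : cf f j * v ^+ j + v * (cf f j * (v ^+ j.-1 *+ j)) = cf f j * (v ^+ j *+ j.+1).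
    rewrite mulrCA -mulrDr [v * (_ *+ _)]mulrnAr; congr (_ * _); case: j => [|j].
      by rewrite mulr0n addr0.
    by rewrite -exprS -mulrS.
  rewrite vj prednK // -mulr_natr (pcharf0 charK) !mulr0 add0r.
  by apply: eq_bigr => j _; rewrite vj.
have Dvj j f : D (v ^+ j * f) = (v ^+ j.-1 *+ j) * f + v ^+ j * D f.
  elim: j => [|j IH]; first by rewrite expr0 mulr0n mul0r add0r !mul1r.
  rewrite exprS -mulrA Dv IH mulrDr addrA !mulrA -mulrDl; congr (_ * _ + _).
  rewrite mulrnAr; case: j {IH} => [|j]; first by rewrite mulr0n addr0.
  by rewrite -exprS -mulrS.
have Dsum n (F : 'I_n -> K) : D (\sum_i F i) = \sum_i D (F i).
  apply: (big_morph D DD); apply: (@addIr _ (D 0)).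
  by rewrite -DD !add0r.
exists D; split => //; split=> // f g.
have [Mf fE] := cfP f.
have -> : D (f * g) = \sum_(j < p) D (cf f j * v ^+ j * g).
  by rewrite [in LHS]fE mulr_suml Dsum.
rewrite [X in _ = X * _ + _]fE [D f]/D mulr_suml [g * _]mulr_sumr -big_split.
by apply: eq_bigr => j _; rewrite -mulrA DM // Dvj /=; ring.
Qed.

Definition pspan1 (v : K) : set K :=
  [set f | exists c : nat -> K, f = \sum_(l < p) c l ^+ p * v ^+ l].

Lemma pspan1_frob v a : pspan1 v (a ^+ p).
Proof.
exists (fun l => if l == 0%N then a else 0).
rewrite (bigD1 (Ordinal p_gt0)) //= mulr1 big1 ?addr0 // => l l0.
have -> : (l == 0 :> nat)%N = false by apply: contraNF l0 => /eqP h; apply/eqP/val_inj.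
by rewrite expr0n gtn_eqF // mul0r.
Qed.

Lemma pspan1_ring v : subring (pspan1 v).
Proof.
have B f g : pspan1 v f -> pspan1 v g -> pspan1 v (f - g).
  move=> [c ->] [d ->]; exists (fun l => c l - d l); rewrite -sumrB.
  by apply: eq_bigr => l _; rewrite (frobB charK) mulrBl.
have P0 : pspan1 v 0 by have := pspan1_frob v 0; rewrite expr0n gtn_eqF.
have A f g : pspan1 v f -> pspan1 v g -> pspan1 v (f + g).
  by move=> hf hg; rewrite -[g]opprK; apply: (B) => //; rewrite -sub0r; exact: B.
have Mp a f : pspan1 v f -> pspan1 v (a ^+ p * f).
  move=> [c ->]; exists (fun l => a * c l); rewrite mulr_sumr.
  by apply: eq_bigr => l _; rewrite exprMn mulrA.
have Mv f : pspan1 v f -> pspan1 v (v * f).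
  move=> [c ->]; exists (fun l => if l is l'.+1 then c l' else v * c p.-1).
  rewrite (sum_ord_recl (fun l => (if l is l'.+1 then c l' else v * c p.-1) ^+ p * v ^+ l)) //.
  have split n (F : nat -> K) : (0 < n)%N -> \sum_(j < n) F j = F n.-1 + \sum_(j < n.-1) F j.
    by case: n => // n _; rewrite big_ord_recr addrC.
  rewrite (split _ (fun l => c l ^+ p * v ^+ l)) // mulrDr expr0 mulr1; congr (_ + _).
    by rewrite mulrCA -exprS prednK // exprMn mulrC.
  by rewrite mulr_sumr; apply: eq_bigr => l _; rewrite mulrCA -exprS.
split=> //; first by have := pspan1_frob v 1; rewrite expr1n.
move=> _ g [c ->] hg; rewrite mulr_suml.
apply: (big_ind (pspan1 v)) => // l _; rewrite -mulrA; apply: Mp.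
by elim: (nat_of_ord l) => [|j IH]; rewrite ?mul1r // exprS -mulrA; exact: Mv.
Qed.

End Frames.

Section DvrFrame.
Variables (K : fieldType) (p : nat).
Hypothesis charK : p \in [pchar K].
Hypothesis deg : pdeg_le2 K p.
Variables (O : set K) (t u : K).
Hypothesis dO : dvr O t.
Hypothesis Ou : O u.
Hypothesis u_res : forall c, O c -> ~ exists2 a, O a & u - c ^+ p = t * a.
Let p_pr : prime p. Proof. exact: pcharf_prime charK. Qed.
Let p_gt0 : (0 < p)%N. Proof. exact: prime_gt0. Qed.
Let sO := dvr_ring dO.
Let t0 := dvr_t0 dO.
Let OX a n : O a -> O (a ^+ n). Proof. exact: subringX. Qed.
Let m := [set f : K | exists2 a, O a & f = t * a].

Let small n (e : nat -> nat -> K) : (n <= p)%N -> (forall l j, O (e l j)) ->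
    (exists2 a, O a & \sum_(l < n) (\sum_(j < p) e l j ^+ p * u ^+ j) * t ^+ l = t ^+ n * a) ->
  forall l j, (l < n)%N -> (j < p)%N -> m (e l j).
Proof.
elim: n e => // n IH e np Oe [a Oa].
rewrite (sum_ord_recl (fun l => (\sum_(j < p) e l j ^+ p * u ^+ j) * t ^+ l)) // expr0 mulr1 /=.
set c0 := \sum_(j < p) _; set S := \sum_(l < n) _ => hS.
pose S' := \sum_(l < n) (\sum_(j < p) e l.+1 j ^+ p * u ^+ j) * t ^+ l.
have SE : S = t * S'.
  by rewrite /S' mulr_sumr; apply: eq_bigr => l _; rewrite mulrCA -exprS.
have OS' : O S'.
  apply: (subring_sum sO) => l _; apply: (subringM sO); last by apply: OX; exact: dvr_t dO.
  by apply: (subring_sum sO) => j _; apply: (subringM sO); apply: OX.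
have lp := dvr_local_pair dO.
have mc0 : m c0.
  exists (t ^+ n * a - S').
    by apply: (subringB sO) => //; apply: (subringM sO) => //; apply: OX; exact: dvr_t dO.
  by rewrite mulrBr -SE mulrA -exprS -hS addrK.
have me0 := residue_independence charK lp Ou u_res (Oe 0%N) mc0.
have [b Ob bE] : exists2 b, O b & c0 = t ^+ n.+1 * b.
  have : forall j : 'I_p, exists2 b, O b & e 0%N j ^+ p * u ^+ j = t ^+ n.+1 * b.
    move=> j; have [b Ob ->] := me0 j (ltn_ord j).
    exists (t ^+ (p - n.+1) * b ^+ p * u ^+ j).
      by do 2?apply: (subringM sO); apply: OX => //; exact: dvr_t dO.
    by rewrite exprMn !mulrA -exprD subnKC.
  move=> /(_ _) h; rewrite /c0; apply: (big_ind (fun c => exists2 b, O b & c = t ^+ n.+1 * b)) => [|_ _ [b Ob ->] [b' Ob' ->]|j _]; last exact: h.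
    by exists 0; rewrite ?mulr0 //; exact: subring0.
  by exists (b + b'); [exact: subringD | rewrite mulrDr].
have h' : exists2 a, O a & S' = t ^+ n * a.
  exists (a - b); first exact: subringB.
  apply: (mulfI t0); rewrite -SE mulrA -exprS mulrBr -hS bE addrAC subrr add0r.
  by [].
case=> [|l] j ln jp; first exact: me0.
exact: (IH (fun l => e l.+1) (ltnW np) _ h').
Qed.

Let pexpE (e : nat -> nat -> K) :
  pexp p t u e = \sum_(l < p) (\sum_(j < p) e l j ^+ p * u ^+ j) * t ^+ l.
Proof.
by apply: eq_bigr => l _; rewrite mulr_suml; apply: eq_bigr => j _; rewrite mulrAC.
Qed.

Let pexp_scale (e : nat -> nat -> K) s : pexp p t u (fun l j => e l j * s) = pexp p t u e * s ^+ p.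
Proof.
rewrite /pexp mulr_suml; apply: eq_bigr => l _; rewrite mulr_suml; apply: eq_bigr => j _.
by rewrite exprMn; ring.
Qed.

Lemma dvr_clear (T : finType) (f : T -> K) : exists N, forall i, O (f i * t ^+ N).
Proof.
have h i : exists n, O (f i * t ^+ n).
  have [->|f0] := eqVneq (f i) 0; first by exists 0%N; rewrite mul0r; exact: subring0.
  have [v [[k|k] [Ov _ _ ->]]] := dvr_val dO f0.
    by exists 0%N; rewrite expr0 mulr1; apply: (subringM sO) => //; apply: OX; exact: dvr_t dO.
  by exists k.+1; rewrite NegzE -exprnN divfK // expf_neq0.
have [n nP] := choice h; exists (\sum_i n i)%N => i.
rewrite (bigD1 i) //= exprD mulrA; apply: (subringM sO) => //; apply: OX; exact: dvr_t dO.
Qed.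

(** Clear denominators by t^N and descend on N. Scaling the coefficients by t^(N+1) puts the sum in
    t^p O, so by [small] the scaled coefficients are still divisible by [t]. *)
Lemma frame_coefs (e : nat -> nat -> K) : O (pexp p t u e) ->
  forall l j, (l < p)%N -> (j < p)%N -> O (e l j).
Proof.
move=> he.
have [N hN] := dvr_clear (fun i : 'I_p * 'I_p => e i.1 i.2).
have {}hN l j : (l < p)%N -> (j < p)%N -> O (e l j * t ^+ N).
  by move=> lp jp; exact: (hN (Ordinal lp, Ordinal jp)).
elim: N hN => [|N IH] hN; first by move=> l j lp jp; have := hN l j lp jp; rewrite expr0 mulr1.
apply: IH => l j lp jp.
pose e' l j := if (l < p)%N && (j < p)%N then e l j * t ^+ N.+1 else 0.
have Oe' l' j' : O (e' l' j').
  by rewrite /e'; case: ifP => [/andP[]|_]; [exact: hN | exact: subring0].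
have e'E : pexp p t u e' = t ^+ p * (pexp p t u e * t ^+ (N * p)).
  have -> : t ^+ p * (pexp p t u e * t ^+ (N * p)) = pexp p t u e * (t ^+ N.+1) ^+ p.
    by rewrite -exprM mulSn exprD; ring.
  rewrite -pexp_scale; apply: eq_bigr => l' _; apply: eq_bigr => j' _.
  by rewrite /e' !ltn_ord.
have := small (leqnn p) Oe'; rewrite -pexpE e'E.
case/(_ _ l j lp jp).
  by exists (pexp p t u e * t ^+ (N * p)) => //; apply: (subringM sO) => //; apply: OX; exact: dvr_t dO.
move=> a Oa; rewrite /e' lp jp /= exprS mulrCA => /(mulfI t0) ->; exact: Oa.
Qed.

(** Scaling by t^(-n) keeps the sum 0, so by [frame_coefs] every coefficient is divisible by all
    powers of [t]. *)
Let frame_indep (e : nat -> nat -> K) : pexp p t u e = 0 ->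
  forall l j, (l < p)%N -> (j < p)%N -> e l j = 0.
Proof.
move=> e0 l j lp jp; apply/eqP; apply: contraT => elj.
have [n] := dvr_pow_ndvd dO elj; case; exists (e l j * t ^- n); last by rewrite mulrC divfK // expf_neq0.
have := @frame_coefs (fun l j => e l j * t ^- n); apply=> //.
by rewrite pexp_scale e0 mul0r; exact: subring0.
Qed.

(** d/du is built over K^p(t) and d/dt over K^p(u); by [frame_coefs] both preserve [O]. *)
Lemma dvr_pbasis : exists Dt Du, pbasis O t u Dt Du.
Proof.
have span f := pexp_span_indep charK f deg frame_indep.
have swap (e : nat -> nat -> K) : pexp p t u e = \sum_(j < p) (\sum_(l < p) e l j ^+ p * t ^+ l) * u ^+ j.
  by rewrite /pexp exchange_big; apply: eq_bigr => j _; rewrite mulr_suml.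
have [Du [dDu DuE]] : exists D, derivation D /\ (forall c : nat -> K, (forall j, pspan1 p t (c j)) ->
    D (\sum_(j < p) c j * u ^+ j) = \sum_(j < p) c j * (u ^+ j.-1 *+ j)).
  apply: (basis_derivation charK); [exact: pspan1_ring | exact: pspan1_frob | |].
    move=> f; have [e fE] := span f; exists (fun j => \sum_(l < p) e l j ^+ p * t ^+ l).
    by split; [move=> j; exists (fun l => e l j) | rewrite fE swap].
  move=> c /choice[e eE] c0 j jp; rewrite eE big1 // => l _.
  rewrite (frame_indep (e := fun l j => e j l)) ?expr0n ?gtn_eqF ?mul0r // swap.
  by rewrite -[RHS]c0; apply: eq_bigr => i _; rewrite eE.
have [Dt [dDt DtE]] : exists D, derivation D /\ (forall c : nat -> K, (forall j, pspan1 p u (c j)) ->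
    D (\sum_(j < p) c j * t ^+ j) = \sum_(j < p) c j * (t ^+ j.-1 *+ j)).
  apply: (basis_derivation charK); [exact: pspan1_ring | exact: pspan1_frob | |].
    move=> f; have [e fE] := span f; exists (fun l => \sum_(j < p) e l j ^+ p * u ^+ j).
    by split; [move=> l; exists (e l) | rewrite fE pexpE].
  move=> c /choice[e eE] c0 l lp; rewrite eE big1 // => j _.
  rewrite (frame_indep (e := e)) ?expr0n ?gtn_eqF ?mul0r // pexpE.
  by rewrite -[RHS]c0; apply: eq_bigr => i _; rewrite eE.
have p_gt1 := prime_gt1 p_pr.
have one (D : K -> K) (v w : K) : (forall c : nat -> K, (forall j, pspan1 p w (c j)) ->
    D (\sum_(j < p) c j * v ^+ j) = \sum_(j < p) c j * (v ^+ j.-1 *+ j)) -> D v = 1.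
  move=> DE; pose c j : K := if j == 1%N then 1 else 0.
  have pick (F : nat -> K) : \sum_(j < p) c j * F j = F 1%N.
    rewrite (bigD1 (Ordinal p_gt1)) //= /c eqxx mul1r big1 ?addr0 // => j j1.
    by rewrite ifN ?mul0r //; apply: contra j1 => /eqP h; apply/eqP/val_inj.
  have := DE c; rewrite (pick (fun j => v ^+ j)) (pick (fun j => v ^+ j.-1 *+ j)); apply.
  move=> j; rewrite /c; case: ifP => _; last exact: subring0 (pspan1_ring charK w).
  exact: subring1 (pspan1_ring charK w).
have zero (D : K -> K) (v w : K) : (forall c : nat -> K, (forall j, pspan1 p w (c j)) ->
    D (\sum_(j < p) c j * v ^+ j) = \sum_(j < p) c j * (v ^+ j.-1 *+ j)) -> pspan1 p w w -> D w = 0.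
  move=> DE hw; pose c j : K := if j == 0%N then w else 0.
  have pick (F : nat -> K) : \sum_(j < p) c j * F j = w * F 0%N.
    rewrite (bigD1 (Ordinal p_gt0)) //= big1 ?addr0 // => j j1.
    by rewrite /c ifN ?mul0r //; apply: contra j1 => /eqP h; apply/eqP/val_inj.
  have := DE c; rewrite (pick (fun j => v ^+ j)) (pick (fun j => v ^+ j.-1 *+ j)) mulr0n mulr0 expr0 mulr1.
  apply=> j; rewrite /c; case: ifP => // _; exact: subring0 (pspan1_ring charK w).
have self (w : K) : pspan1 p w w.
  exists (fun l => if l == 1%N then 1 else 0).
  rewrite (bigD1 (Ordinal p_gt1)) //= expr1n mul1r big1 ?addr0 // => j j1.
  have -> : (j == 1%N :> nat) = false by apply: contraNF j1 => /eqP h; apply/eqP/val_inj.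
  by rewrite expr0n gtn_eqF // mul0r.
have OexpO f : O f -> exists e, f = pexp p t u e /\ forall l j, (l < p)%N -> (j < p)%N -> O (e l j).
  move=> Of; have [e fE] := span f; exists e; split=> //.
  by apply: frame_coefs; rewrite -fE.
exists Dt, Du; split=> //.
- exact: dvr_t dO.
- move=> f /OexpO[e [-> Oe]]; rewrite pexpE (DtE (fun l => \sum_(j < p) e l j ^+ p * u ^+ j)); last by move=> l; exists (e l).
  apply: (subring_sum sO) => l _; apply: (subringM sO).
    apply: (subring_sum sO) => j _; apply: (subringM sO); apply: OX => //.
    exact: Oe.
  rewrite -mulr_natr; apply: (subringM sO); [apply: OX; exact: dvr_t dO | exact: subring_nat].
- move=> f /OexpO[e [-> Oe]]; rewrite swap (DuE (fun j => \sum_(l < p) e l j ^+ p * t ^+ l)); last by move=> j; exists (fun l => e l j).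
  apply: (subring_sum sO) => j _; apply: (subringM sO).
    apply: (subring_sum sO) => l _; apply: (subringM sO); apply: OX.
      exact: Oe.
    exact: dvr_t dO.
  rewrite -mulr_natr; apply: (subringM sO); [exact: OX | exact: subring_nat].
- exact: one _ _ _ DtE.
- by have := zero Dt t u DtE (self u).
- by have := zero Du u t DuE (self t).
- exact: one _ _ _ DuE.
Qed.

End DvrFrame.

(** * Noetherian rings and localization *)

Record ideal (K : fieldType) (A I : set K) : Prop := Ideal {
  id_sub : I `<=` A;
  id0 : I 0;
  idD : forall a b, I a -> I b -> I (a + b);
  idM : forall a b, A a -> I b -> I (a * b) }.

Fixpoint gen_by (K : fieldType) (A : set K) (s : seq K) : set K :=
  if s is g :: s' then [set f | exists a h, [/\ A a, gen_by A s' h & f = a * g + h]]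
  else [set 0].

Definition noetherian (K : fieldType) (A : set K) : Prop :=
  forall I, ideal A I -> exists s, (forall g, g \in s -> I g) /\ I `<=` gen_by A s.

Section GenBy.
Variables (K : fieldType) (A : set K).
Hypothesis sA : subring A.
Implicit Types (I S : set K) (s : seq K).

Lemma idB I a b : ideal A I -> I a -> I b -> I (a - b).
Proof.
move=> iI Ia Ib; apply: (idD iI) => //; rewrite -mulN1r; apply: (idM iI) => //.
exact/(subringN sA)/(subring1 sA).
Qed.

Lemma id_sum I (T : Type) (r : seq T) (P : pred T) F : ideal A I ->
  (forall i, P i -> I (F i)) -> I (\sum_(i <- r | P i) F i).
Proof. by move=> iI h; apply: big_ind => //; [exact: id0 iI | exact: idD iI]. Qed.

(* coefficients in an ideal [S] of [A] (possibly [A] itself) *)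
Lemma gen_by_ideal S s : ideal A S ->
  [/\ gen_by S s 0, forall f g, gen_by S s f -> gen_by S s g -> gen_by S s (f + g)
    & forall a f, A a -> gen_by S s f -> gen_by S s (a * f)].
Proof.
move=> iS; elim: s => [|g s [h0 hD hM]] /=.
  by split=> //= [f g -> ->|a f _ ->]; rewrite ?addr0 ?mulr0.
split.
- by exists 0, 0; split; rewrite ?mul0r ?addr0 //; exact: id0 iS.
- move=> _ _ [a [h [Sa hs ->]]] [a' [h' [Sa' hs' ->]]].
  exists (a + a'), (h + h'); split; [exact: idD iS _ _ _ _ | exact: hD | by ring].
- move=> b _ Ab [a [h [Sa hs ->]]]; exists (b * a), (b * h).
  by split; [exact: idM iS _ _ _ _ | exact: hM | rewrite mulrDr mulrA].
Qed.

Lemma idealA : ideal A A.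
Proof. by split=> //; [exact: subring0 | exact: subringD | exact: subringM]. Qed.

Lemma gen_by_mem s g : g \in s -> gen_by A s g.
Proof.
elim: s => // h s IH; rewrite inE => /orP[/eqP->|/IH hg] /=.
  exists 1, 0; split; [exact: subring1 | | by rewrite mul1r addr0].
  by have [] := gen_by_ideal s idealA.
by exists 0, g; split; [exact: subring0 | | rewrite mul0r add0r].
Qed.

Lemma gen_by_sub I s : ideal A I -> (forall g, g \in s -> I g) -> gen_by A s `<=` I.
Proof.
move=> iI; elim: s => [|g s IH] hs f /=; first by move=> ->; exact: id0 iI.
move=> [a [h [Aa hh ->]]]; apply: (idD iI).
  by apply: (idM iI) => //; apply: hs; rewrite mem_head.
by apply: IH => // x xs; apply: hs; rewrite inE xs orbT.
Qed.

Lemma gen_by_sum S s f : gen_by S s f ->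
  exists c : 'I_(size s) -> K, (forall i, S (c i)) /\ f = \sum_i c i * s`_i.
Proof.
elim: s f => [|g s IH] f /=.
  by move=> ->; exists (fun=> 0); split=> [[]//|]; rewrite big_ord0.
move=> [a [h [Sa /IH[c [Sc ->]] ->]]].
exists (fun i => if unlift ord0 i is Some j then c j else a); split.
  by move=> i; case: unliftP.
rewrite big_ord_recl unlift_none; congr (_ + _).
by apply: eq_bigr => i _; rewrite liftK.
Qed.

Lemma gen_by_scale S s f g : ideal A S -> gen_by A s f -> S g -> gen_by S s (g * f).
Proof.
move=> iS; elim: s f => [|x s IH] f /=; first by move=> -> _; rewrite mulr0.
move=> [a [h [Aa hh ->]]] Sg; exists (a * g), (g * h); split; [exact: idM iS _ _ _ _ | exact: IH | by ring].
Qed.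

(** Zorn's lemma: the union of a chain is finitely generated, so its generators, and hence the
    union, already lie in one member. *)
Lemma noetherian_max (Fam : set (set K)) : noetherian A -> (forall I, Fam I -> ideal A I) ->
  Fam !=set0 -> exists I, Fam I /\ forall J, Fam J -> I `<=` J -> J `<=` I.
Proof.
move=> nA Fid [I0 FI0].
pose P (X : set K) := X = set0 \/ Fam X.
have [F sF tF|X [[X0|FX] Xmax]] := @Zorn_bigcup K P.
- have [[Y [FY FamY]]|no] := pselect (exists Y, F Y /\ Fam Y); last first.
    left; apply/seteqP; split=> // x [Y FY Yx]; case: (sF _ FY) => [Y0|FamY].
      by rewrite Y0 in Yx.
    by case: no; exists Y.
  set U := \bigcup_(X in F) X.
  have nonempty Z z : F Z -> Z z -> Fam Z.
    by move=> FZ Zz; case: (sF _ FZ) => // Z0; rewrite Z0 in Zz.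
  have iU : ideal A U.
    split.
    + by move=> x [Z FZ Zx]; apply: (id_sub (Fid _ (nonempty _ _ FZ Zx))).
    + by exists Y => //; exact: id0 (Fid _ FamY).
    + move=> a b [Z FZ Za] [Z' FZ' Z'b].
      have iZ := Fid _ (nonempty _ _ FZ Za); have iZ' := Fid _ (nonempty _ _ FZ' Z'b).
      case: (tF _ _ FZ FZ') => sub; first by exists Z' => //; apply: (idD iZ') => //; exact: sub.
      by exists Z => //; apply: (idD iZ) => //; exact: sub.
    + move=> a b Aa [Z FZ Zb]; exists Z => //.
      by apply: (idM (Fid _ (nonempty _ _ FZ Zb))).
  have [s [sU Us]] := nA _ iU.
  have [Z [FZ FamZ sZ]] : exists Z, [/\ F Z, Fam Z & forall g, g \in s -> Z g].
    elim: s sU {Us} => [|g s IH] sU; first by exists Y.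
    have [|Z [FZ FamZ sZ]] := IH.
      by move=> x xs; apply: sU; rewrite inE xs orbT.
    have [Z' FZ' Z'g] := sU g (mem_head _ _).
    case: (tF _ _ FZ FZ') => sub.
      exists Z'; split=> //; first exact: nonempty FZ' Z'g.
      by move=> x; rewrite inE => /orP[/eqP->//|/sZ]; exact: sub.
    exists Z; split=> // x; rewrite inE => /orP[/eqP->|/sZ//]; exact: sub.
  right; suff -> : U = Z by [].
  apply/seteqP; split; last by move=> x Zx; exists Z.
  by move=> x /Us; apply: gen_by_sub => //; exact: Fid.
- exfalso; apply: (Xmax I0); last by right.
  by rewrite X0; split=> [x []|sub]; exact: (sub 0 (id0 (Fid _ FI0))).
- exists X; split=> // J FJ XJ; apply: contrapT => nJX.
  by apply: (Xmax J); [split | right].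
Qed.

(** Maximal annihilators are prime: a maximal one is chosen among the conductors of the multiples f
    b outside [A]. This is an associated prime of K / A. *)
Lemma conductor_prime f : noetherian A -> ~ A f ->
  exists b, [/\ A b, ~ A (f * b) & prime_ideal A [set a | A a /\ A (a * (f * b))]].
Proof.
move=> nA nf.
pose cond g := [set a | A a /\ A (a * g)].
pose Fam := [set I | exists b, [/\ A b, ~ A (f * b) & I = cond (f * b)]].
have idc g : ideal A (cond g).
  split=> [a []//||a b [Aa ha] [Ab hb]|a b Aa [Ab hb]].
  - by split; rewrite ?mul0r; exact: subring0.
  - by split; rewrite ?mulrDl; exact: subringD.
  - by split; rewrite -?mulrA; exact: subringM.
have [||I [[b [Ab nfb ->]] Imax]] := @noetherian_max Fam nA.
- by move=> I [b [_ _ ->]].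
- by exists (cond f), 1; split; rewrite ?mulr1 //; exact: subring1.
exists b; split=> //; rewrite -/(cond _); split.
- by move=> a [].
- split; first exact: id0 (idc _).
  by move=> [_]; rewrite mul1r.
- exact: idD (idc _).
- exact: idM (idc _).
move=> x y Ax Ay [_ hxy].
have [hx|nx] := pselect (cond (f * b) x); [by left | right].
have nx' : ~ A (f * (b * x)) by move=> h; apply: nx; split; rewrite // mulrC -mulrA.
have /Imax : Fam (cond (f * (b * x))) by exists (b * x); split=> //; exact: subringM.
apply.
  move=> a [Aa ha]; split=> //; have -> : a * (f * (b * x)) = (a * (f * b)) * x by ring.
  exact: subringM.
by split=> //; have -> : y * (f * (b * x)) = (x * y) * (f * b) by ring.
Qed.

(** The second hypothesis puts [a] in the Jacobson radical. Generators are eliminated one at a time,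
    the coefficient 1 - al being invertible. *)
Lemma nakayama (a N : set K) (s : seq K) : ideal A a ->
    (forall x, a x -> 1 - x != 0 /\ A (1 - x)^-1) ->
    (forall x y, N x -> N y -> N (x + y)) -> (forall b x, A b -> N x -> N (b * x)) -> N 0 ->
    (forall x, x \in s -> exists y, N y /\ gen_by a s (x - y)) ->
  forall x, x \in s -> N x.
Proof.
move=> ia aU ND NM N0; elim: s => // x0 s IH h.
have [_ gD gM] := gen_by_ideal s ia.
have [y0 [Ny0 [al [r [aal hr r0]]]]] := h x0 (mem_head _ _).
have [u0 Au] := aU _ aal.
have x0E : x0 = (1 - al)^-1 * (y0 + r).
  apply: (mulfI u0); rewrite mulVKf // mulrBl mul1r.
  by move/eqP: r0; rewrite subr_eq => /eqP {1}->; ring.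
have Ns : forall x, x \in s -> N x.
  apply: IH => x xs.
  have [|y [Ny [be [r' [abe hr' r'0]]]]] := h x; first by rewrite inE xs orbT.
  exists (y + be * (1 - al)^-1 * y0); split.
    by apply: (ND) => //; apply: (NM) => //; apply: subringM => //; exact: id_sub ia _ abe.
  have -> : x - (y + be * (1 - al)^-1 * y0) = r' + be * (1 - al)^-1 * r.
    by rewrite opprD addrA r'0 x0E; ring.
  by apply: (gD) => //; apply: (gM) => //; apply: subringM => //; exact: id_sub ia _ abe.
move=> x; rewrite inE => /orP[/eqP->|]; last exact: Ns.
rewrite x0E; apply: (NM) => //; apply: (ND) => //.
elim: s r hr Ns {IH h gD gM r0 x0E} => [|g s IH] r /=; first by move=> -> _.
move=> [c [h [ac hh ->]]] Ns; apply: (ND).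
  by apply: (NM); [exact: id_sub ia _ ac | apply: (Ns); rewrite mem_head].
by apply: IH => // y ys; apply: (Ns); rewrite inE ys orbT.
Qed.

End GenBy.

Definition nonunits (K : fieldType) (O : set K) : set K :=
  [set f | O f /\ (f = 0 \/ ~ O f^-1)].

Definition normal_ring (K : fieldType) (O : set K) : Prop :=
  forall (f : K) (P : {poly K}), P \is monic -> (forall j, O P`_j) -> root P f -> O f.

Definition frac_ring (K : fieldType) (O : set K) : Prop :=
  forall f : K, exists a b, [/\ O a, O b, b != 0 & f = a / b].

(** * Integrality, localization and a criterion for discrete valuation rings *)

Section Integrality.
Variables (K : fieldType) (A : set K).
Hypothesis sA : subring A.

Let polyA (P : {poly K}) : Prop := forall j, A P`_j.

Let polyA_M P Q : polyA P -> polyA Q -> polyA (P * Q).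
Proof.
by move=> hP hQ j; rewrite coefM; apply: (subring_sum sA) => i _; exact: subringM.
Qed.
Let polyA_D P Q : polyA P -> polyA Q -> polyA (P + Q).
Proof. by move=> hP hQ j; rewrite coefD; exact: subringD. Qed.
Let polyA_C c : A c -> polyA c%:P.
Proof. by move=> Ac j; rewrite coefC; case: ifP => // _; exact: subring0. Qed.

Lemma char_poly_coefs n (M : 'M[K]_n) : (forall i j, A (M i j)) -> polyA (char_poly M).
Proof.
move=> AM; rewrite /char_poly /determinant.
have P0 : polyA 0 by move=> j; rewrite coef0; exact: subring0.
apply: big_ind => [//||s _]; first exact: polyA_D.
apply: polyA_M.
  rewrite -[-1]/(- 1) -polyC1 -polyCN -polyC_exp; apply: polyA_C.
  exact/(@subringX _ _ sA)/(subringN sA)/(subring1 sA).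
apply: big_ind => [j||i _]; [by rewrite coef1; exact: subring_nat | exact: polyA_M |].
move=> j; rewrite !mxE coefB coefMn coefX coefC.
apply: (subringB sA); first by rewrite -mulrnA; exact: subring_nat.
by case: ifP => _ //; exact: subring0.
Qed.

(** The determinant trick: [f] is an eigenvalue of a matrix with entries in [A], the generators
    forming the eigenvector, hence a root of its characteristic polynomial. *)
Lemma integral_of_stable f (s : seq K) : (exists2 g, g \in s & g != 0) ->
    (forall g, g \in s -> gen_by A s (f * g)) ->
  exists P : {poly K}, [/\ P \is monic, forall j, A P`_j & root P f].
Proof.
move=> [g gs g0] stab.
have /choice[c cP] : forall i : 'I_(size s), exists c : 'I_(size s) -> K,
    (forall j, A (c j)) /\ f * s`_i = \sum_j c j * s`_j.
  by move=> i; apply: gen_by_sum; apply: stab; exact: mem_nth.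
pose M := \matrix_(i, j) c i j.
exists (char_poly M^T); split; first exact: char_poly_monic.
  by apply: char_poly_coefs => i j; rewrite !mxE; case: (cP j).
rewrite -eigenvalue_root_char; apply/eigenvalueP.
exists (\row_j s`_j).
  apply/rowP => i; rewrite !mxE; have [_ ->] := cP i.
  by apply: eq_bigr => j _; rewrite !mxE mulrC.
apply: contraNneq g0 => /rowP h.
have gi : (index g s < size s)%N by rewrite index_mem.
by have := h (Ordinal gi); rewrite !mxE /= nth_index // => ->.
Qed.

End Integrality.

Section Localization.
Variables (K : fieldType) (A q : set K).
Hypothesis sA : subring A.
Hypothesis pq : prime_ideal A q.
Local Notation L := (localization A q).

Lemma prime_sub : q `<=` A. Proof. by case: pq. Qed.
Lemma prime0 : q 0. Proof. by case: pq => _ []. Qed.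
Lemma prime1 : ~ q 1. Proof. by case: pq => _ []. Qed.
Lemma primeD a b : q a -> q b -> q (a + b). Proof. by case: pq => _ _ + _ _; apply. Qed.
Lemma primeM a b : A a -> q b -> q (a * b). Proof. by case: pq => _ _ _ + _; apply. Qed.
Lemma primeP a b : A a -> A b -> q (a * b) -> q a \/ q b.
Proof. by case: pq => _ _ _ _; apply. Qed.
Lemma prime_ideal_ideal : ideal A q.
Proof. by split; [exact: prime_sub | exact: prime0 | exact: primeD | exact: primeM]. Qed.
Lemma notin_prime0 b : ~ q b -> b != 0.
Proof. by move=> nb; apply/eqP => b0; apply: nb; rewrite b0; exact: prime0. Qed.
Lemma notin_primeM a b : A a -> A b -> ~ q a -> ~ q b -> ~ q (a * b).
Proof. by move=> Aa Ab na nb /(primeP Aa Ab)[]. Qed.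

Lemma loc_sub : A `<=` L.
Proof.
move=> a Aa; exists a, 1; split=> //; [exact: subring1 | exact: prime1 | by rewrite divr1].
Qed.

Lemma loc_inv b : A b -> ~ q b -> L b^-1.
Proof. by move=> Ab nb; exists 1, b; split=> //; [exact: subring1 | rewrite mul1r]. Qed.

Lemma loc_ring : subring L.
Proof.
split; first by apply: loc_sub; exact: subring1.
  move=> _ _ [a [b [Aa Ab nb ->]]] [a' [b' [Aa' Ab' nb' ->]]].
  exists (a * b' - a' * b), (b * b'); split.
  - by apply: subringB => //; exact: subringM.
  - exact: subringM.
  - exact: notin_primeM.
  - by field; rewrite !notin_prime0.
move=> _ _ [a [b [Aa Ab nb ->]]] [a' [b' [Aa' Ab' nb' ->]]].
exists (a * a'), (b * b'); split; [exact: subringM | exact: subringM | exact: notin_primeM |].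
by field; rewrite !notin_prime0.
Qed.

Lemma loc_nonunitP f : nonunits L f <-> exists a b, [/\ q a, A b, ~ q b & f = a / b].
Proof.
split.
  move=> [[a [b [Aa Ab nb fE]]] hf]; exists a, b; split=> //.
  apply: contrapT => nqa; have a0 := notin_prime0 nqa; have b0 := notin_prime0 nb.
  case: hf => [f0|]; last by apply; exists b, a; split=> //; rewrite fE invf_div.
  by move/eqP: f0; rewrite fE mulf_eq0 invr_eq0 (negbTE a0) (negbTE b0).
move=> [a [b [qa Ab nb ->]]]; have Aa := prime_sub qa; have b0 := notin_prime0 nb.
split; first by exists a, b.
have [->|a0] := eqVneq a 0; [by left; rewrite mul0r | right].
move=> [c [d [Ac Ad nd e]]]; apply: nd.
have d0 : d != 0 by apply/eqP => d0; move: e; rewrite d0 invr0 mulr0 invf_div => /eqP; rewrite mulf_eq0 invr_eq0 (negbTE a0) (negbTE b0).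
have bd : b * d = c * a.
  by move: e; rewrite invf_div => /eqP; rewrite eqr_div // => /eqP ->.
by have := primeM Ac qa; rewrite -bd => /(primeP Ab Ad)[].
Qed.

Lemma loc_primeE a : A a -> (q a <-> nonunits L a).
Proof.
move=> Aa; split=> [qa|/loc_nonunitP[c [b [qc Ab nb aE]]]].
  by apply/loc_nonunitP; exists a, 1; split=> //; [exact: subring1 | exact: prime1 | rewrite divr1].
have : q (b * a) by rewrite aE mulrC divfK // notin_prime0.
by move/(primeP Ab Aa) => [].
Qed.

Lemma loc_local : local_pair L (nonunits L).
Proof.
have sL := loc_ring.
split=> //.
- by move=> f [].
- by split; [exact: subring0 | left].
- move=> _ _ /loc_nonunitP[a [b [qa Ab nb ->]]] /loc_nonunitP[a' [b' [qa' Ab' nb' ->]]].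
  apply/loc_nonunitP; exists (b' * a - b * a'), (b * b'); split.
  + by apply: (idB sA prime_ideal_ideal); exact: primeM.
  + exact: subringM.
  + exact: notin_primeM.
  + by field; rewrite !notin_prime0.
- move=> _ _ [c [d [Ac Ad nd ->]]] /loc_nonunitP[a [b [qa Ab nb ->]]].
  apply/loc_nonunitP; exists (c * a), (d * b); split; [exact: primeM | exact: subringM | exact: notin_primeM |].
  by field; rewrite !notin_prime0.
- by move=> [_ [/eqP|]]; rewrite ?oner_eq0 // invr1; apply; exact: subring1.
- move=> a La na; apply: contrapT => h; apply: na; split=> //; by right.
Qed.

Lemma loc_noetherian : noetherian A -> noetherian L.
Proof.
move=> nA I iI; pose I' := [set a | A a /\ I a].
have [|s [sI' I's]] := nA I'.
  split=> [a []//||a b [Aa Ia] [Ab Ib]|a b Aa [Ab Ib]].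
  - by split; [exact: subring0 | exact: id0 iI].
  - by split; [exact: subringD | exact: idD iI _ _ _ _].
  - by split; [exact: subringM | apply: (idM iI) => //; exact: loc_sub].
exists s; split=> [g /sI'[]//|f If].
have [a [b [Aa Ab nb fE]]] := id_sub iI If.
have b0 := notin_prime0 nb.
have : I' a.
  by split=> //; rewrite -[a](divfK b0) -fE mulrC; apply: (idM iI) => //; exact: loc_sub.
move/I's => ga; rewrite fE mulrC; have [_ _ hM] := gen_by_ideal s (idealA loc_ring).
apply: hM; first exact: loc_inv.
elim: s a ga {I's sI' Aa fE} => [|g s IH] a //=.
by move=> [c [h [Ac hh ->]]]; exists c, h; split=> //; [exact: loc_sub | exact: IH].
Qed.

Lemma loc_frac : frac_ring A -> frac_ring L.
Proof.
by move=> fA f; have [a [b [Aa Ab b0 ->]]] := fA f; exists a, b; split=> //; exact: loc_sub.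
Qed.

End Localization.

Section DvrCriterion.
Variables (K : fieldType) (O m : set K).
Hypothesis nO : noetherian O.
Hypothesis lO : local_pair O m.
Hypothesis fO : frac_ring O.
Let sO := lp_ring lO.

Lemma lp_ideal : ideal O m.
Proof.
split; [exact: lp_sub lO | exact: lp0 lO | | exact: lpM lO].
move=> a b ma mb; rewrite -[b]opprK; apply: (lpB lO) => //.
by rewrite -sub0r; apply: (lpB lO) => //; exact: lp0 lO.
Qed.

Lemma lp_nonunit a : m a -> a != 0 -> ~ O a^-1.
Proof. by move=> ma a0 h; apply: (lp1 lO); rewrite -(mulVf a0); exact: (lpM lO). Qed.

(** The point is that no nonzero [a] is divisible by all powers of [t]. Otherwise the ideals
    generated by a t^(-n) increase within [O]; their union is finitely generated, so they stop at
    some N, and t^(-1) would be in [O]. *)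
Lemma dvr_of_principal t : t != 0 -> m = [set f | exists2 a, O a & f = t * a] -> dvr O t.
Proof.
move=> t0 mE.
have mt : m t by rewrite mE; exists 1; rewrite ?mulr1 //; exact: subring1.
have Ot := lp_sub lO mt.
have OX n : O (t ^+ n) by exact: subringX.
have key a : a != 0 -> O a -> exists u n, [/\ O u, O u^-1, u != 0 & a = u * t ^+ n].
  move=> a0 Oa.
  have [n nn] : exists n, ~ O (a * t ^- n).
    apply: contrapT => no.
    have all n : O (a * t ^- n) by apply: contrapT => h; apply: no; exists n.
    pose I := [set g | exists n c, O c /\ g = c * (a * t ^- n)].
    have stepI n k : a * t ^- n = t ^+ k * (a * t ^- (n + k)).
      by rewrite exprD; have := expf_neq0 n t0; have := expf_neq0 k t0 => ? ?; field; apply/andP.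
    have [|s [sI Is]] := nO (I := I).
      split.
      - by move=> _ [n [c [Oc ->]]]; exact: subringM.
      - by exists 0%N, 0; split; rewrite ?mul0r //; exact: subring0.
      - move=> _ _ [n [c [Oc ->]]] [n' [c' [Oc' ->]]]; exists (n + n')%N, (c * t ^+ n' + c' * t ^+ n).
        split; first by apply: subringD => //; exact: subringM.
        by rewrite (stepI n n') (stepI n' n) [(n' + n)%N]addnC; ring.
      - by move=> b _ Ob [n [c [Oc ->]]]; exists n, (b * c); split; [exact: subringM | rewrite mulrA].
    have [N hN] : exists N, forall g, g \in s -> exists c, O c /\ g = c * (a * t ^- N).
      elim: s sI {Is} => [|g s IH] sI; first by exists 0%N.
      have [|N hN] := IH; first by move=> x xs; apply: sI; rewrite inE xs orbT.
      have [n [c [Oc gE]]] := sI g (mem_head _ _).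
      exists (N + n)%N => x; rewrite inE => /orP[/eqP->|/hN[d [Od ->]]].
        exists (c * t ^+ N); split; first exact: subringM.
        by rewrite gE (stepI n N) mulrA addnC.
      exists (d * t ^+ n); split; first exact: subringM.
      by rewrite (stepI N n) mulrA.
    have : gen_by O s (a * t ^- N.+1) by apply: Is; exists N.+1, 1; split; rewrite ?mul1r //; exact: subring1.
    have sub : gen_by O s `<=` [set g | exists c, O c /\ g = c * (a * t ^- N)].
      apply: gen_by_sub => //; split.
      - by move=> _ [c [Oc ->]]; exact: subringM.
      - by exists 0; rewrite mul0r; split=> //; exact: subring0.
      - by move=> _ _ [c [Oc ->]] [d [Od ->]]; exists (c + d); rewrite mulrDl; split=> //; exact: subringD.
      - by move=> b _ Ob [c [Oc ->]]; exists (b * c); rewrite mulrA; split=> //; exact: subringM.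
    move=> /sub[c [Oc e]]; apply: (lp_nonunit mt t0).
    have -> : t^-1 = c; last by [].
    have aN : a * t ^- N != 0 by rewrite mulf_neq0 // invr_neq0 // expf_neq0.
    by apply: (mulIf aN); rewrite -e exprS invfM; ring.
  have ex : exists n, `[< ~ O (a * t ^- n) >] by exists n; apply/asboolP.
  case: (ex_minnP ex) => -[|k] /asboolP hk kmin.
    by case: hk; rewrite expr0 invr1 mulr1.
  have Ok : O (a * t ^- k).
    by apply: contrapT => h; have := kmin k (introT (asboolP _) h); rewrite ltnn.
  exists (a * t ^- k), k; split=> //; last by rewrite divfK // expf_neq0.
    apply: (lp_unit lO) => //; rewrite mE => -[b Ob bE]; apply: hk.
    by rewrite exprS invfM mulrCA bE mulrA mulVf ?mul1r.
  by rewrite mulf_neq0 // invr_neq0 // expf_neq0.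
split=> //; first exact: lp_nonunit.
move=> f f0; have [a [b [Oa Ob b0 fE]]] := fO f.
have a0 : a != 0 by apply: contraNneq f0 => a0; rewrite fE a0 mul0r.
have [u [n [Ou Ou' u0 aE]]] := key a a0 Oa; have [v [k [Ov Ov' v0 bE]]] := key b b0 Ob.
exists (u / v), (n%:Z - k%:Z); split.
- exact: subringM.
- by rewrite invf_div; exact: subringM.
- by rewrite mulf_neq0 // invr_neq0.
- by rewrite fE aE bE expfzDr // -exprnN -exprnP invfM; ring.
Qed.

(** If f m were contained in [m], the determinant trick and normality would put [f] in [O]. So a f
    is a unit for some [a] in [m], and f^(-1) generates [m]. *)
Lemma dvr_of_conductor f : normal_ring O -> ~ O f -> (forall a, m a -> O (a * f)) ->
  exists t, dvr O t /\ m = [set g | exists2 a, O a & g = t * a].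
Proof.
move=> norm nf mf.
have f0 : f != 0 by apply/eqP => f0; apply: nf; rewrite f0; exact: subring0.
have [[a [ma nma]]|no] := pselect (exists a, m a /\ ~ m (a * f)); last first.
  exfalso; apply: (nf).
  have stab a : m a -> m (f * a) by move=> ma; apply: contrapT => h; apply: no; exists a; rewrite mulrC.
  have [s [sm ms]] := nO lp_ideal.
  have [b [mb b0]] : exists b, m b /\ b != 0.
    have [a [b [Oa Ob b0 fE]]] := fO f; exists b; split=> //.
    apply: contrapT => nb; apply: nf; rewrite fE; apply: subringM => //.
    exact: (lp_unit lO).
  have [||P [Pm Pc Pf]] := @integral_of_stable _ _ sO f s.
  - apply: contrapT => h; case/eqP: b0; move/ms: mb.
    have h' g : g \in s -> g = 0 by move=> gs; apply/eqP; apply/negPn/negP => g0; apply: h; exists g.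
    elim: s h' {sm ms h} b => [|g s IH] h' b //= [c [x [_ xs ->]]].
    rewrite (h' g) ?mem_head // mulr0 add0r; apply: IH xs => y ys.
    by apply: h'; rewrite inE ys orbT.
  - by move=> g gs; apply: ms; apply: stab; exact: sm.
  exact: norm Pm Pc Pf.
have Oe := mf a ma; have Ee := lp_unit lO Oe nma.
have a0 : a != 0 by apply/eqP => a0; apply: nma; rewrite a0 mul0r; exact: lp0 lO.
have mE : m = [set g | exists2 b, O b & g = f^-1 * b].
  apply/seteqP; split=> [b mb|_ [b Ob ->]] /=; first by exists (b * f); [exact: mf | rewrite mulrC mulfK].
  have -> : f^-1 * b = (b / (a * f)) * a by field; rewrite f0.
  by apply: (lpM lO) => //; exact: subringM.
by exists f^-1; split=> //; apply: dvr_of_principal => //; rewrite invr_neq0.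
Qed.

End DvrCriterion.

Lemma dvr_overring (K : fieldType) (O R : set K) t : dvr O t -> subring R -> O `<=` R ->
  ~ (R `<=` O) -> R = setT.
Proof.
move=> dO sR OR nR; have sO := dvr_ring dO; have t0 := dvr_t0 dO.
have [f [Rf nf]] : exists f, R f /\ ~ O f.
  by apply: contrapT => h; apply: nR => f Rf; apply: contrapT => nf; apply: h; exists f.
have f0 : f != 0 by apply/eqP => f0; apply: nf; rewrite f0; exact: subring0.
have Rt : R t^-1.
  have [u [[k|k] [Ou Ou' u0 fE]]] := dvr_val dO f0.
    by case: nf; rewrite fE; apply: subringM => //; apply: (@subringX _ _ sO); exact: dvr_t dO.
  have -> : t^-1 = u^-1 * f * t ^+ k.
    rewrite fE NegzE -exprnN exprS; have := expf_neq0 k t0 => tk.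
    by move: (t ^+ k) tk => T T0; field; rewrite ?u0 ?t0 ?T0.
  apply: (subringM sR); last by apply: (@subringX _ _ sR); exact/OR/(dvr_t dO).
  by apply: (subringM sR) => //; exact: OR.
apply/seteqP; split=> // g _; have [->|g0] := eqVneq g 0; first exact: subring0.
have [u [[k|k] [Ou _ _ ->]]] := dvr_val dO g0; apply: (subringM sR); try exact: OR.
  by apply: (@subringX _ _ sR); exact/OR/(dvr_t dO).
by rewrite NegzE -exprnN -exprVn; exact: (@subringX _ _ sR).
Qed.

(** * Hilbert's basis theorem *)

Definition adjoin (K : fieldType) (A : set K) (x : K) : set K :=
  [set f | exists P : {poly K}, (forall j, A P`_j) /\ f = P.[x]].

Section Hilbert.
Variables (K : fieldType) (A : set K) (x : K).
Hypothesis sA : subring A.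
Local Notation Ax := (adjoin A x).

Let polyA (P : {poly K}) : Prop := forall j, A P`_j.
Let polyA_M P Q : polyA P -> polyA Q -> polyA (P * Q).
Proof.
by move=> hP hQ j; rewrite coefM; apply: (subring_sum sA) => i _; exact: subringM.
Qed.
Let polyA_D P Q : polyA P -> polyA Q -> polyA (P + Q).
Proof. by move=> hP hQ j; rewrite coefD; exact: subringD. Qed.
Let polyA_B P Q : polyA P -> polyA Q -> polyA (P - Q).
Proof. by move=> hP hQ j; rewrite coefB; exact: subringB. Qed.
Let polyA_C c : A c -> polyA c%:P.
Proof. by move=> Ac j; rewrite coefC; case: ifP => // _; exact: subring0. Qed.
Let polyA_X n : polyA 'X^n.
Proof. by move=> j; rewrite coefXn; exact: subring_nat. Qed.

Lemma adjoin_ring : subring Ax.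
Proof.
split.
- by exists 1; split; [rewrite -polyC1; apply: polyA_C; exact: subring1 | rewrite hornerC].
- by move=> _ _ [P [hP ->]] [Q [hQ ->]]; exists (P - Q); split; [exact: polyA_B | rewrite !hornerE].
- by move=> _ _ [P [hP ->]] [Q [hQ ->]]; exists (P * Q); split; [exact: polyA_M | rewrite hornerM].
Qed.

Lemma adjoin_sub : A `<=` Ax.
Proof. by move=> a Aa; exists a%:P; split; [exact: polyA_C | rewrite hornerC]. Qed.

Lemma adjoin_self : Ax x.
Proof. by exists 'X^1; split; [exact: polyA_X | rewrite expr1 hornerX]. Qed.

Lemma adjoin_min (R : set K) : subring R -> A `<=` R -> R x -> Ax `<=` R.
Proof.
move=> sR AR Rx _ [P [hP ->]]; rewrite horner_coef; apply: (subring_sum sR) => i _.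
by apply: (subringM sR); [exact: AR | exact: (@subringX _ _ sR)].
Qed.

(** The classical argument with leading coefficients. As [x] may satisfy relations over [A], an
    element of A[x] has many representing polynomials; [lead d] collects the d-th coefficients of
    all those of degree at most d with value in [I]. *)
Theorem hilbert_basis : noetherian A -> noetherian Ax.
Proof.
move=> nA I iI; have sX := adjoin_ring.
have IB := idB sX iI.
pose lead d := [set c | exists P : {poly K}, [/\ polyA P, (size P <= d.+1)%N, P`_d = c & I P.[x]]].
have idl d : ideal A (lead d).
  split.
  - by move=> c [P [hP _ <- _]]; exact: hP.
  - exists 0; split; rewrite ?size_poly0 ?coef0 ?horner0 //; last exact: id0 iI.
    by move=> j; rewrite coef0; exact: subring0.
  - move=> a b [P [hP sP Pa IP]] [Q [hQ sQ Qb IQ]]; exists (P + Q); split.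
    + exact: polyA_D.
    + by apply: leq_trans (size_polyD _ _) _; rewrite geq_max sP.
    + by rewrite coefD Pa Qb.
    + by rewrite hornerD; exact: idD iI _ _ _ _.
  - move=> a b Aa [P [hP sP Pb IP]]; exists (a%:P * P); split.
    + by apply: polyA_M => //; exact: polyA_C.
    + by rewrite mul_polyC; apply: leq_trans (size_scale_leq _ _) sP.
    + by rewrite coefCM Pb.
    + by rewrite hornerM hornerC; apply: (idM iI) => //; exact: adjoin_sub.
have lead_mono d e : (d <= e)%N -> lead d `<=` lead e.
  move=> de c [P [hP sP Pc IP]]; exists (P * 'X^(e - d)); split.
  - exact: polyA_M.
  - apply: (leq_trans (size_polyMleq _ _)); rewrite size_polyXn addnS /=.
    by rewrite -ltnS; apply: (leq_ltn_trans (leq_add sP (leqnn _))); rewrite addSn subnKC.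
  - by rewrite coefMXn ltnNge leq_subr /= subKn.
  - rewrite hornerM hornerXn mulrC; apply: (idM iI) => //.
    exact: (@subringX _ _ sX _ _ adjoin_self).
(* The increasing ideals [lead d] are constant from some [D] on. Lifts of their generators for d <=
   D suffice, since higher degrees are reached by multiplying with powers of [x]. *)
have [||_ [[D _ <-] Dmax]] := @noetherian_max _ _ (range lead) nA.
- by move=> _ [d _ <-].
- by exists (lead 0%N), 0%N.
have {}Dmax d : (D <= d)%N -> lead d `<=` lead D.
  by move=> Dd; apply: Dmax; [exists d | exact: lead_mono].
have /choice[s sP] : forall d, exists s, (forall g, g \in s -> lead d g) /\ lead d `<=` gen_by A s.
  by move=> d; exact: nA.
have /choice[lift liftP] : forall dc : nat * K, exists P : {poly K}, lead dc.1 dc.2 ->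
    [/\ polyA P, (size P <= dc.1.+1)%N, P`_dc.1 = dc.2 & I P.[x]].
  move=> [d c]; have [[P hP]|no] := pselect (lead d c); first by exists P.
  by exists 0.
pose gens := flatten [seq [seq (lift (d, c)).[x] | c <- s d] | d <- iota 0 D.+1].
exists gens; split.
  move=> g /flattenP[l /mapP[d _ ->] /mapP[c cs ->]].
  by have [] := liftP (d, c) ((sP d).1 c cs).
have [_ gD gM] := gen_by_ideal gens (idealA sX).
have lower d c : (d <= D)%N -> lead d c ->
    exists Q : {poly K}, [/\ polyA Q, (size Q <= d.+1)%N, Q`_d = c & gen_by Ax gens Q.[x]].
  move=> dD /(sP d).2.
  have : forall g, g \in s d -> exists Q : {poly K},
      [/\ polyA Q, (size Q <= d.+1)%N, Q`_d = g & gen_by Ax gens Q.[x]].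
    move=> g gs; have [hL sL cL IL] := liftP (d, g) ((sP d).1 g gs).
    exists (lift (d, g)); split => //; apply: gen_by_mem => //.
    apply/flattenP; exists [seq (lift (d, c)).[x] | c <- s d].
      by apply/mapP; exists d => //; rewrite mem_iota ltnS.
    by apply/mapP; exists g.
  elim: (s d) c => [|g l IH] c hl /=.
    move=> ->; exists 0; split; rewrite ?size_poly0 ?coef0 ?horner0 //.
      by move=> j; rewrite coef0; exact: subring0.
    by have [] := gen_by_ideal gens (idealA sX).
  move=> [a [h [Aa hh ->]]].
  have [Q [hQ sQ Qg GQ]] := hl g (mem_head _ _).
  have [|Q' [hQ' sQ' Qg' GQ']] := IH h _ hh; first by move=> y yl; apply: hl; rewrite inE yl orbT.
  exists (a%:P * Q + Q'); split.
  - by apply: polyA_D => //; apply: polyA_M => //; exact: polyA_C.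
  - apply: leq_trans (size_polyD _ _) _; rewrite geq_max sQ' andbT mul_polyC.
    exact: leq_trans (size_scale_leq _ _) sQ.
  - by rewrite coefD coefCM Qg Qg'.
  - by rewrite !hornerE; apply: (gD) => //; apply: (gM) => //; exact: adjoin_sub.
have main n : forall P : {poly K}, (size P <= n)%N -> polyA P -> I P.[x] -> gen_by Ax gens P.[x].
  elim: n => [|n IH] P sP' hP IP.
    by move: sP'; rewrite leqn0 size_poly_eq0 => /eqP ->; rewrite horner0; have [] := gen_by_ideal gens (idealA sX).
  have lP : lead n P`_n by exists P.
  have [Q [hQ sQ Qn GQ]] : exists Q : {poly K}, [/\ polyA Q, (size Q <= n.+1)%N, Q`_n = P`_n & gen_by Ax gens Q.[x]].
    have [nD|Dn] := leqP n D; first exact: lower.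
    have [Q [hQ sQ Qn GQ]] := lower D _ (leqnn D) (Dmax _ (ltnW Dn) _ lP).
    exists (Q * 'X^(n - D)); split.
    - exact: polyA_M.
    - apply: (leq_trans (size_polyMleq _ _)); rewrite size_polyXn addnS /=.
      by rewrite -ltnS; apply: (leq_ltn_trans (leq_add sQ (leqnn _))); rewrite addSn subnKC // ltnW.
    - by rewrite coefMXn ltnNge leq_subr /= subKn // ltnW.
    - rewrite hornerM hornerXn mulrC; apply: (gM) => //.
      exact: (@subringX _ _ sX _ _ adjoin_self).
  have GI : I Q.[x].
    suff sub : gen_by Ax gens `<=` I by exact: sub.
    apply: gen_by_sub => // g /flattenP[l /mapP[d _ ->] /mapP[c cs ->]].
    by have [] := liftP (d, c) ((sP d).1 c cs).
  rewrite -[P](subrK Q) hornerD; apply: (gD) => //; apply: IH.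
  - apply/leq_sizeP => j; rewrite leq_eqVlt => /orP[/eqP <-|nj].
      by rewrite coefB Qn subrr.
    by rewrite coefB !(leq_sizeP _ _ _ _ nj) ?subrr.
  - exact: polyA_B.
  - by rewrite !hornerE; exact: IB.
by move=> f If; have [P [hP fE]] := id_sub iI If; rewrite fE; apply: (main (size P)) => //; rewrite -fE.
Qed.

End Hilbert.

Definition eval_range (k K : fieldType) (iota : {rmorphism k -> K}) n (y : 'I_n -> K) : set K :=
  [set f | exists g : {mpoly k[n]}, f = mmap iota y g].

Section EvalRange.
Variables (k K : fieldType) (iota : {rmorphism k -> K}).

Section Fixed.
Variables (n : nat) (y : 'I_n -> K).
Local Notation A := (eval_range iota y).

Lemma eval_range_ring : subring A.
Proof.
split.
- by exists 1; rewrite rmorph1.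
- by move=> _ _ [a ->] [b ->]; exists (a - b); rewrite rmorphB.
- by move=> _ _ [a ->] [b ->]; exists (a * b); rewrite rmorphM.
Qed.

Lemma eval_range_const c : A (iota c).
Proof. by exists c%:MP; rewrite mmapC. Qed.

Lemma eval_range_var j : A (y j).
Proof. by exists 'X_j; rewrite mmapX mmap1U. Qed.

Lemma eval_range_min (R : set K) : subring R -> (forall c, R (iota c)) ->
  (forall j, R (y j)) -> A `<=` R.
Proof.
move=> sR Rc Ry _ [g ->]; rewrite /mmap; apply: (subring_sum sR) => m _.
apply: (subringM sR) => //; apply: (subring_prod sR) => j _.
exact: (@subringX _ _ sR).
Qed.

Lemma eval_range_noetherian : noetherian A.
Proof.
pose T := foldr (fun x B => adjoin B x) (range iota) [seq y j | j <- enum 'I_n].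
have s0 : subring (range iota).
  split; first by exists 1; rewrite ?rmorph1.
    by move=> _ _ [a _ <-] [b _ <-]; exists (a - b); rewrite ?rmorphB.
  by move=> _ _ [a _ <-] [b _ <-]; exists (a * b); rewrite ?rmorphM.
have n0 : noetherian (range iota).
  move=> I iI; have [[c [Ic c0]]|no] := pselect (exists c, I c /\ c != 0).
    exists [:: c]; split=> [g|g Ig]; first by rewrite inE => /eqP->.
    have [a _ aE] := id_sub iI Ic; have [b _ bE] := id_sub iI Ig.
    exists (g / c), 0; split=> //; last by rewrite divfK // addr0.
    by exists (b / a); rewrite // fmorph_div aE bE.
  exists [::]; split=> // g Ig /=; apply/eqP; apply/negPn/negP => g0; apply: no.
  by exists g.
have sub s : subring (foldr (fun x B => adjoin B x) (range iota) s) /\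
   noetherian (foldr (fun x B => adjoin B x) (range iota) s).
  by elim: s => //= x s [h1 h2]; split; [exact: adjoin_ring | exact: hilbert_basis].
have subR s (R : set K) : subring R -> range iota `<=` R -> (forall x, x \in s -> R x) ->
    foldr (fun x B => adjoin B x) (range iota) s `<=` R.
  move=> sR h; elim: s => //= x s IH hs; apply: adjoin_min => //.
    by apply: IH => z zs; apply: hs; rewrite inE zs orbT.
  by apply: hs; rewrite mem_head.
have inc s x : x \in s -> foldr (fun x B => adjoin B x) (range iota) s x.
  elim: s => //= z s IH; rewrite inE => /orP[/eqP->|/IH h].
    by apply: adjoin_self; case: (sub s).
  by apply: adjoin_sub => //; case: (sub s).
have base s : range iota `<=` foldr (fun x B => adjoin B x) (range iota) s.
  by elim: s => //= z s IH c /IH; apply: adjoin_sub; case: (sub s).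
have -> : A = T.
  apply/seteqP; split.
    apply: eval_range_min => [|c|j]; first by case: (sub [seq y j | j <- enum 'I_n]).
      by apply: base; exists c.
    by apply: inc; apply/mapP; exists j; rewrite ?mem_enum.
  apply: subR; first exact: eval_range_ring.
    by move=> _ [c _ <-]; exact: eval_range_const.
  by move=> _ /mapP[j _ ->]; exact: eval_range_var.
by case: (sub [seq y j | j <- enum 'I_n]).
Qed.

End Fixed.
End EvalRange.

(** * Points and prime divisors *)

Lemma loc_loc (K : fieldType) (A q q' : set K) : subring A -> prime_ideal A q ->
    prime_ideal (localization A q) q' ->
  prime_ideal A (A `&` q') /\
  localization (localization A q) q' = localization A (A `&` q').
Proof.
move=> sA pq pq'; have AL := @loc_sub _ _ _ sA pq.
have pA : prime_ideal A (A `&` q').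
  split.
  - by move=> a [].
  - split; first by split; [exact: subring0 | exact: prime0 pq'].
    by move=> [_]; exact: prime1 pq'.
  - by move=> a b [Aa qa] [Ab qb]; split; [exact: subringD | exact: primeD pq' _ _ _ _].
  - by move=> a b Aa [Ab qb]; split; [exact: subringM | apply: (primeM pq') => //; exact: AL].
  - move=> a b Aa Ab [_ /(primeP pq' (AL _ Aa) (AL _ Ab))[h|h]]; [by left | by right].
split=> //; apply/seteqP; split.
  move=> f [a [b [[a1 [s1 [Aa1 As1 ns1 aE]]] [b1 [s2 [Ab1 As2 ns2 bE]]] nb ->]]].
  have s10 := notin_prime0 pq ns1; have s20 := notin_prime0 pq ns2.
  have s1n : ~ q' s1.
    move=> h; apply: (prime1 pq'); rewrite -(mulVf s10); apply: (primeM pq') => //.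
    exact: loc_inv.
  have b1n : ~ q' b1.
    by move=> h; apply: nb; rewrite bE mulrC; apply: (primeM pq') => //; exact: loc_inv.
  have b10 := notin_prime0 pq' b1n.
  exists (a1 * s2), (s1 * b1); split.
  - exact: subringM.
  - exact: subringM.
  - by move=> [_]; apply: (notin_primeM pq') => //; exact: AL.
  - by rewrite aE bE; field; rewrite ?s10 ?s20 ?b10.
move=> f [a [b [Aa Ab nb ->]]]; exists a, b; split; [exact: AL | exact: AL | | by []].
by move=> h; apply: nb.
Qed.

Lemma chain2 (K : Type) (C : set (set K)) (a b c : set K) : C a -> C b -> C c ->
  a `<` b -> b `<` c -> has_chain C 2.
Proof.
move=> Ca Cb Cc ab bc; exists (fun j : 'I_3 => nth a [:: a; b; c] j); split.
  by case=> -[|[|[|]]].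
have ac : a `<` c by split; [exact: subset_trans ab.1 bc.1 | move=> h; apply: bc.2; exact: subset_trans h ab.1].
by case=> -[|[|[|j]]] jp; case=> -[|[|[|l]]] lp.
Qed.

Lemma properN (T : Type) (a b : set T) : a `<=` b -> a <> b -> a `<` b.
Proof. by move=> ab nab; split=> // ba; apply: nab; apply/seteqP. Qed.

Section Variety.
Variables (k : fieldType) (X : proj_variety k).
Local Notation s := (@Defs.coord _ X).
Local Notation A := (chart (constants X) s).
Implicit Types (x y P : set X).

Lemma chart_ring i : subring (A i).
Proof. exact: eval_range_ring. Qed.
Lemma chart_noetherian i : noetherian (A i).
Proof. exact: eval_range_noetherian. Qed.
Lemma chart_const i c : A i (constants X c).
Proof. exact: eval_range_const. Qed.
Lemma chart_var i j : A i (s j / s i).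
Proof. exact: (eval_range_var (constants X) (affine_coord s i) j). Qed.
Lemma chart_frac i : s i != 0 -> frac_ring (A i).
Proof. by move=> si f; exact: coord_gen. Qed.

Lemma ptP x : pt x <-> exists i q, [/\ s i != 0, prime_ideal (A i) q & x = localization (A i) q].
Proof.
split; first by move=> [i [si [q [pq ->]]]]; exists i, q.
by move=> [i [q [si pq ->]]]; exists i; split=> //; exists q.
Qed.

Lemma pt_local x : pt x -> local_pair x (nonunits x).
Proof. by move=> /ptP[i [q [si pq ->]]]; apply: loc_local => //; exact: chart_ring. Qed.
Lemma pt_ring x : pt x -> subring x.
Proof. by move/pt_local/lp_ring. Qed.
Lemma pt_noetherian x : pt x -> noetherian x.
Proof.
move=> /ptP[i [q [si pq ->]]]; apply: loc_noetherian => //; first exact: chart_ring.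
exact: chart_noetherian.
Qed.
Lemma pt_frac x : pt x -> frac_ring x.
Proof.
by move=> /ptP[i [q [si pq ->]]]; apply: loc_frac => //; [exact: chart_ring | exact: chart_frac].
Qed.
Lemma pt_const x c : pt x -> x (constants X c).
Proof.
move=> /ptP[i [q [si pq ->]]]; apply: (loc_sub (chart_ring i) pq); exact: chart_const.
Qed.

Lemma pt_generic : pt [set: X].
Proof.
have [i si] := coord_neq0 X; apply/ptP; exists i, [set 0]; split=> //.
  have sA := chart_ring i; split=> //=.
  - by move=> _ ->; exact: subring0.
  - by split=> //; apply/eqP; exact: oner_neq0.
  - by move=> a b -> ->; rewrite addr0.
  - by move=> a b _ ->; rewrite mulr0.
  - by move=> a b _ _ /eqP; rewrite mulf_eq0 => /orP[/eqP|/eqP]; [left|right].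
apply/seteqP; split=> // f _; have [a [b [Aa Ab b0 ->]]] := chart_frac si f.
by exists a, b; split=> //=; apply/eqP.
Qed.

(** On chart [i], an element of chart [l] has only powers of s_l / s_i as denominators. *)
Lemma chart_homog i l a : s i != 0 -> s l != 0 -> A l a ->
  exists N, forall m, (N <= m)%N -> A i (a * (s l / s i) ^+ m).
Proof.
move=> si sl; set r := s l / s i.
have sA := chart_ring i; have Ar : A i r by exact: chart_var.
have AX n : A i (r ^+ n) by exact: (@subringX _ _ sA).
pose R : set X := [set a | exists N, forall m, (N <= m)%N -> A i (a * r ^+ m)].
suff : A l `<=` R by apply.
have sR : subring R.
  split.
  - by exists 0%N => m _; rewrite mul1r.
  - move=> b c [N hN] [M hM]; exists (N + M)%N => m h; rewrite mulrBl.
    apply: (subringB sA); [apply: hN | apply: hM]; apply: leq_trans h; [exact: leq_addr | exact: leq_addl].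
  - move=> b c [N hN] [M hM]; exists (N + M)%N => m h.
    have -> : b * c * r ^+ m = (b * r ^+ N) * (c * r ^+ (m - N)).
      by rewrite mulrACA -exprD subnKC //; apply: leq_trans h; exact: leq_addr.
    by apply: (subringM sA); [exact: hN | apply: hM; rewrite leq_subRL // (leq_trans _ h) // leq_addr].
apply: eval_range_min => // [c|j].
  by exists 0%N => m _; apply: (subringM sA) => //; exact: chart_const.
exists 1%N => -[//|m] _; rewrite /affine_coord exprS mulrA.
have -> : s j / s l * r = s j / s i by rewrite /r; field; rewrite si.
by apply: (subringM sA) => //; exact: chart_var.
Qed.

Lemma nonunits_prime x i : pt x -> A i `<=` x -> prime_ideal (A i) (A i `&` nonunits x).
Proof.
move=> px Ax; have lx := pt_local px; have sA := chart_ring i.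
split.
- by move=> a [].
- split; first by split; [exact: subring0 | exact: lp0 lx].
  by move=> [_]; exact: lp1 lx.
- by move=> a b [Aa ma] [Ab mb]; split; [exact: subringD | exact: idD (lp_ideal lx) _ _ _ _].
- by move=> a b Aa [Ab mb]; split; [exact: subringM | apply: (lpM lx) => //; exact: Ax].
- move=> a b Aa Ab [_ mab]; have [ma|nma] := pselect (nonunits x a); first by left.
  right; split=> //; have a0 : a != 0 by apply/eqP => a0; apply: nma; rewrite a0; exact: lp0 lx.
  rewrite -[b](mulKf a0); apply: (lpM lx) => //; apply: (lp_unit lx) => //; exact: Ax.
Qed.

(** Numerator and denominator taken from another chart [l] of [x] are multiplied by a power of r =
    s_l / s_i to enter chart [i]; [r] is a unit of [x] because both charts lie in [x]. *)
Lemma pt_in_chart x i : s i != 0 -> pt x -> A i `<=` x ->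
  x = localization (A i) (A i `&` nonunits x).
Proof.
move=> si px Ax; have lx := pt_local px; have sA := chart_ring i; have sx := pt_ring px.
have pN := nonunits_prime px Ax.
apply/seteqP; split; last first.
  move=> _ [a [b [Aa Ab nb ->]]]; apply: (subringM sx); first exact: Ax.
  apply: (lp_unit lx); first exact: Ax.
  by move=> h; apply: nb.
have [l [q [sl pq xE]]] := (ptP x).1 px.
move=> f; rewrite {1}xE => -[a [b [Aa Ab nb ->]]].
have sAl := chart_ring l; have Alx : A l `<=` x by rewrite xE; exact: loc_sub.
have [N hN] := chart_homog si sl Aa; have [M hM] := chart_homog si sl Ab.
pose r := s l / s i; have r0 : r != 0 by rewrite mulf_neq0 // invr_eq0.
have xr : x r by apply: Ax; exact: chart_var.
have xr' : x r^-1 by rewrite /r invf_div; apply: Alx; exact: chart_var.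
have rn n : r ^+ n != 0 by exact: expf_neq0.
have b0 := notin_prime0 pq nb.
exists (a * r ^+ (N + M)), (b * r ^+ (N + M)); split.
- by apply: hN; exact: leq_addr.
- by apply: hM; exact: leq_addl.
- move=> [_ h]; have xb : x b^-1 by rewrite xE; exact: loc_inv.
  apply: (lp1 lx); have -> : 1 = (b^-1 * r^-1 ^+ (N + M)) * (b * r ^+ (N + M)).
    by rewrite exprVn; have := rn (N + M)%N; move: (r ^+ _) => R R0; field; rewrite ?b0 ?R0.
  by apply: (lpM lx) => //; apply: (subringM sx) => //; exact: (@subringX _ _ sx).
- by have := rn (N + M)%N; move: (r ^+ _) => R R0; field; rewrite ?b0 ?R0.
Qed.

Lemma loc_pt i q : s i != 0 -> prime_ideal (A i) q -> pt (localization (A i) q).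
Proof. by move=> si pq; apply/ptP; exists i, q. Qed.

Lemma pt_chart x : pt x -> exists i, [/\ s i != 0 & A i `<=` x].
Proof.
move=> /ptP[i [q [si pq ->]]]; exists i; split=> //; apply: loc_sub => //; exact: chart_ring.
Qed.

Section PrimeDivisor.
Variable P : set X.
Hypothesis dP : prime_divisor P.
Let pP : pt P. Proof. by case: dP. Qed.

Lemma divisor_proper : P <> setT.
Proof.
move=> PT; have [_ [[c [hc hlt]] _]] := dP.
have [_ sub0] := hc ord0.
have := hlt ord0 (@Ordinal 2 1 isT) isT; case=> _; apply.
by rewrite PT in sub0; move=> f _; exact: sub0.
Qed.

Lemma divisor_above y : pt y -> P `<=` y -> y = P \/ y = setT.
Proof.
move=> py Py; have [yP|nyP] := pselect (y = P); [by left | right].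
apply: contrapT => nyT; have [_ [_ no]] := dP; apply: no.
apply: (@chain2 _ _ P y setT); try by split=> //; exact: pt_generic.
  by apply: properN => // /esym.
exact: properN.
Qed.

End PrimeDivisor.

(** By [dvr_overring] there is no ring strictly between a discrete valuation ring and its field, so
    no point strictly between [P] and the generic one. *)
Lemma dvr_prime_divisor P t : pt P -> dvr P t -> prime_divisor P.
Proof.
move=> pP dO; split=> //; split.
  exists (fun j : 'I_2 => if j == ord0 then P else setT); split.
    by move=> j; case: ifP => _; split=> //; exact: pt_generic.
  case=> -[|[|j]] jp; case=> -[|[|l]] lp //= _; split=> //.
  by move=> h; apply: (dvr_tV dO); exact: h.
move=> [c [hc hlt]].
have [p0 P0] := hc ord0; have [p1 P1] := hc (@Ordinal 3 1 isT).
have [s01 n01] := hlt ord0 (@Ordinal 3 1 isT) isT.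
have [s12 n12] := hlt (@Ordinal 3 1 isT) (@Ordinal 3 2 isT) isT.
apply: n12; rewrite (_ : c (@Ordinal 3 1 isT) = setT) //.
apply: (dvr_overring dO (pt_ring p1) P1) => h; apply: n01.
exact: subset_trans h P0.
Qed.

Hypothesis X_normal : normal_variety X.

Lemma pt_normal x : pt x -> normal_ring x.
Proof. by move=> px f g gm gx rf; exact: (X_normal px gm gx rf). Qed.

(** Localizing at an associated prime of K / P gives a point above [P]: [P] itself or the generic
    point. The latter is excluded since f b would have a denominator outside its own conductor. So
    the prime is the maximal ideal, and [dvr_of_conductor] applies. *)
Lemma prime_divisor_dvr P : prime_divisor P ->
  exists t, dvr P t /\ nonunits P = [set g | exists2 a, P a & g = t * a].
Proof.
move=> dP; have pP : pt P by case: dP.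
have [f nf] : exists f, ~ P f.
  apply: contrapT => h; apply: (divisor_proper dP); apply/seteqP; split=> // f _.
  by apply: contrapT => nf; apply: h; exists f.
have sP := pt_ring pP; have nP := pt_noetherian pP; have lP := pt_local pP.
have [b [Pb nfb pq']] := conductor_prime sP nP nf.
set q' := [set a | P a /\ _] in pq'.
have [i [q [si pq PE]]] := (ptP P).1 pP.
have [pA yE] : prime_ideal (A i) (A i `&` q') /\ localization P q' = localization (A i) (A i `&` q').
  by have := pq'; rewrite {1 2}PE => h; apply: loc_loc => //; exact: chart_ring.
have py : pt (localization P q') by rewrite yE; exact: loc_pt.
have Py : P `<=` localization P q' by exact: loc_sub.
have [e|e] := divisor_above dP py Py; last first.
  exfalso; have [a [c [Pa Pc nc fbE]]] : localization P q' (f * b) by rewrite e.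
  have c0 := notin_prime0 pq' nc; apply: nc; split=> //.
  by rewrite fbE mulrC divfK.
apply: (dvr_of_conductor nP lP (pt_frac pP) (pt_normal pP) nfb) => a ma.
apply: contrapT => h; apply: (lp1 lP).
have Pa := lp_sub lP ma; have nqa : ~ q' a by move=> [_].
rewrite -(mulVf (notin_prime0 pq' nqa)); apply: (lpM lP) => //.
by rewrite -e; exact: loc_inv.
Qed.

(** [ord_is] brings its own uniformizer, which differs from [t] by a unit, so that the order is the
    same. *)
Lemma ord_val_ge P t f (m n : int) : dvr P t ->
    nonunits P = [set g | exists2 a, P a & g = t * a] ->
  ord_is P f m -> n <= m -> val_ge P t n f.
Proof.
move=> dO mE [t' [u [mE' Pu Pu' u0 ->]]] nm; have sP := dvr_ring dO; have t0 := dvr_t0 dO.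
have mE2 : [set t' * a | a in P] = [set g | exists2 a, P a & g = t * a] by rewrite -mE -mE'.
have [a Pa t'E] : exists2 a, P a & t' = t * a.
  have : [set t' * a | a in P] t' by exists 1; rewrite ?mulr1 //; exact: subring1.
  by rewrite mE2.
have [b Pb tE] : exists2 b, P b & t' * b = t.
  suff : [set t' * a | a in P] t by [].
  by rewrite mE2; exists 1; rewrite ?mulr1 //; exact: subring1.
have a0 : a != 0.
  by apply: contraNneq t0 => a0; rewrite -tE t'E a0 mulr0 mul0r.
have aV : P a^-1.
  suff -> : a^-1 = b by [].
  by apply: (mulfI a0); rewrite mulfV //; apply: (mulfI t0); rewrite mulr1 mulrA -t'E tE.
have aZ : P (a ^ m).
  case: (m) => j; first exact: (@subringX _ _ sP).
  by rewrite NegzE -exprnN -exprVn; exact: (@subringX _ _ sP).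
rewrite /val_ge /=.
have -> : u * t' ^ m * t ^ (- n) = (u * a ^ m) * t ^ (m - n).
  by rewrite t'E expfzMl expfzDr //; ring.
apply: (subringM sP); first exact: subringM.
have : 0 <= m - n by rewrite subr_ge0.
by case: (m - n) => // j _; apply: (@subringX _ _ sP); exact: dvr_t dO.
Qed.

Lemma val_ge_ord P t f (n : int) : dvr P t ->
    nonunits P = [set g | exists2 a, P a & g = t * a] -> f != 0 ->
  val_ge P t n f -> exists m, ord_is P f m /\ n <= m.
Proof.
move=> dO mE f0 hf; have [u [m [Pu Pu' u0 fE]]] := dvr_val dO f0.
have sP := dvr_ring dO; have t0 := dvr_t0 dO.
exists m; split.
  exists t, u; split=> //; rewrite -[max_ideal P]/(nonunits P) mE.
  by apply/seteqP; split=> [_ [a Pa ->]|_ [a Pa <-]]; exists a.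
rewrite leNgt; apply/negP => mn; apply: (dvr_tV dO).
have [j jE] : exists j : nat, n = m + j.+1%:Z.
  exists (`|n - m|%N).-1; rewrite prednK; last by rewrite absz_gt0 subr_eq0 gt_eqF.
  by rewrite gez0_abs ?subr_ge0 ?ltW // [RHS]addrC subrK.
have -> : t^-1 = u^-1 * (f * t ^ (- n)) * t ^+ j.
  rewrite fE jE opprD expfzDr // -[t ^ (- j.+1%:Z)]exprnN exprS.
  have := expf_neq0 j t0; have tm : t ^ m != 0 by rewrite expfz_neq0.
  rewrite -[t ^ (- m)]invr_expz; move: (t ^ m) tm (t ^+ j) => x x0 z z0.
  by field; rewrite ?u0 ?t0 ?z0 ?x0.
by do 2?apply: (subringM sP) => //; apply: (@subringX _ _ sP); exact: dvr_t dO.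
Qed.

(** A normal noetherian ring is the intersection of its localizations at height one primes: for [f]
    outside the chart, the localization at an associated prime is a discrete valuation ring by
    [dvr_of_conductor], hence a prime divisor, and it does not contain [f]. *)
Lemma in_all_divisors_chart f i : s i != 0 -> (forall P, prime_divisor P -> P f) -> A i f.
Proof.
move=> si hf; apply: contrapT => nf; have sA := chart_ring i.
have [b [Ab nfb pq]] := conductor_prime sA (@chart_noetherian i) nf.
set q := [set a | A i a /\ _] in pq.
have py := loc_pt si pq; set y := localization _ _ in py.
have nfy : ~ y (f * b).
  move=> [a [c [Aa Ac nc fbE]]]; apply: (nc); split=> //.
  by rewrite fbE mulrC divfK // (notin_prime0 pq nc).
have [|t [dO _]] := dvr_of_conductor (pt_noetherian py) (pt_local py) (pt_frac py) (pt_normal py) nfy.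
  move=> a /(loc_nonunitP pq)[c [d [[Ac qc] Ad nd ->]]].
  exists (c * (f * b)), d; split=> //; by rewrite mulrAC.
apply: nfy; apply: (subringM (pt_ring py)); first exact: hf (dvr_prime_divisor py dO).
exact: (loc_sub sA pq).
Qed.

End Variety.

(** * Global functions and the Iitaka dimension *)

Section AlgebraicFunctions.
Variables (k K : fieldType) (iota : {rmorphism k -> K}).

Lemma algebraic_root_exp (f : K) n : (0 < n)%N ->
  algebraicOver iota (f ^+ n) -> algebraicOver iota f.
Proof.
move=> n0 /integral_algebraic h; apply/integral_algebraic.
apply: (@integral_root_monic _ _ _ _ ('X^n - (f ^+ n)%:P)).
- by rewrite monicXnsubC.
- by rewrite /root !hornerE subrr.
- apply/integral_poly => j; rewrite coefB coefXn coefC.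
  apply: integral_sub; first exact: integral_nat.
  by case: ifP => _ //; exact: integral0.
Qed.

(** A monic equation of degree n for b^(-1), multiplied by b^(n-1), expresses b^(-1) as a polynomial
    in [b]. *)
Lemma algebraic_inv_in (R : set K) (b : K) : subring R -> (forall c, R (iota c)) ->
  R b -> b != 0 -> algebraicOver iota b -> R b^-1.
Proof.
move=> sR Rc Rb b0 /algebraic_inv/integral_algebraic[P Pm /rootP rP].
have [n sP] : exists n, size P = n.+1.
  by exists (size P).-1; rewrite prednK // lt0n size_poly_eq0 monic_neq0.
have n0 : (0 < n)%N.
  case: n sP => // sP; move: rP.
  have /size_poly1P[c c0 PE] : size P == 1%N by rewrite sP.
  by rewrite PE map_polyC hornerC /= => /eqP; rewrite fmorph_eq0 (negbTE c0).
have lead : P`_n = 1 by have := monicP Pm; rewrite /lead_coef sP.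
have key : b^-1 = - \sum_(j < n) iota P`_j * b ^+ (n.-1 - j).
  move: rP; rewrite horner_coef size_map_poly sP big_ord_recr /= coef_map /= lead rmorph1 mul1r.
  move/eqP; rewrite addrC addr_eq0 => /eqP e.
  have bn : b ^+ n.-1 != 0 by rewrite expf_neq0.
  have e' : b^-1 = b ^+ n.-1 * b^-1 ^+ n.
    by rewrite -{2}(prednK n0) exprS exprVn mulrCA mulfV ?mulr1.
  rewrite e' e mulrN mulr_sumr; congr (- _); apply: eq_bigr => j _.
  rewrite coef_map mulrCA; congr (_ * _); rewrite exprVn.
  have jn : (j <= n.-1)%N by rewrite -ltnS prednK.
  by rewrite -{1}(subnK jn) exprD mulfK // expf_neq0.
rewrite key; apply: (subringN sR); apply: (subring_sum sR) => j _.
by apply: (subringM sR) => //; exact: (@subringX _ _ sR).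
Qed.

Section Proper.
Variables (n : nat) (s : 'I_n.+1 -> K).
Local Notation A i := (eval_range iota (affine_coord s i)).

Let V D : set K := [set f | exists P : {mpoly k[n.+1]},
  (forall m, m \in msupp P -> mdeg m = D) /\ f = mmap iota s P].

Let V_D D f g : V D f -> V D g -> V D (f - g).
Proof.
move=> [P [hP ->]] [Q [hQ ->]]; exists (P - Q); split; last by rewrite rmorphB.
by move=> m /msuppB_le; rewrite mem_cat => /orP[/hP|/hQ].
Qed.

Let V_M D E f g : V D f -> V E g -> V (D + E)%N (f * g).
Proof.
move=> [P [hP ->]] [Q [hQ ->]]; exists (P * Q); split; last by rewrite rmorphM.
by move=> m /msuppM_le /allpairsP[[m1 m2] /= [h1 h2 ->]]; rewrite mdegD hP // hQ.
Qed.

Let V_mono m : V (mdeg m) (mmap1 s m).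
Proof.
by exists 'X_[m]; split; [move=> m'; rewrite msuppX inE => /eqP-> | rewrite mmapX].
Qed.

Let mmap1_Un j N : mmap1 s (U_(j) *+ N)%MM = s j ^+ N.
Proof.
rewrite /mmap1 (bigD1 j) //= mulmnE mnm1E eqxx mul1n big1 ?mulr1 // => i ij.
by rewrite mulmnE mnm1E eq_sym (negbTE ij) mul0n expr0.
Qed.

Let V_s j N : V N (s j ^+ N).
Proof. by have := V_mono (U_(j) *+ N)%MM; rewrite mdegMn mdeg1 mul1n mmap1_Un. Qed.

Let V_const c : V 0 (iota c).
Proof.
exists c%:MP; split; last by rewrite mmapC.
by move=> m; rewrite msuppC; case: ifP => // _; rewrite inE => /eqP ->; rewrite mdeg0.
Qed.

Let chart_V i f : s i != 0 -> A i f -> exists N, forall m, (N <= m)%N -> V m (f * s i ^+ m).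
Proof.
move=> si; pose R : set K := [set f | exists N, forall m, (N <= m)%N -> V m (f * s i ^+ m)].
suff : A i `<=` R by apply.
apply: eval_range_min => [|c|j].
- split.
  + by exists 0%N => m _; rewrite mul1r; exact: V_s.
  + move=> b c [N hN] [M hM]; exists (N + M)%N => m h; rewrite mulrBl.
    apply: V_D; [apply: hN | apply: hM]; apply: leq_trans h; [exact: leq_addr | exact: leq_addl].
  + move=> b c [N hN] [M hM]; exists (N + M)%N => m h.
    have Nm : (N <= m)%N by apply: leq_trans h; exact: leq_addr.
    have -> : b * c * s i ^+ m = (b * s i ^+ N) * (c * s i ^+ (m - N)).
      by rewrite mulrACA -exprD subnKC.
    rewrite -[X in V X](subnKC Nm); apply: V_M; first exact: hN.
    by apply: hM; rewrite leq_subRL.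
- by exists 0%N => m _; apply: (V_M (V_const c) (V_s i m)).
- exists 1%N => -[//|m] _; rewrite /affine_coord exprS mulrA divfK // -add1n.
  by apply: V_M => //; have := V_s j 1; rewrite expr1.
Qed.

(** In high degree [D], multiplication by [f] preserves the finite-dimensional space [V D] of values
    of forms at [s], so the determinant trick over [k] applies. *)
Lemma algebraic_of_all_charts f : (exists i, s i != 0) ->
  (forall i, s i != 0 -> A i f) -> algebraicOver iota f.
Proof.
move=> [i0 si0] hf.
have /choice[N hN] : forall i, exists N, s i != 0 -> forall m, (N <= m)%N -> V m (f * s i ^+ m).
  move=> i; have [->|si] := eqVneq (s i) 0; first by exists 0%N.
  by have [N hN] := chart_V si (hf i si); exists N.
(* In this degree some exponent m_j exceeds N_j. If s_j is nonzero, s_j^(m_j) absorbs the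
   denominator of [f]; if s_j = 0, the monomial vanishes. *)
pose D := (\sum_i (N i).+1)%N.
pose mons := [seq mmap1 s (val m) | m <- enum {: bmultinom n.+1 D.+1} & mdeg (val m) == D].
have sI : subring (range iota).
  split; first by exists 1; rewrite ?rmorph1.
    by move=> _ _ [a _ <-] [b _ <-]; exists (a - b); rewrite ?rmorphB.
  by move=> _ _ [a _ <-] [b _ <-]; exists (a * b); rewrite ?rmorphM.
have iA := idealA sI.
have VD g : V D g -> gen_by (range iota) mons g.
  move=> [P [hP ->]]; have [g0 gD gM] := gen_by_ideal mons iA.
  rewrite /mmap big_seq; apply: big_ind => // m mP; apply: (gM); first by exists (P@_m).
  apply: gen_by_mem => //; have mD := hP _ mP.
  have lt : (mdeg m < D.+1)%N by rewrite mD.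
  by apply/mapP; exists (BMultinom lt); rewrite // mem_filter /= mD eqxx mem_enum.
have mono_f m : mdeg m = D -> V D (f * mmap1 s m).
  move=> mD.
  have [[i [ni si]]|no] := pselect (exists i, (N i <= m i)%N /\ s i != 0).
    pose m' := (m - U_(i) *+ m i)%MM.
    have mE : m = (U_(i) *+ m i + m')%MM.
      apply/mnmP => j; rewrite mnmDE mnmBE mulmnE mnm1E.
      by case: eqP => [->|_]; rewrite ?mul1n ?mul0n ?subnn ?addn0 ?subn0.
    have hd : (m i + mdeg m' = D)%N by rewrite -mD [in RHS]mE mdegD mdegMn mdeg1 mul1n.
    have -> : mmap1 s m = s i ^+ m i * mmap1 s m'.
      by rewrite {1}mE commr_mmap1_M ?mmap1_Un // => l x; exact: mulrC.
    rewrite mulrA -hd; apply: V_M => //; exact: hN.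
  have [j [sj mj]] : exists j, s j = 0 /\ (0 < m j)%N.
    have [j mj] : exists j, (N j < m j)%N.
      apply: contrapT => h; have : (D <= \sum_i N i)%N.
        rewrite -mD mdegE; apply: leq_sum => j _; rewrite leqNgt; apply/negP => mj.
        by apply: h; exists j.
      rewrite leqNgt => /negP; apply; rewrite /D (bigD1 i0) //= [X in (_ < X)%N](bigD1 i0) //=.
      by rewrite addSn ltnS leq_add2l; apply: leq_sum => j _.
    exists j; split; last exact: leq_ltn_trans mj.
    by apply/eqP/negPn/negP => sj; apply: no; exists j; split=> //; exact: ltnW.
  have -> : mmap1 s m = 0.
    by rewrite /mmap1 (bigD1 j) //= sj expr0n gtn_eqF // mul0r.
  rewrite mulr0; exists 0; split; last by rewrite rmorph0.
  by move=> m'; rewrite msupp0.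
have mem_mons m : mdeg m = D -> mmap1 s m \in mons.
  move=> mD; have lt : (mdeg m < D.+1)%N by rewrite mD.
  by apply/mapP; exists (BMultinom lt); rewrite // mem_filter /= mD eqxx mem_enum.
have [||P [Pm Pc Pf]] := @integral_of_stable _ _ sI f mons.
- exists (mmap1 s (U_(i0) *+ D)%MM); first by apply: mem_mons; rewrite mdegMn mdeg1 mul1n.
  by rewrite mmap1_Un expf_neq0.
- by move=> g /mapP[m]; rewrite mem_filter => /andP[/eqP mD _] ->; apply: VD; exact: mono_f.
apply/integral_algebraic; apply: (@integral_root_monic _ _ _ _ P) => //.
apply/integral_poly => j; have [c _ <-] := Pc j; exact: integral_id.
Qed.

End Proper.
End AlgebraicFunctions.

Section ImageDimension.
Variables (k K : fieldType) (iota : {rmorphism k -> K}).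
Variables (n : nat) (f : 'I_n.+1 -> K).

Lemma algebraic_ring : subring [set a | algebraicOver iota a].
Proof.
split=> [|a b|a b] /=.
- by rewrite -(rmorph1 iota); exact: algebraic_id.
- exact: algebraic_sub.
- exact: algebraic_mul.
Qed.

(** If all ratios are algebraic, every chart ring is a field, so it has only one point, the ring
    itself, and all charts coincide. Then there is no chain of length 1. *)
Lemma dim_pos_transcendental d : (0 < d)%N -> has_chain (points iota f) d ->
  exists i j, f i != 0 /\ ~ algebraicOver iota (f j / f i).
Proof.
case: d => // d _ [c [hc hlt]]; apply: contrapT => no.
have alg i j : f i != 0 -> algebraicOver iota (f j / f i).
  by move=> fi; apply: contrapT => h; apply: no; exists i, j.
have chart_alg i a : f i != 0 -> chart iota f i a -> algebraicOver iota a.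
  move=> fi; apply: (@eval_range_min _ _ iota _ (affine_coord f i) _ algebraic_ring) => [c'|j] /=.
    exact: algebraic_id.
  exact: alg.
have chart_inv i a : f i != 0 -> chart iota f i a -> a != 0 -> chart iota f i a^-1.
  move=> fi Aa a0; apply: (@algebraic_inv_in _ _ iota) => //.
  - exact: eval_range_ring.
  - exact: eval_range_const.
  - exact: chart_alg Aa.
have point_chart x : points iota f x -> exists2 i, f i != 0 & x = chart iota f i.
  move=> [i [fi [q [[qA [q0 q1] _ qM _] ->]]]]; exists i => //.
  have sA : subring (chart iota f i) by exact: eval_range_ring.
  have qz a : q a -> a = 0.
    move=> qa; apply/eqP; apply: contrapT => /negP a0; apply: (q1).
    by rewrite -(mulVf a0); apply: qM => //; apply: chart_inv => //; exact: qA.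
  apply/seteqP; split=> [_ [a [b [Aa Ab nb ->]]]|a Aa].
    apply: (subringM sA) => //; apply: chart_inv => //.
    by apply/eqP => b0; apply: nb; rewrite b0.
  exists a, 1; split=> //; [exact: subring1 sA | by rewrite divr1].
have [sub nsub] := hlt ord0 (lift ord0 ord0) isT; apply: nsub.
have [i fi xE] := point_chart _ (hc ord0).
have [j fj ->] := point_chart _ (hc (lift ord0 ord0)).
rewrite xE; have sA : subring (chart iota f i) by exact: eval_range_ring.
have v l : chart iota f i (f l / f i) by exact: (eval_range_var iota (affine_coord f i)).
apply: eval_range_min => // [c'|l]; first exact: eval_range_const.
have -> : affine_coord f j l = (f l / f i) * (f j / f i)^-1.
  by rewrite /affine_coord invf_div mulrA divfK.
by apply: (subringM sA) => //; apply: chart_inv => //; rewrite mulf_neq0 ?invr_eq0.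
Qed.

End ImageDimension.

Section Iitaka.
Variables (k : fieldType) (X : proj_variety k).
Hypothesis X_normal : normal_variety X.
Local Notation iota := (constants X).
Local Notation s := (@Defs.coord _ X).

Lemma algebraic_of_all_divisors f : (forall P, prime_divisor P -> P f) -> algebraicOver iota f.
Proof.
move=> hf; apply: (@algebraic_of_all_charts _ _ iota _ s) => [|i si].
  exact: coord_neq0.
exact: in_all_divisors_chart hf.
Qed.

Lemma basis_section (E : set X -> int) N (f : 'I_N.+1 -> X) j :
  is_basis_H0 E f -> global_sections E (f j).
Proof.
move=> [h _]; apply/h; exists (fun l => (l == j)%:R); rewrite (bigD1 j) //= eqxx rmorph1 mul1r.
by rewrite big1 ?addr0 // => l /negbTE ->; rewrite rmorph0 mul0r.
Qed.

Lemma iitaka_no_sections (D : set X -> int) d psi m : (0 < d)%N ->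
    iitaka_dim_is D (Some d) -> (0 < m)%N ->
    (forall P t, prime_divisor P -> dvr P t ->
       nonunits P = [set g | exists2 a, P a & g = t * a] -> val_ge P t (D P *+ m) psi) ->
  psi = 0.
Proof.
move=> d0 [[m0 [m00 [N [f [bf [ch _]]]]]] _] mpos hpsi; apply/eqP/negPn/negP => psi0.
have [i [j [fi nalg]]] := dim_pos_transcendental d0 ch.
(* Along [P] the bounds m m0 D_P for psi^m0 and -m m0 D_P for f_l^m cancel. *)
have alg l : algebraicOver iota (psi ^+ m0 * f l ^+ m).
  apply: algebraic_of_all_divisors => P dP.
  have [t [dO mE]] := prime_divisor_dvr X_normal dP.
  have h1 := hpsi P t dP dO mE.
  have h2 : val_ge P t (- (D P *+ m0)) (f l).
    have [->|] := basis_section l bf; first by rewrite /val_ge /= mul0r; exact: subring0 (dvr_ring dO).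
    move=> /(_ P dP.1 dP)[n [fn hn]]; apply: (ord_val_ge dO mE fn).
    by rewrite lerNl -subr_ge0 opprK addrC.
  have := val_geM dO (val_geX dO m0 h1) (val_geX dO m h2).
  rewrite -!mulrnA mulNrn -mulrnA mulnC subrr.
  by rewrite /val_ge /= oppr0 expr0z mulr1.
apply: nalg; apply: (algebraic_root_exp mpos).
have -> : (f j / f i) ^+ m = (psi ^+ m0 * f j ^+ m) / (psi ^+ m0 * f i ^+ m).
  by rewrite expr_div_n; have := expf_neq0 m fi; have := expf_neq0 m0 psi0; move: (psi ^+ m0) (f i ^+ m) => a b a0 b0; field; rewrite a0 b0.
exact: algebraic_div.
Qed.

End Iitaka.

(** * Open sets and the Frobenius splitting *)

Lemma loc_denominator (K : fieldType) (A q : set K) (fs : seq K) : subring A -> prime_ideal A q ->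
    (forall f, f \in fs -> localization A q f) ->
  exists h, [/\ A h, ~ q h & forall f, f \in fs -> A (h * f)].
Proof.
move=> sA pq; elim: fs => [_|f fs IH hfs].
  by exists 1; split=> //; [exact: subring1 | exact: prime1 pq].
have [|h [Ah nh hh]] := IH; first by move=> g gs; apply: hfs; rewrite inE gs orbT.
have [a [b [Aa Ab nb fE]]] := hfs f (mem_head _ _).
exists (h * b); split; [exact: subringM | exact: (notin_primeM pq) |].
move=> g; rewrite inE => /orP[/eqP->|gs].
  by rewrite fE -mulrA [b * _]mulrC divfK ?(notin_prime0 pq nb) //; exact: subringM.
by rewrite mulrAC; apply: (subringM sA) => //; exact: hh.
Qed.

Section Opens.
Variables (k : fieldType) (X : proj_variety k).
Local Notation s := (@Defs.coord _ X).
Local Notation A := (chart (constants X) s).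
Implicit Types (x y P : set X) (V W : set (set X)).

Lemma opnI V W : opn V -> opn W -> opn (V `&` W).
Proof.
move=> [Vp hV] [Wp hW]; split; first by move=> x [/Vp].
move=> i si; have [I IA hI] := hV i si; have [J JA hJ] := hW i si.
exists [set f | exists a b, [/\ I a, J b & f = a * b]].
  move=> _ [a [b [Ia Jb ->]]]; have sA := @chart_ring _ X i; apply: (subringM sA); [exact: IA | exact: JA].
move=> q pq; rewrite /setI /= (hI q pq) (hJ q pq); split.
  move=> [nI nJ] sub; apply: nI => a Ia; apply: contrapT => nqa; apply: nJ => b Jb.
  by have [||] := primeP pq (IA _ Ia) (JA _ Jb); first by apply: sub; exists a, b.
move=> nIJ; split=> sub; apply: nIJ => _ [a [b [Ia Jb ->]]].
  by rewrite mulrC; apply: (primeM pq); [exact: JA | exact: sub].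
by apply: (primeM pq); [exact: IA | exact: sub].
Qed.

Lemma opn_generic V : opn V -> V !=set0 -> V [set: X].
Proof.
move=> [Vp hV] [x Vx]; have [i [q [si pq xE]]] := (ptP x).1 (Vp _ Vx).
have [I IA hI] := hV i si.
have p0 : prime_ideal (A i) (A i `&` nonunits [set: X]).
  by apply: nonunits_prime => //; exact: pt_generic.
rewrite (pt_in_chart si (pt_generic X) (@subsetT _ _)); apply/(hI _ p0) => sub.
rewrite xE in Vx; move/(hI _ pq): Vx; apply => a Ia.
by have [_ [_ [->|//]]] := sub a Ia; exact: prime0 pq.
Qed.

Lemma opn_basic i h : s i != 0 -> A i h ->
  opn [set x | [/\ pt x, A i `<=` x & ~ nonunits x h]].
Proof.
move=> si Ah; split; first by move=> x [].
move=> j sj; set r := s i / s j.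
have r0 : r != 0 by rewrite mulf_neq0 // invr_eq0.
have sA := chart_ring j; have Ar : A j r by exact: chart_var.
have [N hN] := chart_homog sj si Ah.
(* r^N clears the denominators of [h] on chart [j]; the additional factor [r] confines the set to
   chart [i]. *)
exists [set h * r ^+ N.+1]; first by move=> _ ->; exact: hN.
move=> q pq /=; set x := localization _ _.
have px : pt x by exact: loc_pt.
have Ax : A j `<=` x by exact: loc_sub.
have lx := pt_local px; have sx := pt_ring px.
have nE a : A j a -> (q a <-> nonunits x a) by move=> Aa; apply: loc_primeE.
split=> [[_ Aix nh] /(_ _ erefl)|nq].
  rewrite nE; last exact: hN.
  move=> nn; apply: nh; rewrite -[h](mulfK (expf_neq0 N.+1 r0)) mulrC; apply: (lpM lx) => //.
  rewrite -exprVn; apply: (@subringX _ _ sx); rewrite /r invf_div; apply: Aix; exact: chart_var.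
have nqr : ~ q r.
  by move=> qr; apply: nq => _ ->; rewrite exprSr mulrA; apply: (primeM pq) => //; exact: hN.
have xrV : x r^-1 by exact: loc_inv.
split=> //.
  apply: eval_range_min => // [c|l]; first by apply: Ax; exact: chart_const.
  have -> : affine_coord s i l = (s l / s j) * r^-1.
    by rewrite /affine_coord /r invf_div mulrA divfK.
  by apply: (subringM sx) => //; apply: Ax; exact: chart_var.
move=> nh; apply: nq => _ ->; apply/nE; first exact: hN.
by rewrite mulrC; apply: (lpM lx) => //; apply: (@subringX _ _ sx); exact: Ax.
Qed.

Lemma local_open x (fs : seq X) : pt x -> (forall f, f \in fs -> x f) ->
  exists V, [/\ opn V, V x & forall y f, V y -> f \in fs -> y f].
Proof.
move=> px hfs; have [i [q [si pq xE]]] := (ptP x).1 px.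
have sA := chart_ring i.
have [|h [Ah nh hh]] := @loc_denominator _ (A i) q fs sA pq; first by move=> f /hfs; rewrite xE.
exists [set x | [/\ pt x, A i `<=` x & ~ nonunits x h]]; split; first exact: opn_basic.
  split=> //; rewrite xE; first exact: loc_sub.
  by move/(loc_primeE sA pq Ah).
move=> y f [py Ay nhy] ff.
have hy := lp_unit (pt_local py) (Ay _ Ah) nhy; have h0 := notin_prime0 pq nh.
rewrite -[f](mulKf h0); apply: (subringM (pt_ring py)) => //; apply: Ay; exact: hh.
Qed.

(** Besides [fs], the functions made regular on [V] are c / t for generators c of the ideal of [x]
    in a chart, so that [t] generates this ideal at all points of [V], and the affine coordinates,
    so that [V] lies in the chart. *)
Lemma local_open_equation x (fs : seq X) t : pt x -> (forall f, f \in fs -> x f) ->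
    nonunits x = [set g | exists2 a, x a & g = t * a] ->
  exists V, [/\ opn V, V x, forall y f, V y -> f \in fs -> y f,
    forall y, V y -> y t /\ (nonunits y t -> y `<=` x)
    & forall y g, V y -> y g -> nonunits x g -> y (g / t)].
Proof.
move=> px hfs tE; have [i [si Ax]] := pt_chart px; have lx := pt_local px.
have [cs [csI csP]] := chart_noetherian (prime_ideal_ideal (nonunits_prime px Ax)).
have xt : x t.
  apply: (lp_sub lx); rewrite tE; exists 1; rewrite ?mulr1 //; exact: subring1 (pt_ring px).
pose gs := [seq s l / s i | l <- enum 'I_(@ambient_dim _ X).+1] ++
  [seq c / t | c <- cs].
have [|V [oV Vx hV]] := @local_open x (t :: gs ++ fs) px.
  move=> f; rewrite inE !mem_cat => /orP[/eqP->//|/orP[/orP[]|//]]; last by exact: hfs.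
    by move=> /mapP[l _ ->]; apply: Ax; exact: chart_var.
  move=> /mapP[c /csI[_ +] ->].
  rewrite tE => -[a xa ->]; have [->|t0] := eqVneq t 0.
    by rewrite !mul0r; exact: subring0 (pt_ring px).
  by rewrite mulrAC mulfV // mul1r.
have VA y : V y -> A i `<=` y.
  move=> Vy; have py := (proj1 oV) _ Vy.
  apply: eval_range_min => [||l]; first exact: pt_ring.
    by move=> c; exact: pt_const.
  apply: hV => //; rewrite inE !mem_cat; apply/orP; right; apply/orP; left; apply/orP; left.
  by apply/mapP; exists l; rewrite ?mem_enum.
have Vc y c : V y -> c \in cs -> y (c / t).
  by move=> Vy cc; apply: hV => //; rewrite inE !mem_cat (map_f (fun c => c / t) cc) !orbT.
exists V; split=> // [y f Vy ff|y Vy|y g Vy yg xg].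
- by apply: hV => //; rewrite inE mem_cat ff !orbT.
- have py := (proj1 oV) _ Vy; have ly := pt_local py; have Ay := VA y Vy.
  split=> [|nt]; first by apply: hV => //; rewrite mem_head.
  have sub : A i `&` nonunits x `<=` nonunits y.
    have iY := prime_ideal_ideal (nonunits_prime py Ay).
    move=> a /csP /(gen_by_sub iY) [|_ //] c cc; have [Ac nc] := csI c cc; split=> //.
    have [t0|t0] := eqVneq t 0; first by move: nc; rewrite tE t0 => -[b _ ->]; rewrite mul0r; exact: lp0 ly.
    by rewrite -[c](divfK t0); apply: (lpM ly) => //; exact: Vc.
  rewrite (pt_in_chart si py Ay) (pt_in_chart si px Ax).
  move=> _ [a [b [Aa Ab nb ->]]]; exists a, b; split=> // -[_ nxb]; apply: nb; split=> //.
  by apply: sub.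
- have py := (proj1 oV) _ Vy; have ly := pt_local py; have sy := pt_ring py; have Ay := VA y Vy.
  have := yg; rewrite {1}(pt_in_chart si py Ay) => -[a [b [Aa Ab nb gE]]].
  have b0 := notin_prime0 (nonunits_prime py Ay) nb.
  have yb : y b^-1 by apply: (lp_unit ly); [exact: Ay | move=> h; apply: nb].
  have : (A i `&` nonunits x) a.
    by split=> //; rewrite -[a](divfK b0) -gE mulrC; apply: (lpM lx) => //; exact: Ax.
  move/csP/gen_by_sum => [r [Ar aE]].
  rewrite gE mulrAC aE mulr_suml; apply: (subringM sy) => //; apply: (subring_sum sy) => l _.
  by rewrite -mulrA; apply: (subringM sy); [exact/Ay/Ar | apply: Vc => //; exact: mem_nth].
Qed.

End Opens.

Section Splitting.
Variables (k : fieldType) (X : proj_variety k).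
Hypothesis X_normal : normal_variety X.
Implicit Types (x y P : set X) (V W : set (set X)).

Lemma regular_divisorial V (E : set X -> int) f : (forall P, 0 <= E P) ->
  regular_functions V f -> divisorial_sections V E f.
Proof.
move=> E0 Vf; have [->|f0] := eqVneq f 0; [by left | right] => P VP dP.
have [t [dO mE]] := prime_divisor_dvr X_normal dP.
have [|m [om m0]] := @val_ge_ord _ X P t f 0 dO mE f0; first by rewrite /val_ge /= oppr0 expr0z mulr1; exact: Vf.
by exists m; split=> //; exact: addr_ge0.
Qed.

(** [Phi f] is the value of the splitting on some open set [U f] where [f] is regular. Any two
    nonempty open sets meet in the generic point, so restriction shows independence of the choice
    and transfers the algebraic rules. *)
Lemma frobenius_trace_generic q (E : set X -> int) (phi : set (set X) -> X -> X) :
    (forall P, 0 <= E P) ->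
    (forall V, opn V -> V !=set0 ->
     [/\ forall f, divisorial_sections V E f -> regular_functions V (phi V f),
      forall f g, divisorial_sections V E f -> divisorial_sections V E g ->
        phi V (f + g) = phi V f + phi V g,
      forall a f, regular_functions V a -> divisorial_sections V E f ->
        phi V (a ^+ q * f) = a * phi V f,
      forall W f, opn W -> W !=set0 -> W `<=` V ->
        divisorial_sections V E f -> phi W f = phi V f
    & forall a, regular_functions V a -> phi V (a ^+ q) = a]) ->
  exists Phi : X -> X, [/\ forall f g, Phi (f + g) = Phi f + Phi g,
    forall a f, Phi (a ^+ q * f) = a * Phi f, Phi 1 = 1
  & forall P t f, prime_divisor P -> dvr P t ->
      nonunits P = [set g | exists2 a, P a & g = t * a] ->
      val_ge P t (- E P) f -> P (Phi f)].
Proof.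
move=> E0 hphi.
have gen := pt_generic X.
have /choice[U hU] : forall f : X, exists V, [/\ opn V, V setT & regular_functions V f].
  move=> f; have [|V [oV VT hV]] := local_open (fs := [:: f]) gen; first by [].
  by exists V; split=> // x Vx; apply: hV => //; rewrite mem_head.
have oU f : opn (U f) by case: (hU f).
have UT f : U f setT by case: (hU f).
have Uf f : regular_functions (U f) f by case: (hU f).
have ne V : V setT -> V !=set0 by move=> VT; exists setT.
pose Phi f := phi (U f) f.
have PhiE V f : opn V -> V !=set0 -> divisorial_sections V E f -> phi V f = Phi f.
  move=> oV Vn Vf; have VT := opn_generic oV Vn.
  have oW := opnI oV (oU f); have Wn : V `&` U f !=set0 by exact: ne.
  have [_ _ _ r1 _] := hphi _ oV Vn; have [_ _ _ r2 _] := hphi _ (oU f) (ne _ (UT f)).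
  have WV : V `&` U f `<=` V by move=> x [].
  have WU : V `&` U f `<=` U f by move=> x [].
  by rewrite /Phi -(r1 _ _ oW Wn WV Vf) (r2 _ _ oW Wn WU) //; exact: regular_divisorial.
exists Phi; split.
- move=> f g; pose V := U f `&` U g `&` U (f + g).
  have oV : opn V by do 2?apply: opnI.
  have Vn : V !=set0 by apply: ne.
  have [_ hD _ _ _] := hphi _ oV Vn.
  have Vf : divisorial_sections V E f by apply: regular_divisorial => // x [[/Uf]].
  have Vg : divisorial_sections V E g by apply: regular_divisorial => // x [[_ /Uf]].
  have Vfg : divisorial_sections V E (f + g) by apply: regular_divisorial => // x [_ /Uf].
  by rewrite -!(PhiE V) // hD.
- move=> a f; pose V := U a `&` U f `&` U (a ^+ q * f).
  have oV : opn V by do 2?apply: opnI.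
  have Vn : V !=set0 by apply: ne.
  have [_ _ hM _ _] := hphi _ oV Vn.
  have Va : regular_functions V a by move=> x [[/Uf]].
  have Vf : divisorial_sections V E f by apply: regular_divisorial => // x [[_ /Uf]].
  have Vfg : divisorial_sections V E (a ^+ q * f) by apply: regular_divisorial => // x [_ /Uf].
  by rewrite -!(PhiE V) // hM.
- have [_ _ _ _ h1] := hphi _ (oU 1) (ne _ (UT 1)).
  by rewrite /Phi -{2}(expr1n _ q) h1.
- move=> P t f dP dO mE hf; have pP := dP.1.
  have ff : P (f * t ^ (E P)) by move: hf; rewrite /val_ge /= opprK.
  have [|V [oV VP hV eV _]] := local_open_equation (fs := [:: f * t ^ (E P)]) pP _ mE.
    by move=> g; rewrite inE => /eqP ->.
  have [hreg _ _ _ _] := hphi _ oV (ex_intro _ P VP).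
  (* On [V] the function [t] vanishes along [P] only: at any other prime divisor of [V] it is a
     unit, and [f] is regular because f t^(E P) is. *)
  have Vf : divisorial_sections V E f.
    have [->|f0] := eqVneq f 0; [by left | right] => Q VQ dQ.
    have [tQ [dOQ mEQ]] := prime_divisor_dvr X_normal dQ.
    have [nt|nnt] := pselect (nonunits Q t).
      have QP := (eV Q VQ).2 nt.
      have [PQ|PT] := divisor_above dQ pP QP; last by case: (divisor_proper dP).
      rewrite -PQ; have [m [om mm]] := val_ge_ord dO mE f0 hf.
      by exists m; split=> //; rewrite -lerBlDr sub0r.
    have lQ := pt_local dQ.1; have Qt := (eV Q VQ).1; have QtV := lp_unit lQ Qt nnt.
    have Qf : Q f.
      have -> : f = (f * t ^ E P) * t^-1 ^ (E P).
        by rewrite -mulrA -expfzMl mulfV ?(dvr_t0 dO) // exp1rz mulr1.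
      apply: (subringM (lp_ring lQ)); first by apply: hV => //; rewrite mem_head.
      have := E0 P; case: (E P) => // n _; exact: (@subringX _ _ (lp_ring lQ)).
    have [|m [om m0]] := @val_ge_ord _ X Q tQ f 0 dOQ mEQ f0; first by rewrite /val_ge /= oppr0 expr0z mulr1.
    by exists m; split=> //; exact: addr_ge0.
  by rewrite -(PhiE V) //; [exact: hreg | exists P].
Qed.

(** Precomposing with the p^(e-1)-st power turns a p^e-splitting into one for p. A pole t^(1-p)
    becomes a pole of order (p-1) p^(e-1) <= p^e - 1, which is within E as soon as the coefficient
    of [B] is at least 1. *)
Lemma frobenius_trace p (B : set X -> rat) : p \in [pchar X] -> (forall P, 0 <= B P) ->
    globally_F_split p B ->
  exists phi : X -> X, [/\ forall f g, phi (f + g) = phi f + phi g,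
    forall a f, phi (a ^+ p * f) = a * phi f, phi 1 = 1
  & forall P t f, prime_divisor P -> dvr P t ->
      nonunits P = [set g | exists2 a, P a & g = t * a] -> P f ->
      P (phi (f / (if floor_div B P == 0 then 1 else t) ^+ p.-1))].
Proof.
move=> charX B0 [e [e0 [phi hphi]]].
have p_gt0 : (0 < p)%N by apply: prime_gt0; exact: pcharf_prime charX.
have pe0 n : 0 <= (p ^ n)%N%:R - 1 :> rat by rewrite subr_ge0 ler1n expn_gt0 p_gt0.
set E := floor_div _ in hphi.
have E0 P : 0 <= E P by rewrite /E /floor_div floor_ge0 mulr_ge0.
have [Phi [PhiD PhiM Phi1 PhiP]] := frobenius_trace_generic E0 hphi.
exists (fun f => Phi (f ^+ (p ^ e.-1))); split.
- move=> f g; rewrite -PhiD; congr Phi.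
  elim: (e.-1) => // n IH; by rewrite expnSr !exprM IH (frobD charX).
- by move=> a f; rewrite exprMn -exprM -expnS prednK.
- by rewrite expr1n.
- move=> P t f dP dO mE Pf; apply: (PhiP P t) => //.
  have PfX : P (f ^+ (p ^ e.-1)) by exact: (@subringX _ _ (dvr_ring dO)).
  have t0 := dvr_t0 dO.
  case: ifPn => [_|Bn].
    rewrite expr1n divr1 /val_ge /= opprK; apply: (subringM (dvr_ring dO)) => //.
    have := E0 P; case: (E P) => // n _; apply: (@subringX _ _ (dvr_ring dO)); exact: dvr_t dO.
  have B1 : 1 <= B P.
    by move: Bn; rewrite /floor_div floor_neq0 ltNge B0.
  have EB : (p ^ e).-1%:Z <= E P.
    rewrite /E /floor_div floor_ge_int -pmulrn -subn1 natrB ?expn_gt0 ?p_gt0 //.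
    exact: ler_peMr.
  rewrite expr_div_n -exprM /val_ge /= opprK -mulrA; apply: (subringM (dvr_ring dO)) => //.
  have le : (p.-1 * p ^ e.-1 <= (p ^ e).-1)%N.
    have N0 : (0 < p ^ e.-1)%N by rewrite expn_gt0 p_gt0.
    by rewrite -ltnS prednK ?expn_gt0 ?p_gt0 // -{2}(prednK e0) expnS ltn_pmul2r // prednK.
  have : ((p.-1 * p ^ e.-1)%N%:Z <= E P) by apply: le_trans EB; rewrite lez_nat.
  case: (E P) => // n; rewrite lez_nat => ln.
  rewrite -[t ^ n]/(t ^+ n) -(subnKC ln) exprD mulKf ?expf_neq0 //.
  apply: (@subringX _ _ (dvr_ring dO)); exact: dvr_t dO.
Qed.

End Splitting.

(** * Noether normalization and the p-degree *)

Lemma mpoly_rmorph_ext (k : fieldType) n (S : nzRingType) (f g : {rmorphism {mpoly k[n]} -> S}) :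
  (forall c, f c%:MP = g c%:MP) -> (forall i, f 'X_i = g 'X_i) -> f =1 g.
Proof.
move=> fgC fgX P; rewrite [P]mpolyE !rmorph_sum; apply: eq_bigr => m _.
rewrite -mul_mpolyC !rmorphM fgC mpolyXE_id !rmorph_prod; congr (_ * _).
by apply: eq_bigr => i _; rewrite !rmorphXn fgX.
Qed.

Lemma digits_inj n e (a b : 'I_n -> nat) : (forall i, (a i < e)%N) -> (forall i, (b i < e)%N) ->
  (\sum_i a i * e ^ i = \sum_i b i * e ^ i)%N -> a =1 b.
Proof.
elim: n a b => [|n IH] a b ha hb; first by move=> _ [].
have split (c : 'I_n.+1 -> nat) : (\sum_i c i * e ^ i = (\sum_(i < n) c (lift ord0 i) * e ^ i) * e + c ord0)%N.
  rewrite big_ord_recl expn0 muln1 addnC big_distrl /=; congr (_ + _)%N.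
  by apply: eq_bigr => i _; rewrite /bump /= add1n expnS [(e * _)%N]mulnC mulnA.
rewrite !split => h.
have e0 : (0 < e)%N by apply: leq_ltn_trans (ha ord0).
have h0 : a ord0 = b ord0.
  by have := congr1 (fun x => x %% e)%N h; rewrite !modnMDl !modn_small.
have hs : (\sum_(i < n) a (lift ord0 i) * e ^ i = \sum_(i < n) b (lift ord0 i) * e ^ i)%N.
  by apply/eqP; rewrite -(eqn_pmul2r e0) -(eqn_add2r (a ord0)) {2}h0 h.
move=> i; have [j ->|->//] := unliftP ord0 i.
exact: (IH (fun j => a (lift ord0 j)) (fun j => b (lift ord0 j))).
Qed.

Section Nagata.
Variables (k K : fieldType) (iota : {rmorphism k -> K}).

Lemma mmap_eval_range m n (y : 'I_m -> K) (z : 'I_n -> K) :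
  (forall i, eval_range iota z (y i)) -> eval_range iota y `<=` eval_range iota z.
Proof.
move=> h; apply: eval_range_min => //; [exact: eval_range_ring | exact: eval_range_const].
Qed.

Let monic_size (R : nzRingType) (P : {poly R}) d := P \is monic /\ size P = d.+1.

Let monic_sizeM (R : nzRingType) (P Q : {poly R}) d e :
  monic_size P d -> monic_size Q e -> monic_size (P * Q) (d + e).
Proof.
move=> [mP sP] [mQ sQ]; split; first by rewrite monicMl.
by rewrite size_monicM ?monic_neq0 // sP sQ addnS.
Qed.

Section Relation.
Variables (n : nat) (y : 'I_n.+1 -> K) (F : {mpoly k[n.+1]}).
Hypotheses (F0 : F != 0) (Fy : mmap iota y F = 0).

Let e := msize F.
Let wt (m : 'X_{1..n.+1}) := (\sum_i m i * e ^ i)%N.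
Let w := y ord0.
Let y' (i : 'I_n) := y (lift ord0 i) - w ^+ (e ^ lift ord0 i).
Let h (i : 'I_n.+1) : {poly {mpoly k[n]}} :=
  if unlift ord0 i is Some j then ('X_j)%:P + 'X^(e ^ i) else 'X.
Let c0 : {rmorphism k -> {poly {mpoly k[n]}}} := polyC \o @mpolyC n k.
(** The relation [F] after Nagata's substitution y_i = y'_i + w^(e^i), read as a polynomial in w
    over the remaining variables; a monomial [m] becomes monic of degree [wt m]. *)
Let G := mmap c0 h F.

Let e_gt0 : (0 < e)%N.
Proof. by rewrite /e lt0n msize_poly_eq0. Qed.

Let h_monic i : monic_size (h i) (e ^ i).
Proof.
rewrite /h; case: unliftP => [j _|->]; last by split; [exact: monicX | rewrite size_polyX].
have lt : (size (('X_j : {mpoly k[n]})%:P)%R < size ('X^(e ^ i) : {poly {mpoly k[n]}})%R)%N.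
  rewrite size_polyXn; apply: leq_ltn_trans (size_polyC_leq1 _) _.
  by rewrite ltnS expn_gt0 e_gt0.
by split; [rewrite monicE lead_coefDr // lead_coefXn | rewrite addrC size_polyDl // size_polyXn].
Qed.

Let mono_monic m : monic_size (mmap1 h m) (wt m).
Proof.
rewrite /mmap1 /wt; elim/big_ind2: _ => [|P d Q d' hP hQ|i _].
- by split; [exact: monic1 | rewrite size_poly1].
- exact: monic_sizeM.
- elim: (m i) => [|l IH]; first by rewrite mul0n expr0; split; [exact: monic1 | rewrite size_poly1].
  by rewrite exprS mulSn; apply: monic_sizeM.
Qed.

Let G_eval : (map_poly (mmap iota y') G).[w] = 0.
Proof.
rewrite -Fy /G [mmap iota y F]/mmap [mmap c0 h F]/mmap rmorph_sum horner_sum; apply: eq_bigr => m _.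
rewrite rmorphM hornerM /= map_polyC hornerC /= mmapC; congr (_ * _).
rewrite /mmap1 rmorph_prod horner_prod; apply: eq_bigr => i _.
rewrite rmorphXn horner_exp; congr (_ ^+ _); rewrite /h.
case: unliftP => [j ->|->] /=; last by rewrite map_polyX hornerX.
rewrite rmorphD /= map_polyC map_polyXn hornerD hornerC hornerXn.
by rewrite /= mmapX mmap1U subrK.
Qed.

(** All exponents in [F] are below [e], so by uniqueness of base-e digits the weights of its
    monomials are distinct. Hence the leading coefficient of [G] is a constant of [k], and [w] is
    integral over the new elements. *)
Lemma nagata : exists y0 : 'I_n -> K, (forall i, eval_range iota y (y0 i)) /\
  forall i, integralOver (mmap iota y0) (y i).
Proof.
exists y'; have sR := eval_range_ring iota y; split.
  move=> i; apply: (subringB sR); first exact: eval_range_var.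
  by apply: (@subringX _ _ sR); exact: eval_range_var.
have w_int : integralOver (mmap iota y') w.
  have [m0 m0F m0max] : exists2 m0, m0 \in msupp F &
      forall m, m \in msupp F -> m != m0 -> (wt m < wt m0)%N.
    have [m0 m0F m0max] : exists2 m0, m0 \in msupp F & forall m, m \in msupp F -> (wt m <= wt m0)%N.
      have : msupp F != [::] by rewrite msupp_eq0.
      elim: (msupp F) => // m s IH _; have [->|/IH[m1 m1s m1max]] := eqVneq s [::].
        by exists m => [|m']; rewrite inE // => /eqP->.
      have [le|lt] := leqP (wt m) (wt m1).
        exists m1; first by rewrite inE m1s orbT.
        by move=> m'; rewrite inE => /orP[/eqP->|/m1max].
      exists m; first exact: mem_head.
      move=> m'; rewrite inE => /orP[/eqP->//|/m1max le]; exact: leq_trans le (ltnW lt).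
    exists m0 => // m mF; apply: contraNT; rewrite -leqNgt => le.
    have bound m' i : m' \in msupp F -> (m' i < e)%N.
      move=> /msize_mdeg_lt; apply: leq_ltn_trans; rewrite mdegE (bigD1 i) //=; exact: leq_addr.
    apply/eqP/mnmP; apply: (digits_inj (e := e)) => [i|i|]; try exact: bound.
    by apply/eqP; rewrite eqn_leq m0max.
  pose c : {mpoly k[n]} := (F@_m0)%:MP; pose ci : {mpoly k[n]} := ((F@_m0)^-1)%:MP.
  have Fm0 : F@_m0 != 0 by rewrite -mcoeff_msupp.
  have cci : ci * c = 1 by rewrite -mpolyCM mulVf.
  have [mm sm] := mono_monic m0.
  have rest : (size (\sum_(m <- msupp F | m != m0) c0 F@_m * mmap1 h m)%R < (wt m0).+1)%N.
    rewrite ltnS big_seq_cond; apply: (leq_trans (size_sum _ _ _)); apply/bigmax_leqP_seq => m mF /andP[_ nm].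
    rewrite mul_polyC; apply: (leq_trans (size_scale_leq _ _)).
    by have [_ ->] := mono_monic m; exact: m0max.
  have GE : G = c *: mmap1 h m0 + \sum_(m <- msupp F | m != m0) c0 F@_m * mmap1 h m.
    by rewrite /G /mmap (bigD1_seq m0) ?msupp_uniq //= mul_polyC.
  exists (ci *: G).
    rewrite GE scalerDr scalerA cci scale1r monicE lead_coefDl; first exact: mm.
    by rewrite sm; apply: leq_ltn_trans rest; exact: size_scale_leq.
  by rewrite /root map_polyZ hornerZ G_eval mulr0.
move=> i; have [j ->|->//] := unliftP ord0 i.
rewrite -[y _](subrK (w ^+ (e ^ lift ord0 j))); apply: integral_add.
  by have := integral_id (mmap iota y') ('X_j : {mpoly k[n]}); rewrite /= mmapX mmap1U.
by elim: (e ^ _)%N => [|l IH]; [exact: integral1 | rewrite exprS; exact: integral_mul].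
Qed.

End Relation.

Lemma noether_normalization n (y : 'I_n -> K) : exists r (z : 'I_r -> K),
  [/\ injective (mmap iota z), forall j, eval_range iota y (z j)
    & forall a, eval_range iota y a -> integralOver (mmap iota z) a].
Proof.
have int_sub m (u : 'I_m -> K) l (z : 'I_l -> K) : (forall i, integralOver (mmap iota z) (u i)) ->
    forall a, eval_range iota u a -> integralOver (mmap iota z) a.
  move=> h; apply: (@eval_range_min _ _ iota _ u [set a | integralOver (mmap iota z) a]) => //=.
    by split; [exact: integral1 | exact: integral_sub | exact: integral_mul].
  by move=> c; have := integral_id (mmap iota z) c%:MP; rewrite /= mmapC.
have injP m (u : 'I_m -> K) : (forall F, mmap iota u F = 0 -> F = 0) -> injective (mmap iota u).
  by move=> h P Q PQ; apply/eqP; rewrite -subr_eq0; apply/eqP/h; rewrite rmorphB /= PQ subrr.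
elim: n y => [|n IH] y.
  exists 0%N, y; split=> [|j|a]; [|exact: eval_range_var|by apply: int_sub => -[]].
  apply: injP => F; rewrite (nvar0_mpolyC F) mmapC => /eqP; rewrite fmorph_eq0 => /eqP ->; exact: mpolyC0.
have [inj|] := pselect (forall F, mmap iota y F = 0 -> F = 0).
  exists n.+1, y; split; [exact: injP | exact: eval_range_var | apply: int_sub => i].
  by have := integral_id (mmap iota y) 'X_i; rewrite /= mmapX mmap1U.
move=> /existsNP[F /not_implyP[Fy /eqP F0]].
have [y0 [y0y yint]] := nagata F0 Fy.
have [r [z [inj zy zint]]] := IH y0; exists r, z; split=> //.
  by move=> j; apply: mmap_eval_range (zy j).
apply: int_sub => i; have [P Pm rP] := yint i.
apply: (integral_root_monic _ rP); first exact: monic_map.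
apply/integral_poly => j; rewrite coef_map; apply: zint.
by exists P`_j.
Qed.

End Nagata.

Section DropVariable.
Variables (k K : fieldType) (iota : {rmorphism k -> K}).
Variables (r : nat) (z : 'I_r.+1 -> K).
Hypothesis z_inj : injective (mmap iota z).
Let z' i := z (lift ord0 i).
Local Notation R := (eval_range iota z).
Local Notation R' := (eval_range iota z').

Let emb : {rmorphism {mpoly k[r]} -> {mpoly k[r.+1]}} :=
  mmap (@mpolyC r.+1 k) (fun i => 'X_(lift ord0 i)).
Let ev : {rmorphism {mpoly k[r.+1]} -> {mpoly k[r]}} :=
  mmap (@mpolyC r k) (fun i => if unlift ord0 i is Some j then 'X_j else 0).

Let ev_emb Q : ev (emb Q) = Q.
Proof.
apply: (@mpoly_rmorph_ext _ _ _ (ev \o emb) idfun) => [c|i] /=.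
  by rewrite /emb /ev /= !mmapC.
by rewrite /emb /ev /= mmapX mmap1U mmapX mmap1U liftK.
Qed.

Let mmap_emb Q : mmap iota z (emb Q) = mmap iota z' Q.
Proof.
apply: (@mpoly_rmorph_ext _ _ _ (mmap iota z \o emb) (mmap iota z')) => [c|i] /=.
  by rewrite /emb /= !mmapC.
by rewrite /emb /= mmapX mmap1U mmapX mmap1U mmapX mmap1U.
Qed.

Lemma drop_inj : injective (mmap iota z').
Proof.
by move=> P Q; rewrite -!mmap_emb => /z_inj /(congr1 ev); rewrite !ev_emb.
Qed.

Lemma drop_sub : R' `<=` R.
Proof. by apply: mmap_eval_range => i; exact: eval_range_var. Qed.

Lemma drop_split f : R f -> exists c g, [/\ R' c, R g & f = c + z ord0 * g].
Proof.
have sR := eval_range_ring iota z; have sR' := eval_range_ring iota z'.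
have R0 : R 0 by exact: subring0.
apply: (@eval_range_min _ _ iota _ z [set f | exists c g, [/\ R' c, R g & f = c + z ord0 * g]]).
- split.
  + by exists 1, 0; split; [exact: subring1 | by [] | ring].
  + move=> _ _ [c [g [Rc Rg ->]]] [c' [g' [Rc' Rg' ->]]].
    by exists (c - c'), (g - g'); split; [exact: subringB | exact: subringB | ring].
  + move=> _ _ [c [g [Rc Rg ->]]] [c' [g' [Rc' Rg' ->]]].
    exists (c * c'), (c * g' + g * c' + g * (z ord0 * g')); split; [exact: subringM | | ring].
    have sc : R c by exact: drop_sub. have sc' : R c' by exact: drop_sub.
    have sz : R (z ord0) by exact: eval_range_var.
    by do 2?apply: (subringD sR); do ?apply: (subringM sR).
- by move=> c; exists (iota c), 0; split; [exact: eval_range_const | by [] | ring].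
- move=> i; have [j ->|->] := unliftP ord0 i.
    by exists (z' j), 0; split; [exact: eval_range_var | by [] | rewrite mulr0 addr0].
  by exists 0, 1; split; [exact: subring0 | exact: subring1 | ring].
Qed.

Lemma drop_indep c g : R' c -> R g -> c = z ord0 * g -> c = 0.
Proof.
move=> [P ->] [Q ->]; rewrite -mmap_emb.
have -> : z ord0 = mmap iota z 'X_ord0 by rewrite mmapX mmap1U.
rewrite -rmorphM => /z_inj /(congr1 ev); rewrite ev_emb rmorphM => ->.
by rewrite /ev /= mmapX mmap1U unlift_none mul0r raddf0 rmorph0.
Qed.

Lemma drop_neq0 : z ord0 != 0.
Proof.
apply/eqP => z0; have : mmap iota z 'X_ord0 = mmap iota z 0 by rewrite mmapX mmap1U z0 rmorph0.
by move/z_inj => /eqP; rewrite -msupp_eq0 msuppX.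
Qed.

End DropVariable.

(** * Chains of primes and the number of variables in a normalization *)

Section LyingOver.
Variables (K : fieldType) (A R R' q : set K) (x : K).
Hypotheses (sA : subring A) (nA : noetherian A) (pq : prime_ideal A q).
Hypotheses (sR : subring R) (RA : R `<=` A) (sR' : subring R') (R'R : R' `<=` R) (Rx : R x).
Hypothesis split : forall f, R f -> exists c g, [/\ R' c, R g & f = c + x * g].
Hypothesis indep : forall c g, R' c -> R g -> c = x * g -> c = 0.
Hypothesis qR : forall c, R c -> q c -> c = 0.
Hypothesis int : forall a, A a -> exists P : {poly K}, [/\ P \is monic, forall j, R P`_j & q P.[a]].

Let iq := prime_ideal_ideal pq.

(** q' is maximal among the ideals containing [q] and [x] and meeting R' only in 0. It lies over the
    prime x R, since R is the sum of R' and x R by [split], and this sum is direct by [indep]. *)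
Theorem lying_over : exists q', [/\ prime_ideal A q', q `<=` q', q' x,
    forall c, R' c -> q' c -> c = 0
  & forall a, A a -> exists P : {poly K}, [/\ P \is monic, forall j, R' P`_j & q' P.[a]]].
Proof.
have Ax := RA Rx.
pose F := [set I | [/\ ideal A I, q `<=` I, I x & forall c, R' c -> I c -> c = 0]].
have add I a : ideal A I -> A a -> exists J, [/\ ideal A J, I `<=` J, J a &
    forall f, J f -> exists u v, [/\ I u, A v & f = u + a * v]].
  move=> iI Aa; exists [set f | exists u v, [/\ I u, A v & f = u + a * v]]; split=> //.
  - split.
    + move=> _ [u [v [Iu Av ->]]]; apply: (subringD sA); [exact: id_sub iI _ _ | exact: subringM].
    + by exists 0, 0; split; [exact: id0 iI | exact: subring0 | ring].
    + move=> _ _ [u [v [Iu Av ->]]] [u' [v' [Iu' Av' ->]]].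
      by exists (u + u'), (v + v'); split; [exact: idD iI _ _ _ _ | exact: subringD | ring].
    + move=> b _ Ab [u [v [Iu Av ->]]].
      by exists (b * u), (b * v); split; [exact: idM iI _ _ _ _ | exact: subringM | ring].
  - by move=> u Iu; exists u, 0; split; [by [] | exact: subring0 | ring].
  - by exists 0, 1; split; [exact: id0 iI | exact: subring1 | ring].
(* The ideal q + x A qualifies. For c = b + x a in R', homogenizing a monic equation of [a] modulo
   [q] gives an element of q and R, hence 0; all its terms but c^n are divisible by [x] in R, so c^n
   = 0 by [indep]. *)
have Fne : exists I, F I.
  have [J [iJ qJ Jx Jf]] := add q x iq Ax; exists J; split=> // c R'c /Jf[b [a [qb Aa cE]]].
  have [P [Pm RP qP]] := int Aa; have Rc := R'R R'c; have Ac := RA Rc.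
  have [n sP] : exists n, size P = n.+1.
    by exists (size P).-1; rewrite prednK // lt0n size_poly_eq0 monic_neq0.
  have lead : P`_n = 1 by have := monicP Pm; rewrite /lead_coef sP.
  have qT : q (\sum_(j < n.+1) P`_j * x ^+ (n - j) * c ^+ j).
    have -> : \sum_(j < n.+1) P`_j * x ^+ (n - j) * c ^+ j =
        x ^+ n * P.[a] + \sum_(j < n.+1) P`_j * x ^+ (n - j) * (c ^+ j - (x * a) ^+ j).
      rewrite horner_coef sP mulr_sumr -big_split; apply: eq_bigr => j _ /=.
      have jn : (j <= n)%N by rewrite -ltnS.
      have -> : x ^+ n = x ^+ (n - j) * x ^+ j by rewrite -exprD subnK.
      rewrite exprMn; ring.
    have AX u m : A u -> A (u ^+ m) by exact: (@subringX _ _ sA).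
    apply: (idD iq); first by apply: (idM iq) => //; exact: AX.
    apply: (id_sum _ iq) => j _; rewrite subrXX cE addrK mulrA.
    rewrite [_ * b]mulrC -mulrA mulrC.
    apply: (idM iq) => //; apply: (subringM sA).
      by apply: (subringM sA); [exact: RA | exact: AX].
    apply: (subring_sum sA) => l _; apply: (subringM sA); apply: AX; first by rewrite -cE.
    exact: subringM.
  have Rx' m : R (x ^+ m) by exact: (@subringX _ _ sR).
  have Rc' m : R (c ^+ m) by exact: (@subringX _ _ sR).
  have RT : R (\sum_(j < n.+1) P`_j * x ^+ (n - j) * c ^+ j).
    by apply: (subring_sum sR) => j _; do 2?apply: (subringM sR).
  have := qR RT qT; rewrite big_ord_recr /= lead subnn expr0 !mul1r addrC => /eqP.
  rewrite addr_eq0 => /eqP cn.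
  have : c ^+ n = 0.
    apply: (indep (g := - \sum_(j < n) P`_j * x ^+ (n - j).-1 * c ^+ j)).
    - exact: (@subringX _ _ sR').
    - by apply: (subringN sR); apply: (subring_sum sR) => j _; do 2?apply: (subringM sR).
    - rewrite cn mulrN mulr_sumr; congr (- _); apply: eq_bigr => j _.
      have : (0 < n - j)%N by rewrite subn_gt0.
      by case: (n - j)%N => // m _; rewrite exprS /=; ring.
  by move/eqP; rewrite expf_eq0 => /andP[_ /eqP].
have [||q' [[iq' qq' q'x q'R'] q'max]] := @noetherian_max _ _ F nA.
- by move=> I [].
- exact: Fne.
(* By maximality q' + a A contains a nonzero element of R'. Multiplying two such elements shows that
   q' is prime. *)
have big a : A a -> ~ q' a -> exists c u v, [/\ R' c, c != 0, q' u, A v & c = u + a * v].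
  move=> Aa nqa; have [J [iJ qJ Ja Jf]] := add q' a iq' Aa; apply: contrapT => h.
  apply: nqa; apply: (q'max J) => //; split=> //.
  - exact: subset_trans qJ.
  - exact: qJ.
  - move=> c R'c /Jf[u [v [q'u Av cE]]]; apply/eqP/negPn/negP => c0; apply: h.
    by exists c, u, v.
exists q'; split=> //.
- split.
  + exact: id_sub iq'.
  + split; first exact: id0 iq'.
    by move=> /(q'R' _ (subring1 sR')) /eqP; rewrite oner_eq0.
  + exact: idD iq'.
  + exact: idM iq'.
  + move=> a b Aa Ab q'ab; apply: contrapT => /not_orP[nqa nqb].
    have [c [u [v [R'c c0 q'u Av cE]]]] := big a Aa nqa.
    have [d [u' [v' [R'd d0 q'u' Av' dE]]]] := big b Ab nqb.
    have : c * d = 0.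
      apply: q'R'; first exact: subringM.
      have -> : c * d = (u' + b * v') * u + (a * v) * u' + (v * v') * (a * b) by rewrite cE dE; ring.
      apply: (idD iq'); first apply: (idD iq'); apply: (idM iq') => //; try exact: subringM.
      by apply: (subringD sA); [exact: id_sub iq' _ _ | exact: subringM].
    by move/eqP; rewrite mulf_eq0 (negbTE c0) (negbTE d0).
- move=> a Aa; have [P [Pm RP qP]] := int Aa.
  (* Replacing the coefficients by their parts in R' changes the value at [a] by an element of x A,
     inside q'. *)
  have /choice[c hc] : forall j, exists c, R' c /\ exists2 g, R g & P`_j = c + x * g.
    by move=> j; have [c [g [R'c Rg ->]]] := split (RP j); exists c; split=> //; exists g.
  have [n sP] : exists n, size P = n.+1.
    by exists (size P).-1; rewrite prednK // lt0n size_poly_eq0 monic_neq0.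
  have lead : P`_n = 1 by have := monicP Pm; rewrite /lead_coef sP.
  have lt : (size (\poly_(j < n) c j)%R < size ('X^n : {poly K})%R)%N.
    by rewrite size_polyXn ltnS size_poly.
  exists ('X^n + \poly_(j < n) c j); split.
  + by rewrite monicE lead_coefDl // lead_coefXn.
  + move=> j; rewrite coefD coefXn coef_poly; apply: (subringD sR').
      by case: eqP => _; [exact: subring1 | exact: subring0].
    by case: ifP => _; [case: (hc j) | exact: subring0].
  + have -> : ('X^n + \poly_(j < n) c j).[a] = P.[a] + (-1) * \sum_(j < n) (P`_j - c j) * a ^+ j.
      rewrite hornerD hornerXn horner_poly horner_coef sP big_ord_recr /= lead mul1r.
      under [X in _ + -1 * X]eq_bigr do rewrite mulrBl.
      rewrite big_split sumrN /=; ring.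
    apply: (idD iq'); first exact: qq'.
    apply: (idM iq'); first by apply: (subringN sA); exact: subring1.
    apply: (id_sum _ iq') => j _; have [_ [g Rg ->]] := hc j.
    rewrite addrAC subrr add0r -mulrA mulrC; apply: (idM iq') => //.
    by apply: (subringM sA); [exact: RA | exact: (@subringX _ _ sA)].
Qed.

End LyingOver.

Lemma loc_proper (K : fieldType) (A q q' : set K) x : subring A -> prime_ideal A q ->
  prime_ideal A q' -> q `<=` q' -> q' x -> ~ q x -> localization A q' `<` localization A q.
Proof.
move=> sA pq pq' qq' q'x nqx; have Ax := prime_sub pq' q'x; split.
  by move=> _ [a [b [Aa Ab nb ->]]]; exists a, b; split=> // /qq'.
move=> sub; have [_ [x0|]] : nonunits (localization A q') x by exact/(loc_primeE sA pq' Ax).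
  by apply: nqx; rewrite x0; exact: prime0 pq.
by apply; apply: sub; exact: (loc_inv sA Ax nqx).
Qed.

(** Once powers of X are divided out of an equation of [a], its constant term is a nonzero multiple
    of [a]. *)
Lemma norm_multiple (K : fieldType) (A R : set K) a (P : {poly K}) : subring A -> R `<=` A ->
    A a -> a != 0 -> P != 0 -> (forall j, R P`_j) -> P.[a] = 0 ->
  exists c h, [/\ R c, c != 0, A h & c = a * h].
Proof.
move=> sA RA Aa a0; move: {2}(size P) (leqnn (size P)) => n.
elim: n P => [|n IH] P sP P0 RP Pa.
  by move: sP; rewrite leqn0 size_poly_eq0 (negbTE P0).
have [p0|p0] := eqVneq P`_0 0; last first.
  exists P`_0, (- \sum_(j < (size P).-1) P`_j.+1 * a ^+ j); split=> //.
    by apply: (subringN sA); apply: (subring_sum sA) => j _; apply: (subringM sA); [exact: RA | exact: (@subringX _ _ sA)].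
  move: Pa; have s0 : (0 < size P)%N by rewrite size_poly_gt0.
  rewrite (@horner_coef_wide _ (size P).-1.+1); last by rewrite prednK.
  rewrite big_ord_recl /= expr0 mulr1 => /eqP.
  rewrite addr_eq0 => /eqP ->; rewrite mulrN mulr_sumr; congr (- _).
  by apply: eq_bigr => j _; rewrite /bump /= add1n exprS; ring.
have PE : P = (\poly_(j < (size P).-1) P`_j.+1) * 'X.
  apply/polyP => -[|j]; rewrite coefMX //= coef_poly; case: ltnP => // h.
  by rewrite nth_default //; move: h; case: (size P).
set Q := \poly_(_ < _) _ in PE.
have Q0 : Q != 0 by apply: contraNneq P0 => Q0; rewrite PE Q0 mul0r.
apply: (IH Q) => //.
- by rewrite -ltnS; apply: leq_trans sP; rewrite PE size_mulX.
- move=> j; rewrite /Q coef_poly; case: ifP => _ //.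
  by rewrite -p0; exact: RP.
- by move: Pa; rewrite PE hornerM hornerX => /eqP; rewrite mulf_eq0 (negbTE a0) orbF => /eqP.
Qed.

Section Primes.
Variables (k K : fieldType) (iota : {rmorphism k -> K}) (A : set K).
Hypotheses (sA : subring A) (nA : noetherian A).

Definition integral_mod (q : set K) n (z : 'I_n -> K) : Prop :=
  forall a, A a -> exists P : {poly K},
    [/\ P \is monic, forall j, eval_range iota z P`_j & q P.[a]].

Lemma lying_over_drop r (z : 'I_r.+1 -> K) q : injective (mmap iota z) ->
    eval_range iota z `<=` A -> prime_ideal A q ->
    (forall c, eval_range iota z c -> q c -> c = 0) -> integral_mod q z ->
  let z' := fun i => z (lift ord0 i) in
  exists q', [/\ prime_ideal A q', q `<=` q', ~ q (z ord0) /\ q' (z ord0),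
    forall c, eval_range iota z' c -> q' c -> c = 0 & integral_mod q' z'].
Proof.
move=> inj zA pq qz int z'.
have Rz : eval_range iota z (z ord0) by exact: eval_range_var.
have [|||||q' [pq' qq' q'z q'R' int']] := @lying_over _ A _ (eval_range iota z') q (z ord0) sA nA pq
    (eval_range_ring _ _) zA (eval_range_ring _ _) _ Rz.
- exact: drop_sub.
- by move=> f; exact: drop_split.
- by move=> c g; exact: drop_indep.
- by [].
- exact: int.
exists q'; split=> //; split=> // /(qz _ Rz) z0.
by have := drop_neq0 inj; rewrite z0 eqxx.
Qed.

Lemma integral_mod0 n (z : 'I_n -> K) q : q 0 ->
  (forall a, A a -> integralOver (mmap iota z) a) -> integral_mod q z.
Proof.
move=> q0 int a /int[P Pm /rootP rP]; exists (map_poly (mmap iota z) P); split.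
- exact: monic_map.
- by move=> j; rewrite coef_map; exists P`_j.
- by rewrite rP.
Qed.

(** With at most one variable, a nonzero element of [q] makes A / q algebraic over [k], hence a
    field. So for [b] in q' outside [q] there is [B] with b B - 1 in [q], and 1 would lie in q'. *)
Lemma small_residue_field r (z : 'I_r -> K) q q' a : (r <= 1)%N -> eval_range iota z `<=` A ->
    (forall c, A (iota c)) ->
    injective (mmap iota z) -> (forall b, A b -> integralOver (mmap iota z) b) ->
    prime_ideal A q -> prime_ideal A q' -> q `<=` q' -> q a -> a != 0 -> q' `<=` q.
Proof.
move=> r1 zA Ac inj int pq pq' qq' qa a0 b q'b; apply: contrapT => nqb.
have Aa := prime_sub pq qa; have Ab := prime_sub pq' q'b.
have sR := eval_range_ring iota z.
have [c [h [Rc c0 Ah cE]]] : exists c h, [/\ eval_range iota z c, c != 0, A h & c = a * h].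
  have [P Pm /rootP rP] := int a Aa.
  apply: (@norm_multiple _ A _ a (map_poly (mmap iota z) P)) => //.
    by rewrite monic_neq0 // monic_map.
  by move=> j; rewrite coef_map; exists P`_j.
have qc : q c by rewrite cE mulrC; exact: (primeM pq).
have lL := loc_local sA pq; set L := localization A q in lL.
have AL : A `<=` L by exact: loc_sub.
have [F [pi [pi1 piD piM pi0 _]]] := residue_field_exists lL.
have piB u v : L u -> L v -> pi (u - v) = pi u - pi v.
  move=> Lu Lv; apply/eqP; rewrite eq_sym subr_eq -piD ?subrK //; exact: (subringB (lp_ring lL)).
have Lc d : L (iota d) by apply: AL; exact: Ac.
have sL := lp_ring lL.
have pi00 : pi 0 = 0 by apply/pi0; [exact: (subring0 sL) | exact: lp0 lL].
have piX u l : L u -> pi (u ^+ l) = pi u ^+ l.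
  move=> Lu; elim: l => [|l IHl]; first by rewrite !expr0 pi1.
  by rewrite !exprS piM ?IHl //; exact: (@subringX _ _ sL).
have pi_sum l (u : 'I_l -> K) : (forall j, L (u j)) -> pi (\sum_j u j) = \sum_j pi (u j).
  elim: l u => [|l IHl] u Lu; first by rewrite !big_ord0.
  by rewrite !big_ord_recl piD ?IHl //; exact: (subring_sum sL).
have [g gE] : exists g : {rmorphism k -> F}, forall d, g d = pi (iota d).
  pose f d := pi (iota d).
  have fB : {morph f : x y / x - y} by move=> x y; rewrite /f rmorphB piB.
  have fM : GRing.monoid_morphism f.
    by split=> [|x y]; rewrite /f ?rmorph1 ?pi1 // rmorphM piM.
  pose g : {rmorphism k -> F} := HB.pack f
    (GRing.isZmodMorphism.Build k F f fB) (GRing.isMonoidMorphism.Build k F f fM).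
  by exists g.
have Lz i : L (z i) by apply: AL; apply: zA; exact: eval_range_var.
have Lmm Q : L (mmap iota z Q) by apply: AL; apply: zA; exists Q.
have piz Q : pi (mmap iota z Q) = mmap g (fun i => pi (z i)) Q.
  elim/mpolyind: Q => [|d m Q _ _ IH]; first by rewrite !rmorph0 pi00.
  rewrite !rmorphD piD; [|exact: Lmm|exact: Lmm].
  rewrite /= IH; congr (_ + _); rewrite -mul_mpolyC (rmorphM (mmap iota z)).
  rewrite (rmorphM (mmap g (fun i => pi (z i)))) /= !mmapC !mmapX /= gE.
  have Lm : L (mmap1 z m) by apply: (subring_prod sL) => i _; apply: (@subringX _ _ sL).
  rewrite (piM _ _ (Lc d) Lm).
  congr (_ * _); rewrite /mmap1.
  have : pi (\prod_(i < r) z i ^+ m i) = \prod_(i < r) pi (z i) ^+ m i /\ L (\prod_(i < r) z i ^+ m i).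
    elim/big_rec2: _ => [|i u v _ [IHu Lu]]; first by split=> //; exact: (subring1 sL).
    have LX l : L (z i ^+ l) by exact: (@subringX _ _ sL).
    split; last exact: (subringM sL).
    by rewrite piM // IHu piX.
  by case.
(* The element [c] of [q] is a nonzero polynomial in the single variable, so the image of that
   variable satisfies an equation over [k]; [nagata] with no variable left makes it integral. *)
have zint i : integralOver g (pi (z i)).
  case: r r1 z {int} inj zA Rc sR Lz Lmm piz i => [|[|//]] _ z inj zA Rc sR Lz Lmm piz i; first by case: i.
  have [Q cQ] := Rc.
  have Q0 : Q != 0 by apply: contraNneq c0 => Q0; rewrite cQ Q0 rmorph0.
  have Qpi : mmap g (fun i => pi (z i)) Q = 0.
    by rewrite -piz -cQ; apply/pi0; [apply: AL; exact: prime_sub pq _ _ | apply/(loc_primeE sA pq (prime_sub pq qc))].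
  have [y0 [_ yint]] := nagata Q0 Qpi.
  have [P Pm rP] := yint i; apply: (integral_root_monic _ rP); first exact: monic_map.
  apply/integral_poly => j; rewrite coef_map /= (nvar0_mpolyC P`_j) mmapC; exact: integral_id.
have Rint u : eval_range iota z u -> integralOver g (pi u).
  move=> [Q ->]; rewrite piz.
  apply: (@eval_range_min _ _ g _ (fun i => pi (z i)) [set v | integralOver g v]) => //=.
  - by split; [exact: integral1 | exact: integral_sub | exact: integral_mul].
  - by move=> d; exact: integral_id.
  - by exists Q.
have bint : algebraicOver g (pi b).
  apply/integral_algebraic; have [P Pm rP] := int b Ab.
  apply: (@integral_root_monic _ _ _ _ (map_poly (mmap g (fun i => pi (z i))) P)).
  - exact: monic_map.
  - have le (S : nzRingType) (u : {mpoly k[r]} -> S) : (size (map_poly u P) <= size P)%N by exact: size_poly.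
    move: rP => /rootP; rewrite /root !(horner_coef_wide _ (le _ _)) => /(congr1 pi).
    have LX l : L (b ^+ l) by apply: AL; exact: (@subringX _ _ sA).
    rewrite pi00 pi_sum => [h0|j]; last by rewrite coef_map; apply: (subringM sL); [exact: Lmm | exact: LX].
    apply/eqP; rewrite -[RHS]h0; apply: eq_bigr => j _.
    by rewrite !coef_map /= piM // piz piX //; exact: AL.
  - by apply/integral_poly => j; rewrite coef_map /= -piz; apply: Rint; exists P`_j.
have [B AB bE] : exists2 B, A B & (pi b)^-1 = pi B.
  have : [set v | exists2 B, A B & v = pi B] (pi b)^-1.
    apply: (@algebraic_inv_in _ _ g) => //.
    - split; first by exists 1; [exact: (subring1 sA) | rewrite pi1].
        move=> _ _ [u Au ->] [v Av ->]; exists (u - v); [exact: (subringB sA) | by rewrite piB //; exact: AL].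
      move=> _ _ [u Au ->] [v Av ->]; exists (u * v); [exact: (subringM sA) | by rewrite piM //; exact: AL].
    - by move=> d; exists (iota d); rewrite ?gE.
    - by exists b.
    - apply/eqP => /(pi0 _ (AL _ Ab)) /(loc_primeE sA pq Ab); exact: nqb.
  by case=> B AB e; exists B.
have nb0 : pi b != 0.
  by apply/eqP => /(pi0 _ (AL _ Ab)) /(loc_primeE sA pq Ab); exact: nqb.
have AbB : A (b * B - 1) by apply: (subringB sA); [exact: subringM | exact: subring1].
have : q (b * B - 1).
  apply/(loc_primeE sA pq AbB); apply/pi0; first exact: AL.
  rewrite piB; [| by apply: (subringM sL); exact: AL | exact: (subring1 sL)].
  rewrite piM; [| exact: AL | exact: AL].
  by rewrite -bE mulfV // pi1 subrr.
move/qq' => hB; apply: (prime1 pq').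
have -> : 1 = B * b - (b * B - 1) by ring.
by apply: (idB sA (prime_ideal_ideal pq')) => //; exact: (primeM pq').
Qed.

End Primes.

Section SurfaceNormalization.
Variables (k : fieldType) (X : proj_variety k).
Local Notation s := (@Defs.coord _ X).
Local Notation iota := (constants X).
Local Notation A := (chart iota s).

Let loc_anti (B q q' : set X) : q `<=` q' -> localization B q' `<=` localization B q.
Proof. by move=> sub _ [a [b [Aa Ab nb ->]]]; exists a, b; split=> // /sub. Qed.

Lemma chain_of_normalization i r (z : 'I_r.+3 -> X) : s i != 0 -> injective (mmap iota z) ->
    (forall j, A i (z j)) -> (forall a, A i a -> integralOver (mmap iota z) a) ->
  has_chain (@pt _ X) 3.
Proof.
move=> si inj zA int.
have sA := @chart_ring _ X i; have nA := @chart_noetherian _ X i.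
have RA : eval_range iota z `<=` A i.
  by apply: eval_range_min => // c; exact: chart_const.
have p0 : prime_ideal (A i) (A i `&` nonunits [set: X]).
  by apply: nonunits_prime => //; exact: pt_generic.
set q0 := A i `&` _ in p0.
have q0E a : q0 a -> a = 0 by case=> _ [_ [//|]]; case.
have z0 c : eval_range iota z c -> q0 c -> c = 0 by move=> _; exact: q0E.
have [q1 [p1 q01 [n1 y1] z1 int1]] :=
  lying_over_drop sA nA inj RA p0 z0 (integral_mod0 (prime0 p0) int).
have inj1 := drop_inj inj; have RA1 := subset_trans (@drop_sub _ _ iota _ z) RA.
have [q2 [p2 q12 [n2 y2] z2 int2]] := lying_over_drop sA nA inj1 RA1 p1 z1 int1.
have inj2 := drop_inj inj1; have RA2 := subset_trans (@drop_sub _ _ iota _ _) RA1.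
have [q3 [p3 q23 [n3 y3] _ _]] := lying_over_drop sA nA inj2 RA2 p2 z2 int2.
have l10 := loc_proper sA p0 p1 q01 y1 n1.
have l21 := loc_proper sA p1 p2 q12 y2 n2.
have l32 := loc_proper sA p2 p3 q23 y3 n3.
exists (fun j : 'I_4 => localization (A i) (nth q0 [:: q3; q2; q1; q0] j)); split.
  by case=> -[|[|[|[|//]]]] jp /=; apply: loc_pt.
have tr (a b c : set X) : a `<` b -> b `<` c -> a `<` c.
  move=> [ab nab] [bc nbc]; split; first exact: subset_trans bc.
  by move=> ca; apply: nab; exact: subset_trans ca.
have l20 := tr _ _ _ l21 l10; have l31 := tr _ _ _ l32 l21; have l30 := tr _ _ _ l32 l20.
by case=> -[|[|[|[|j]]]] jp; case=> -[|[|[|[|l]]]] lp.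
Qed.

(** Chains determine the number of variables: r <= 1 contradicts the given chain of length 2 by
    [small_residue_field], and r >= 3 produces one of length 3 by dropping three variables in
    turn. *)
Theorem surface_normalization : dim_is (@pt _ X) 2 ->
  exists i (z : 'I_2 -> X), [/\ s i != 0, injective (mmap iota z), forall j, A i (z j)
    & forall a, A i a -> integralOver (mmap iota z) a].
Proof.
move=> [[c [hc hlt]] no].
have [i [si Ai]] := pt_chart (hc ord0).
have [r [z [inj zA int]]] := noether_normalization iota (affine_coord s i).
have sA := @chart_ring _ X i.
pose j1 : 'I_3 := @Ordinal 3 1 isT; pose j2 : 'I_3 := @Ordinal 3 2 isT.
have [s01 n01] := hlt ord0 j1 isT; have [s12 n12] := hlt j1 j2 isT.
have A1 := subset_trans Ai s01; have A2 := subset_trans A1 s12.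
have p0 := nonunits_prime (hc ord0) Ai; have p1 := nonunits_prime (hc j1) A1.
have c0E := pt_in_chart si (hc ord0) Ai; have c1E := pt_in_chart si (hc j1) A1.
set q0 := _ `&` nonunits _ in p0 c0E; set q1 := _ `&` nonunits _ in p1 c1E.
have q10 : q1 `<=` q0.
  move=> a q1a; have Aa := prime_sub p1 q1a; apply/(loc_primeE sA p0 Aa).
  rewrite -c0E; split; first exact: Ai.
  have [a0|a0] := eqVneq a 0; [by left | right => h].
  have /(loc_primeE sA p1 Aa)[_ [/eqP|]] := q1a; first by rewrite (negbTE a0).
  by apply; rewrite -c1E; exact: s01.
have RA : eval_range iota z `<=` A i.
  by apply: eval_range_min => // d; exact: chart_const.
have [r1|] := leqP r 1.
  exfalso; have [a q1a a0] : exists2 a, q1 a & a != 0.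
    apply: contrapT => h; apply: n12; rewrite c1E => f _.
    have [a [b [Aa Ab b0 ->]]] := chart_frac si f; exists a, b; split=> // q1b.
    by apply: h; exists b.
  apply: n01; rewrite c0E {1}c1E; apply: loc_anti.
  by apply: (small_residue_field sA r1 RA _ inj int p1 p0 q10 q1a a0) => d; exact: chart_const.
case: r z inj zA int RA => [|[|[|r]]] // z inj zA int RA _; first by exists i, z.
by case: no; apply: (chain_of_normalization si inj zA int).
Qed.

End SurfaceNormalization.

(** * Ranks over subrings and the degree of the function field over its p-th powers *)

Section LinearDependence.
Variables (K : fieldType) (S : set K).
Hypothesis sS : subring S.

Definition dependent (T : finType) (v : T -> K) : Prop :=
  exists c : T -> K, [/\ forall i, S (c i), exists i, c i != 0 & \sum_i c i * v i = 0].

(** Gaussian elimination by cross-multiplication, since [S] is only a ring; [B] records the rows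
    still in use. *)
Lemma elimination N (T : finType) (v : T -> 'I_N -> K) (B : {set T}) : (N < #|B|)%N ->
    (forall i j, S (v i j)) ->
  exists c : T -> K, [/\ forall i, S (c i), exists2 i, i \in B & c i != 0,
    forall i, i \notin B -> c i = 0 & forall j, \sum_i c i * v i j = 0].
Proof.
elim: N v B => [|N IH] v B ltB Sv.
  have [i iB] : exists i, i \in B by apply/set0Pn; rewrite -cards_eq0 -lt0n.
  exists (fun l => (l == i)%:R); split=> [l||l|[]//].
  - exact: subring_nat.
  - by exists i; rewrite ?eqxx ?oner_eq0.
  - by case: eqP => [->|//]; rewrite iB.
have [[i0 i0B a0]|no] := pselect (exists2 i, i \in B & v i ord0 != 0); last first.
  have [|c [Sc nz c0 cv]] := IH (fun i j => v i (lift ord0 j)) B (ltnW ltB) _; first by [].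
  exists c; split=> // j; have [l ->|->] := unliftP ord0 j; first exact: cv.
  apply: big1 => i _; have [iB|/c0->] := boolP (i \in B); last by rewrite mul0r.
  have [->|vi] := eqVneq (v i ord0) 0; first by rewrite mulr0.
  by case: no; exists i.
set a := v i0 ord0 in a0.
pose v' i j := a * v i (lift ord0 j) - v i ord0 * v i0 (lift ord0 j).
have [||c [Sc [i iB ci] c0 cv]] := IH v' (B :\ i0).
- by move: ltB; rewrite (cardsD1 i0 B) i0B.
- by move=> i j; rewrite /v'; apply: (subringB sS); apply: (subringM sS); exact: Sv.
have ci0 : c i0 = 0 by apply: c0; rewrite !inE eqxx.
pose t := \sum_i c i * v i ord0.
(* The coefficient -t at the pivot row clears the first column and accounts for the pivot terms in
   [v']. *)
exists (fun i => a * c i - (i == i0)%:R * t); split.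
- move=> l; apply: (subringB sS); first by apply: (subringM sS) => //; exact: Sv.
  apply: (subringM sS); first exact: subring_nat.
  by apply: (subring_sum sS) => l' _; apply: (subringM sS) => //; exact: Sv.
- exists i; first by move: iB; rewrite inE => /andP[].
  by move: iB; rewrite !inE => /andP[/negbTE -> _]; rewrite mul0r subr0 mulf_neq0.
- move=> l nl; rewrite c0 ?inE ?(negbTE nl) ?andbF // mulr0 sub0r.
  by case: eqP nl => [->|_ _]; rewrite ?i0B // mul0r oppr0.
have key (f : T -> K) : \sum_i (a * c i - (i == i0)%:R * t) * f i = a * (\sum_i c i * f i) - t * f i0.
  under eq_bigr do rewrite mulrBl.
  rewrite big_split sumrN /=; congr (_ - _).
    by rewrite mulr_sumr; apply: eq_bigr => l _; rewrite mulrA.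
  rewrite (bigD1 i0) //= eqxx mul1r big1 ?addr0 // => l /negbTE ->; by rewrite !mul0r.
move=> j; rewrite key; have [l ->|->] := unliftP ord0 j; last by rewrite -/t -/a; ring.
rewrite mulr_sumr mulr_suml -sumrB -[RHS](cv l); apply: eq_bigr => m _; rewrite /v'; ring.
Qed.

Lemma dependent_of_span (U : finType) (e : U -> K) (T : finType) (v : T -> K) :
    (forall f, exists b c, [/\ S b, b != 0, forall j, S (c j) & b * f = \sum_j c j * e j]) ->
  (#|U| < #|T|)%N -> dependent v.
Proof.
move=> span lt.
have /choice[b hb] : forall i, exists b, S b /\ b != 0 /\
    exists c, (forall j, S (c j)) /\ b * v i = \sum_j c j * e j.
  by move=> i; have [b [c [Sb b0 Sc E]]] := span (v i); exists b; split=> //; split=> //; exists c.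
have /choice[c hc] : forall i, exists c, (forall j, S (c j)) /\ b i * v i = \sum_j c j * e j.
  by move=> i; have [_ [_ h]] := hb i.
have [||d [Sd [i _ di] _ dc]] := @elimination #|U| T (fun i j => c i (enum_val j)) (finset.setTfor T).
- by rewrite cardsT.
- by move=> i j; case: (hc i).
exists (fun i => d i * b i); split.
- by move=> l; apply: (subringM sS) => //; case: (hb l).
- by exists i; rewrite mulf_neq0 //; case: (hb i) => _ [].
under eq_bigr => l _ do rewrite -mulrA (proj2 (hc l)) mulr_sumr.
rewrite exchange_big big1 //= => u _.
under eq_bigr do rewrite mulrA.
rewrite -mulr_suml; have := dc (enum_rank u).
by under eq_bigr do rewrite enum_rankK; move=> ->; rewrite mul0r.
Qed.

Lemma rank_exists M0 : (forall (T : finType) (v : T -> K), (M0 < #|T|)%N -> dependent v) ->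
  exists N (e : 'I_N -> K), [/\ (0 < N)%N,
    forall c, (forall j, S (c j)) -> \sum_j c j * e j = 0 -> forall j, c j = 0
  & forall f, exists b c, [/\ S b, b != 0, forall j, S (c j) & b * f = \sum_j c j * e j]].
Proof.
move=> bound.
pose ind N := exists e : 'I_N -> K, forall c, (forall j, S (c j)) ->
  \sum_j c j * e j = 0 -> forall j, c j = 0.
have indB N : ind N -> (N <= M0)%N.
  move=> [e he]; rewrite leqNgt; apply/negP => lt.
  have [|c [Sc [j cj] s0]] := bound 'I_N e; first by rewrite card_ord.
  by move: cj; rewrite (he c Sc s0) eqxx.
have ind1 : ind 1%N.
  exists (fun=> 1) => c Sc; rewrite big_ord1 mulr1 => c0 j; by rewrite ord1.
have exN : exists N, `[< ind N >] by exists 1%N; apply/asboolP.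
have ubN N : `[< ind N >] -> (N <= M0)%N by move=> /asboolP; exact: indB.
case: (ex_maxnP exN ubN) => N /asboolP[e he] maxN; exists N, e; split=> //.
  by apply: maxN; apply/asboolP.
move=> f; pose e' (j : 'I_N.+1) := if unlift ord0 j is Some l then e l else f.
have [c [Sc [j cj] s0]] : dependent e'.
  apply: contrapT => nd; suff : (N.+1 <= N)%N by rewrite ltnn.
  apply: maxN; apply/asboolP; exists e' => c Sc s0 j; apply/eqP/negPn/negP => cj.
  by apply: nd; exists c; split=> //; exists j.
move: s0; rewrite big_ord_recl /e' unlift_none.
under eq_bigr do rewrite liftK.
move=> s0; exists (c ord0), (fun l => - c (lift ord0 l)); split=> //.
- apply/eqP => c0; move: s0; rewrite c0 mul0r add0r => /(he _ (fun l => Sc _)) h.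
  by move: cj; have [l ->|->] := unliftP ord0 j; rewrite ?h ?c0 eqxx.
- by move=> l; exact: subringN.
- by under eq_bigr do rewrite mulNr; rewrite sumrN; apply/eqP; rewrite -addr_eq0 s0.
Qed.

End LinearDependence.

Section FiniteModule.
Variables (K : fieldType) (R : set K).
Hypothesis sR : subring R.

Lemma adjoin_finite (B : set K) (s : seq K) x (P : {poly K}) :
    B `<=` gen_by R s -> P \is monic -> (forall j, R P`_j) -> P.[x] = 0 ->
  exists s', adjoin B x `<=` gen_by R s'.
Proof.
move=> Bs Pm RP Px; have iR := idealA sR.
have [d sP] : exists d, size P = d.+1.
  by exists (size P).-1; rewrite prednK // lt0n size_poly_eq0 monic_neq0.
have lead : P`_d = 1 by have := monicP Pm; rewrite /lead_coef sP.
have xd : x ^+ d = - \sum_(l < d) P`_l * x ^+ l.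
  by move: Px; rewrite horner_coef sP big_ord_recr /= lead mul1r addrC => /eqP; rewrite addr_eq0 => /eqP.
pose s' := [seq g * x ^+ j | g <- s, j <- iota 0 d]; exists s'.
have [g0 gD gM] := gen_by_ideal s' iR.
have gsum (I : finType) (F : I -> K) : (forall i, gen_by R s' (F i)) -> gen_by R s' (\sum_i F i).
  by move=> h; elim/big_rec: _ => [//|i u _]; apply: (gD); exact: h.
have powers g j : g \in s -> gen_by R s' (g * x ^+ j).
  move=> gs; elim/ltn_ind: j => j IH; have [jd|dj] := ltnP j d.
    apply: gen_by_mem => //; apply/allpairsP; exists (g, j); split=> //=.
    by rewrite mem_iota.
  rewrite -(subnK dj) exprD xd mulrN mulr_sumr mulrN -mulN1r.
  apply: (gM); first by apply: (subringN sR); exact: subring1.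
  rewrite mulr_sumr; apply: (gsum) => l.
  have -> : g * (x ^+ (j - d) * (P`_l * x ^+ l)) = P`_l * (g * x ^+ (j - d + l)) by rewrite exprD; ring.
  apply: (gM) => //; apply: IH; rewrite -[X in (_ < X)%N](subnK dj) ltn_add2l; exact: ltn_ord.
move=> _ [Q [BQ ->]]; rewrite horner_coef; apply: (gsum) => j.
have [c [Rc ->]] := gen_by_sum (Bs _ (BQ j)).
rewrite mulr_suml; apply: (gsum) => l; rewrite -mulrA; apply: (gM) => //.
by apply: (powers); exact: mem_nth.
Qed.

Lemma finite_of_integral (s : seq K) :
    (forall x, x \in s -> exists P : {poly K}, [/\ P \is monic, forall j, R P`_j & P.[x] = 0]) ->
  exists B s', [/\ subring B, R `<=` B, forall x, x \in s -> B x & B `<=` gen_by R s'].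
Proof.
elim: s => [_|x s IH hs].
  exists R, [:: 1]; split=> //; move=> a Ra /=; exists a, 0; split=> //; by rewrite mulr1 addr0.
have [|B [s' [sB RB sBs Bs']]] := IH; first by move=> y ys; apply: hs; rewrite inE ys orbT.
have [P [Pm RP Px]] := hs x (mem_head _ _).
have [s'' h] := adjoin_finite Bs' Pm RP Px.
exists (adjoin B x), s''; split=> //; first exact: adjoin_ring.
- by apply: subset_trans RB _; exact: adjoin_sub.
- move=> y; rewrite inE => /orP[/eqP->|/sBs]; first exact: adjoin_self.
  exact: adjoin_sub.
Qed.

End FiniteModule.

Section PDegree.
Variables (k K : fieldType) (iota : {rmorphism k -> K}) (p : nat).
Hypothesis k_perfect : perfect_field p k.
Variables (r : nat) (z : 'I_r -> K).
Hypothesis z_inj : injective (mmap iota z).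
Local Notation R := (eval_range iota z).
Local Notation U := {ffun 'I_r -> 'I_p}.

Let chark : p \in [pchar k]. Proof. by case: k_perfect. Qed.
Let charK : p \in [pchar K]. Proof. exact: (rmorph_pchar iota chark). Qed.
Let charM : p \in [pchar {mpoly k[r]}]. Proof. exact: (rmorph_pchar (@mpolyC r k) chark). Qed.
Let p_gt0 : (0 < p)%N. Proof. by apply: prime_gt0; exact: pcharf_prime chark. Qed.
Let sR : subring R. Proof. exact: eval_range_ring. Qed.
Let iR := idealA sR.
Let M (a : U) : K := \prod_i z i ^+ a i.
Let S : set K := [set c ^+ p | c in R].

Let sS : subring S.
Proof.
split.
- by exists 1; [exact: subring1 | rewrite expr1n].
- by move=> _ _ [c Rc <-] [d Rd <-]; exists (c - d); [exact: subringB | rewrite (frobB charK)].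
- by move=> _ _ [c Rc <-] [d Rd <-]; exists (c * d); [exact: subringM | rewrite exprMn].
Qed.

(** Division of the exponents by [p] splits a monomial into a p-th power and some [M a]; constants
    are p-th powers because [k] is perfect. *)
Lemma eval_range_pspan g : R g -> exists c : U -> K, (forall a, R (c a)) /\ g = \sum_a c a ^+ p * M a.
Proof.
move=> [Q ->]; elim/mpolyind: Q => [|d m Q _ _ [c [Rc cE]]].
  exists (fun=> 0); split=> [a|]; first exact: subring0.
  by rewrite rmorph0 big1 // => a _; rewrite expr0n gtn_eqF // mul0r.
- have [e de] := (proj2 k_perfect) d.
  pose a0 : U := [ffun i => Ordinal (ltn_pmod (m i) p_gt0)].
  pose t := iota e * \prod_i z i ^+ (m i %/ p)%N.
  have Rt : R t.
    apply: (subringM sR); first exact: eval_range_const.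
    by apply: (subring_prod sR) => i _; apply: (@subringX _ _ sR); exact: eval_range_var.
  exists (fun a => (a == a0)%:R * t + c a); split.
    by move=> a; apply: (subringD sR) => //; apply: (subringM sR) => //; exact: subring_nat.
  rewrite rmorphD /= cE (_ : mmap _ _ _ = t ^+ p * M a0); last first.
    rewrite -mul_mpolyC rmorphM /= mmapC mmapX /mmap1 /M /t exprMn -rmorphXn de -mulrA.
    congr (_ * _); rewrite -prodrXl -big_split; apply: eq_bigr => i _ /=.
    by rewrite ffunE /= -exprM -exprD -divn_eq.
  under [in RHS]eq_bigr do rewrite (frobD charK) exprMn mulrDl.
  rewrite big_split /=; congr (_ + _); rewrite (bigD1 a0) //= eqxx expr1n mul1r.
  by rewrite big1 ?addr0 // => a /negbTE ->; rewrite expr0n gtn_eqF // !mul0r.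
Qed.

Let R_free (c : U -> K) : (forall a, R (c a)) -> \sum_a c a ^+ p * M a = 0 -> forall a, c a = 0.
Proof.
move=> Rc s0; have /choice[Q cQ] : forall a, exists Q, c a = mmap iota z Q by move=> a; exact: Rc.
pose m_of (a : U) : 'X_{1..r} := [multinom (a i : nat) | i < r].
have Q0 : \sum_a Q a ^+ p * 'X_[m_of a] = 0.
  apply: z_inj; rewrite rmorph0 rmorph_sum -[RHS]s0; apply: eq_bigr => a _.
  rewrite rmorphM rmorphXn /= -cQ mmapX; congr (_ * _).
  by apply: eq_bigr => i _; rewrite mnmE.
have Qp a : Q a ^+ p = \sum_(m <- msupp (Q a)) ((Q a)@_m ^+ p)%:MP * 'X_[m *+ p].
  rewrite {1}[Q a]mpolyE.
  transitivity (\sum_(m <- msupp (Q a)) ((Q a)@_m *: 'X_[m] : {mpoly k[r]}) ^+ p).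
    exact: (rmorph_sum (pFrobenius_aut charM)).
  by apply: eq_bigr => m _; rewrite -mul_mpolyC exprMn -rmorphXn /= mpolyXn.
have uniq_digits (a a' : U) (m m' : 'X_{1..r}) : (m' *+ p + m_of a' = m *+ p + m_of a)%MM -> a' = a /\ m' = m.
  move=> h; have hi i : (m' i * p + a' i = m i * p + a i)%N.
    by have /mnmP/(_ i) := h; rewrite !mnmDE !mulmnE !mnmE.
  split.
    apply/ffunP => i; apply/val_inj => /=.
    by have := congr1 (fun x => x %% p)%N (hi i); rewrite !modnMDl !modn_small.
  apply/mnmP => i; have := congr1 (fun x => x %/ p)%N (hi i).
  by rewrite !divnMDl // !divn_small // !addn0.
move=> a; rewrite cQ (_ : Q a = 0) ?rmorph0 //; apply/mpolyP => m; rewrite mcoeff0.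
have coef a' : (Q a' ^+ p * 'X_[m_of a'])@_(m *+ p + m_of a) = (a' == a)%:R * (Q a)@_m ^+ p.
  rewrite Qp mulr_suml raddf_sum /=.
  under eq_bigr => m' _ do rewrite -mulrA mcoeffCM -mpolyXD mcoeffX.
  have [->|na] := eqVneq a' a; last first.
    rewrite mul0r big1 // => m' _; case: eqP => [/uniq_digits[e _]|]; last by rewrite mulr0.
    by rewrite e eqxx in na.
  rewrite mul1r; have [mQ|mQ] := boolP (m \in msupp (Q a)).
    rewrite (bigD1_seq m) ?msupp_uniq //= eqxx mulr1 big1 ?addr0 // => m' nm.
    by case: eqP => [/uniq_digits[_ e]|]; rewrite ?mulr0 // e eqxx in nm *.
  rewrite big_seq big1 => [|m' m'Q]; first by rewrite (memN_msupp_eq0 mQ) expr0n gtn_eqF.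
  case: eqP => [/uniq_digits[_ e]|]; last by rewrite mulr0.
  by rewrite -e m'Q in mQ.
have := congr1 (fun P : {mpoly k[r]} => P@_(m *+ p + m_of a)) Q0; rewrite /= raddf_sum mcoeff0 /=.
under eq_bigr do rewrite coef.
rewrite (bigD1 a) //= eqxx mul1r big1 ?addr0 => [/eqP|a' /negbTE ->]; last by rewrite mul0r.
by rewrite expf_eq0 => /andP[_ /eqP].
Qed.

Section Extension.
Variables (N : nat) (e : 'I_N -> K).
Hypothesis N_gt0 : (0 < N)%N.
Hypothesis e_free : forall c, (forall j, R (c j)) -> \sum_j c j * e j = 0 -> forall j, c j = 0.
Hypothesis e_span : forall f, exists b c,
  [/\ R b, b != 0, forall j, R (c j) & b * f = \sum_j c j * e j].

Let cardU : #|{: U}| = (p ^ r)%N. Proof. by rewrite card_ffun !card_ord. Qed.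

(* Both bounds compare, over [S = R^p], the families [M a * e j] and
   [v t * e j ^+ p]: [#|U| * N] is the rank of [K] over [R^p], and [N] is also
   the rank of [K^p] over [R^p]. *)
Lemma pdegree_upper (T : finType) (v : T -> K) : (p ^ r < #|T|)%N ->
  exists c : T -> K, (exists i, c i != 0) /\ \sum_i c i ^+ p * v i = 0.
Proof.
move=> lt; apply: contrapT => nd.
have span f : exists b (c : U * 'I_N -> K), [/\ S b, b != 0, forall j, S (c j)
    & b * f = \sum_j c j * (M j.1 * e j.2)].
  have [b [c [Rb b0 Rc E]]] := e_span f.
  have /choice[d hd] : forall j, exists d : U -> K, (forall a, R (d a)) /\
      b ^+ p.-1 * c j = \sum_a d a ^+ p * M a.
    by move=> j; apply: eval_range_pspan; apply: (subringM sR) => //; exact: (@subringX _ _ sR).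
  exists (b ^+ p), (fun x => d x.2 x.1 ^+ p); split.
  - by exists b.
  - exact: expf_neq0.
  - by move=> [a j]; exists (d j a) => //; case: (hd j).
  - rewrite -[in LHS](prednK p_gt0) exprSr -mulrA E mulr_sumr.
    rewrite -(pair_big_dep xpredT (fun _ => xpredT) (fun a j => d j a ^+ p * (M a * e j))) exchange_big /=.
    apply: eq_bigr => j _; rewrite mulrA (proj2 (hd j)) mulr_suml.
    by apply: eq_bigr => a _; rewrite mulrA.
have [|c [Sc [[t i] nz] s0]] := @dependent_of_span _ S sS _ _ _ (fun x : T * 'I_N => v x.1 * e x.2 ^+ p) span.
  by rewrite !card_prod cardU card_ord ltn_pmul2r.
have /choice[d hd] : forall x, exists d, R d /\ d ^+ p = c x.
  by move=> x; have [d Rd dE] := Sc x; exists d.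
(* The coefficients of v_t e_i^p are themselves p-th powers d^p, so for fixed t they add up to the
   p-th power of the sum of the d e_i. *)
apply: nd; exists (fun t => \sum_i d (t, i) * e i); split.
  exists t; apply/eqP => /(e_free (fun i => proj1 (hd (t, i)))) /(_ i) d0.
  by move: nz; rewrite -(proj2 (hd (t, i))) d0 expr0n gtn_eqF // eqxx.
transitivity (\sum_t \sum_j c (t, j) * (v t * e j ^+ p)); last first.
  by rewrite -[RHS]s0 pair_bigA; apply: eq_bigr => -[].
apply: eq_bigr => t' _; rewrite /= (frob_sum charK) mulr_suml; apply: eq_bigr => j _.
by rewrite exprMn (proj2 (hd _)) mulrAC mulrA.
Qed.

Lemma pdegree_lower (L : nat) (f : 'I_L -> K) : (L < p ^ r)%N ->
  ~ forall g, exists h : 'I_L -> K, g = \sum_m h m ^+ p * f m.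
Proof.
move=> lt hf.
have span g : exists b (c : 'I_L * 'I_N -> K), [/\ S b, b != 0, forall j, S (c j)
    & b * g = \sum_j c j * (f j.1 * e j.2 ^+ p)].
  have [h ->] := hf g.
  have /choice[bc hbc] : forall m, exists bc : K * ('I_N -> K), [/\ R bc.1, bc.1 != 0,
      forall j, R (bc.2 j) & bc.1 * h m = \sum_j bc.2 j * e j].
    by move=> m; have [b [c H]] := e_span (h m); exists (b, c).
  have Rb m : R (bc m).1 by case: (hbc m).
  pose b := \prod_m (bc m).1; pose b' m := \prod_(l | l != m) (bc l).1.
  have bE m : b = b' m * (bc m).1 by rewrite /b (bigD1 m) //= mulrC.
  have Rb' m : R (b' m) by apply: (subring_prod sR) => l _.
  exists (b ^+ p), (fun x => (b' x.1 * (bc x.1).2 x.2) ^+ p); split.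
  - by exists b => //; apply: (subring_prod sR) => l _.
  - by apply/expf_neq0/prodf_neq0 => m _; case: (hbc m).
  - move=> [m j]; exists (b' m * (bc m).2 j) => //; apply: (subringM sR) => //=.
    by case: (hbc m).
  - rewrite mulr_sumr -(pair_big_dep xpredT (fun _ => xpredT)
      (fun m j => (b' m * (bc m).2 j) ^+ p * (f m * e j ^+ p))) /=.
    apply: eq_bigr => m _; rewrite mulrA -exprMn (bE m) -mulrA.
    have [_ _ _ ->] := hbc m; rewrite mulr_sumr (frob_sum charK) mulr_suml.
    by apply: eq_bigr => j _; rewrite !exprMn; ring.
have [|c [Sc [[a i] nz] s0]] := @dependent_of_span _ S sS _ _ _ (fun x : U * 'I_N => M x.1 * e x.2) span.
  by rewrite !card_prod cardU !card_ord ltn_pmul2r.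
have /choice[d hd] : forall x, exists d, R d /\ d ^+ p = c x.
  by move=> x; have [d Rd dE] := Sc x; exists d.
have inner j : R (\sum_a d (a, j) ^+ p * M a).
  apply: (subring_sum sR) => l _; apply: (subringM sR).
    by apply: (@subringX _ _ sR); case: (hd (l, j)).
  by apply: (subring_prod sR) => l' _; apply: (@subringX _ _ sR); exact: eval_range_var.
have outer : \sum_j (\sum_a d (a, j) ^+ p * M a) * e j = 0.
  transitivity (\sum_a \sum_j c (a, j) * (M a * e j)); last first.
    by rewrite -[RHS]s0 pair_bigA; apply: eq_bigr => -[].
  rewrite exchange_big /=.
  apply: eq_bigr => j _; rewrite mulr_suml; apply: eq_bigr => l _.
  by rewrite (proj2 (hd _)) mulrA.
have := R_free (fun a => proj1 (hd (a, i))) (e_free inner outer i) a => d0.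
by move: nz; rewrite -(proj2 (hd (a, i))) d0 expr0n gtn_eqF // eqxx.
Qed.

End Extension.

Theorem pdegree n (y : 'I_n -> K) : R `<=` eval_range iota y -> frac_ring (eval_range iota y) ->
    (forall a, eval_range iota y a -> integralOver (mmap iota z) a) ->
  (forall (T : finType) (v : T -> K), (p ^ r < #|T|)%N ->
     exists c : T -> K, (exists i, c i != 0) /\ \sum_i c i ^+ p * v i = 0) /\
  forall (L : nat) (f : 'I_L -> K), (L < p ^ r)%N ->
    ~ forall g, exists h : 'I_L -> K, g = \sum_m h m ^+ p * f m.
Proof.
move=> RA fA int; have sA := eval_range_ring iota y.
have int' a : eval_range iota y a -> exists P : {poly K}, [/\ P \is monic, forall j, R P`_j & P.[a] = 0].
  move=> /int[P Pm /rootP rP]; exists (map_poly (mmap iota z) P); split=> //; first exact: monic_map.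
  by move=> j; rewrite coef_map; exists P`_j.
have [|B [s' [sB RB By Bs']]] := @finite_of_integral _ _ sR [seq y j | j <- enum 'I_n].
  by move=> _ /mapP[j _ ->]; apply: int'; exact: eval_range_var.
have AB : eval_range iota y `<=` B.
  apply: eval_range_min => // [c|j]; first by apply: RB; exact: eval_range_const.
  by apply: By; apply/mapP; exists j; rewrite ?mem_enum.
have span f : exists b (c : 'I_(size s') -> K), [/\ R b, b != 0, forall j, R (c j)
    & b * f = \sum_j c j * s'`_j].
  have [a [b [Aa Ab b0 ->]]] := fA f.
  have [P [Pm RP Pb]] := int' b Ab.
  have [c [h [Rc c0 Ah cE]]] := norm_multiple sA RA Ab b0 (monic_neq0 Pm) RP Pb.
  have Aah : eval_range iota y (h * a) by exact: (subringM sA).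
  have [d [Rd dE]] := gen_by_sum (Bs' _ (AB _ Aah)).
  by exists c, d; split=> //; rewrite -dE cE; field.
have [|N [e [N0 ef es]]] := @rank_exists _ R sR (size s').
  move=> T v lt; have h := @dependent_of_span _ R sR _ (fun j : 'I_(size s') => s'`_j) T v span.
  by apply: h; rewrite card_ord.
by split; [exact: pdegree_upper N0 ef es | exact: pdegree_lower N0 ef es].
Qed.

End PDegree.

Section ResidueBasis.
Variables (k : fieldType) (X : proj_variety k) (p : nat).
Local Notation s := (@Defs.coord _ X).
Local Notation iota := (constants X).
Local Notation A := (chart iota s).
Hypothesis k_perfect : perfect_field p k.
Hypothesis X_surface : dim_is (@pt _ X) 2.
Hypothesis X_normal : normal_variety X.

Lemma surface_pchar : p \in [pchar X].
Proof. by case: k_perfect => h _; exact: (rmorph_pchar iota h). Qed.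
Let charX := surface_pchar.
Let p_gt0 : (0 < p)%N. Proof. by apply: prime_gt0; exact: pcharf_prime charX. Qed.
Let p_gt1 : (1 < p)%N. Proof. by apply: prime_gt1; exact: pcharf_prime charX. Qed.

Lemma surface_pdegree : pdeg_le2 X p /\
  forall t : X, ~ forall g, exists c : 'I_p -> X, g = \sum_m c m ^+ p * t ^+ m.
Proof.
have [i [z [si inj zA int]]] := surface_normalization X_surface.
have RA : eval_range iota z `<=` A i.
  by apply: eval_range_min => // [|c]; [exact: chart_ring | exact: chart_const].
have [up low] := pdegree k_perfect inj RA (chart_frac si) int.
split; first by move=> T v lt; apply: up; rewrite -mulnn.
by move=> t; apply: low; rewrite -[X in (X < _)%N]expn1 ltn_exp2l.
Qed.

Let pring (O : set X) : subring O -> subring [set c ^+ p | c in O].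
Proof.
move=> sO; split.
- by exists 1; [exact: subring1 | rewrite expr1n].
- by move=> _ _ [c Rc <-] [d Rd <-]; exists (c - d); [exact: subringB | rewrite (frobB charX)].
- by move=> _ _ [c Rc <-] [d Rd <-]; exists (c * d); [exact: subringM | rewrite exprMn].
Qed.

(** Since a / b = (1/b)^p a b^(p-1), it suffices to treat the chart, spanned over its p-th powers by
    the monomials with exponents below [p]. *)
Lemma pt_pfinite (x : set X) : pt x -> exists l, (forall g, g \in l -> x g) /\
  x `<=` gen_by [set c ^+ p | c in x] l.
Proof.
move=> px; have [i [q [si pq xE]]] := (ptP x).1 px; have sx := pt_ring px.
have sA := @chart_ring _ X i; have Ax : A i `<=` x by rewrite xE; exact: loc_sub.
pose M (a : {ffun 'I_(@ambient_dim _ X).+1 -> 'I_p}) : X := \prod_j (s j / s i) ^+ a j.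
exists [seq M a | a <- enum {: {ffun 'I_(@ambient_dim _ X).+1 -> 'I_p}}]; split.
  move=> _ /mapP[a _ ->]; apply: (subring_prod sx) => j _.
  by apply: (@subringX _ _ sx); apply: Ax; exact: chart_var.
have [_ gD gM] := gen_by_ideal [seq M a | a <- enum {: {ffun 'I_(@ambient_dim _ X).+1 -> 'I_p}}] (idealA (pring sx)).
move=> f; rewrite {1}xE => -[a [b [Aa Ab nb ->]]].
have b0 := notin_prime0 pq nb.
have xb : x b^-1 by rewrite xE; exact: loc_inv.
have Aab : A i (a * b ^+ p.-1) by apply: (subringM sA) => //; exact: (@subringX _ _ sA).
have [c [Ac cE]] := eval_range_pspan k_perfect Aab.
have -> : a / b = b^-1 ^+ p * (a * b ^+ p.-1).
  rewrite -{1}(prednK p_gt0) exprS exprVn; have := expf_neq0 p.-1 b0.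
  by move: (b ^+ _) => B B0; field; rewrite b0 B0.
apply: (gM); first by exists b^-1.
rewrite cE; elim/big_rec: _ => [|d u _ hu]; first by have [] := gen_by_ideal [seq M a | a <- enum {: {ffun 'I_(@ambient_dim _ X).+1 -> 'I_p}}] (idealA (pring sx)).
apply: (gD) => //; apply: (gM); first by exists (c d) => //; exact/Ax/Ac.
by apply: gen_by_mem; [exact: pring | apply/mapP; exists d; rewrite ?mem_enum].
Qed.

(** If all residues were p-th powers, p successive expansions would write each element of [P] as a
    sum of c_j^p t^j with j < p, up to a multiple of t^p. As [P] is finite over its p-th powers,
    Nakayama's lemma removes the remainder, and [K : K^p] <= p contradicts [surface_pdegree]. *)
Lemma divisor_residue (P : set X) t : pt P -> dvr P t ->
    nonunits P = [set g | exists2 a, P a & g = t * a] ->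
  exists2 u, P u & forall c, P c -> ~ exists2 a, P a & u - c ^+ p = t * a.
Proof.
move=> pP dP tE; apply: contrapT => no; have sP := pt_ring pP; have lP := pt_local pP.
have res u : P u -> exists c a, [/\ P c, P a & u = c ^+ p + t * a].
  move=> Pu; apply: contrapT => h; apply: no; exists u => // c Pc [a Pa e].
  by apply: h; exists c, a; split=> //; rewrite -e addrC subrK.
have [_ low] := surface_pdegree; apply: (low t).
have mt : nonunits P t by rewrite tE; exists 1; rewrite ?mulr1 //; exact: subring1.
have Pt := lp_sub lP mt.
have expand n u : P u -> exists c a, [/\ forall j, P (c j), P a
    & u = \sum_(j < n) c j ^+ p * t ^+ j + t ^+ n * a].
  elim: n u => [|n IH] u Pu.
    by exists (fun=> 0), u; split=> [[]//||] //; rewrite big_ord0 expr0 mul1r add0r.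
  have [c [a [Pc Pa ->]]] := IH u Pu; have [d [b [Pd Pb ->]]] := res a Pa.
  exists (fun j => if unlift ord_max j is Some l then c l else d), b; split=> //.
    by move=> j; case: unliftP.
  rewrite big_ord_recr /= unlift_none; under [in RHS]eq_bigr => j _.
    rewrite (_ : widen_ord _ j = lift ord_max j); last by apply: val_inj; rewrite /= /bump leqNgt ltn_ord.
    rewrite liftK; over.
  by rewrite exprSr; ring.
pose N : set X := [set g | exists c : 'I_p -> X, g = \sum_j c j ^+ p * t ^+ j].
have ND x y : N x -> N y -> N (x + y).
  move=> [c ->] [d ->]; exists (fun j => c j + d j); rewrite -big_split.
  by apply: eq_bigr => j _; rewrite (frobD charX) mulrDl.
have NM b x : N x -> N (b ^+ p * x).
  move=> [c ->]; exists (fun j => b * c j); rewrite mulr_sumr; apply: eq_bigr => j _.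
  by rewrite exprMn mulrA.
have N0 : N 0 by exists (fun=> 0); rewrite big1 // => j _; rewrite expr0n gtn_eqF // mul0r.
have [l [lP' Pl]] := pt_pfinite pP.
(* Nakayama's lemma is used over the ring of p-th powers of elements of [P], whose maximal ideal
   contains t^p. *)
have im : ideal [set c ^+ p | c in P] [set c ^+ p | c in nonunits P].
  split.
  - by move=> _ [c mc <-]; exists c => //; exact: lp_sub mc.
  - by exists 0; [exact: lp0 lP | rewrite expr0n gtn_eqF].
  - move=> _ _ [c mc <-] [d md <-]; exists (c + d); last exact: frobD.
    exact: (idD (lp_ideal lP)).
  - move=> _ _ [c Pc <-] [d md <-]; exists (c * d); last by rewrite exprMn.
    exact: (lpM lP).
have Nl : forall x, x \in l -> N x.
  apply: (@nakayama _ [set c ^+ p | c in P] (pring sP) [set c ^+ p | c in nonunits P] N l) => //.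
  - move=> _ [c mc <-]; rewrite -{1 2}(expr1n _ p) -(frobB charX).
    have P1c : P (1 - c) by apply: (subringB sP); [exact: subring1 | exact: lp_sub mc].
    have nm : ~ nonunits P (1 - c).
      move=> h; apply: (lp1 lP); rewrite -(subrK c 1); exact: (idD (lp_ideal lP)).
    have n0 : 1 - c != 0 by apply/eqP => e; apply: nm; rewrite e; exact: lp0 lP.
    split; first exact: expf_neq0.
    by exists (1 - c)^-1; [exact: (lp_unit lP) | rewrite exprVn].
  - by move=> _ x [b _ <-]; exact: NM.
  - move=> x /lP' Px; have [c [a [Pc Pa xE]]] := expand p x Px.
    exists (\sum_(j < p) c j ^+ p * t ^+ j); split; first by exists c.
    rewrite {1}xE addrAC subrr add0r.
    apply: (@gen_by_scale _ [set c ^+ p | c in P]) => //; last by exists t.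
    exact: Pl.
have PN x : P x -> N x.
  move/Pl/gen_by_sum => [c [Pc ->]]; elim/big_rec: _ => // j u _ Nu; apply: (ND) => //.
  by have [d _ <-] := Pc j; apply: (NM); apply: (Nl); exact: mem_nth.
move=> g; have [a [b [Pa Pb b0 ->]]] := pt_frac pP g.
have -> : a / b = b^-1 ^+ p * (a * b ^+ p.-1).
  rewrite -{1}(prednK p_gt0) exprS exprVn; have := expf_neq0 p.-1 b0.
  by move: (b ^+ _) => B B0; field; rewrite b0 B0.
by apply: (NM); apply: (PN); apply: (subringM sP) => //; exact: (@subringX _ _ sP).
Qed.

Lemma divisor_pbasis (P : set X) t : prime_divisor P -> dvr P t ->
    nonunits P = [set g | exists2 a, P a & g = t * a] ->
  exists u Dt Du, pbasis P t u Dt Du.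
Proof.
move=> dP dO tE; have [u Pu u_res] := divisor_residue dP.1 dO tE.
have [Dt [Du pb]] := dvr_pbasis charX (proj1 surface_pdegree) dO Pu u_res.
by exists u, Dt, Du.
Qed.

End ResidueBasis.

(** * Log smoothness along prime divisors *)

Section RegularSystem.
Variables (K : fieldType) (p : nat).
Hypothesis charK : p \in [pchar K].
Hypothesis deg : pdeg_le2 K p.
Variable O : set K.
Local Notation m := (nonunits O).
Hypotheses (lO : local_pair O m) (nO : noetherian O).
Hypothesis root : forall a, O (a ^+ p) -> O a.

Let sO := lp_ring lO.
Let im := lp_ideal lO.
Let p_gt0 : (0 < p)%N. Proof. by apply: prime_gt0; exact: pcharf_prime charK. Qed.
Let p_gt1 : (1 < p)%N. Proof. by apply: prime_gt1; exact: pcharf_prime charK. Qed.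
Let OX a n : O a -> O (a ^+ n). Proof. exact: (@subringX _ _ sO). Qed.

Let powp (a : K) : a ^+ p = a * a ^+ p.-1. Proof. by rewrite -exprS prednK. Qed.

Lemma nonunit_inv a : O a -> ~ m a -> a != 0 /\ O a^-1.
Proof.
move=> Oa nma; split; last exact: (lp_unit lO).
by apply/eqP => a0; apply: nma; rewrite a0; exact: lp0 lO.
Qed.

Let mX a : O a -> m (a ^+ p) -> m a.
Proof.
move=> Oa ma; apply: contrapT => nma; have [a0 Oa'] := nonunit_inv Oa nma.
apply: (lp1 lO); rewrite -(mulVf (expf_neq0 p a0)) -exprVn.
by apply: (lpM lO) => //; exact: OX.
Qed.

Let mP a n : m a -> (0 < n)%N -> m (a ^+ n).
Proof.
by case: n => // n ma _; rewrite exprSr; apply: (lpM lO) => //; apply: OX; exact: lp_sub ma.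
Qed.

(* Nakayama's lemma: since [p >= 2], the terms of the p-basis expansion whose
   coefficient lies in [m] belong to [m * m]. *)
Lemma maximal_ideal_gen x w D E I : pbasis O x w D E -> ideal O I ->
    (forall e, (forall l j, O (e l j)) -> m (pexp p x w e) ->
      forall l j, (l < p)%N -> (j < p)%N -> I (x ^+ l * w ^+ j) \/ m (e l j ^+ p)) ->
  m `<=` I.
Proof.
move=> pb iI hI; have [Ox Ow _ _ _ _ _ _ _ _] := pb.
have [s [sm ms]] := nO im; have [g0 gD gM] := gen_by_ideal s im.
have aU x' : m x' -> 1 - x' != 0 /\ O (1 - x')^-1.
  move=> mx; apply: nonunit_inv.
    by apply: (subringB sO); [exact: subring1 | exact: lp_sub mx].
  by move=> h; apply: (lp1 lO); rewrite -(subrK x' 1); exact: idD im _ _ _ _.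
have sI : forall y, y \in s -> I y.
  apply: (nakayama sO im aU (idD iI) _ (id0 iI)) => [b y Ob Iy|y ys]; first exact: idM iI _ _ Ob Iy.
  have my := sm _ ys; have [e [Oe yE]] := pexp_expand charK deg sO root pb (lp_sub lO my).
  suff : exists z, I z /\ gen_by m s (pexp p x w e - z) by rewrite -yE.
  have key (T : Type) (r : seq T) (F : T -> K) : (forall i, exists z, I z /\ gen_by m s (F i - z)) ->
      exists z, I z /\ gen_by m s (\sum_(i <- r) F i - z).
    move=> h; elim: r => [|i r [z [Iz hz]]].
      by exists 0; rewrite big_nil subrr; split=> //; exact: id0 iI.
    have [z' [Iz' hz']] := h i; exists (z' + z); split; first exact: idD iI _ _ _ _.
    by rewrite big_cons opprD addrACA; exact: gD.
  apply: (key) => l; apply: (key) => j.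
  have me : m (pexp p x w e) by rewrite -yE.
  have [Ilj|mlj] := hI e Oe me l j (ltn_ord l) (ltn_ord j).
    exists (e l j ^+ p * (x ^+ l * w ^+ j)); split; last by rewrite mulrA subrr.
    by apply: (idM iI) => //; exact: OX.
  exists 0; split; first exact: id0 iI.
  have mel := mX (Oe l j) mlj.
  have -> : e l j ^+ p * x ^+ l * w ^+ j - 0 = e l j * (x ^+ l * w ^+ j * e l j ^+ p.-1).
    by rewrite subr0 powp; ring.
  apply: (gen_by_scale (A := O)) => //; apply: ms; apply: (lpM lO).
    by apply: (subringM sO); exact: OX.
  by apply: mP => //; rewrite -subn1 subn_gt0.
by move=> f /ms; apply: gen_by_sub.
Qed.

Let msub f I : m f -> I `<=` [set g | exists2 a, O a & g = f * a] -> I `<=` m.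
Proof. by move=> mf h g /h[a Oa ->]; rewrite mulrC; exact: (lpM lO). Qed.

(** If both derivations preserved [m], the coefficients in expansions of elements of [m] would lie
    in [m], and [maximal_ideal_gen] for the zero ideal would give m = 0. An element of [m] with a
    unit derivative is exchanged into the p-basis. *)
Lemma move_maximal x w D E : pbasis O x w D E -> m <> [set 0] ->
  exists x' f D' E', m f /\ pbasis O x' f D' E'.
Proof.
move=> pb m0; have [Ox Ow dD dE DO EO Dx Dw Ex Ew] := pb.
have [[f [mf nf]]|noE] := pselect (exists f, m f /\ ~ m (E f)).
  have [n0 Oi] := nonunit_inv (EO _ (lp_sub lO mf)) nf.
  by exists x, f; do 2!eexists; split=> //; exact: pbasis_exchange pb (lp_sub lO mf) n0 Oi.
have [[f [mf nf]]|noD] := pselect (exists f, m f /\ ~ m (D f)).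
  have [n0 Oi] := nonunit_inv (DO _ (lp_sub lO mf)) nf.
  exists w, f; do 2!eexists; split=> //.
  exact: pbasis_exchange (pbasis_swap pb) (lp_sub lO mf) n0 Oi.
case: m0; apply/seteqP; split; last by move=> _ ->; exact: lp0 lO.
have i0 : ideal O [set 0].
  split.
  - by move=> _ ->; exact: subring0.
  - by [].
  - by move=> _ _ -> ->; rewrite addr0.
  - by move=> a _ _ ->; rewrite mulr0.
apply: (maximal_ideal_gen pb i0) => e Oe me l j lp jp; right.
apply: (pexp_coefs charK pb) me l j lp jp.
  split; [exact: lp0 lO | exact: lpB lO | by move=> a ma; apply: (lpM lO) |].
  by move=> a ma; apply: contrapT => h; apply: noD; exists a.
split; [exact: lp0 lO | exact: lpB lO | by move=> a ma; apply: (lpM lO) |].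
by move=> a ma; apply: contrapT => h; apply: noE; exists a.
Qed.

(** If [D] preserves [m], expansions modulo [f] have coefficients in [m], and [f] generates [m].
    Otherwise some [h] in [m] with [D h] a unit forms a p-basis with [f], and 1 is the only monomial
    outside the ideal they generate. *)
Lemma regular_system x f D E : pbasis O x f D E -> m f ->
  m = [set g | exists2 a, O a & g = f * a] \/
  exists h, m = [set g | exists a b, [/\ O a, O b & g = a * h + b * f]].
Proof.
move=> pb mf; have [Ox Of dD dE DO EO Dx Dw Ex Ew] := pb.
have [[h [mh nh]]|noD] := pselect (exists h, m h /\ ~ m (D h)); last first.
  left; apply/seteqP; split; last by apply: (msub mf).
  have iI : ideal O [set g | exists2 a, O a & g = f * a].
    split.
    - by move=> _ [a Oa ->]; exact: subringM.
    - by exists 0; [exact: subring0 | rewrite mulr0].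
    - by move=> _ _ [a Oa ->] [b Ob ->]; exists (a + b); [exact: subringD | rewrite mulrDr].
    - by move=> c _ Oc [a Oa ->]; exists (c * a); [exact: subringM | ring].
  apply: (maximal_ideal_gen pb iI) => e Oe me l [|j] lp jp; last first.
    by left; exists (x ^+ l * f ^+ j); [apply: (subringM sO); exact: OX | rewrite exprS; ring].
  right; have dS : der_stable D x m.
    split; [exact: lp0 lO | exact: lpB lO | by move=> a ma; apply: (lpM lO) |].
    by move=> a ma; apply: contrapT => h; apply: noD; exists a.
  apply: (der_coefs charK (c := fun l => e l 0%N ^+ p) dD Dx dS (leqnn p)) lp.
    by move=> l' _; exact: der_frob.
  have -> : \sum_(l < p) e l 0%N ^+ p * x ^+ l =
      pexp p x f e - \sum_(l < p) \sum_(j < p | j != Ordinal p_gt0) e l j ^+ p * x ^+ l * f ^+ j.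
    rewrite /pexp -sumrB; apply: eq_bigr => l' _.
    by rewrite (bigD1 (Ordinal p_gt0)) //= expr0 mulr1 addrK.
  apply: (lpB lO) => //; apply: (id_sum _ im) => l' _; apply: (id_sum _ im) => j j0.
  apply: (lpM lO); first by apply: (subringM sO); do ?apply: OX.
  by apply: mP => //; rewrite lt0n; apply: contra j0 => /eqP e0; apply/eqP/val_inj.
right; exists h; have [n0 Oi] := nonunit_inv (DO _ (lp_sub lO mh)) nh.
have pb' := pbasis_exchange sO (pbasis_swap pb) (lp_sub lO mh) n0 Oi.
apply/seteqP; split; last first.
  move=> _ [a [b [Oa Ob ->]]]; apply: (idD im); exact: (lpM lO).
have iI : ideal O [set g | exists a b, [/\ O a, O b & g = a * h + b * f]].
  split.
  - by move=> _ [a [b [Oa Ob ->]]]; apply: (subringD sO); apply: (subringM sO) => //; exact: lp_sub mh.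
  - by exists 0, 0; split; [exact: subring0 | exact: subring0 | ring].
  - move=> _ _ [a [b [Oa Ob ->]]] [c [d [Oc Od ->]]].
    by exists (a + c), (b + d); split; [exact: subringD | exact: subringD | ring].
  - move=> c _ Oc [a [b [Oa Ob ->]]].
    by exists (c * a), (c * b); split; [exact: subringM | exact: subringM | ring].
apply: (maximal_ideal_gen pb' iI) => e Oe me [|l] [|j] lp jp.
- right; have -> : e 0%N 0%N ^+ p = pexp p f h e -
      (\sum_(l < p | l != Ordinal p_gt0) \sum_(j < p) e l j ^+ p * f ^+ l * h ^+ j +
       \sum_(j < p | j != Ordinal p_gt0) e 0%N j ^+ p * f ^+ 0 * h ^+ j).
    rewrite /pexp (bigD1 (Ordinal p_gt0)) //= (bigD1 (Ordinal p_gt0)) //= !expr0 !mulr1.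
    by rewrite -[X in _ = X]addrA; ring.
  have pos (j : 'I_p) : j != Ordinal p_gt0 -> (0 < j)%N.
    by rewrite lt0n; apply: contra => /eqP e0; apply/eqP/val_inj.
  have Oh := lp_sub lO mh.
  apply: (lpB lO) => //; apply: (idD im); apply: (id_sum _ im) => j j0.
    apply: (id_sum _ im) => j' _; rewrite mulrAC; apply: (lpM lO).
      by apply: (subringM sO); apply: OX.
    by apply: mP => //; exact: pos.
  apply: (lpM lO); first by apply: (subringM sO); apply: OX.
  by apply: mP => //; exact: pos.
- left; exists (h ^+ j), 0; split; [apply: OX; exact: lp_sub mh | exact: subring0 | rewrite expr0 exprS; ring].
- left; exists 0, (f ^+ l); split; [exact: subring0 | exact: OX | rewrite expr0 exprS; ring].
- left; exists 0, (f ^+ l * h ^+ j.+1); split; [exact: subring0 | | rewrite exprS; ring].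
  by apply: (subringM sO); apply: OX => //; exact: lp_sub mh.
Qed.

End RegularSystem.

Lemma pbasis_jacobian (K : fieldType) (O : set K) t u Dt Du x v : subring O -> pbasis O t u Dt Du ->
    O x -> O v -> Dt x * Du v - Du x * Dt v != 0 -> O (Dt x * Du v - Du x * Dt v)^-1 ->
  exists D E, pbasis O x v D E.
Proof.
move=> sO [Ot Ou dt du tO uO _ _ _ _] Ox Ov; set J := _ - _ => J0 OJ.
exists (fun f => (J^-1 * Du v) * Dt f + (- (J^-1 * Dt v)) * Du f),
  (fun f => (- (J^-1 * Du x)) * Dt f + (J^-1 * Dt x) * Du f).
have OM a b c d : O a -> O b -> O c -> O d -> O (a * b + c * d).
  by move=> *; apply: (subringD sO); exact: (subringM sO).
have OJm a : O a -> O (J^-1 * a) by exact: (subringM sO).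
have ON a : O a -> O (- a) by exact: (subringN sO).
split=> //.
- exact: der_lin.
- exact: der_lin.
- by move=> f Of; apply: OM; do ?[apply: ON | apply: OJm | apply: tO | apply: uO].
- by move=> f Of; apply: OM; do ?[apply: ON | apply: OJm | apply: tO | apply: uO].
- by rewrite -[RHS](mulVf J0) /J; ring.
- by ring.
- by ring.
- by rewrite -[RHS](mulVf J0) /J; ring.
Qed.

Lemma mderivXp (k : fieldType) n (i : 'I_n) (P : {mpoly k[n]}) p : p \in [pchar k] ->
  mderiv i (P ^+ p) = 0.
Proof.
move=> chark; have E m : mderiv i (P ^+ m) = P ^+ m.-1 * mderiv i P *+ m.
  elim: m => [|m IH]; first by rewrite expr0 mderivC mulr0n.
  rewrite exprS mderivM IH mulrnAr mulrS; congr (_ + _).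
    by rewrite mulrC.
  by case: m {IH} => [|m]; rewrite ?mulr0n // mulrA -exprS.
by rewrite E -mulr_natr (pcharf0 (rmorph_pchar (@mpolyC n k) chark)) mulr0.
Qed.

Lemma mderiv_var (k : fieldType) n (i j : 'I_n) : mderiv i ('X_j : {mpoly k[n]}) = (i == j)%:R.
Proof.
rewrite mderivX mnm1E eq_sym; case: eqP => [->|_]; last by rewrite scale0r.
rewrite scale1r (_ : (U_(j) - U_(j))%MM = 0%MM) ?mpolyX0 //.
by apply/mnmP => l; rewrite mnmBE subnn mnm0E.
Qed.

Lemma mderiv_sum (k : fieldType) n (i : 'I_n) (I : Type) (r : seq I) (P : pred I)
    (F : I -> {mpoly k[n]}) :
  mderiv i (\sum_(j <- r | P j) F j) = \sum_(j <- r | P j) mderiv i (F j).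
Proof. exact: (big_morph _ (@mderivD _ _ i) (@mderiv0 _ _ i)). Qed.

(** * Smoothness from a p-basis of coordinates *)

Section Smooth.
Variables (k : fieldType) (X : proj_variety k) (p : nat).
Local Notation s := (@Defs.coord _ X).
Local Notation iota := (constants X).
Local Notation A := (chart iota s).
Hypothesis k_perfect : perfect_field p k.
Hypothesis X_surface : dim_is (@pt _ X) 2.
Hypothesis X_normal : normal_variety X.
Implicit Types (x y P : set X).

Let chark : p \in [pchar k]. Proof. by case: k_perfect. Qed.
Let charX : p \in [pchar X]. Proof. exact: surface_pchar. Qed.
Let deg : pdeg_le2 X p. Proof. by case: (surface_pdegree k_perfect X_surface). Qed.
Let p_gt0 : (0 < p)%N. Proof. by apply: prime_gt0; exact: pcharf_prime charX. Qed.

Lemma der_const D c : derivation D -> D (iota c) = 0 :> X.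
Proof.
by move=> dD; have [b <-] := (proj2 k_perfect) c; rewrite rmorphXn (der_frob charX).
Qed.

Lemma pt_root y a : pt y -> y (a ^+ p) -> y a.
Proof.
move=> py ya; have sy := pt_ring py; apply: (@pt_normal _ _ X_normal y py a ('X^p - (a ^+ p)%:P)).
- by rewrite monicXnsubC.
- move=> j; rewrite coefB coefXn coefC; apply: (subringB sy).
    exact: subring_nat.
  by case: ifP => _ //; exact: subring0.
- by rewrite /root !hornerE subrr.
Qed.

Lemma der_pt D y i : derivation D -> s i != 0 -> pt y -> A i `<=` y ->
  (forall j, y (D (s j / s i))) -> forall f, y f -> y (D f).
Proof.
move=> dD si py Ay hD; have sy := pt_ring py; have ly := pt_local py.
have DA : A i `<=` [set f | y f /\ y (D f)].
  apply: eval_range_min => [|c|j] /=.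
  - split=> [|a b [ya yDa] [yb yDb]|a b [ya yDa] [yb yDb]] /=.
    + by rewrite (der1 dD); split; [exact: subring1 | exact: subring0].
    + by rewrite (derB _ _ dD); split; exact: subringB.
    + rewrite (derM dD); split; first exact: subringM.
      by apply: (subringD sy); exact: subringM.
  - by rewrite der_const //; split; [exact: pt_const | exact: subring0].
  - by split; [apply: Ay; exact: chart_var | exact: hD].
move=> f; rewrite {1}(pt_in_chart si py Ay) => -[a [b [Aa Ab nb ->]]].
have [ya yDa] := DA a Aa; have [yb yDb] := DA b Ab.
have b0 := notin_prime0 (nonunits_prime py Ay) nb.
have ybV : y b^-1 by apply: (lp_unit ly) => // h; apply: nb.
rewrite (derM dD) (derV _ dD); apply: (subringD sy); last exact: subringM.
apply: (subringM sy) => //; apply: (subringN sy); apply: (subringM sy) => //.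
by rewrite -exprVn; exact: (@subringX _ _ sy).
Qed.

(** The Jacobian is a derivation in each argument. If it were in the maximal ideal for all pairs of
    coordinates, this would extend to all pairs in [P], one argument at a time; but it is 1 for (t,
    u). *)
Lemma jacobian_minor P t u Dt Du i : s i != 0 -> pt P -> A i `<=` P -> pbasis P t u Dt Du ->
  exists j j', ~ nonunits P (Dt (s j / s i) * Du (s j' / s i) - Du (s j / s i) * Dt (s j' / s i)).
Proof.
move=> si pP AP [Pt Pu dt du tO uO Dtt Dtu Dut Duu]; apply: contrapT => no.
have lP := pt_local pP; have sP := pt_ring pP; have im := lp_ideal lP.
have all (F : X -> X) : (forall f, P f -> P (F f)) -> derivation F ->
    (forall j, nonunits P (F (s j / s i))) -> forall f, P f -> nonunits P (F f).
  move=> FO dF hF.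
  have FA : A i `<=` [set f | P f /\ nonunits P (F f)].
    apply: eval_range_min => [|c|j] /=.
    - split=> [|a b [ya yDa] [yb yDb]|a b [ya yDa] [yb yDb]] /=.
      + by rewrite (der1 dF); split; [exact: subring1 | exact: lp0 lP].
      + by rewrite (derB _ _ dF); split; [exact: subringB | exact: lpB lP _ _ _ _].
      + rewrite (derM dF); split; first exact: subringM.
        by apply: (idD im); apply: (lpM lP).
    - by rewrite der_const //; split; [exact: pt_const | exact: lp0 lP].
    - by split; [apply: AP; exact: chart_var | exact: hF].
  move=> f; rewrite {1}(pt_in_chart si pP AP) => -[a [b [Aa Ab nb ->]]].
  have [ya yDa] := FA a Aa; have [yb yDb] := FA b Ab.
  have b0 := notin_prime0 (nonunits_prime pP AP) nb.
  have ybV : P b^-1 by apply: (lp_unit lP) => // h; apply: nb.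
  rewrite (derM dF) (derV _ dF); apply: (idD im); last by apply: (lpM lP).
  have -> : a * - (F b / b ^+ 2) = (- (a * b^-1 ^+ 2)) * F b by rewrite exprVn; ring.
  apply: (lpM lP) => //; apply: (subringN sP); apply: (subringM sP) => //; exact: (@subringX _ _ sP).
have minor h f : P h -> P f -> (forall j, nonunits P (Dt (s j / s i) * Du h - Du (s j / s i) * Dt h)) ->
    nonunits P (Dt f * Du h - Du f * Dt h).
  move=> Ph Pf hj; pose F g := Du h * Dt g + (- Dt h) * Du g.
  have FE g : F g = Dt g * Du h - Du g * Dt h by rewrite /F; ring.
  rewrite -FE; apply: all Pf => [g Pg||j]; last by rewrite FE.
    by apply: (subringD sP); apply: (subringM sP); do ?apply: (subringN sP); auto.
  exact: der_lin.
have h1 j f : P f -> nonunits P (Dt f * Du (s j / s i) - Du f * Dt (s j / s i)).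
  move=> Pf; apply: minor => //; first by apply: AP; exact: chart_var.
  by move=> j'; apply: contrapT => h; apply: no; exists j', j.
have : nonunits P (Dt t * Du u - Du t * Dt u).
  apply: minor => // j; have := h1 j u Pu.
  have -> : Dt (s j / s i) * Du u - Du (s j / s i) * Dt u =
    (-1) * (Dt u * Du (s j / s i) - Du u * Dt (s j / s i)) by ring.
  by apply: (lpM lP); apply: (subringN sP); exact: subring1.
by rewrite Dtt Duu Dut mul0r subr0 mulr1; exact: lp1 lP.
Qed.

(** The p-basis expansion of each remaining coordinate, with denominators cleared by b^p, is an
    equation whose coefficients are p-th powers. Its derivatives outside the columns j0 and j1
    therefore see only the linear term, and the minor is diagonal with unit entries b^p. *)
Lemma smooth_of_basis y i j0 j1 D E : s i != 0 -> pt y -> A i `<=` y -> j1 != j0 ->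
  pbasis y (s j1 / s i) (s j0 / s i) D E -> smooth_at y.
Proof.
move=> si py Ay j10 pb; have sA := @chart_ring _ X i; have sy := pt_ring py; have ly := pt_local py.
have pq := nonunits_prime py Ay; have yE := pt_in_chart si py Ay.
exists 2%N; split=> //; exists i; split=> //; split; first by exists (A i `&` nonunits y).
set ev := mpoly.mmap _ _ => /=.
have /choice[g hg] : forall j, exists g : {mpoly k[(@ambient_dim _ X).+1]}, ev g = 0 /\
    exists b, [/\ y b, b != 0, y b^-1 & forall h, h != j0 -> h != j1 -> ev (mderiv h g) = (h == j)%:R * b].
  move=> j; have ya : y (s j / s i) by apply: Ay; exact: chart_var.
  have [e [ye aE]] := pexp_expand charX deg sy (fun a => @pt_root y a py) pb ya.
  have [|b [Ab nb hb]] := @loc_denominator _ (A i) _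
      [seq e l m | l <- seq.iota 0 p, m <- seq.iota 0 p] sA pq.
    by move=> _ /allpairsP[[l m] /= [_ _ ->]]; rewrite -yE.
  have b0 := notin_prime0 pq nb.
  have ybV : y b^-1 by apply: (lp_unit ly); [exact: Ay | move=> h; apply: nb].
  have [Q bE] := Ab.
  have /choice[G hG] : forall lm : nat * nat, exists G : {mpoly k[(@ambient_dim _ X).+1]},
      (lm.1 < p)%N -> (lm.2 < p)%N -> ev G = b * e lm.1 lm.2.
    move=> [l m] /=; have [lp|] := ltnP l p; last by exists 0.
    have [mp|] := ltnP m p; last by exists 0.
    have [|G GE] := hb (e l m); last by exists G.
    by apply/allpairsP; exists (l, m); rewrite /= !mem_iota lp mp.
  exists ('X_j * Q ^+ p - \sum_(l < p) \sum_(m < p) G (nat_of_ord l, nat_of_ord m) ^+ p * ('X_j1 ^+ l * 'X_j0 ^+ m)); split.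
    rewrite /ev rmorphB rmorphM rmorphXn rmorph_sum /= mmapX mmap1U -bE /affine_coord.
    rewrite -[X in X * _]/(s j / s i) aE /pexp mulr_suml; apply/eqP; rewrite subr_eq0; apply/eqP.
    apply: eq_bigr => l _; rewrite rmorph_sum mulr_suml; apply: eq_bigr => m _.
    rewrite !rmorphM !rmorphXn /= !mmapX !mmap1U -/ev (hG (_, _) (ltn_ord l) (ltn_ord m)) /affine_coord /= [(b * _) ^+ p]exprMn; ring.
  exists (b ^+ p); split.
  - by apply: (@subringX _ _ sy); exact: Ay.
  - exact: expf_neq0.
  - by rewrite -exprVn; exact: (@subringX _ _ sy).
  - move=> h hj0 hj1; rewrite mderivB mderivM mderivXp // mulr0 addr0 mderiv_var mderiv_sum.
    rewrite big1 ?subr0 => [|l _].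
      rewrite ?addr0 /ev rmorphM rmorph_nat rmorphXn /=; congr (_ * _ ^+ _); exact: esym bE.
    rewrite mderiv_sum big1 // => m _; rewrite mderivM mderivXp // mul0r add0r.
    have dX (j' : 'I_(@ambient_dim _ X).+1) n : h != j' -> mderiv h ('X_j' ^+ n : {mpoly k[_]}) = 0.
      move=> hj'; elim: n => [|n IH]; first by rewrite expr0 mderivC.
      by rewrite exprS mderivM IH mulr0 addr0 mderiv_var (negbTE hj') mul0r.
    by rewrite mderivM !dX // mul0r mulr0 addr0 mulr0.
pose H := [seq j <- enum 'I_(@ambient_dim _ X).+1 | (j != j0) && (j != j1)].
have uH : uniq H by rewrite filter_uniq // enum_uniq.
have sH : size H = ((@ambient_dim _ X).+1 - 2)%N.
  rewrite -(card_uniqP uH) -[in RHS](card_ord (@ambient_dim _ X).+1) -(cardC (pred2 j0 j1)) card2 eq_sym j10 addKn.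
  by apply: eq_card => j; rewrite !inE mem_filter mem_enum andbT negb_or.
pose h (b : 'I_((@ambient_dim _ X).+1 - 2)) := nth j0 H b.
have hH b : h b \in H by apply: mem_nth; rewrite sH.
have hinj a b : h a = h b -> a = b.
  by move/eqP; rewrite nth_uniq ?sH // => /eqP e; apply: val_inj.
exists (fun a => g (h a)), h; split; first by move=> a; case: (hg (h a)).
have /choice[b hb] : forall a, exists b, [/\ y b, b != 0, y b^-1 &
    forall l, l != j0 -> l != j1 -> ev (mderiv l (g (h a))) = (l == h a)%:R * b].
  by move=> a; case: (hg (h a)) => _.
have -> : \matrix_(a, b0) ev (mderiv (h b0) (g (h a))) = diag_mx (\row_a b a).
  apply/matrixP => a c; rewrite !mxE; have [_ _ _ ->] := hb a.
    have [->|ac] := eqVneq a c; first by rewrite eqxx mul1r.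
    by case: eqP => [/hinj e|_]; rewrite ?mul0r // e eqxx in ac *.
    by have := hH c; rewrite mem_filter => /andP[/andP[]].
  by have := hH c; rewrite mem_filter => /andP[/andP[]].
rewrite det_diag; split.
  by apply/prodf_neq0 => a _; rewrite mxE; case: (hb a).
rewrite -prodfV; apply: (subring_prod sy) => a _; rewrite mxE; by case: (hb a).
Qed.

End Smooth.

Section LogSmooth.
Variables (k : fieldType) (X : proj_variety k) (p : nat).
Local Notation s := (@Defs.coord _ X).
Local Notation iota := (constants X).
Local Notation A := (chart iota s).
Hypothesis k_perfect : perfect_field p k.
Hypothesis X_surface : dim_is (@pt _ X) 2.
Hypothesis X_normal : normal_variety X.
Implicit Types (x y P Q : set X).

Let charX : p \in [pchar X]. Proof. exact: surface_pchar. Qed.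
Let deg : pdeg_le2 X p. Proof. by case: (surface_pdegree k_perfect X_surface). Qed.

Lemma codim_generic : codim_is [set: X] 0.
Proof.
split; first by exists (fun=> setT); split=> [j|[[|j] jp] [[|l] lp]] //; split=> //; exact: pt_generic.
move=> [c [hc hlt]]; have [_ [_ sub]] := conj I (conj I (hc ord0).2).
have [_ nsub] := hlt ord0 (@Ordinal 2 1 isT) isT.
by apply: nsub => f _; exact: (hc ord0).2.
Qed.

Lemma codim_cases y : pt y -> y <> setT -> prime_divisor y \/ codim_is y 2.
Proof.
move=> py yT; have [d1|nd1] := pselect (codim_is y 1); [by left; split | right].
have c1 : has_chain [set z | pt z /\ y `<=` z] 1.
  exists (fun j : 'I_2 => if j == ord0 then y else setT); split.
    by move=> j; case: ifP => _; split=> //; exact: pt_generic.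
  by case=> -[|[|j]] jp; case=> -[|[|l]] lp //= _; exact: properN.
split; first by apply: contrapT => h; apply: nd1; split.
move=> [c [hc hlt]]; apply: (proj2 X_surface); exists c; split=> // j.
by case: (hc j).
Qed.

Lemma pt_field y : pt y -> nonunits y = [set 0] -> y = setT.
Proof.
move=> py m0; have ly := pt_local py; apply/seteqP; split=> // f _.
have [a [b [ya yb b0 ->]]] := pt_frac py f; apply: (subringM (lp_ring ly)) => //.
by apply: (lp_unit ly) => //; rewrite m0 => /eqP; rewrite (negbTE b0).
Qed.

Lemma principal_divisor y f : pt y -> y <> setT ->
  nonunits y = [set g | exists2 a, y a & g = f * a] -> prime_divisor y.
Proof.
move=> py yT mE; apply: (dvr_prime_divisor (t := f)) => //; apply: (dvr_of_principal (pt_noetherian py) (pt_local py) (pt_frac py)) => //.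
apply/eqP => f0; apply: yT; apply: (pt_field py); rewrite mE f0.
apply/seteqP; split; first by move=> _ [a _ ->]; rewrite mul0r.
by move=> _ ->; exists 0; [exact: subring0 (pt_ring py) | rewrite mul0r].
Qed.

Variable B' : set X -> int.
Hypothesis B'_prime : forall Q, B' Q != 0 -> prime_divisor Q.

(** The generic point and prime divisors take zero and one parameter. In codimension 2, either [t]
    is in the maximal ideal and belongs to a pair of parameters by [regular_system], or the boundary
    does not pass through [y] and any pair from [move_maximal] serves. *)
Lemma snc_of_basis y P t u Dt Du : pt y -> prime_divisor P -> dvr P t -> pbasis y t u Dt Du ->
    (forall g, y g -> nonunits P g -> y (g / t)) -> nonunits P = [set g | exists2 a, P a & g = t * a] ->
    (forall Q, B' Q != 0 -> y `<=` Q -> Q = P) ->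
  snc_at B' y.
Proof.
move=> py dP dO pb div tE comp; have ly := pt_local py; have sy := pt_ring py.
have [yT|yT] := pselect (y = setT).
  exists 0%N, (fun=> 0); rewrite yT; split; first exact: codim_generic.
    apply/seteqP; split=> [f [_ [->|]]|f [a [_ ->]]] //; last first.
      by rewrite big_ord0; split=> //; left.
    by exists (fun=> 0); split=> [[]//|]; rewrite big_ord0.
  move=> Q BQ sub; case: (divisor_proper (B'_prime BQ)).
  by apply/seteqP; split=> // f _; exact: sub.
have [dy|cy] := codim_cases py yT.
  have [t' [dt' mE]] := prime_divisor_dvr X_normal dy.
  have mE' : nonunits y = [set t' * a | a in y].
    by rewrite mE; apply/seteqP; split=> [_ [a ya ->]|_ [a ya <-]]; exists a.
  exists 1%N, (fun=> t'); split; first by case: dy.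
    rewrite -[max_ideal y]/(nonunits y) mE; apply/seteqP; split=> f.
      by move=> [a ya ->]; exists (fun=> a); split=> //; rewrite big_ord1 mulrC.
    by move=> [a [ya ->]]; rewrite big_ord1; exists (a ord0); rewrite // mulrC.
  move=> Q BQ yQ; exists ord0; have dQ := B'_prime BQ.
  have [->|QT] := divisor_above dy dQ.1 yQ; last by case: (divisor_proper dQ).
  rewrite /local_equation -[max_ideal y]/(nonunits y) -mE'.
  by apply/seteqP; split=> [f []|f mf] //; split=> //; exact: lp_sub mf.
have ndy : ~ prime_divisor y by move=> [_ [_ no]]; case: cy => c _; exact: (no c).
have root a : y (a ^+ p) -> y a by exact: (pt_root k_perfect X_normal py).
have nonprincipal f : nonunits y <> [set g | exists2 a, y a & g = f * a].
  by move=> mE; apply: ndy; exact: principal_divisor mE.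
have two f h : nonunits y = [set g | exists a b, [/\ y a, y b & g = a * h + b * f]] ->
    max_ideal y = [set g | exists a : 'I_2 -> X, (forall j, y (a j)) /\
      g = \sum_j a j * (if j == ord0 then f else h)].
  rewrite -[max_ideal y]/(nonunits y) => ->; apply/seteqP; split=> g.
    move=> [a [b [ya yb ->]]]; exists (fun j => if j == ord0 then b else a); split.
      by move=> j; case: ifP.
    by rewrite big_ord_recl big_ord1 /= addrC.
  move=> [a [ya ->]]; rewrite big_ord_recl big_ord1 /=.
  by exists (a (lift ord0 ord0)), (a ord0); split; rewrite // addrC.
have [mt|nmt] := pselect (nonunits y t).
  have [|[h mE]] := regular_system charX deg ly (pt_noetherian py) root (pbasis_swap pb) mt.
    by move/nonprincipal.
  exists 2%N, (fun j => if j == ord0 then t else h); split=> //; first exact: two.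
  move=> Q BQ yQ; have QP := comp Q BQ yQ; exists ord0; rewrite /= QP; rewrite QP in yQ.
  rewrite /local_equation -[max_ideal P]/(nonunits P); apply/seteqP; split.
    by move=> g [yg mg]; exists (g / t); [exact: div | rewrite mulrC divfK // (dvr_t0 dO)].
  move=> _ [a ya <-]; split; first by apply: (subringM sy) => //; exact: pb_x pb.
  by rewrite tE; exists a => //; exact: yQ.
have m0 : nonunits y <> [set 0] by move/(pt_field py).
have [x' [f [D' [E' [mf pb']]]]] := move_maximal charX deg ly (pt_noetherian py) root pb m0.
have [|[h mE]] := regular_system charX deg ly (pt_noetherian py) root pb' mf.
  by move/nonprincipal.
exists 2%N, (fun j => if j == ord0 then f else h); split=> //; first exact: two.
move=> Q BQ yQ; case: (dvr_tV dO); rewrite -(comp Q BQ yQ); apply: yQ.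
by apply: (lp_unit ly) => //; exact: pb_x pb.
Qed.

(** Finitely many functions are made regular around [P]: they keep (t, u) a p-basis, keep a Jacobian
    minor of two coordinates invertible, and exclude the other boundary components. *)
Theorem divisor_log_smooth P : finite_set [set Q | B' Q != 0] -> prime_divisor P ->
  log_smooth_locus B' P.
Proof.
move=> finB dP; have pP := dP.1; have lP := pt_local pP; have sP := pt_ring pP.
have [t [dO tE]] := prime_divisor_dvr X_normal dP.
have [u [Dt [Du pb]]] := divisor_pbasis k_perfect X_surface dP dO tE.
have [i [si AP]] := pt_chart pP.
have [j1 [j0 nJ]] := jacobian_minor k_perfect si pP AP pb.
set J := _ - _ in nJ; have [Pt Pu dt du tO uO Dtt Dtu Dut Duu] := pb.
have Pa j : P (s j / s i) by apply: AP; exact: chart_var.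
have PJ : P J by apply: (subringB sP); apply: (subringM sP); auto.
have [J0 PJV] := nonunit_inv lP PJ nJ.
(* [sep Q] is regular at [P] but not at [Q]; where it is regular, no point specializes [Q]. *)
have /choice[sep hsep] : forall Q, exists g, B' Q != 0 -> Q <> P -> P g /\ ~ Q g.
  move=> Q; have [[BQ QP]|h] := pselect (B' Q != 0 /\ Q <> P); last first.
    by exists 0 => BQ QP; case: h.
  have [PQ|/existsNP[g /not_implyP[Pg nQ]]] := pselect (P `<=` Q); last by exists g.
  have dQ := B'_prime BQ; exfalso; have [//|QT] := divisor_above dP dQ.1 PQ.
  exact: (divisor_proper dQ).
have /finite_seqP[gs gsE] := finite_image sep finB.
pose fs := [:: u; J^-1] ++ [seq s j / s i | j <- enum 'I_(@ambient_dim _ X).+1] ++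
  [seq Dt (s j / s i) | j <- enum 'I_(@ambient_dim _ X).+1] ++
  [seq Du (s j / s i) | j <- enum 'I_(@ambient_dim _ X).+1] ++ [seq g <- gs | `[< P g >]].
have [|V [oV VP hV eV dV]] := local_open_equation (fs := fs) pP _ tE.
  move=> f; rewrite !mem_cat => /orP[|/orP[|/orP[|/orP[|]]]].
  - by rewrite !inE => /orP[/eqP->|/eqP->].
  - by move=> /mapP[j _ ->].
  - by move=> /mapP[j _ ->]; exact: tO.
  - by move=> /mapP[j _ ->]; exact: uO.
  - by rewrite mem_filter => /andP[/asboolP].
exists V; split=> // y Vy; have py := (proj1 oV) _ Vy; have sy := pt_ring py.
have ya j : y (s j / s i).
  by apply: hV => //; rewrite !mem_cat (map_f (fun j => s j / s i)) ?mem_enum ?orbT.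
have yt j : y (Dt (s j / s i)).
  by apply: hV => //; rewrite !mem_cat (map_f (fun j => Dt (s j / s i))) ?mem_enum ?orbT.
have yu j : y (Du (s j / s i)).
  by apply: hV => //; rewrite !mem_cat (map_f (fun j => Du (s j / s i))) ?mem_enum ?orbT.
have Ay : A i `<=` y.
  by apply: eval_range_min => // c; exact: pt_const.
have yuu : y u by apply: hV => //; rewrite mem_cat mem_head.
have yJ : y J^-1 by apply: hV => //; rewrite mem_cat !inE eqxx orbT.
have pby : pbasis y t u Dt Du.
  by split=> //; [case: (eV y Vy) | exact: (der_pt k_perfect dt si) | exact: (der_pt k_perfect du si)].
split.
  have [D [E pbj]] := pbasis_jacobian sy pby (ya j1) (ya j0) J0 yJ.
  apply: (smooth_of_basis k_perfect X_surface X_normal si py Ay _ pbj).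
  by apply: contraNneq J0 => e; rewrite /J e mulrC subrr.
apply: (snc_of_basis py dP dO pby _ tE) => [g yg mg|Q BQ yQ]; first exact: dV.
apply: contrapT => QP; have [Pg nQ] := hsep Q BQ QP; apply: nQ; apply: yQ.
apply: hV => //; rewrite !mem_cat mem_filter; apply/orP; right; apply/orP; right.
apply/orP; right; apply/orP; right; apply/andP; split; first exact/asboolP.
by have : [set` gs] (sep Q) by rewrite -gsE; exists Q.
Qed.

End LogSmooth.

(** * Kähler forms *)

From mathcomp Require Import freeg.

Lemma freegUZ (K : fieldType) (T : choiceType) (c d : K) (a : T) :
  c *: << d *g a >> = << (c * d) *g a >> :> {freeg T / K}.
Proof. by apply/eqP/freeg_eqP => b; rewrite coeffZ !coeffU mulrA. Qed.

Section Pairing.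
Variables (k K : fieldType) (iota : {rmorphism k -> K}) (i : nat).
Local Notation Omega := (kahler_forms iota i).
Local Notation symbols := {freeg {ffun 'I_i -> K} / K}.
Variable D : 'I_i -> K -> K.
Hypothesis D_der : forall r, derivation (D r).
Hypothesis D_const : forall r c, D r (iota c) = 0.

Let M (a : 'I_i -> K) : 'M[K]_i := \matrix_(l, r) D r (a l).
Let lift (w : symbols) : K^o := fglift (fun a : {ffun 'I_i -> K} => \det (M a) : K^o) w.

Let lift_symb a : lift (symb a) = \det (M a).
Proof.
rewrite /lift /symb liftU scale1r; congr (\det _); apply/matrixP => l r; by rewrite !mxE ffunE.
Qed.

Let liftB u v : lift (u - v) = lift u - lift v.
Proof. exact: lift_is_additive. Qed.
Let lift0 : lift 0 = 0.
Proof. by rewrite -(subrr 0) liftB subrr. Qed.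
Let liftD u v : lift (u + v) = lift u + lift v.
Proof. by rewrite -{1}[v]opprK liftB -sub0r liftB lift0 sub0r opprK. Qed.
Let liftZ c u : lift (c *: u) = c * lift u.
Proof.
elim/freeg_ind_dom0: u => [|d a u _ _ IH]; first by rewrite scaler0 lift0 mulr0.
rewrite scalerDr !liftD IH mulrDr; congr (_ + _).
by rewrite freegUZ /lift !liftU -scalerA.
Qed.

Let det_subst a j x y z b c : (forall r, D r x = b * D r y + c * D r z) ->
  \det (M (subst a j x)) = b * \det (M (subst a j y)) + c * \det (M (subst a j z)).
Proof.
move=> h; apply: (determinant_multilinear (i0 := j)).
- by apply/rowP => r; rewrite !mxE /subst eqxx h.
- by apply/matrixP => l r; rewrite !mxE /subst eq_sym (negbTE (neq_lift _ _)).
- by apply/matrixP => l r; rewrite !mxE /subst eq_sym (negbTE (neq_lift _ _)).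
Qed.

Let lift_relator w : kahler_relator iota w -> lift w = 0.
Proof.
case=> [a j x y|a j x y|a j c|a j l jl al].
- rewrite !liftB !lift_symb (@det_subst a j (x + y) x y 1 1); first by rewrite !mul1r; ring.
  by move=> r; rewrite (derD (D_der r)) !mul1r.
- rewrite !liftB !liftZ !lift_symb (@det_subst a j (x * y) y x x y); first by ring.
  by move=> r; rewrite (derM (D_der r)).
- rewrite lift_symb (@det_subst a j (iota c) 0 0 0 0); first by rewrite !mul0r addr0.
  by move=> r; rewrite D_const !mul0r addr0.
- rewrite lift_symb; apply: (determinant_alternate jl) => r.
  by rewrite !mxE al.
Qed.

(** Contraction with the wedge of the derivations [D r]. It does not depend on the representative
    since determinants respect all four kinds of relators. *)
Definition pairing (w : Omega) : K := lift (repr w).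

Let pairing_kform w : pairing (kform iota w) = lift w.
Proof.
have /kform_eq : kform iota (repr (kform iota w)) = kform iota w by exact: kformK.
rewrite /pairing => h; apply/eqP; rewrite -subr_eq0 -liftB; apply/eqP.
elim: h => [|c r u hr _ IH]; first exact: lift0.
by rewrite liftD liftZ (lift_relator hr) IH mulr0 addr0.
Qed.

Lemma pairingD u v : pairing (u + v) = pairing u + pairing v.
Proof. by rewrite -[u]kformK -[v]kformK -kformD !pairing_kform liftD. Qed.

Lemma pairingZ c u : pairing (c *: u) = c * pairing u.
Proof.
rewrite -[u]kformK -[c *: _]/(kscale c _) kformZ !pairing_kform liftZ //.
Qed.

Lemma pairing_wedge a : pairing (wedge_d iota a) = \det (\matrix_(l, r) D r (a l)).
Proof. by rewrite /wedge_d pairing_kform lift_symb. Qed.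

Lemma pairing_sum n (F : 'I_n -> Omega) : pairing (\sum_l F l) = \sum_l pairing (F l).
Proof.
elim: n F => [|n IH] F; last by rewrite !big_ord_recl pairingD IH.
by rewrite !big_ord0 -(scale0r (0 : Omega)) pairingZ mul0r.
Qed.

End Pairing.

Section Wedge.
Variables (k K : fieldType) (iota : {rmorphism k -> K}) (i : nat).
Local Notation Omega := (kahler_forms iota i).
Local Notation wedge := (wedge_d iota).

Let kform0 : kform iota 0 = 0 :> Omega.
Proof. by apply: (@addIr _ (kform iota 0)); rewrite -kformD !add0r. Qed.

Let relator0 w : kahler_relator iota w -> kform iota w = 0 :> Omega.
Proof.
move=> hr; rewrite -kform0; apply/kform_eq; rewrite subr0 -[w]scale1r -[1 *: w]addr0.
by apply: kahler_relation_lin => //; exact: kahler_relation0.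
Qed.

Let kformZ' c w : kform iota (c *: w) = c *: (kform iota w : Omega).
Proof. by rewrite -[RHS]/(kscale c _) kformZ. Qed.

Let kformB u v : kform iota (u - v) = kform iota u - kform iota v :> Omega.
Proof. by rewrite kformD -[- v]scaleN1r kformZ' scaleN1r. Qed.

Lemma wedge_add a j x y :
  wedge (subst a j (x + y)) = wedge (subst a j x) + wedge (subst a j y) :> Omega.
Proof.
have := relator0 (@relD _ _ iota i a j x y); rewrite !kformB => /eqP.
by rewrite subr_eq0 subr_eq /wedge_d => /eqP ->; exact: addrC.
Qed.

Lemma wedge_mul a j x y :
  wedge (subst a j (x * y)) = x *: wedge (subst a j y) + y *: wedge (subst a j x) :> Omega.
Proof.
have := relator0 (@relM _ _ iota i a j x y); rewrite !kformB !kformZ' => /eqP.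
by rewrite subr_eq0 subr_eq /wedge_d => /eqP ->; exact: addrC.
Qed.

Lemma wedge_alt a j l : j != l -> a j = a l -> wedge a = 0 :> Omega.
Proof. by move=> jl al; apply: relator0; exact: relA jl al. Qed.

Lemma subst_id (a : 'I_i -> K) j : subst a j (a j) = a.
Proof. by apply/funext => l; rewrite /subst; case: eqP => [->|]. Qed.

Lemma wedge_span (w : Omega) : exists n (c : 'I_n -> K) (a : 'I_n -> 'I_i -> K),
  w = \sum_l c l *: wedge (a l).
Proof.
rewrite -[w]kformK; elim/freeg_ind_dom0: (repr w) => [|c a u _ _ [n [d [b IH]]]].
  exists 0%N, (fun=> 0), (fun _ _ => 0); rewrite big_ord0.
  exact: kform0.
exists n.+1, (fun l => if unlift ord0 l is Some m then d m else c),
  (fun l => if unlift ord0 l is Some m then b m else a).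
rewrite kformD IH big_ord_recl unlift_none; congr (_ + _).
  rewrite -kformZ' /symb; congr kform; rewrite (_ : finfun a = a).
    by rewrite -[in LHS](mulr1 c) -freegUZ.
  by apply/ffunP => l; rewrite ffunE.
by apply: eq_bigr => l _; rewrite liftK.
Qed.

Variable p : nat.
Hypothesis charK : p \in [pchar K].
Hypothesis deg : pdeg_le2 K p.
Variables (z x : K) (Dz Dx : K -> K).
Hypothesis pb : pbasis setT z x Dz Dx.

Lemma wedge_chain a j : wedge a = Dz (a j) *: wedge (subst a j z) + Dx (a j) *: wedge (subst a j x) :> Omega.
Proof.
rewrite -{1}(subst_id a j).
exact: (pbasis_chain charK (delta := fun f => wedge (subst a j f) : Omega) (a j) deg pb (wedge_add a j) (wedge_mul a j)).
Qed.

End Wedge.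

Section WedgeBases.
Variables (k K : fieldType) (iota : {rmorphism k -> K}) (p : nat).
Hypothesis charK : p \in [pchar K].
Hypothesis deg : pdeg_le2 K p.
Variables (z x : K) (Dz Dx : K -> K).
Hypothesis pb : pbasis setT z x Dz Dx.

Lemma span_of_wedges i (V : set (kahler_forms iota i)) : V 0 -> (forall u v, V u -> V v -> V (u + v)) ->
  (forall c a, V (c *: wedge_d iota a)) -> forall w, V w.
Proof.
move=> V0 VD VW w; have [n [c [a ->]]] := wedge_span w.
by elim/big_rec: _ => // l u _ Vu; exact: VD.
Qed.

Lemma kahler0_basis (w : kahler_forms iota 0) : exists c, w = c *: wedge_d iota (fun=> 0).
Proof.
apply: (span_of_wedges (V := [set w | exists c, w = c *: wedge_d iota (fun=> 0)])) => [|_ _ [c ->] [d ->]|c a] /=.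
- by exists 0; rewrite scale0r.
- by exists (c + d); rewrite scalerDl.
- by exists c; congr (_ *: wedge_d _ _); apply/funext => -[].
Qed.

Lemma kahler1_basis (w : kahler_forms iota 1) : exists w1 w2,
  w = w1 *: wedge_d iota (fun=> z) + w2 *: wedge_d iota (fun=> x).
Proof.
apply: (span_of_wedges (V := [set w | exists w1 w2,
  w = w1 *: wedge_d iota (fun=> z) + w2 *: wedge_d iota (fun=> x)])) => [|_ _ [c [d ->]] [c' [d' ->]]|c a] /=.
- by exists 0, 0; rewrite !scale0r addr0.
- by exists (c + c'), (d + d'); rewrite !scalerDl addrACA.
- have s1 f : subst a ord0 f = (fun=> f) by apply/funext => l; rewrite /subst ord1 eqxx.
  exists (c * Dz (a ord0)), (c * Dx (a ord0)).
  by rewrite (wedge_chain iota charK deg pb a ord0) !s1 scalerDr !scalerA.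
Qed.

Lemma kahler2_basis (w : kahler_forms iota 2) : exists c,
  w = c *: wedge_d iota (fun l => if l == ord0 then z else x).
Proof.
pose e (f g : K) : 'I_2 -> K := fun l => if l == ord0 then f else g.
pose W f g : kahler_forms iota 2 := wedge_d iota (e f g).
have s0 f g h : subst (e f g) ord0 h = e h g.
  by apply/funext => l; rewrite /subst /e; case: eqP.
have s1 f g h : subst (e f g) ord_max h = e f h.
  by apply/funext => -[[|[|l]] lp].
have W1 f g : W f g = Dz f *: W z g + Dx f *: W x g.
  by have := wedge_chain iota charK deg pb (e f g) ord0; rewrite !s0.
have W2 f g : W f g = Dz g *: W f z + Dx g *: W f x.
  by have := wedge_chain iota charK deg pb (e f g) ord_max; rewrite !s1.
have Wff f : W f f = 0 by apply: (@wedge_alt _ _ iota 2 _ ord0 ord_max) => //.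
have Wxz : W x z = - W z x.
  have D0 f f' g : W (f + f') g = W f g + W f' g.
    by have := wedge_add iota (e f g) ord0 f f'; rewrite !s0.
  have D1 f g g' : W f (g + g') = W f g + W f g'.
    by have := wedge_add iota (e f g) ord_max g g'; rewrite !s1.
  apply/eqP; rewrite -addr_eq0; apply/eqP.
  by have := Wff (z + x); rewrite D0 !D1 !Wff add0r addr0 addrC.
apply: (span_of_wedges (V := [set w | exists c,
  w = c *: wedge_d iota (fun l => if l == ord0 then z else x)])) => [|_ _ [c ->] [d ->]|c a] /=.
- by exists 0; rewrite scale0r.
- by exists (c + d); rewrite scalerDl.
- have -> : wedge_d iota a = W (a ord0) (a ord_max).
    rewrite /W; congr wedge_d; apply/funext => -[[|[|l]] lp] //; rewrite /e /=; congr a; exact: val_inj.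
  rewrite W1 (W2 z) (W2 x) !Wff Wxz !scaler0 add0r addr0 scalerN scalerN !scalerA -scaleNr -scalerDl scalerA.
  by eexists.
Qed.

(** Expanding three slots along the p-basis leaves wedges with dz or dx in each of them, so two
    slots agree. *)
Lemma kahler3_zero i (w : kahler_forms iota i.+3) : w = 0.
Proof.
pose j0 : 'I_i.+3 := ord0; pose j1 : 'I_i.+3 := fintype.lift ord0 ord0; pose j2 : 'I_i.+3 := ord_max.
have j01 : j0 != j1 by []. have j02 : j0 != j2 by []. have j12 : j1 != j2 by [].
pose zx f := f = z \/ f = x.
have sj (a : 'I_i.+3 -> K) j f : subst a j f j = f by rewrite /subst eqxx.
have sn (a : 'I_i.+3 -> K) j l f : l != j -> subst a j f l = a l by rewrite /subst => /negbTE ->.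
have a3 (a : 'I_i.+3 -> K) : zx (a j0) -> zx (a j1) -> zx (a j2) -> wedge_d iota a = 0.
  move=> [h0|h0] [h1|h1] [h2|h2];
    by [apply: (wedge_alt iota j01); rewrite h0 h1 | apply: (wedge_alt iota j02); rewrite h0 h2
       | apply: (wedge_alt iota j12); rewrite h1 h2].
have zz : zx z by left. have xx : zx x by right.
have a2 (a : 'I_i.+3 -> K) : zx (a j0) -> zx (a j1) -> wedge_d iota a = 0.
  move=> h0 h1; rewrite (wedge_chain iota charK deg pb a j2).
  by rewrite !a3 ?sj ?(sn _ _ _ _ j02) ?(sn _ _ _ _ j12) // !scaler0 addr0.
have a1 (a : 'I_i.+3 -> K) : zx (a j0) -> wedge_d iota a = 0.
  move=> h0; rewrite (wedge_chain iota charK deg pb a j1).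
  by rewrite !a2 ?sj ?(sn _ _ _ _ j01) // !scaler0 addr0.
apply: (span_of_wedges (V := [set w | w = 0])) => [|_ _ -> ->|c a] //=; first by rewrite addr0.
by rewrite (wedge_chain iota charK deg pb a j0) !a1 ?sj // !scaler0 addr0 scaler0.
Qed.

End WedgeBases.

(** * Logarithmic forms paired with logarithmic derivations *)

Section Stalks.
Variables (k : fieldType) (X : proj_variety k).
Hypothesis X_normal : normal_variety X.
Local Notation iota := (constants X).
Variables (B' : set X -> int) (P : set X) (t : X).
Hypothesis B'_prime : forall Q, B' Q != 0 -> prime_divisor Q.
Hypotheses (dP : prime_divisor P) (dO : dvr P t).
Hypothesis tE : nonunits P = [set g | exists2 a, P a & g = t * a].

Let lam := if B' P == 0 then 1 else t.

(** Writing a = t b with [b] a unit, F a / a = F t / t + F b / b. *)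
Lemma test_der_local_equation F a : test_der P lam F -> B' P != 0 -> local_equation P P a ->
  P (a^-1 * F a).
Proof.
rewrite /lam => -[dF FO Fl] BP; rewrite (negbTE BP) in Fl.
rewrite /local_equation -[max_ideal P]/(nonunits P) => aE; have sP := dvr_ring dO; have t0 := dvr_t0 dO.
have lP := pt_local dP.1.
have [b Pb aeq] : exists2 b, P b & a = t * b.
  have : (P `&` nonunits P) a by rewrite aE; exists 1; rewrite ?mulr1 //; exact: subring1.
  by rewrite tE => -[].
have [c Pc ceq] : exists2 c, P c & a * c = t.
  have : (P `&` nonunits P) t.
    split; first exact: dvr_t dO.
    by rewrite tE; exists 1; rewrite ?mulr1 //; exact: subring1.
  by rewrite aE.
have bc : b * c = 1 by apply: (mulfI t0); rewrite mulrA -aeq ceq mulr1.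
have b0 : b != 0 by apply: contra_eq_neq bc => ->; rewrite mul0r eq_sym oner_eq0.
have cE : c = b^-1 by apply: (mulfI b0); rewrite bc mulfV.
have -> : a^-1 * F a = F t / t + c * F b.
  by rewrite aeq (derM dF) cE; field; rewrite t0 b0.
by apply: (subringD sP) => //; apply: (subringM sP) => //; exact: FO.
Qed.

Lemma pairing_log_generator i (Ds : 'I_i -> X -> X) w :
    (forall r c, Ds r (iota c) = 0) -> (forall r, test_der P lam (Ds r)) ->
  log_generator B' P w -> P (pairing Ds w : X).
Proof.
move=> Dc tD [J [a [aJ aJ' ->]]]; have sP := dvr_ring dO.
have Dd r : derivation (Ds r) := td_der (tD r).
rewrite (pairingZ Dd Dc) (pairing_wedge Dd Dc) big_mkcond /=.
(* The factors 1 / a_l are absorbed into the rows of the determinant, whose entries then lie in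
   [P]. *)
pose d := \row_l (if l \in J then (a l)^-1 else 1).
have -> : \prod_l (if l \in J then (a l)^-1 else 1) = \det (diag_mx d).
  by rewrite det_diag; apply: eq_bigr => l _; rewrite mxE.
rewrite -det_mulmx.
have entry l r : P ((diag_mx d *m \matrix_(l, r) Ds r (a l)) l r).
  rewrite mul_diag_mx !mxE; case: ifPn => lJ; last first.
    by rewrite mul1r; apply: (td_O (tD r)); exact: aJ.
  have [Q [BQ PQ le]] := aJ' l lJ; have dQ := B'_prime BQ.
  have [QP|QT] := divisor_above dP dQ.1 PQ; last by case: (divisor_proper dQ).
  by rewrite QP in BQ le; exact: test_der_local_equation.
rewrite /determinant; apply: (subring_sum sP) => s _; apply: (subringM sP).
  by apply: (@subringX _ _ sP); apply: (subringN sP); exact: subring1.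
by apply: (subring_prod sP) => l _; exact: entry.
Qed.

Lemma pairing_stalk i (Ds : 'I_i -> X -> X) (D : set X -> int) w :
    (forall r c, Ds r (iota c) = 0) -> (forall r, test_der P lam (Ds r)) ->
    log_forms_stalk B' (fun Q => - D Q) P w ->
  val_ge P t (D P) (pairing Ds w : X).
Proof.
move=> Dc tD [n [c [g [hc hg ->]]]]; have sP := dvr_ring dO.
have Dd r : derivation (Ds r) := td_der (tD r).
rewrite (pairing_sum Dd Dc) /val_ge /= mulr_suml; apply: (subring_sum sP) => l _.
rewrite (pairingZ Dd Dc) mulrAC; apply: (subringM sP); last exact: pairing_log_generator.
have [V [oV VP [->|/(_ P VP dP)[m [om hm]]]]] := hc l; first by rewrite mul0r; exact: subring0.
by apply: (ord_val_ge dO tE om); rewrite -subr_ge0.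
Qed.

End Stalks.

Lemma det_mx2 (R : comNzRingType) (M : 'M[R]_2) :
  \det M = M ord0 ord0 * M ord_max ord_max - M ord0 ord_max * M ord_max ord0.
Proof.
rewrite (expand_det_row _ ord0) !big_ord_recl big_ord0 /cofactor !det_mx11 !mxE /= addr0.
rewrite expr0 mul1r expr1 mulN1r mulrN.
by congr (_ * M _ _ - M _ _ * M _ _); apply: val_inj.
Qed.

Theorem theorem3 (k : fieldType) (p : nat) (k_perfect : perfect_field p k)
    (X : proj_variety k) (X_normal : normal_variety X)
    (X_surface : dim_is (@pt k X) 2)
    (B : set X -> rat) (B_div : is_divisor B) (B_eff : forall P, 0 <= B P)
    (XB_split : globally_F_split p B)
    (i : nat) (D : set X -> int) (D_div : is_divisor D)
    (kappa : option nat) (D_kappa : iitaka_dim_is D kappa)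
    (kappa_gt_i : exists2 d, kappa = Some d & (i < d)%N) :
  reflexive_log_forms (i := i) (floor_div B) (fun P => - (D P)%:~R) (@pt k X)
  = [set 0].
Proof.
have [dk kE ik] := kappa_gt_i; rewrite kE in D_kappa; have dk0 : (0 < dk)%N := leq_ltn_trans (leq0n i) ik.
have charX := surface_pchar X k_perfect; have [deg _] := surface_pdegree k_perfect X_surface.
set B' := floor_div B.
have B'_prime Q : B' Q != 0 -> prime_divisor Q.
  move=> BQ; apply: (proj1 B_div); apply: contraNneq BQ => BQ.
  by rewrite /B' /floor_div BQ floor0.
have finB : finite_set [set Q | B' Q != 0].
  apply: sub_finite_set (proj2 B_div) => Q /=; apply: contraNN => /eqP BQ.
  by rewrite /B' /floor_div BQ floor0.
have [phi [phiD phiM phi1 phiP]] := frobenius_trace X_normal charX B_eff XB_split.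
pose J := {P : set X | prime_divisor P}.
have /choice[t ht] : forall j : J, exists t, dvr (sval j) t /\
    nonunits (sval j) = [set g | exists2 a, sval j a & g = t * a].
  by move=> j; have [t [dO tE]] := prime_divisor_dvr X_normal (svalP j); exists t.
pose lam (j : J) := if B' (sval j) == 0 then 1 else t j.
have frames j : exists u Dt Du, local_frame p phi (sval j) (t j) u Dt Du (lam j).
  have [dO tE] := ht j; have [u [Dt [Du pb]]] := divisor_pbasis k_perfect X_surface (svalP j) dO tE.
  exists u, Dt, Du; split=> //; first by rewrite /lam; case: ifP; [left | right].
  by move=> f Pf; exact: phiP (svalP j) dO tE Pf.
(* The bounds hold for the chosen uniformizers; [ord_is] transports them to arbitrary ones. *)
have no_sections psi m : (0 < m)%N ->
    (forall j, val_ge (sval j) (t j) (D (sval j) *+ m) psi) -> psi = 0.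
  move=> m0 hpsi; apply: (iitaka_no_sections X_normal dk0 D_kappa m0) => P t' dP dO' tE'.
  have [dO tE] := ht (exist _ P dP); have h := hpsi (exist _ P dP).
  have [->|psi0] := eqVneq psi 0; first by rewrite /val_ge /= mul0r; exact: subring0 (dvr_ring dO').
  by have [n [on le]] := val_ge_ord dO tE psi0 h; exact: (ord_val_ge dO' tE' on).
(* Without prime divisors [no_sections] would apply to the function 1. *)
have [j0 _] : exists j : J, True.
  apply: contrapT => no; have : (1 : X) = 0 by apply: (no_sections 1 1%N) => // j; case: no; exists j.
  by move/eqP; rewrite oner_eq0.
have [u0 [Dz [Dx [_ pb0 _ _]]]] := frames j0; have pb := pbasisT pb0.
have Dconst (F : X -> X) c : derivation F -> F (constants X c) = 0 by move=> dF; exact: (der_const k_perfect c dF).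
apply/seteqP; split; last first.
  move=> _ -> x _; exists 0%N, (fun=> 0), (fun=> 0); split=> [[]//|[]//|].
  by rewrite big_ord0.
move=> w hw.
have floorD : floor_div (fun P => - (D P)%:~R) = (fun P => - D P).
  by apply/funext => P; rewrite /floor_div -mulrNz intrKfloor.
have stalk (j : J) : log_forms_stalk B' (fun Q => - D Q) (sval j) w.
  have dPj : prime_divisor (sval j) := svalP j.
  rewrite -floorD; apply: hw; split; first exact: dPj.1.
  exact: (divisor_log_smooth k_perfect X_surface X_normal B'_prime finB (svalP j)).
have pair (j : J) (Ds : 'I_i -> X -> X) : (forall r, test_der (sval j) (lam j) (Ds r)) ->
    val_ge (sval j) (t j) (D (sval j)) (pairing Ds w : X).
  move=> tD; have [dO tE] := ht j.
  apply: (pairing_stalk B'_prime (svalP j) dO tE _ tD (stalk j)) => r c.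
  by apply: Dconst; exact: td_der (tD r).
have pairE (Ds : 'I_i -> X -> X) c a : (forall r, derivation (Ds r)) ->
    pairing Ds (c *: wedge_d (constants X) a) = c * \det (\matrix_(l, r) Ds r (a l)).
  move=> dD; have Dc r c' : Ds r (constants X c') = 0 by exact: Dconst.
  by rewrite (pairingZ dD Dc) (pairing_wedge dD Dc).
(* In degree 0 the coefficient itself is a section of -D. Degrees 1 and 2 are [no_oneform2] and
   [no_twoform], and higher forms vanish on a surface. *)
case: i w hw stalk pair pairE {ik kappa_gt_i} => [|[|[|i]]] w hw stalk pair pairE /=.
- have [c wE] := kahler0_basis w; rewrite wE (no_sections c 1%N) ?scale0r // => j.
  rewrite mulr1n; have := pair j (fun=> id); rewrite wE pairE ?det_mx00 ?mulr1; last by case.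
  by apply; case.
- have [w1 [w2 wE]] := kahler1_basis charX deg pb w.
  have [w10 w20] : w1 = 0 /\ w2 = 0.
    apply: (no_oneform2 charX deg phiD phiM phi1 frames no_sections pb) => j F tF.
    have := pair j (fun=> F) (fun=> tF); have dF := td_der tF.
    by rewrite wE (pairingD (fun=> dF) (fun _ c => Dconst F c dF)) !pairE // !det_mx11 !mxE.
  by rewrite wE w10 w20 !scale0r addr0.
- have [c wE] := kahler2_basis charX deg pb w; rewrite wE.
  suff -> : c = 0 by rewrite scale0r.
  apply: (no_twoform charX deg phiD phiM phi1 frames no_sections pb) => j F G tF tG.
  have tD r : test_der (sval j) (lam j) (if r == ord0 :> 'I_2 then F else G) by case: ifP.
  have := pair j _ tD; rewrite wE pairE => [|r]; last exact: td_der (tD r).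
  by rewrite det_mx2 !mxE.
- by rewrite (kahler3_zero charX deg pb w).
Qed.
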